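(* Let $(X,d,\mu,\mathcal D)$ be a space of homogeneous type. Let $m\in\mathbb N$, $\eta\in[0,m)$, $r_1,\dots,r_m,s'\in[1,\infty)$, $p_1,\dots,p_m\in(1,\infty)$ and $\frac1{\tilde p}:=\sum_{i=1}^m\frac1{p_i}-\eta>0$. Assume that $T_\eta$ is an $m$-sublinear operator such that for any nonnegative $f_1,\dots,f_m,\psi\in L^\infty_b(X)$, $$|\langle T_\eta(\vec f),\psi\rangle|\lesssim\sup_{\mathcal S\subseteq\mathcal D}\mathcal A_{\eta,\mathcal S,\vec r,s'}(\vec f,\psi),$$ the supremum being over sparse families. If $(\vec r,s)\prec(\vec p,\tilde p)$ and $\vec\omega\in A_{(\vec p,\tilde p),(\vec r,s)}$, then $$\|T_\eta\|_{\prod_{i=1}^mL^{p_i}(\omega_i^{p_i})\to L^{\tilde p}(\omega^{\tilde p})}\lesssim\begin{cases}[\vec\omega]^{\Theta}_{A_{(\vec p,\tilde p),(\vec r,s)}}&\text{if }\tilde p>1,\\ C\big([\vec\omega]_{A_{(\vec p,\tilde p),(\vec r,s)}}\big)&\text{if }0<\tilde p\le1,\end{cases}$$ where $\Theta:=\max\big\{\frac{p_1}{p_1-r_1},\dots,\frac{p_m}{p_m-r_m},\frac{\tilde p'}{\tilde p'-s'}\big\}$. Further, for the same family of exponents and weights, and for all exponents $\vec t=(t_1,\dots,t_m)$ with $\frac1{\tilde t}:=\sum_i\frac1{t_i}-\eta>0$ and $(\vec r,s)\prec(\vec t,\tilde t)$, $$\Big\|\big\|\{T_\eta(f_1^j,\dots,f_m^j)\}_j\big\|_{\ell^{\tilde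 t}}\Big\|_{L^{\tilde p}(\omega^{\tilde p})}\lesssim\prod_{i=1}^m\Big\|\big\|\{f_i^j\}_j\big\|_{\ell^{t_i}}\Big\|_{L^{p_i}(\omega_i^{p_i})}.$$
   Context: $(X,d,\mu)$ is a space of homogeneous type: $d$ is a quasi-metric and $\mu$ a regular measure with $0<\mu(B(x,2r))\le C_\mu\mu(B(x,r))<\infty$ for all quasi-metric balls. $\mathcal D=\bigcup_{j=1}^N\mathcal D^j$, where $\mathcal D^1,\dots,\mathcal D^N$ are fixed dyadic lattices. A dyadic lattice with parameters $0<c_0\le C_0<\infty$, $0<\delta<1$ is $\bigcup_{k\in\mathbb Z}\mathcal D_k$, $\mathcal D_k=\{Q^k_j\}_{j\in J_k}$ measurable sets with centres $z_j^k$, such that (i) $X=\bigcup_jQ_j^k$ for each $k$; (ii) for $k\ge l$, $Q\in\mathcal D_k$, $Q'\in\mathcal D_l$, either $Q\cap Q'=\emptyset$ or $Q\subseteq Q'$; (iii) $B(z_j^k,c_0\delta^k)\subseteq Q_j^k\subseteq B(z_j^k,C_0\delta^k)$; (iv) if $l\ge k$ and $Q_{j'}^l\subseteq Q_j^k$ then $B(z_{j'}^l,C_0\delta^l)\subseteq B(z_j^k,C_0\delta^k)$. The lattices are chosen so that for some $\gamma\ge1$ every ball $B(x,r)$ is contained in some $Q\in\mathcal D$ with $\operatorname{diam}Q\le\gamma r$. $L_b^\infty(X)$: bounded functions with bounded support. Sparse: $\mathcal S\subseteq\mathcal D$ is $\delta_0$-sparse ($\delta_0\in(0,1)$ fixed)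 if there are pairwise disjoint measurable $E_Q\subseteq Q$, $Q\in\mathcal S$, with $\mu(E_Q)\ge\delta_0\mu(Q)$. $\langle f\rangle_{r,B}=\big(\frac1{\mu(B)}\int_B|f|^rd\mu\big)^{1/r}$ (ess. sup if $r=\infty$), and $\mathcal A_{\eta,\mathcal S,\vec r,s'}(\vec f,\psi):=\sum_{B\in\mathcal S}\mu(B)^{\eta+1}\prod_{i=1}^m\langle|f_i|\rangle_{r_i,B}\,\langle\psi\rangle_{s',B}$. $s,s'$ are conjugate, and $\frac1{\tilde p'}=1-\frac1{\tilde p}$. $\|f\|_{L^p(\omega^p)}=\|f\omega\|_{L^p(\mu)}$; weights are locally integrable functions positive and finite a.e. $(\vec r,s)\preceq(\vec p,\tilde p)$ means $r_i\le p_i$ for all $i$ and $\tilde p\le s$; $(\vec r,s)\prec(\vec p,\tilde p)$ means $r_i<p_i$ for all $i$ and $\tilde p<s$. $\vec\omega\in A_{(\vec p,\tilde p),(\vec r,s)}$ iff $[\vec\omega]_{A_{(\vec p,\tilde p),(\vec r,s)}}:=\sup_{B\in\mathcal D}\big(\prod_{j=1}^m\langle\omega_j^{-1}\rangle_{\frac1{1/r_j-1/p_j},B}\big)\langle\omega\rangle_{\frac1{1/\tilde p-1/s},B}<\infty$ with $\omega:=\prod_i\omega_i$. $C(\cdot)$ is a constant depending only on the indicated quantity and fixed parameters; in the last estimate the implicit constant may depend on $[\vec\omega]$. *)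

(* Defs.v *)
From HB Require Import structures.
From mathcomp Require Import all_boot all_order all_algebra.
From mathcomp Require Import all_classical all_reals all_analysis ess_sup_inf.
Set Implicit Arguments.
Unset Strict Implicit.
Unset Printing Implicit Defensive.
Import Order.TTheory GRing.Theory Num.Theory.
Import numFieldNormedType.Exports.
Local Open Scope classical_set_scope.
Local Open Scope ring_scope.

Section quasi_metric.
Context {R : realType} {X : Type}.
Variable rho : X -> X -> R.

Record quasi_metric : Prop := QuasiMetric {
  quasi_metric_ge0 : forall x y, 0 <= rho x y ;
  quasi_metric_eq0 : forall x y, rho x y = 0 <-> x = y ;
  quasi_metric_sym : forall x y, rho x y = rho y x ;
  quasi_metric_triangle : exists A0 : R,
    forall x y z, rho x z <= A0 * (rho x y + rho y z) }.

Definition qball (x : X) (r : R) : set X := [set y | rho x y < r].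

Definition qdiam (A : set X) : \bar R :=
  ereal_sup [set (rho u.1 u.2)%:E | u in A `*` A].

(* A quasi-metric ball need not be open for this topology. *)
Definition qopen (U : set X) : Prop :=
  forall x, U x -> exists2 r : R, 0 < r & qball x r `<=` U.

Definition qclosed (F : set X) : Prop := qopen (~` F).

End quasi_metric.

Section homogeneous_type.
Context {R : realType} {d : measure_display} {X : measurableType d}.
Variables (rho : X -> X -> R) (mu : {measure set X -> \bar R}).

(* Inner regularity is required with closed sets: compact subsets are closed,
   so this is implied by the variant of the definition with compact sets. *)
Definition regular_measure : Prop :=
  (forall U, qopen rho U -> measurable U) /\
  (forall A, measurable A ->
     mu A = ereal_inf [set mu U | U in [set U | qopen rho U /\ A `<=` U]] /\
     mu A = ereal_sup [set mu F | F in [set F | qclosed rho F /\ F `<=` A]]).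

Record homogeneous_type : Prop := HomogeneousType {
  homogeneous_quasi_metric : quasi_metric rho ;
  homogeneous_regular : regular_measure ;
  homogeneous_measurable_ball : forall x r, measurable (qball rho x r) ;
  homogeneous_doubling : exists Cmu : R, forall x r, 0 < r ->
    [/\ (0 < mu (qball rho x (2 * r)))%E,
        (mu (qball rho x (2 * r)) <= Cmu%:E * mu (qball rho x r))%E &
        (mu (qball rho x r) < +oo)%E] }.

End homogeneous_type.

Section dyadic.
Context {R : realType} {d : measure_display} {X : measurableType d}.
Variable rho : X -> X -> R.

Record dyadic_lattice := DyadicLattice {
  dy_c0 : R ;
  dy_C0 : R ;
  dy_delta : R ;
  dy_index : int -> Type ;
  dy_cube : forall k, dy_index k -> set X ;
  dy_center : forall k, dy_index k -> X ;
  dy_c0_gt0 : 0 < dy_c0 ;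
  dy_c0_le_C0 : dy_c0 <= dy_C0 ;
  dy_delta_bound : 0 < dy_delta < 1 ;
  dy_measurable : forall k (j : dy_index k), measurable (dy_cube j) ;
  dy_cover : forall k, \bigcup_(j in [set: dy_index k]) dy_cube j = [set: X] ;
  dy_nested : forall k l (i : dy_index k) (j : dy_index l), l <= k ->
    dy_cube i `&` dy_cube j = set0 \/ dy_cube i `<=` dy_cube j ;
  dy_ball_sub : forall k (j : dy_index k),
    qball rho (dy_center j) (dy_c0 * dy_delta ^ k) `<=` dy_cube j /\
    dy_cube j `<=` qball rho (dy_center j) (dy_C0 * dy_delta ^ k) ;
  dy_ball_nested : forall k l (j : dy_index k) (i : dy_index l), k <= l ->
    dy_cube i `<=` dy_cube j ->
    qball rho (dy_center i) (dy_C0 * dy_delta ^ l) `<=`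
    qball rho (dy_center j) (dy_C0 * dy_delta ^ k) }.

Definition dyadic_cubes (N : nat) (D : 'I_N -> dyadic_lattice) : set (set X) :=
  [set Q | exists n k (j : dy_index (D n) k), Q = dy_cube j].

Definition adjacent_lattices (N : nat) (D : 'I_N -> dyadic_lattice) : Prop :=
  exists2 gamma : R, 1 <= gamma & forall x r, 0 < r ->
    exists Q, [/\ dyadic_cubes D Q, qball rho x r `<=` Q &
                  (qdiam rho Q <= (gamma * r)%:E)%E].

Definition Linfb : set (X -> R) :=
  [set f : X -> R | [/\ measurable_fun setT f,
               exists M : R, forall x, `|f x| <= M &
               exists x0 r, forall x, f x != 0 -> qball rho x0 r x]].

End dyadic.

Section sparse.
Context {R : realType} {d : measure_display} {X : measurableType d}.
Variable mu : {measure set X -> \bar R}.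

Definition sparse (delta0 : R) (S : set (set X)) : Prop :=
  exists E : set X -> set X,
    trivIset S E /\
    forall Q, S Q ->
      [/\ measurable (E Q), E Q `<=` Q & (delta0%:E * mu Q <= mu (E Q))%E].

Definition average (r : \bar R) (B : set X) (f : X -> R) : \bar R :=
  match r with
  | r'%:E => (((mu B)^-1 * \int[mu]_(x in B) (`|f x| `^ r')%:E) `^ r'^-1)%E
  | +oo%E => ess_sup mu ((fun x => `|f x|%:E) \_ B)
  | -oo%E => 0%E
  end.

Definition sparse_form (m : nat) (eta : R) (S : set (set X))
    (r : 'I_m -> \bar R) (s' : \bar R) (f : 'I_m -> X -> R) (psi : X -> R) :
    \bar R :=
  (\esum_(B in S)
     (mu B `^ (eta + 1) * \prod_(i < m) average (r i) B (f i)
      * average s' B psi))%E.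

End sparse.

Section exponents.
Context {R : realType}.

(* The exponent \tilde p, for p_i in (0, +oo] and positive 1 / \tilde p. *)
Definition inv_ptilde (m : nat) (eta : R) (p : 'I_m -> \bar R) : R :=
  \sum_(i < m) fine ((p i)^-1)%E - eta.

Definition ptilde (m : nat) (eta : R) (p : 'I_m -> \bar R) : R :=
  (inv_ptilde eta p)^-1.

Definition exponents_lt (m : nat) (r : 'I_m -> \bar R) (s : \bar R)
    (p : 'I_m -> \bar R) (pt : \bar R) : Prop :=
  (forall i, (r i < p i)%E) /\ (pt < s)%E.

(* 1 / (1 / a - 1 / b), equal to +oo when a = b. *)
Definition gap_exponent (a b : \bar R) : \bar R := ((a^-1 - b^-1)^-1)%E.

Definition Theta (m : nat) (r : 'I_m -> R) (s' : R) (p : 'I_m -> R) (pt : R) :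
    R :=
  let pt' := (1 - pt^-1)^-1 in
  \big[Num.max / (pt' / (pt' - s'))]_(i < m) (p i / (p i - r i)).

End exponents.

Section weights.
Context {R : realType} {d : measure_display} {X : measurableType d}.
Variables (rho : X -> X -> R) (mu : {measure set X -> \bar R}).

Definition weight (w : X -> R) : Prop :=
  [/\ measurable_fun setT w,
      \forall x \ae mu, 0 < w x &
      forall x r, mu.-integrable (qball rho x r) (EFin \o w)].

Definition weight_prod (m : nat) (w : 'I_m -> X -> R) : X -> R :=
  fun x => \prod_(i < m) w i x.

Definition A_const (Dcubes : set (set X)) (m : nat) (r : 'I_m -> \bar R)
    (s : \bar R) (p : 'I_m -> \bar R) (pt : \bar R) (w : 'I_m -> X -> R) :
    \bar R :=
  ereal_sup
    [set (\prod_(j < m)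
            average mu (gap_exponent (r j) (p j)) B (fun x => (w j x)^-1)%R
          * average mu (gap_exponent pt s) B (weight_prod w))%E
    | B in Dcubes].

(* The norm of L^p(w^p). *)
Definition wnorm (p : \bar R) (w : X -> R) (f : X -> \bar R) : \bar R :=
  Lnorm mu p (fun x => f x * (w x)%:E)%E.

Definition wLp (p : \bar R) (w : X -> R) : set (X -> R) :=
  [set f : X -> R | measurable_fun setT f /\ (wnorm p w (EFin \o f) < +oo)%E].

Definition ell_norm (t : \bar R) (u : nat -> R) : \bar R :=
  Lnorm (@counting nat R) t (EFin \o u).

End weights.

Section operators.
Context {R : realType} {d : measure_display} {X : measurableType d}.
Variables (mu : {measure set X -> \bar R}) (m : nat).
Implicit Types (T : ('I_m -> X -> R) -> X -> R) (F : 'I_m -> set (X -> R)).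

(* Only the values of T on tuples with i-th entry in F i matter. *)
Definition msublinear F T : Prop :=
  [/\ forall f, (forall i, F i (f i)) -> measurable_fun setT (T f),
      forall f i g h, (forall k, F k (f k)) -> F i g -> F i h ->
        \forall x \ae mu,
          `|T (dfwith f i (fun y => g y + h y)) x|
            <= `|T (dfwith f i g) x| + `|T (dfwith f i h) x| &
      forall f i (c : R), (forall k, F k (f k)) ->
        \forall x \ae mu,
          `|T (dfwith f i (fun y => c * f i y)) x| = `|c| * `|T f x|].

(* T' extends T when T is given on tuples with i-th entry in F0 i and T' on
   tuples with i-th entry in F i. *)
Definition operator_extends F0 F T T' : Prop :=
  forall f, (forall i, F0 i (f i)) -> (forall i, F i (f i)) ->
    \forall x \ae mu, T' f x = T f x.

(* The norm of T from the product of the L^{p_i}(w_i^{p_i}) to L^q(v^q). *)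
Definition operator_norm (p : 'I_m -> \bar R) (w : 'I_m -> X -> R)
    (q : \bar R) (v : X -> R) T : \bar R :=
  ereal_inf
    [set C%:E | C in [set C : R | 0 <= C /\
      forall f, (forall i, wLp mu (p i) (w i) (f i)) ->
        (wnorm mu q v (EFin \o T f)
           <= C%:E * \prod_(i < m) wnorm mu (p i) (w i) (EFin \o f i))%E]].

(* Where the positive and negative parts of T f * psi both have infinite
   integral, the left-hand side is +oo. *)
Definition sparse_dominated (rho : X -> X -> R) (Dcubes : set (set X))
    (delta0 eta : R) (r : 'I_m -> \bar R) (s' : \bar R) (K : R) T : Prop :=
  forall (f : 'I_m -> X -> R) (psi : X -> R),
    (forall i, Linfb rho (f i)) -> (forall i x, 0 <= f i x) ->
    Linfb rho psi -> (forall x, 0 <= psi x) ->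
    (`| \int[mu]_x (T f x * psi x)%:E |
       <= K%:E * ereal_sup
            [set sparse_form mu eta S r s' f psi
            | S in [set S | S `<=` Dcubes /\ sparse mu delta0 S]])%E.

End operators.

(* Main.v *)
(** Let v_k be the weights of the Muckenhoupt condition in symmetric form: with
    gap exponents g_k (k ranging over 1..m and one further index for the dual
    function psi), v_k is a power of w_k, the product of the v_k^g_k is 1, and the
    constant bounds the products of the averages of the v_k over dyadic cubes.
    Everything is measured by the dyadic maximal operators M_k of the measures
    v_k mu.

    Sharp bound (pt > 1): each term of the sparse form is a product of averages
    with respect to the v_k mu; sparseness lets v_k mu(B) be replaced by
    v_k mu(E_B) at the cost of a power of the constant, and Hoelder's inequality
    together with the L^P bound of M_k, uniform in the measure, concludes.
    Duality turns the bound of the form into a bound of T.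

    Vector-valued bound, including pt <= 1: a portion of a cube which is
    small for some v_k mu is small for mu, so that on most of each cube all the
    averages in the form are controlled by pointwise maximal functions. This dominates the form
    by an integral, even after testing against powers A^(-al) of weights with
    M A <= C A. These weighted estimates extrapolate to l^tau-valued ones through
    the Rubio de Francia iteration, and the Fefferman-Stein inequality for the M_k
    bounds the majorant. The natural exponent, 1 / tau = sum of the 1 / t_i, is
    smaller than the required one, so the l^tau estimate is stronger.

    The operator is extended along rapidly converging truncations: by
    sublinearity, |T f_n| converges almost everywhere to a limit which does not
    depend on the approximating sequence. *)

Require Import Defs.
From HB Require Import structures.
From mathcomp Require Import all_boot all_order all_algebra.
From mathcomp Require Import all_classical all_reals all_analysis measurable_realfun ess_sup_inf.
From mathcomp Require Import ring lra.
Set Implicit Arguments.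
Unset Strict Implicit.
Unset Printing Implicit Defensive.
Import Order.TTheory GRing.Theory Num.Theory.
Import numFieldNormedType.Exports.
Local Open Scope classical_set_scope.
Local Open Scope ring_scope.
Local Open Scope ereal_scope.

(** Duality fails in L^pt for pt <= 1. It is used instead at an auxiliary exponent kappa > 1 with 1
    / kappa > 1 / s, larger than pt and than tau; the weights A^(-al) then carry the estimates from
    kappa down to pt and tau at once.

    The factor mu(B)^eta is attached to a cube and not to a point, so no maximal function absorbs it
    directly. It is traded for a function z, with mu(B)^eta <= C (int z)^eta z^(-eta) on most of B.
    Let 1 / q1 = sum of the 1 / p_i = 1 / pt + eta. If z is the q1-th power of the majorant that
    would serve for eta = 0, times the weight, then the pt-th power of z^(-eta) z^(1 / q1) is z
    again, and only int z remains to be bounded.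

    The maximal bounds are uniform in the measure because Doob's inequality only sees nested cubes;
    having N lattices costs a factor N.

    Origin of Theta: let b_i = 1 / p_i, b_None = 1 - 1 / pt, so that g_k + b_k = 1 / r_k with r_None
    = s'. The averages of the v_k to the powers g_k cost one factor of the constant, the passage
    from B to E_B costs the power max b_k / g_k, and 1 + max b_k / g_k is Theta. *)

Ltac posR := solve [repeat first
  [ assumption | done | exact: powR_ge0 | apply: powR_gt0
  | apply: mulr_gt0 | apply: addr_gt0 | rewrite invr_gt0
  | apply: mulr_ge0 | apply: addr_ge0 | rewrite invr_ge0
  | apply: ltW ]].

(** * Powers, integrals and maximal functions *)

Section extended_powers.
Context {R : realType}.
Implicit Types (x y : \bar R) (r : R).

Lemma exprn_powR (a r : R) n : (0 <= a)%R -> ((a ^+ n) `^ r = (a `^ r) ^+ n)%R.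
Proof.
move=> a0; rewrite -(powR_mulrn n a0) -(powR_mulrn n (powR_ge0 a r)).
by rewrite -!powRrM mulrC.
Qed.

Lemma lee_poweR r x y : (0 <= r)%R -> 0 <= x -> x <= y -> x `^ r <= y `^ r.
Proof.
move=> r0 x0 xy; apply: gt0_ler_poweR => //; rewrite in_itv /= leey andbT //.
exact: le_trans xy.
Qed.

Lemma poweRK r x : r != 0%R -> 0 <= x -> (x `^ r) `^ r^-1 = x.
Proof. by move=> r0 x0; rewrite -poweRrM mulfV// poweRe1. Qed.

Lemma poweRVK r x : r != 0%R -> 0 <= x -> (x `^ r^-1) `^ r = x.
Proof. by move=> r0 x0; rewrite -poweRrM mulVf// poweRe1. Qed.

Lemma poweR_le_root r x y : (0 < r)%R -> 0 <= x -> x `^ r <= y -> x <= y `^ r^-1.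
Proof.
move=> r0 x0 xy; rewrite -[leLHS](@poweRK r) ?gt_eqF// lee_poweR//.
  by rewrite invr_ge0 ltW.
exact: poweR_ge0.
Qed.

Lemma le_poweR_root r x y : (0 < r)%R -> 0 <= x -> 0 <= y -> x <= y `^ r^-1 -> x `^ r <= y.
Proof.
move=> r0 x0 y0 xy; rewrite -[leRHS](@poweRVK r) ?gt_eqF// lee_poweR//.
exact: ltW.
Qed.

Lemma prode_poweR (I : Type) (s : seq I) (f : I -> \bar R) r :
  (forall i, 0 <= f i) -> (\prod_(i <- s) f i) `^ r = \prod_(i <- s) (f i `^ r).
Proof.
move=> f0; elim: s => [|i s IH]; first by rewrite !big_nil poweR1r.
by rewrite !big_cons poweRM ?IH// prode_ge0.
Qed.

Lemma lee_prod (I : Type) (s : seq I) (f g : I -> \bar R) :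
  (forall i, 0 <= f i) -> (forall i, f i <= g i) ->
  \prod_(i <- s) f i <= \prod_(i <- s) g i.
Proof.
move=> f0 fg; elim: s => [|i s IH]; first by rewrite !big_nil.
by rewrite !big_cons lee_pmul// prode_ge0.
Qed.

Lemma prode_gt0 (I : Type) (s : seq I) (f : I -> \bar R) :
  (forall i, 0 < f i) -> 0 < \prod_(i <- s) f i.
Proof.
move=> f0; elim: s => [|i s IH]; first by rewrite !big_nil lte01.
by rewrite !big_cons mule_gt0.
Qed.

Lemma prodEFin (I : Type) (s : seq I) (f : I -> R) :
  \prod_(i <- s) (f i)%:E = (\prod_(i <- s) f i)%:E.
Proof. by elim/big_rec2 : _ => // i x y _ ->; rewrite EFinM. Qed.

Lemma prode_eqy (I : finType) (f : I -> \bar R) i :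
  (forall k, 0 < f k) -> f i = +oo -> \prod_k f k = +oo.
Proof.
move=> f0 fi; rewrite (bigD1 i)//= fi gt0_mulye// big_mkcond.
by apply: prode_gt0 => k; case: ifP => // _; exact: lte01.
Qed.

Lemma prode_eq0 (I : finType) (f : I -> \bar R) i : f i = 0 -> \prod_k f k = 0.
Proof. by move=> fi; rewrite (bigD1 i)//= fi mul0e. Qed.

(** Each term [2 ^+ k.+1 * z k] is at most the r-th root of the right-hand side, and the inverse
    weights sum to 1. Valid for every r > 0, this replaces Minkowski's inequality, which fails for r
    < 1. *)
Lemma nneseries_poweR_le (z : nat -> \bar R) r : (0 < r)%R -> (forall k, 0 <= z k) ->
  (\sum_(0 <= k <oo) z k) `^ r <= \sum_(0 <= k <oo) ((2 ^+ k.+1)%:E * z k) `^ r.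
Proof.
move=> r0 z0; set S := (X in _ <= X).
have S0 : 0 <= S by apply: nneseries_ge0 => *; exact: poweR_ge0.
have [->|Sy] := eqVneq S +oo; first by rewrite leey.
have Sf : S \is a fin_num by rewrite ge0_fin_numE// lt_neqAle Sy leey.
apply: le_poweR_root => //; first exact: nneseries_ge0.
have Sr : S `^ r^-1 \is a fin_num by rewrite fin_num_poweR.
rewrite -(fineK Sr); apply: le_trans (epsilon_trick0 predT _); last first.
  by rewrite fine_ge0// poweR_ge0.
apply: lee_nneseries => // k _.
have h : ((2 ^+ k.+1)%:E * z k) `^ r <= S.
  rewrite /S; apply: le_trans (nneseries_lim_ge k.+1 _); last by move=> *; exact: poweR_ge0.
  by rewrite big_nat_recr//= leeDr// sume_ge0// => *; exact: poweR_ge0.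
have {h} := poweR_le_root r0 _ h; rewrite mule_ge0// ?lee_fin ?exprn_ge0// => /(_ isT).
rewrite EFinM (fineK Sr) natrX muleC => h.
by rewrite lee_pdivlMr// exprn_gt0.
Qed.

Lemma poweRD_le x y r : (0 <= r)%R -> 0 <= x -> 0 <= y ->
  (x + y) `^ r <= (2 `^ r)%:E * (x `^ r + y `^ r).
Proof.
move=> r0 x0 y0; wlog xy : x y x0 y0 / x <= y => [H|].
  by have [xy|/ltW xy] := leP x y; [exact: H|rewrite addeC (addeC (x `^ r)); exact: H].
have : x + y <= 2%:E * y by rewrite mule_natl mule2n leeD2r.
move=> /(lee_poweR r0 (adde_ge0 x0 y0)) /le_trans; apply.
rewrite poweRM// ?lee_fin//= lee_pmul// ?lee_fin ?powR_ge0// ?poweR_ge0//.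
by rewrite leeDr// poweR_ge0.
Qed.

(** Division by t^(1 - 1/rho) is legitimate because t is finite, whereas +oo would satisfy the
    assumed inequality. Hence the truncations wherever this is applied: a moment is first made
    finite, then absorbed. *)
Lemma absorb_poweR (t : \bar R) (K rho : R) : (1 < rho)%R -> (0 <= K)%R -> 0 <= t -> t < +oo ->
  t <= K%:E * t `^ (1 - rho^-1) -> t <= (K `^ rho)%:E.
Proof.
move=> r1 K0; case: t => [t||]// t0 _; rewrite poweR_EFin -EFinM !lee_fin => h.
rewrite lee_fin in t0.
move: t0; rewrite le_eqVlt => /predU1P[<-|t0]; first exact: powR_ge0.
have rp : (0 < rho)%R by apply: lt_trans r1.
have e : (t = t `^ rho^-1 * t `^ (1 - rho^-1))%R.
  by rewrite -powRD ?(gt_eqF t0) ?implybT// addrC subrK powRr1// ltW.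
have h2 : (t `^ rho^-1 <= K)%R.
  by rewrite -(@ler_pM2r _ (t `^ (1 - rho^-1))%R) ?powR_gt0// -e.
have -> : (t = (t `^ rho^-1) `^ rho)%R by rewrite -powRrM mulVf ?powRr1 ?gt_eqF//; exact: ltW.
by apply: ge0_ler_powR; rewrite ?nnegrE ?powR_ge0// ltW.
Qed.

End extended_powers.

(** * Arithmetic and geometric means, and Hoelder's inequality for sums *)

Section amgm.
Context {R : realType} {I : finType}.
Variable b : I -> R.
Hypothesis b0 : forall i, (0 <= b i)%R.
Hypothesis b1 : (\sum_i b i = 1)%R.

Let exb : exists i, (0 < b i)%R.
Proof.
apply/not_existsP => h; move: b1; rewrite big1 => [/esym/eqP|i _]; first by rewrite oner_eq0.
by apply/eqP; rewrite eq_le b0 andbT leNgt; apply/negP/h.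
Qed.

(** The tangent inequality 1 + y <= exp y at y = x_i / S - 1 bounds each factor by S^(b_i) exp(b_i
    (x_i / S - 1)); these exponents of exp sum to 0, because S is the weighted mean and the b_i sum
    to 1. *)
Lemma weighted_amgm (x : I -> R) : (forall i, 0 <= x i)%R ->
  (\prod_i (x i `^ b i) <= \sum_i b i * x i)%R.
Proof.
move=> x0; set S := (X in (_ <= X)%R).
have bx0 i : (0 <= b i * x i)%R by rewrite mulr_ge0.
have S0 : (0 <= S)%R by rewrite sumr_ge0.
have [SE|SN] := eqVneq S 0%R.
  have [i bi] := exb.
  rewrite (bigD1 i)//= (_ : x i = 0%R) ?powR0 ?gt_eqF// ?mul0r//.
  have /eqP := SE; rewrite psumr_eq0// => /allP/(_ i (mem_index_enum _)).
  by rewrite mulf_eq0 gt_eqF//= => /eqP.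
have Sp : (0 < S)%R by rewrite lt_neqAle eq_sym SN.
have h i : (x i `^ b i <= S `^ b i * expR (b i * (x i / S - 1)))%R.
  have -> : (expR (b i * (x i / S - 1)) = expR (x i / S - 1) `^ b i)%R.
    by rewrite /powR gt_eqF ?expR_gt0// expRK.
  rewrite -powRM ?expR_ge0// ge0_ler_powR// ?nnegrE ?mulr_ge0// ?expR_ge0//.
  rewrite mulrC -ler_pdivrMr//.
  by have := expR_ge1Dx (x i / S - 1)%R; rewrite addrC subrK.
apply: (@le_trans _ _ (\prod_i (S `^ b i * expR (b i * (x i / S - 1))))%R).
  by apply: ler_prod => i _; rewrite powR_ge0 h.
rewrite big_split/= -(big_morph expR (@expRD R) (@expR0 R)).
have -> : (\sum_i b i * (x i / S - 1) = 0)%R.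
  under eq_bigr do rewrite mulrBr mulr1 mulrA.
  by rewrite sumrB b1 -mulr_suml -/S divff// subrr.
rewrite expR0 mulr1 -[leRHS](@powRr1 _ S)// -b1.
rewrite le_eqVlt; apply/orP; left; apply/eqP/esym.
by apply: (big_morph (fun c => S `^ c)%R) => [c d|]; rewrite ?powRr0// powRD// SN implybT.
Qed.

Lemma weighted_amgme (x : I -> \bar R) : (forall i, 0 <= x i) ->
  \prod_i (x i `^ b i) <= \sum_i (b i)%:E * x i.
Proof.
move=> x0.
have t0 i : 0 <= (b i)%:E * x i by rewrite mule_ge0// lee_fin.
have [[i [bi xi]]|h] := pselect (exists i, (0 < b i)%R /\ x i = +oo).
  by rewrite [leRHS](bigD1 i)//= xi gt0_muley ?lte_fin// addye ?leey// gt_eqF// (@lt_le_trans _ _ 0)// sume_ge0.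
have e i : x i `^ b i = ((fine (x i)) `^ b i)%:E.
  have [->|bN] := eqVneq (b i) 0%R; first by rewrite poweRe0 powRr0.
  rewrite -poweR_EFin fineK// ge0_fin_numE// lt_neqAle leey andbT.
  by apply/eqP => xi; apply: h; exists i; split => //; rewrite lt_neqAle eq_sym bN b0.
under eq_bigr do rewrite e.
rewrite prodEFin; apply: (@le_trans _ _ (\sum_i b i * fine (x i))%:E).
  by rewrite lee_fin; apply: weighted_amgm => i; rewrite fine_ge0.
rewrite -sumEFin; apply: lee_sum => i _; rewrite EFinM lee_pmul// ?lee_fin ?fine_ge0//.
by case: (x i) (x0 i) => //= ; rewrite ?leey.
Qed.

(** A product of powers is replaced by a linear expression, which can be summed or integrated term
    by term. With [N i] the sum or the integral of [x i], Hoelder's inequality follows for any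
    number of functions. *)
Lemma weighted_amgm_normalized (N x : I -> \bar R) : (forall i, 0 <= x i) ->
  (forall i, 0 <= N i) ->
  (forall i, (0 < b i)%R -> 0 < N i /\ N i < +oo) ->
  \prod_i (x i `^ b i) <= \prod_i (N i `^ b i) * \sum_i (b i / fine (N i))%:E * x i.
Proof.
move=> x0 N0 hN.
(* An index with exponent 0 puts no condition on [N i], which may then be 0 or +oo; it is normalized
   by 1. *)
pose c i : R := if b i == 0%R then 1%R else fine (N i).
have c0 i : (0 < c i)%R.
  rewrite /c; case: ifPn => // bi; rewrite fine_gt0//; apply/andP; apply: hN.
  by rewrite lt_neqAle eq_sym bi b0.
have cN i : N i `^ b i = (c i)%:E `^ b i.
  rewrite /c; case: ifPn => [/eqP->|bi]; first by rewrite !poweRe0.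
  rewrite fineK// ge0_fin_numE//; apply: (proj2 (hN i _)).
  by rewrite lt_neqAle eq_sym bi b0.
have -> : \prod_i (x i `^ b i) = \prod_i (N i `^ b i) * \prod_i (((c i)^-1%:E * x i) `^ b i).
  rewrite -big_split/=; apply: eq_bigr => i _; rewrite cN -poweRM; [|by rewrite lee_fin; exact: ltW|].
    by rewrite muleA -EFinM mulfV ?mul1e// gt_eqF.
  by apply: mule_ge0 => //; rewrite lee_fin invr_ge0; apply: ltW.
rewrite lee_pmul//; first by rewrite prode_ge0// => *; exact: poweR_ge0.
  by rewrite prode_ge0// => *; exact: poweR_ge0.
apply: (le_trans (weighted_amgme _)) => [i|].
  by apply: mule_ge0 => //; rewrite lee_fin invr_ge0; apply: ltW.
apply: lee_sum => i _; rewrite muleA -EFinM /c; case: eqVneq => [->|//].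
by rewrite !mul0r.
Qed.

(** The normalized inequality applies when every [N i] with positive exponent is positive and
    finite. If one of them is 0, the left-hand side vanishes; if none is 0 and one is +oo, the
    right-hand side is +oo. *)
Lemma hoelder_sum (J : Type) (s : seq J) (x : I -> J -> \bar R) :
  (forall i j, 0 <= x i j) ->
  \sum_(j <- s) \prod_i (x i j `^ b i) <= \prod_i ((\sum_(j <- s) x i j) `^ b i).
Proof.
move=> x0; set N := fun i => \sum_(j <- s) x i j.
have N0 i : 0 <= N i by apply: sume_ge0.
have [[i [bi Ni]]|h0] := pselect (exists i, (0 < b i)%R /\ N i = 0).
  have z : forall s', \sum_(j <- s') x i j = 0 -> \sum_(j <- s') \prod_i (x i j `^ b i) = 0.
    elim => [|j s' IH]; first by rewrite !big_nil.
    rewrite !big_cons => /eqP; rewrite padde_eq0 ?sume_ge0// => /andP[/eqP xj /eqP/IH ->].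
    by rewrite (@prode_eq0 _ _ _ i) ?add0e// xj poweR0r ?gt_eqF.
  by rewrite z// prode_ge0// => *; exact: poweR_ge0.
have Np i : (0 < b i)%R -> 0 < N i.
  by move=> bi; rewrite lt_neqAle N0 andbT eq_sym; apply/eqP => Ni; apply: h0; exists i.
have [[i [bi Ni]]|hy] := pselect (exists i, (0 < b i)%R /\ N i = +oo).
  rewrite (@prode_eqy _ _ _ i) ?leey//; last by rewrite -/(N i) Ni poweRyr ?gt_eqF.
  move=> k; have [->|bk] := eqVneq (b k) 0%R; first by rewrite poweRe0 lte01.
  by apply: poweR_gt0; apply: Np; rewrite lt_neqAle eq_sym bk b0.
have hN i : (0 < b i)%R -> 0 < N i /\ N i < +oo.
  move=> bi; split; first exact: Np.
  by rewrite lt_neqAle leey andbT; apply/eqP => Ni; apply: hy; exists i.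
have P0 : 0 <= \prod_i (N i `^ b i) by apply: prode_ge0 => *; exact: poweR_ge0.
apply: (@le_trans _ _ (\sum_(j <- s) (\prod_i (N i `^ b i) * \sum_i (b i / fine (N i))%:E * x i j))).
  by apply: lee_sum => j _; exact: weighted_amgm_normalized.
have t0 i j : 0 <= (b i / fine (N i))%:E * x i j.
  by rewrite mule_ge0// lee_fin divr_ge0// fine_ge0.
rewrite -ge0_sume_distrr; last by move=> j _; apply: sume_ge0.
rewrite -[leRHS]mule1 lee_pmul// ?sume_ge0//; first by move=> *; exact: sume_ge0.
rewrite exchange_big/= -b1 -sumEFin; apply: lee_sum => i _.
rewrite -ge0_sume_distrr; last by move=> *; exact: x0.
rewrite -/(N i); have [->|bi] := eqVneq (b i) 0%R; first by rewrite mul0r mul0e.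
have [N1 N2] : 0 < N i /\ N i < +oo by apply: hN; rewrite lt_neqAle eq_sym bi b0.
by rewrite -[in X in _ * X](@fineK _ (N i)) ?ge0_fin_numE// -EFinM divfK// gt_eqF// fine_gt0// N1.
Qed.

End amgm.

(** * Integrals of nonnegative measurable functions *)

Section nonneg_measurable.
Context {R : realType} {d : measure_display} {X : measurableType d}.
Implicit Types f g : X -> \bar R.

(** Enough for monotonicity, linearity and convergence of integrals with values in [0, +oo], so that
    no integrability has to be carried along. *)
Definition nnm f := measurable_fun setT f /\ forall x, 0 <= f x.

Lemma nnm_cst (c : \bar R) : 0 <= c -> nnm (cst c).
Proof. by move=> c0; split => //; exact: measurable_cst. Qed.

Lemma nnm_EFin (f : X -> R) : measurable_fun setT f -> (forall x, (0 <= f x)%R) ->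
  nnm (EFin \o f).
Proof. by move=> mf f0; split => [|x]; [exact/measurable_EFinP|rewrite lee_fin]. Qed.

Lemma nnm_mul f g : nnm f -> nnm g -> nnm (fun x => f x * g x).
Proof.
move=> [mf f0] [mg g0]; split=> [|x]; last exact: mule_ge0.
exact: emeasurable_funM.
Qed.

Lemma nnm_add f g : nnm f -> nnm g -> nnm (fun x => f x + g x).
Proof.
move=> [mf f0] [mg g0]; split=> [|x]; last exact: adde_ge0.
exact: emeasurable_funD.
Qed.

Lemma nnm_pow f (r : R) : measurable_fun setT f -> nnm (fun x => f x `^ r).
Proof.
move=> mf; split=> [|x]; last exact: poweR_ge0.
by apply: (measurableT_comp (measurable_poweR r)).
Qed.

Lemma nnm_sum (I : Type) (s : seq I) (f : I -> X -> \bar R) : (forall i, nnm (f i)) ->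
  nnm (fun x => \sum_(i <- s) f i x).
Proof.
move=> mf; split=> [|x]; last by apply: sume_ge0 => i _; exact: (mf i).2.
by apply: emeasurable_sum => i; exact: (mf i).1.
Qed.

Lemma nnm_prod (I : Type) (s : seq I) (f : I -> X -> \bar R) : (forall i, nnm (f i)) ->
  nnm (fun x => \prod_(i <- s) f i x).
Proof.
move=> mf; elim: s => [|i s IH].
  by under eq_fun do rewrite big_nil; exact: nnm_cst.
by under eq_fun do rewrite big_cons; exact: nnm_mul.
Qed.

Lemma nnm_series (f : nat -> X -> \bar R) : (forall i, nnm (f i)) ->
  nnm (fun x => \sum_(0 <= i <oo) f i x).
Proof.
move=> mf; split=> [|x]; last by apply: nneseries_ge0 => i _ _; exact: (mf i).2.
by apply: ge0_emeasurable_sum => [k x _ _|k _]; [exact: (mf k).2|exact: (mf k).1].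
Qed.

Lemma nnm_indic (A : set X) : measurable A -> nnm (fun x => (\1_A x)%:E).
Proof. by move=> mA; apply: nnm_EFin => //; exact: measurable_indic. Qed.

Lemma nnm_sup (f : nat -> X -> \bar R) : (forall i, nnm (f i)) ->
  nnm (fun x => ereal_sup (range (f^~ x))).
Proof.
move=> mf; split=> [|x].
  have := @measurable_fun_esups _ _ R setT f (fun n => (mf n).1) 0%N.
  by congr (measurable_fun _ _); apply/funext => x; rewrite /esups /sdrop; congr ereal_sup;
    apply/seteqP; split => y /= [k _ <-]; exists k.
by apply: ereal_sup_ge; exists (f 0%N x); [exists 0%N|exact: (mf 0%N).2].
Qed.

Variable nu : {measure set X -> \bar R}.

Lemma le_int f g : nnm f -> nnm g -> (forall x, f x <= g x) ->
  \int[nu]_x f x <= \int[nu]_x g x.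
Proof. by move=> [mf f0] [mg g0] fg; apply: ge0_le_integral. Qed.

Lemma le_int_ae f g : nnm f -> nnm g -> (\forall x \ae nu, f x <= g x) ->
  \int[nu]_x f x <= \int[nu]_x g x.
Proof.
move=> [mf f0] [mg g0] fg; apply: ae_ge0_le_integral => //.
by apply: filterS fg => x.
Qed.

Lemma eq_int_ae f g : nnm f -> nnm g -> (\forall x \ae nu, f x = g x) ->
  \int[nu]_x f x = \int[nu]_x g x.
Proof.
by move=> mf mg fg; apply/eqP; rewrite eq_le !le_int_ae//; apply: filterS fg => x ->.
Qed.

Lemma int_ge0 f : nnm f -> 0 <= \int[nu]_x f x.
Proof. by move=> [_ f0]; apply: integral_ge0. Qed.

Lemma int_scale f (k : \bar R) : nnm f -> 0 <= k ->
  \int[nu]_x (k * f x) = k * \int[nu]_x f x.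
Proof. by move=> [mf f0] k0; rewrite ge0_integralZl. Qed.

Lemma int_add f g : nnm f -> nnm g ->
  \int[nu]_x (f x + g x) = \int[nu]_x f x + \int[nu]_x g x.
Proof. by move=> [mf f0] [mg g0]; rewrite ge0_integralD. Qed.

Lemma int_sum (I : Type) (s : seq I) (f : I -> X -> \bar R) : (forall i, nnm (f i)) ->
  \int[nu]_x (\sum_(i <- s) f i x) = \sum_(i <- s) \int[nu]_x f i x.
Proof. by move=> mf; rewrite ge0_integral_sum// => [i|i x _]; apply mf. Qed.

Lemma int_series (f : nat -> X -> \bar R) : (forall i, nnm (f i)) ->
  \int[nu]_x (\sum_(0 <= i <oo) f i x) = \sum_(0 <= i <oo) \int[nu]_x f i x.
Proof. by move=> mf; rewrite integral_nneseries// => [i|i x _]; apply mf. Qed.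

Lemma int_set f (A : set X) : measurable A ->
  \int[nu]_(x in A) f x = \int[nu]_x (f x * (\1_A x)%:E).
Proof.
move=> mA; rewrite integral_mkcond; apply: eq_integral => x _.
by rewrite patchE indicE; case: ifP; rewrite ?mule1 ?mule0.
Qed.

Lemma nnm_setf f (A : set X) : measurable A -> nnm f -> nnm (fun x => f x * (\1_A x)%:E).
Proof. by move=> mA mf; apply: nnm_mul => //; exact: nnm_indic. Qed.

Lemma ae_eq0_int f : nnm f -> \int[nu]_x f x = 0 -> \forall x \ae nu, f x = 0.
Proof.
move=> [mf f0] h.
have /(ae_eq_integral_abs nu measurableT mf).1 : \int[nu]_x `|f x| = 0.
  by rewrite -h; apply: eq_integral => x _; rewrite gee0_abs.
by apply: filterS => x /= ->.
Qed.

Lemma ae_lty_int f : nnm f -> \int[nu]_x f x < +oo -> \forall x \ae nu, f x < +oo.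
Proof.
move=> [mf f0] h; have fi : nu.-integrable setT f.
  by apply/integrableP; split => //; rewrite (eq_integral f)// => x _; rewrite gee0_abs.
have := integrable_ae measurableT fi; apply: filterS => x /= /(_ I).
by rewrite ge0_fin_numE.
Qed.

Lemma int_sup_le (f : nat -> X -> \bar R) (C : \bar R) : (forall n, nnm (f n)) ->
  (forall x, nondecreasing_seq (f^~ x)) -> (forall n, \int[nu]_x f n x <= C) ->
  \int[nu]_x ereal_sup (range (f^~ x)) <= C.
Proof.
move=> mf ndf hC.
have -> : \int[nu]_x ereal_sup (range (f^~ x)) = \int[nu]_x limn (f^~ x).
  by apply: eq_integral => x _; apply/esym/cvg_lim => //; exact: ereal_nondecreasing_cvgn.
rewrite monotone_convergence//; first last.
- by move=> n x _; exact: (mf n).2.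
- by move=> n; exact: (mf n).1.
apply: lime_le; last by apply: nearW.
apply: ereal_nondecreasing_is_cvgn => m n mn.
by apply: le_int => // x; exact: ndf.
Qed.

Lemma int_Markov f (c : \bar R) : nnm f -> 0 <= c ->
  c * nu [set x | c <= f x] <= \int[nu]_x f x.
Proof.
move=> mf c0; have mA : measurable [set x | c <= f x].
  by rewrite -[X in measurable X]setTI; apply: emeasurable_fun_c_infty => //; exact: mf.1.
set A := [set x | c <= f x] in mA *.
have -> : nu A = \int[nu]_x (\1_A x)%:E.
  by rewrite integral_indic// setIT.
rewrite -int_scale//; last exact: nnm_indic.
apply: le_int => // [|x].
  by apply: nnm_mul; [exact: nnm_cst|exact: nnm_indic].
rewrite indicE; case: (boolP (x \in A)) => [/set_mem/=|_]; rewrite ?mule1 ?mule0//.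
exact: mf.2.
Qed.

Section hoelder_integral.
Context {I : finType}.
Variable b : I -> R.
Hypothesis b0 : forall i, (0 <= b i)%R.
Hypothesis b1 : (\sum_i b i = 1)%R.

(** The same three cases as for sums; if one integral is 0, the product vanishes almost
    everywhere. *)
Lemma hoelder_int (x : I -> X -> \bar R) : (forall i, nnm (x i)) ->
  \int[nu]_t \prod_i (x i t `^ b i) <= \prod_i ((\int[nu]_t x i t) `^ b i).
Proof.
move=> mx; have x0 i t : 0 <= x i t by exact: (mx i).2.
have mp : nnm (fun t => \prod_i (x i t `^ b i)).
  by apply: nnm_prod => i; apply: nnm_pow; exact: (mx i).1.
set N := fun i => \int[nu]_t x i t.
have N0 i : 0 <= N i by apply: int_ge0.
have [[i [bi Ni]]|h0] := pselect (exists i, (0 < b i)%R /\ N i = 0).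
  rewrite (@eq_int_ae _ (cst 0)) ?integral0//.
  - by rewrite prode_ge0// => *; exact: poweR_ge0.
  - have := ae_eq0_int (mx i) Ni; apply: filterS => t xt.
    by rewrite (@prode_eq0 _ _ _ i)// xt poweR0r ?gt_eqF.
have Np i : (0 < b i)%R -> 0 < N i.
  by move=> bi; rewrite lt_neqAle N0 andbT eq_sym; apply/eqP => Ni; apply: h0; exists i.
have [[i [bi Ni]]|hy] := pselect (exists i, (0 < b i)%R /\ N i = +oo).
  rewrite (@prode_eqy _ _ _ i) ?leey//; last by rewrite -/(N i) Ni poweRyr ?gt_eqF.
  move=> k; have [->|bk] := eqVneq (b k) 0%R; first by rewrite poweRe0 lte01.
  by apply: poweR_gt0; apply: Np; rewrite lt_neqAle eq_sym bk b0.
have hN i : (0 < b i)%R -> 0 < N i /\ N i < +oo.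
  move=> bi; split; first exact: Np.
  by rewrite lt_neqAle leey andbT; apply/eqP => Ni; apply: hy; exists i.
have P0 : 0 <= \prod_i (N i `^ b i) by apply: prode_ge0 => *; exact: poweR_ge0.
have mt i : nnm (fun t => (b i / fine (N i))%:E * x i t).
  by apply: nnm_mul => //; apply: nnm_cst; rewrite lee_fin divr_ge0// fine_ge0.
apply: (@le_trans _ _ (\int[nu]_t (\prod_i (N i `^ b i) * \sum_i (b i / fine (N i))%:E * x i t))).
  apply: le_int => // [|t]; last by apply: weighted_amgm_normalized.
  by apply: nnm_mul; [exact: nnm_cst|exact: nnm_sum].
rewrite int_scale//; last exact: nnm_sum.
rewrite -[leRHS]mule1 lee_pmul//; first by apply: int_ge0; exact: nnm_sum.
rewrite int_sum// -b1 -sumEFin; apply: lee_sum => i _.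
rewrite int_scale//; last by rewrite lee_fin divr_ge0// fine_ge0.
rewrite -/(N i); have [->|bi] := eqVneq (b i) 0%R; first by rewrite mul0r mul0e.
have [N1 N2] : 0 < N i /\ N i < +oo by apply: hN; rewrite lt_neqAle eq_sym bi b0.
by rewrite -[in X in _ * X](@fineK _ (N i)) ?ge0_fin_numE// -EFinM divfK// gt_eqF// fine_gt0// N1.
Qed.

End hoelder_integral.

Lemma hoelder_int2 f g (a b : R) : (0 <= a)%R -> (0 <= b)%R -> (a + b = 1)%R ->
  nnm f -> nnm g ->
  \int[nu]_x (f x `^ a * g x `^ b) <= (\int[nu]_x f x) `^ a * (\int[nu]_x g x) `^ b.
Proof.
move=> a0 b0 ab mf mg.
have := @hoelder_int _ (fun i : bool => if i then a else b) _ _ (fun i : bool => if i then f else g).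
rewrite !big_bool /=; under eq_integral do rewrite big_bool.
by apply => // -[].
Qed.

End nonneg_measurable.

(** * Measures given by a density *)

Section density.
Import HBNNSimple.
Context {R : realType} {d : measure_display} {X : measurableType d}.
Variables (mu : {measure set X -> \bar R}) (v : X -> R).

(** The proof [mv] is a parameter because the measure structure attached below depends on the
    measurability and the sign of v. *)
Definition dens (mv : nnm (EFin \o v)) (A : set X) : \bar R :=
  \int[mu]_(x in A) (v x)%:E.

Hypothesis mv : nnm (EFin \o v).

Let v0 x : (0 <= v x)%R. Proof. by rewrite -lee_fin; exact: (mv.2 x). Qed.

Let dens0 : dens mv set0 = 0.
Proof. by rewrite /dens integral_set0. Qed.

Let dens_ge0 A : 0 <= dens mv A.
Proof. by apply: integral_ge0 => x _; rewrite lee_fin. Qed.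

Let dens_sigma_additive : semi_sigma_additive (dens mv).
Proof.
move=> F mF tF mUF; rewrite /dens ge0_integral_bigcup//.
- by apply: is_cvg_nneseries => n _ _; apply: integral_ge0 => x _; rewrite lee_fin.
- by apply: measurable_funTS; exact: mv.1.
- by move=> x _; rewrite lee_fin.
Qed.

HB.instance Definition _ := isMeasure.Build _ _ _ (dens mv) dens0 dens_ge0 dens_sigma_additive.

Definition density : {measure set X -> \bar R} := dens mv.

Lemma densityE A : density A = \int[mu]_(x in A) (v x)%:E. Proof. by []. Qed.

(** For simple functions the identity follows from the definition of the measure by linearity;
    monotone convergence on both sides does the rest. *)
Lemma int_density (f : X -> \bar R) : nnm f ->
  \int[density]_x f x = \int[mu]_x (f x * (v x)%:E).
Proof.
move=> [mf f0].
pose f_ := nnsfun_approx measurableT mf.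
have cv x : EFin \o (fun n => f_ n x) @ \oo --> f x by apply: cvg_nnsfun_approx.
have nd x : nondecreasing_seq (EFin \o (fun n => f_ n x)).
  by move=> m n mn; rewrite lee_fin; have /lefP := nd_nnsfun_approx measurableT mf mn.
have s0 n x : 0 <= (f_ n x)%:E by rewrite lee_fin.
have ms n : nnm (fun x => (f_ n x)%:E) by apply: nnm_EFin.
transitivity (limn (fun n => \int[density]_x (f_ n x)%:E)).
  rewrite -(@monotone_convergence _ _ _ density _ measurableT (fun n x => (f_ n x)%:E)).
  - by apply: eq_integral => x _; apply/esym/cvg_lim => //; exact: cv.
  - by move=> n; exact: (ms n).1.
  - by move=> n x _.
  - by move=> x _; exact: nd.
transitivity (limn (fun n => \int[mu]_x ((f_ n x)%:E * (v x)%:E))); last first.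
  rewrite -(@monotone_convergence _ _ _ mu _ measurableT (fun n x => (f_ n x)%:E * (v x)%:E)).
  - apply: eq_integral => x _; apply/cvg_lim => //.
    by apply: cvgeZr => //; exact: cv.
  - by move=> n; exact: (nnm_mul (ms n) mv).1.
  - by move=> n x _; apply: mule_ge0 => //; exact: (mv.2 x).
  - by move=> x _ m n mn; rewrite lee_wpmul2r//; [exact: (mv.2 x)|exact: nd].
congr (limn _); apply/funext => n.
have mi r : measurable (f_ n @^-1` [set r]) by exact: measurable_sfunP.
transitivity (\sum_(r \in range (f_ n)) r%:E * density (f_ n @^-1` [set r])).
  by rewrite integralT_nnsfun sintegralE.
transitivity (\int[mu]_x (\sum_(r \in range (f_ n)) r%:E * ((\1_(f_ n @^-1` [set r]) x)%:E * (v x)%:E))).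
  rewrite ge0_integral_fsum//; first last.
  - move=> r x _; rewrite indicE; case: (boolP (x \in _)) => [/set_mem/= <-|_].
      by rewrite mul1e mule_ge0// ?lee_fin.
    by rewrite mul0e mule0.
  - move=> r; apply: measurable_funeM.
    by apply: emeasurable_funM; [exact: (nnm_indic (mi r)).1|exact: mv.1].
  apply: eq_fsbigr => r /set_mem[x _ <-].
  rewrite int_scale ?lee_fin//; last by apply: nnm_mul => //; exact: nnm_indic.
  congr (_ * _); rewrite densityE int_set//; apply: eq_integral => y _.
  by rewrite muleC.
apply: eq_integral => x _.
rewrite [in RHS](fimfunE (f_ n)) -fsumEFin//.
rewrite ge0_mule_fsuml.
  by apply: eq_fsbigr => r _; rewrite muleA -EFinM.
move=> r; rewrite indicE; case: (boolP (x \in _)) => [/set_mem/= <-|_].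
  by rewrite mulr1 lee_fin.
by rewrite mulr0.
Qed.

Lemma density_setE A : measurable A -> density A = \int[mu]_x ((v x)%:E * (\1_A x)%:E).
Proof. by move=> mA; rewrite densityE int_set. Qed.

End density.

(** * Duality *)

Section duality.
Context {R : realType} {d : measure_display} {X : measurableType d}.
Variable (nu : {measure set X -> \bar R}).

(* The existence of such a function takes the role of sigma-finiteness. *)
Definition integrable_pos (e : X -> R) :=
  [/\ measurable_fun setT e, forall x, (0 < e x)%R & \int[nu]_x (e x)%:E <= 1].

Variable e : X -> R.
Hypothesis he : integrable_pos e.

(** The natural test function is Y^(rho - 1), but its norm may be infinite. With phi_n = min(Y, n
    c), the integral t of phi_n^rho is finite, the hypothesis yields t <= 4 K t^(1 - 1/rho), and t
    is absorbed. Test functions are strictly positive so that they can later serve as densities. *)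
Lemma dual_poweR (Y : X -> \bar R) (rho K : R) : (1 < rho)%R -> (0 <= K)%R -> nnm Y ->
  (forall phi : X -> R, measurable_fun setT phi -> (forall x, 0 < phi x)%R ->
    \int[nu]_x (phi x `^ (1 - rho^-1)^-1)%:E < +oo ->
    \int[nu]_x (Y x * (phi x)%:E) <=
      K%:E * (\int[nu]_x (phi x `^ (1 - rho^-1)^-1)%:E) `^ (1 - rho^-1)) ->
  \int[nu]_x (Y x `^ rho) <= ((4 * K) `^ rho)%:E.
Proof.
move=> r1 K0 mY hY; have [me e0 e1] := he.
have r0 : (0 < rho)%R by apply: lt_trans r1.
set k := (1 - rho^-1)%R in hY *.
have k0 : (0 < k)%R by rewrite subr_gt0 invf_lt1.
have k1 : (k <= 1)%R by rewrite gerBl invr_ge0 ltW.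
have rk : ((rho - 1) * k^-1 = rho)%R.
  by rewrite /k -[X in (X - rho^-1)%R](@mulfV _ rho) ?gt_eqF// -[X in (_ - X)%R]mul1r -mulrBl invfM invrK mulrA mulfV ?mul1r// subr_eq0 gt_eqF.
(* c^rho is the integrable function e, so [phi n], which is bounded by n c, has a finite rho-th
   moment. *)
pose c x := (e x `^ rho^-1)%R.
have c0 x : (0 < c x)%R by rewrite powR_gt0.
have mc : measurable_fun setT c by apply: (measurableT_comp (measurable_powR _)).
pose phi (n : nat) x : R := fine (mine (Y x) (n%:R * c x)%:E).
have phiE n x : (phi n x)%:E = mine (Y x) (n%:R * c x)%:E.
  rewrite /phi fineK// ge0_fin_numE ?le_min ?mY.2 ?lee_fin ?mulr_ge0// ?ltW//.
  by rewrite gt_min ltry orbT.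
have phi0 n x : (0 <= phi n x)%R.
  by rewrite -lee_fin phiE le_min mY.2 lee_fin mulr_ge0// ltW.
have mphi n : measurable_fun setT (phi n).
  apply: (measurableT_comp (fine_measurable _)) => //.
  apply: measurable_mine; first exact: mY.1.
  by apply/measurable_EFinP; apply: measurable_funM.
have mphip n (r : R) : nnm (fun x => (phi n x `^ r)%:E).
  apply: nnm_EFin => [|x]; last exact: powR_ge0.
  exact: (measurableT_comp (measurable_powR r)).
have le_phi n x : (phi n x)%:E <= Y x by rewrite phiE ge_min lexx.
apply: (@le_trans _ _ (\int[nu]_x ereal_sup (range (fun n => (phi n x `^ rho)%:E)))).
  apply: le_int; first by apply: nnm_pow; exact: mY.1.
    by apply: (nnm_sup (f := fun n x => (phi n x `^ rho)%:E)).
  move=> x; set S := ereal_sup _.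
  have hS n : (phi n x `^ rho)%:E <= S by apply: ereal_sup_ubound; exists n.
  have S0 : 0 <= S by apply: le_trans (hS 0%N); rewrite lee_fin powR_ge0.
  apply: le_poweR_root => //; first exact: mY.2.
  have {}hS n : (phi n x)%:E <= S `^ rho^-1.
    by apply: poweR_le_root => //; rewrite ?lee_fin ?phi0// poweR_EFin.
  move: hS (poweR_ge0 S rho^-1); case: (S `^ rho^-1) => [s hs s0| _ _|//]; last by rewrite leey.
  have /(_ (Num.truncn (s / c x)).+1) := hs.
  rewrite phiE ge_min => /orP[//|]; rewrite lee_fin leNgt => /negP[].
  by rewrite -ltr_pdivrMr// truncnS_gt.
apply: int_sup_le => //.
  move=> x m n mn; rewrite lee_fin; apply: ge0_ler_powR; rewrite ?nnegrE ?phi0//; first exact: ltW.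
  rewrite -lee_fin !phiE le_min ge_min lexx/= ge_min lee_fin ler_pM2r// ler_nat mn orbT//.
move=> n; set t := \int[nu]_x _.
have t0 : 0 <= t by apply: int_ge0.
have ty : t < +oo.
  apply: (@le_lt_trans _ _ (\int[nu]_x ((n%:R `^ rho)%:E * (e x)%:E))).
    apply: le_int => //.
      by apply: nnm_mul; [apply: nnm_cst; rewrite lee_fin powR_ge0|apply: nnm_EFin => // x; exact: ltW].
    move=> x; have : (phi n x)%:E <= (n%:R * c x)%:E by rewrite phiE ge_min lexx orbT.
    rewrite -EFinM !lee_fin => h.
    apply: (@le_trans _ _ ((n%:R * c x) `^ rho)%R).
      by rewrite ge0_ler_powR ?nnegrE ?phi0 ?mulr_ge0// ltW.
    by rewrite (powRM rho (ler0n _ n) (ltW (c0 x))) /c -powRrM mulVf ?gt_eqF// powRr1//; exact: ltW.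
  rewrite int_scale ?lee_fin ?powR_ge0//; last by apply: nnm_EFin => // x; exact: ltW.
  apply: (@le_lt_trans _ _ ((n%:R `^ rho)%:E * 1)); last by rewrite mule1 ltry.
  by apply: lee_wpmul2l => //; rewrite lee_fin powR_ge0.
have [->|tn] := eqVneq t 0; first by rewrite lee_fin powR_ge0.
have tf : t \is a fin_num by rewrite ge0_fin_numE.
pose l := fine t.
have l0 : (0 < l)%R by rewrite fine_gt0// ty andbT lt_neqAle eq_sym tn t0.
apply: absorb_poweR => //; first by rewrite mulr_ge0.
(* The second summand makes the test function positive. As e has integral at most 1, it adds at most
   l = t to the integral of ph^(1/k), no more than the first summand. *)
pose ph x := (phi n x `^ (rho - 1) + (l * e x) `^ k)%R.
have mph : measurable_fun setT ph.
  apply: measurable_funD; first exact: (measurableT_comp (measurable_powR _)).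
  by apply: (measurableT_comp (measurable_powR _)) => //; exact: measurable_funM.
have ph0 x : (0 < ph x)%R by rewrite /ph ltr_wpDl ?powR_ge0// powR_gt0// mulr_gt0.
have kV : (0 <= k^-1)%R by rewrite invr_ge0 ltW.
have hph : \int[nu]_x (ph x `^ k^-1)%:E <= (2 `^ k^-1)%:E * (2%:E * t).
  apply: (@le_trans _ _ (\int[nu]_x ((2 `^ k^-1)%:E * ((phi n x `^ rho)%:E + l%:E * (e x)%:E)))).
    apply: le_int.
    - by apply: nnm_EFin => [|x]; [exact: (measurableT_comp (measurable_powR _))|exact: powR_ge0].
    - apply: nnm_mul; first by apply: nnm_cst; rewrite lee_fin powR_ge0.
      apply: nnm_add => //; apply: nnm_mul; first by apply: nnm_cst; rewrite lee_fin ltW.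
      by apply: nnm_EFin => // x; exact: ltW.
    move=> x; have := @poweRD_le _ (phi n x `^ (rho - 1))%:E ((l * e x) `^ k)%:E k^-1 kV.
    rewrite !lee_fin !powR_ge0 => /(_ isT isT) /le_trans; apply.
    by rewrite -!powRrM rk mulfV ?gt_eqF// powRr1//; apply: mulr_ge0; exact: ltW.
  rewrite int_scale ?lee_fin ?powR_ge0//; last first.
    apply: nnm_add => //; apply: nnm_mul; first by apply: nnm_cst; rewrite lee_fin ltW.
    by apply: nnm_EFin => // x; exact: ltW.
  rewrite lee_pmul2l ?lte_fin ?powR_gt0// int_add//; last first.
    apply: nnm_mul; first by apply: nnm_cst; rewrite lee_fin ltW.
    by apply: nnm_EFin => // x; exact: ltW.
  rewrite int_scale ?lee_fin ?(ltW l0)//; last by apply: nnm_EFin => // x; exact: ltW.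
  rewrite mule_natl mule2n leeD2l// -[leRHS](fineK tf) -[leRHS]mule1.
  by rewrite lee_pmul2l// lte_fin.
have phy : \int[nu]_x (ph x `^ k^-1)%:E < +oo.
  by apply: le_lt_trans hph _; rewrite -(fineK tf) -!EFinM ltry.
have := hY ph mph ph0 phy => h.
apply: (@le_trans _ _ (\int[nu]_x (Y x * (ph x)%:E))).
  apply: le_int => //.
    by apply: nnm_mul => //; apply: nnm_EFin => // x; exact: ltW.
  move=> x; apply: (@le_trans _ _ ((phi n x)%:E * (phi n x `^ (rho - 1))%:E)).
    by rewrite -EFinM lee_fin mulr_powRB1.
  by rewrite lee_pmul ?lee_fin ?powR_ge0// /ph lerDl powR_ge0.
apply: (le_trans h); rewrite (mulrC 4%R K) (EFinM K 4%R) -muleA; apply: lee_wpmul2l; first by rewrite lee_fin.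
apply: (le_trans (lee_poweR (ltW k0) _ hph)).
  by apply: int_ge0; apply: nnm_EFin => [|x]; [exact: (measurableT_comp (measurable_powR _))|exact: powR_ge0].
rewrite muleA -EFinM poweRM; [|by rewrite lee_fin; apply: mulr_ge0 => //; exact: powR_ge0|by []].
apply: lee_wpmul2r; first exact: poweR_ge0.
(* The constant 4: a factor 2 is the k-th power of 2^(1/k), and the doubled integral gives 2^k <=
   2. *)
rewrite poweR_EFin lee_fin powRM ?powR_ge0// -powRrM mulVf ?gt_eqF// powRr1//.
have : (2 `^ k <= 2 `^ 1 :> R)%R by rewrite ler_powR// ler1n.
by rewrite powRr1// => h2; apply: (@le_trans _ _ (2 * 2)%R); [rewrite ler_pM2l|rewrite -natrM].
Qed.

End duality.

(** The function e / (1 + v) works, since v / (1 + v) <= 1. Weighted measures thus inherit what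
    duality asks for. *)
Lemma density_integrable_pos (R : realType) (d : measure_display) (X : measurableType d)
  (mu : {measure set X -> \bar R}) (v e : X -> R) (mv : nnm (EFin \o v)) :
  integrable_pos mu e -> exists e', integrable_pos (density mu mv) e'.
Proof.
move=> [me e0 e1]; have v0 x : (0 <= v x)%R by rewrite -lee_fin; exact: (mv.2 x).
have v1 x : (0 < 1 + v x)%R by rewrite ltr_wpDr.
have mv' : measurable_fun setT v by apply/measurable_EFinP; exact: mv.1.
exists (fun x => e x * (1 + v x) `^ (-1))%R; split.
- apply: measurable_funM => //; apply: (measurableT_comp (measurable_powR _)) => //.
  exact: measurable_funD.
- by move=> x; rewrite mulr_gt0// powR_gt0.
- have mE : nnm (fun x => (e x * (1 + v x) `^ (-1))%:E).
    apply: nnm_EFin => [|x]; last by rewrite mulr_ge0 ?powR_ge0// ltW.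
    apply: measurable_funM => //; apply: (measurableT_comp (measurable_powR _)) => //.
    exact: measurable_funD.
  rewrite int_density//; apply: le_trans e1; apply: le_int.
  + exact: nnm_mul.
  + by apply: nnm_EFin => // x; exact: ltW.
  + move=> x; rewrite -EFinM lee_fin -mulrA ler_piMr//; [exact: ltW|rewrite powR_inv1 ?(ltW (v1 x))//].
    by rewrite mulrC ler_pdivrMr// mul1r lerDr.
Qed.

(** * Averages with respect to a measure *)

Section averages.
Context {R : realType} {d : measure_display} {X : measurableType d}.
Variable nu : {measure set X -> \bar R}.
Implicit Types (f g : X -> \bar R) (A : set X).

(** By [fine], the normalizing factor is a real number, equal to 0 when the measure of A is 0 or
    +oo. In contrast to [average], there is neither absolute value nor exponent. *)
Definition avg f A : \bar R :=
  (fine (nu A))^-1%:E * \int[nu]_x (f x * (\1_A x)%:E).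

Lemma avg_ge0 f A : nnm f -> 0 <= avg f A.
Proof.
move=> mf; rewrite /avg mule_ge0 ?lee_fin ?invr_ge0 ?fine_ge0//.
by apply: integral_ge0 => x _; rewrite mule_ge0// ?lee_fin//; exact: mf.2.
Qed.

Section one_set.
Variable A : set X.
Hypothesis mA : measurable A.
Hypothesis A0 : 0 < nu A.
Hypothesis Ay : nu A < +oo.

Let a0 : (0 < fine (nu A))%R. Proof. by rewrite fine_gt0// A0. Qed.
Let aE : (fine (nu A))%:E = nu A. Proof. by rewrite fineK// ge0_fin_numE// ltW. Qed.

Lemma avgK f : nu A * avg f A = \int[nu]_x (f x * (\1_A x)%:E).
Proof. by rewrite /avg muleA -{1}aE -EFinM mulfV ?mul1e// gt_eqF. Qed.

Lemma le_avg f g : nnm f -> nnm g -> (forall x, A x -> f x <= g x) -> avg f A <= avg g A.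
Proof.
move=> mf mg fg; rewrite /avg lee_wpmul2l ?lee_fin ?invr_ge0 ?fine_ge0//.
apply: le_int; try exact: nnm_setf.
by move=> x; rewrite indicE; case: (boolP (x \in A)) => [/set_mem/fg|_]; rewrite ?mule1 ?mule0.
Qed.

Lemma avg_scale f (k : \bar R) : nnm f -> 0 <= k -> avg (fun x => k * f x) A = k * avg f A.
Proof.
move=> mf k0; rewrite /avg muleCA -(int_scale _ (nnm_setf mA mf) k0).
by congr (_ * _); apply: eq_integral => x _; rewrite muleA.
Qed.

Lemma avg_cst (k : \bar R) : 0 <= k -> avg (cst k) A = k.
Proof.
move=> k0; rewrite /avg int_scale//; last exact: nnm_indic.
by rewrite integral_indic// setIT -{2}aE muleCA -EFinM mulVf ?mule1// gt_eqF.
Qed.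

Lemma avg_series (f : nat -> X -> \bar R) : (forall n, nnm (f n)) ->
  avg (fun x => \sum_(0 <= n <oo) f n x) A = \sum_(0 <= n <oo) avg (f n) A.
Proof.
move=> mf; rewrite /avg nneseriesZl => [|n _]; last first.
  by apply: integral_ge0 => x _; rewrite mule_ge0// ?lee_fin//; exact: (mf n).2.
congr (_ * _); rewrite -int_series => [|n]; last exact: nnm_setf.
apply: eq_integral => x _; rewrite muleC -nneseriesZl => [|n _]; last exact: (mf n).2.
by apply: eq_eseriesr => n _; rewrite muleC.
Qed.

Lemma avg_hoelder f g (a b : R) : (0 <= a)%R -> (0 <= b)%R -> (a + b = 1)%R ->
  nnm f -> nnm g ->
  avg (fun x => f x `^ a * g x `^ b) A <= avg f A `^ a * avg g A `^ b.
Proof.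
move=> a0' b0 ab mf mg; rewrite /avg.
have i0 h : nnm h -> 0 <= \int[nu]_x (h x * (\1_A x)%:E).
  by move=> mh; apply: int_ge0; exact: nnm_setf.
have c0 : 0 <= (fine (nu A))^-1%:E :> \bar R by rewrite lee_fin invr_ge0 fine_ge0.
rewrite !poweRM ?i0// muleACA -poweRD; last by rewrite /poweRD_def ab oner_eq0.
rewrite ab poweRe1//; apply: lee_wpmul2l => //.
apply: le_trans (hoelder_int2 nu a0' b0 ab (nnm_setf mA mf) (nnm_setf mA mg)).
apply: le_int.
- apply: nnm_setf => //; apply: nnm_mul; apply: nnm_pow; [exact: mf.1|exact: mg.1].
- by apply: nnm_mul; apply: nnm_pow; apply: emeasurable_funM;
    [exact: mf.1|exact: (nnm_indic mA).1|exact: mg.1|exact: (nnm_indic mA).1].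
- move=> x; rewrite indicE; case: (boolP (x \in A)) => _; rewrite ?mule1// mule0.
  by rewrite mule_ge0// poweR_ge0.
Qed.

(** Jensen's inequality, as the case of Hoelder's inequality in which one function is the constant
    1. *)
Lemma avg_poweR f (P : R) : (1 <= P)%R -> nnm f ->
  avg f A `^ P <= avg (fun x => f x `^ P) A.
Proof.
move=> P1 mf; have P0 : (0 < P)%R by apply: lt_le_trans P1.
have mfP : nnm (fun x => f x `^ P) by apply: nnm_pow; exact: mf.1.
apply: le_poweR_root => //; [exact: avg_ge0|exact: avg_ge0|].
have := @avg_hoelder (fun x => f x `^ P) (cst 1) P^-1 (1 - P^-1).
rewrite subr_ge0 invf_le1// P1 invr_ge0 (ltW P0) addrC subrK => /(_ isT isT erefl mfP).
have m1 : nnm (cst 1 : X -> \bar R) by apply: nnm_cst.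
move=> /(_ m1); rewrite avg_cst// poweR1r mule1; apply: le_trans.
apply: le_avg => // [|x _].
  by apply: nnm_mul; [apply: nnm_pow; exact: mfP.1|apply: nnm_cst].
by rewrite mule1 poweRK ?gt_eqF//; exact: mf.2.
Qed.

End one_set.
End averages.

(** * Dyadic maximal operators and Doob's inequality *)

Section cubes.
Context {R : realType} {d : measure_display} {X : measurableType d}.

(* [lab n] tells to which of the [N] laminar subfamilies [Q n] belongs. *)
Record laminar (N : nat) (Q : nat -> set X) (lab : nat -> 'I_N) : Prop := Laminar {
  laminar_measurable : forall n, measurable (Q n) ;
  laminar_nested : forall i j, lab i = lab j ->
    Q i `&` Q j = set0 \/ Q i `<=` Q j \/ Q j `<=` Q i }.

Definition finite_pos (Q : nat -> set X) (nu : {measure set X -> \bar R}) : Prop :=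
  forall n, 0 < nu (Q n) /\ nu (Q n) < +oo.

Variables (N : nat) (Q : nat -> set X) (lab : nat -> 'I_N).
Hypothesis lamQ : laminar Q lab.

Let mQ n : measurable (Q n). Proof. exact: laminar_measurable lamQ n. Qed.

Section one_measure.
Variable nu : {measure set X -> \bar R}.
Hypothesis nuQ : finite_pos Q nu.
Implicit Types (f g : X -> \bar R).

(** Cubes that miss x stay in the supremum and contribute 0. It is thus a countable supremum of
    measurable functions, over indices that do not depend on x. *)
Definition maximal f (x : X) : \bar R :=
  ereal_sup (range (fun n => avg nu f (Q n) * (\1_(Q n) x)%:E)).

Lemma nnm_maximal f : nnm f -> nnm (maximal f).
Proof.
move=> mf; apply: (nnm_sup (f := fun n x => avg nu f (Q n) * (\1_(Q n) x)%:E)) => n.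
by apply: nnm_mul; [apply: nnm_cst; exact: avg_ge0|exact: nnm_indic].
Qed.

Lemma avg_le_maximal f n x : Q n x -> avg nu f (Q n) <= maximal f x.
Proof.
by move=> Qx; apply: ereal_sup_ubound; exists n => //; rewrite indicE mem_set// mule1.
Qed.

Lemma maximal_le f x y : 0 <= y -> (forall n, Q n x -> avg nu f (Q n) <= y) ->
  maximal f x <= y.
Proof.
move=> y0 h; apply: ge_ereal_sup => _ [n _ <-]; rewrite indicE.
by case: (boolP (x \in Q n)) => [/set_mem/h|_]; rewrite ?mule1 ?mule0.
Qed.

Lemma le_maximal f g x : nnm f -> nnm g -> (forall y, f y <= g y) ->
  maximal f x <= maximal g x.
Proof.
move=> mf mg fg; apply: maximal_le => [|n Qx]; first exact: (nnm_maximal mg).2.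
by apply: le_trans (avg_le_maximal _ Qx); apply: le_avg.
Qed.

Section finite_maximal.
Variable alpha : nat -> R.

(** A maximal function over finitely many cubes, with arbitrary real values alpha n in place of
    averages. The recursion on the list allows Doob's inequality to be proved by adding one cube at
    a time. *)
Fixpoint fmax (s : seq nat) (x : X) : R :=
  if s is n :: s' then Num.max (alpha n * \1_(Q n) x)%R (fmax s' x) else 0%R.

Lemma fmax_ge0 s x : (0 <= fmax s x)%R.
Proof. by elim: s => //= n s IH; rewrite le_max IH orbT. Qed.

Lemma fmax_le s x y : (0 <= y)%R -> (forall n, n \in s -> Q n x -> (alpha n <= y)%R) ->
  (fmax s x <= y)%R.
Proof.
move=> y0; elim: s => //= n s IH h; rewrite ge_max IH ?andbT => [|k ks]; last first.
  by apply: h; rewrite inE ks orbT.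
rewrite indicE; case: (boolP (x \in Q n)) => [/set_mem/h|_]; rewrite ?mulr1 ?mulr0//.
by apply; rewrite inE eqxx.
Qed.

Lemma le_fmax s x n : n \in s -> Q n x -> (alpha n <= fmax s x)%R.
Proof.
move=> + Qx; elim: s => //= k s IH; rewrite inE => /orP[/eqP<-|/IH h].
  by rewrite indicE mem_set// mulr1 le_max lexx.
by rewrite le_max h orbT.
Qed.

Lemma sub_fmax s s' x : {subset s <= s'} -> (fmax s x <= fmax s' x)%R.
Proof. by move=> ss; apply: fmax_le => [|n /ss]; [exact: fmax_ge0|exact: le_fmax]. Qed.

Lemma measurable_fmax s : measurable_fun setT (fmax s).
Proof.
elim: s => [|n s IH] /=; first exact: measurable_cst.
by apply: measurable_maxr => //; apply: measurable_funM => //; exact: measurable_indic.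
Qed.

(** No cube of the tail lies strictly inside the head. Within one laminar family, a tail cube that
    meets the head then contains it, so the maximum over the tail is constant on the head. This
    order replaces a filtration. *)
Fixpoint minfirst (s : seq nat) : Prop :=
  if s is n :: s' then
    (forall k, k \in s' -> Q k `<=` Q n -> Q n `<=` Q k) /\ minfirst s' else True.

Lemma minfirst_exists (s : seq nat) : exists2 s' : seq nat, s' =i s & minfirst s'.
Proof.
have [m] := ubnP (size s); elim: m s => // m IH [|a s] /=; first by exists [::].
rewrite ltnS => sm.
have [n ns hn] : exists2 n, n \in a :: s &
    forall k, k \in a :: s -> Q k `<=` Q n -> Q n `<=` Q k.
  elim: s a {sm} => [|b s IHs] a; first by exists a; rewrite ?inE// => k; rewrite inE => /eqP->.
  have [n ns hn] := IHs b.
  have [an|an] := pselect (Q a `<=` Q n).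
    exists a; rewrite ?inE ?eqxx// => k; rewrite inE => /orP[/eqP->//|/hn h] ka.
    by apply: (subset_trans an); apply: h; exact: (subset_trans ka an).
  exists n; first by rewrite inE ns orbT.
  by move=> k; rewrite inE => /orP[/eqP->//|/hn].
have [|s' s'E hs'] := IH (rem n (a :: s)).
  by rewrite size_rem//=.
exists (n :: s').
  move=> k; rewrite inE s'E; apply/orP/idP => [[/eqP->//|/mem_rem//]|kas].
  have [->|kn] := eqVneq k n; first by left.
  by right; move: kas; rewrite (perm_mem (perm_to_rem ns)) inE (negbTE kn).
by split=> // k; rewrite s'E => /mem_rem/hn.
Qed.

End finite_maximal.

Section one_lattice.
Variables (f : X -> \bar R) (l : 'I_N) (P : R).
Hypothesis mf : nnm f.
Hypothesis P1 : (1 < P)%R.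
Hypothesis fin : forall n, avg nu f (Q n) < +oo.

Let alpha n := fine (avg nu f (Q n)).
Let alphaE n : (alpha n)%:E = avg nu f (Q n).
Proof. by rewrite fineK// ge0_fin_numE//; exact: avg_ge0. Qed.
Let alpha0 n : (0 <= alpha n)%R. Proof. by rewrite fine_ge0//; exact: avg_ge0. Qed.
Let P0 : (0 < P)%R. Proof. by apply: lt_trans P1. Qed.
Let P10 : (0 < P - 1)%R. Proof. by rewrite subr_gt0. Qed.
Let m := fmax alpha.

Let mm s (r : R) : nnm (fun x => (m s x `^ r)%:E).
Proof.
apply: nnm_EFin => [|x]; last exact: powR_ge0.
by apply: (measurableT_comp (measurable_powR r)); exact: measurable_fmax.
Qed.

(** Equivalent to Young's inequality a c^(P-1) <= a^P / P + (1 - 1/P) c^P. *)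
Lemma doob_increment (a c : R) : (0 <= c)%R -> (c <= a)%R ->
  (a `^ P - c `^ P <= P / (P - 1) * (a * (a `^ (P - 1) - c `^ (P - 1))))%R.
Proof.
move=> c0 ca; have a0 := le_trans c0 ca.
rewrite mulrBr mulr_powRB1// mulrAC ler_pdivlMr//.
have h : (a * c `^ (P - 1) <= P^-1 * a `^ P + (1 - P^-1) * c `^ P)%R.
  have := @weighted_amgm R bool (fun i => if i then P^-1 else 1 - P^-1)%R.
  rewrite big_bool /= addrC subrK => /(_ _ erefl) => /(_ _ (fun i => if i then a `^ P else c `^ P)%R).
  rewrite !big_bool /= -!powRrM mulfV ?gt_eqF// powRr1// mulrBr mulr1 mulfV ?gt_eqF//.
  apply=> -[]; rewrite ?invr_ge0 ?(ltW P0) ?powR_ge0//.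
  by rewrite subr_ge0 invf_le1// ltW.
have : (P * (a * c `^ (P - 1)) <= P * (P^-1 * a `^ P + (1 - P^-1) * c `^ P))%R.
  by rewrite ler_pM2l.
rewrite mulrDr !mulrA mulfV ?gt_eqF// mul1r mulrBr mulr1 mulfV ?gt_eqF//.
by rewrite -mulrA; lra.
Qed.

(** Adding a minimal cube Q n raises m^P on it by the constant alpha^P - c^P, and m^(P-1) likewise.
    As f has integral alpha nu(Q n) over this cube, the induction step is [doob_increment]
    multiplied by nu(Q n). *)
Lemma doob_fmax s : (forall n, n \in s -> lab n = l) -> minfirst s ->
  \int[nu]_x (m s x `^ P)%:E <=
  (P / (P - 1))%:E * \int[nu]_x (f x * (m s x `^ (P - 1))%:E).
Proof.
elim: s => [|n s IH] hl /=.
  move=> _; rewrite (eq_integral (cst 0)) ?integral0 => [|x _]; last first.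
    by rewrite /m /= powR0// gt_eqF.
  apply: mule_ge0; first by rewrite lee_fin divr_ge0// ltW.
  by apply: integral_ge0 => x _; rewrite mule_ge0// ?lee_fin ?powR_ge0//; exact: mf.2.
move=> [hn hs]; have {}IH := IH (fun k ks => hl k (@mem_behead _ (n :: s) k ks)) hs.
pose s' := [seq k <- s | `[< Q n `<=` Q k >]].
(* The value taken on the whole of Q n by the maximum over the tail. *)
pose c := \big[Num.max/0%R]_(k <- s') alpha k.
have c0 : (0 <= c)%R by rewrite /c; elim/big_rec : _ => // i x _ x0; rewrite le_max x0 orbT.
have mc x : Q n x -> m s x = c.
  move=> Qx; apply/eqP; rewrite eq_le; apply/andP; split.
    apply: fmax_le => // k ks Qk; apply: le_bigmax_seq => //.
    rewrite mem_filter ks andbT; apply/asboolP.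
    have : lab n = lab k by rewrite !hl// ?inE ?eqxx ?ks ?orbT.
    move=> /(laminar_nested lamQ)[nk|[//|/(hn _ ks)//]].
    by have : (Q n `&` Q k) x by []; rewrite nk.
  rewrite /c big_seq; apply: bigmax_le => [|k]; first exact: fmax_ge0.
  by rewrite mem_filter => /andP[/asboolP nk ks]; apply: le_fmax => //; exact: nk.
(* If the new value does not exceed c, adding the cube changes nothing; otherwise the maximum jumps
   from c to alpha n on Q n. *)
have [ac|ca] := leP (alpha n) c.
  have e x : Num.max (alpha n * \1_(Q n) x)%R (m s x) = m s x.
    apply/max_idPr; rewrite indicE; case: (boolP (x \in Q n)) => [/set_mem Qx|_].
      by rewrite mulr1 mc.
    by rewrite mulr0 fmax_ge0.
  under eq_integral do rewrite e.
  by under [X in _ <= _ * X]eq_integral do rewrite e.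
have e r x : (0 <= r)%R -> ((Num.max (alpha n * \1_(Q n) x) (m s x)) `^ r =
    (m s x) `^ r + (alpha n `^ r - c `^ r) * \1_(Q n) x)%R.
  move=> r0; rewrite indicE; case: (boolP (x \in Q n)) => [/set_mem Qx|_].
    by rewrite mulr1 mc// (max_l (ltW ca)) mulr1 addrC subrK.
  by rewrite !mulr0 addr0 max_r ?fmax_ge0.
have d0 r : (0 <= r)%R -> (0 <= alpha n `^ r - c `^ r)%R.
  by move=> r0; rewrite subr_ge0 ge0_ler_powR ?nnegrE ?alpha0// ltW.
under eq_integral do rewrite (e _ _ (ltW P0)) EFinD EFinM.
have P1' := ltW P10.
under [X in _ <= _ * X]eq_integral do
  rewrite (e _ _ P1') EFinD EFinM ge0_muleDr ?lee_fin ?powR_ge0 ?mulr_ge0 ?d0// muleCA.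
have n1 r : 0 <= r -> nnm (fun x => r * (\1_(Q n) x)%:E).
  by move=> r0; apply: nnm_mul; [exact: nnm_cst|exact: nnm_indic].
rewrite int_add//; last by apply: n1; rewrite lee_fin d0// ltW.
rewrite int_add//; last 2 first.
  by apply: nnm_mul.
  by apply: nnm_mul; [apply: nnm_cst; rewrite lee_fin d0|exact: nnm_setf].
rewrite ge0_muleDr; last 2 first.
  by apply: int_ge0; exact: nnm_mul.
  by apply: int_ge0; apply: nnm_mul; [apply: nnm_cst; rewrite lee_fin d0|exact: nnm_setf].
apply: leeD => //.
rewrite int_scale ?lee_fin ?(d0 _ (ltW P0))//; last exact: nnm_indic.
rewrite int_scale ?lee_fin ?d0//; last exact: nnm_setf.
rewrite integral_indic// setIT -avgK; [|exact: (nuQ n).1|exact: (nuQ n).2].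
rewrite -alphaE muleA muleCA [in leRHS]muleC; rewrite [in leLHS]muleC.
rewrite [leRHS]muleC; apply: lee_wpmul2l => //; rewrite -!EFinM lee_fin.
by rewrite -mulrA [X in (_ * X)%R]mulrC; exact: (doob_increment c0 (ltW ca)).
Qed.

(** Hoelder's inequality on the right-hand side of [doob_fmax] leaves the integral to the power 1 -
    1/P, which is absorbed. It is finite a priori, because finitely many cubes of finite measure
    carry finite values. *)
Lemma doob_strong s : (forall n, n \in s -> lab n = l) ->
  \int[nu]_x (f x `^ P) < +oo ->
  \int[nu]_x (m s x `^ P)%:E <= ((P / (P - 1)) `^ P)%:E * \int[nu]_x (f x `^ P).
Proof.
move=> hl fP.
have [s' s's hs'] := minfirst_exists s.
have -> : m s = m s'.
  by apply/funext => x; apply/eqP; rewrite eq_le !sub_fmax// => k; rewrite s's.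
have {}hl k : k \in s' -> lab k = l by rewrite s's => /hl.
have mfP : nnm (fun x => f x `^ P) by apply: nnm_pow; exact: mf.1.
set F := (X in X < _) in fP *.
have F0 : 0 <= F by apply: int_ge0.
have Ff : F \is a fin_num by rewrite ge0_fin_numE.
have ty : \int[nu]_x (m s' x `^ P)%:E < +oo.
  have h x : (m s' x `^ P)%:E <= \sum_(n <- s') ((alpha n `^ P)%:E * (\1_(Q n) x)%:E).
    elim: s' {s's hs' hl} => [|n s1 IH] /=; first by rewrite big_nil /m/= powR0// gt_eqF.
    rewrite big_cons /m /=; have [h|h] := leP (alpha n * \1_(Q n) x)%R (fmax alpha s1 x).
      by apply: (le_trans IH); rewrite leeDr// mule_ge0 ?lee_fin ?powR_ge0.
    rewrite (@le_trans _ _ ((alpha n `^ P)%:E * (\1_(Q n) x)%:E))//.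
      rewrite indicE; case: (x \in Q n); rewrite ?mulr1 ?mule1// mulr0 mule0.
      by rewrite powR0// gt_eqF.
    by rewrite leeDl// sume_ge0// => k _; rewrite mule_ge0 ?lee_fin ?powR_ge0.
  apply: (@le_lt_trans _ _ (\int[nu]_x \sum_(n <- s') ((alpha n `^ P)%:E * (\1_(Q n) x)%:E))).
    by apply: le_int => //; apply: nnm_sum => n; apply: nnm_mul;
      [apply: nnm_cst; rewrite lee_fin powR_ge0|exact: nnm_indic].
  rewrite int_sum => [|n]; last by apply: nnm_mul;
      [apply: nnm_cst; rewrite lee_fin powR_ge0|exact: nnm_indic].
  apply: lte_sum_pinfty => n _; rewrite int_scale ?lee_fin ?powR_ge0//; last exact: nnm_indic.
  rewrite integral_indic// setIT; have [] := nuQ n; case: (nu (Q n)) => // r _ _.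
  by rewrite -EFinM ltry.
have t0 : 0 <= \int[nu]_x (m s' x `^ P)%:E by apply: int_ge0.
have PP : (0 <= P / (P - 1))%R by rewrite divr_ge0// ltW.
have := @absorb_poweR _ _ (P / (P - 1) * fine (F `^ P^-1))%R P P1 _ t0 ty.
have E : ((P / (P - 1) * fine (F `^ P^-1)) `^ P)%:E = ((P / (P - 1)) `^ P)%:E * F.
  rewrite powRM ?fine_ge0 ?poweR_ge0// EFinM; congr (_ * _).
  by rewrite -poweR_EFin fineK ?fin_num_poweR// poweRVK// gt_eqF.
rewrite E; apply; first by rewrite mulr_ge0// fine_ge0 ?poweR_ge0.
apply: (le_trans (doob_fmax hl hs')); rewrite [X in _ <= X * _]EFinM -muleA fineK ?fin_num_poweR//.
rewrite lee_wpmul2l ?lee_fin//.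
have i0 : (0 <= P^-1)%R by rewrite invr_ge0 ltW.
have i1 : (0 <= 1 - P^-1)%R by rewrite subr_ge0 invf_le1// ltW.
have := @hoelder_int2 _ _ _ nu (fun x => f x `^ P) (fun x => (m s' x `^ P)%:E) _ _ i0 i1.
rewrite addrC subrK => /(_ erefl mfP (mm _ _)); apply: le_trans.
apply: le_int.
- exact: nnm_mul.
- by apply: nnm_mul; apply: nnm_pow; [exact: mfP.1|exact: (mm _ _).1].
- move=> x; rewrite poweRK ?gt_eqF//; last exact: mf.2.
  by rewrite poweR_EFin -powRrM mulrBr mulr1 mulfV// gt_eqF.
Qed.

End one_lattice.

(** The constant does not involve nu, so the bound applies to every weighted measure. The cubes are
    exhausted by finite lists, and each list is split according to the N labels, which explains the
    factor N. *)
Lemma maximal_strong f (P : R) : nnm f -> (1 < P)%R ->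
  \int[nu]_x (maximal f x `^ P) <=
  (N%:R * (P / (P - 1)) `^ P)%:E * \int[nu]_x (f x `^ P).
Proof.
move=> mf P1; have P0 : (0 < P)%R by apply: lt_trans P1.
have C0 : (0 <= (P / (P - 1)) `^ P)%R by rewrite powR_ge0.
have mfP : nnm (fun x => f x `^ P) by apply: nnm_pow; exact: mf.1.
have F0 : 0 <= \int[nu]_x (f x `^ P) by apply: int_ge0.
have [Fy|Fy] := eqVneq (\int[nu]_x (f x `^ P)) +oo.
  rewrite Fy; have [i _] : exists i : 'I_N, True by exists (lab 0%N).
  rewrite gt0_muley ?leey// lte_fin mulr_gt0 ?powR_gt0 ?divr_gt0 ?subr_gt0//.
  by rewrite ltr0n (leq_ltn_trans _ (ltn_ord i)).
have {}Fy : \int[nu]_x (f x `^ P) < +oo by rewrite lt_neqAle Fy leey.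
(* By Jensen's inequality, the P-th power of an average of f is at most the average of f^P, which is
   finite. *)
have fin n : avg nu f (Q n) < +oo.
  have [Q0 Qy] := nuQ n.
  have := avg_poweR (mQ n) Q0 Qy (ltW P1) mf.
  rewrite /(avg _ (fun x => f x `^ P)) => h.
  apply: (@lty_poweRy _ _ P); first by rewrite gt_eqF.
  apply: (le_lt_trans h); apply: lte_mul_pinfty => //.
  apply: le_lt_trans Fy; apply: le_int => //; first exact: nnm_setf.
  by move=> x; rewrite -[leRHS]mule1 lee_wpmul2l ?poweR_ge0// lee_fin indicE lern1 leq_b1.
pose al n := fine (avg nu f (Q n)).
have alE n : (al n)%:E = avg nu f (Q n).
  by rewrite fineK// ge0_fin_numE//; exact: avg_ge0.
have mm s : nnm (fun x => (fmax al s x `^ P)%:E).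
  apply: nnm_EFin => [|x]; last exact: powR_ge0.
  by apply: (measurableT_comp (measurable_powR P)); exact: measurable_fmax.
apply: (@le_trans _ _ (\int[nu]_x ereal_sup (range (fun k => (fmax al (iota 0 k) x `^ P)%:E)))).
  apply: le_int; first by apply: nnm_pow; exact: (nnm_maximal mf).1.
    by apply: (nnm_sup (f := fun k x => (fmax al (iota 0 k) x `^ P)%:E)).
  move=> x; set S := ereal_sup _.
  have hS n : (fmax al (iota 0 n) x `^ P)%:E <= S by apply: ereal_sup_ubound; exists n.
  have S0 : 0 <= S by apply: le_trans (hS 0%N); rewrite lee_fin powR_ge0.
  apply: le_poweR_root => //; first exact: (nnm_maximal mf).2.
  apply: maximal_le => [|n Qx]; first exact: poweR_ge0.
  apply: poweR_le_root => //; first exact: avg_ge0.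
  apply: le_trans (hS n.+1); rewrite -alE poweR_EFin lee_fin.
  apply: ge0_ler_powR; rewrite ?nnegrE ?fmax_ge0//; first exact: ltW.
    by rewrite fine_ge0//; exact: avg_ge0.
  by apply: (le_fmax al (s := iota 0 n.+1)) => //; rewrite mem_iota add0n ltnSn.
apply: int_sup_le => //.
  move=> x m n mn; rewrite lee_fin; apply: ge0_ler_powR; rewrite ?nnegrE ?fmax_ge0//.
    exact: ltW.
  by apply: sub_fmax => k; rewrite !mem_iota !add0n => /leq_trans; apply.
move=> k.
pose s l := [seq n <- iota 0 k | lab n == l].
apply: (@le_trans _ _ (\int[nu]_x \sum_(l < N) (fmax al (s l) x `^ P)%:E)).
  apply: le_int => //; first exact: nnm_sum.
  move=> x; rewrite sumEFin lee_fin.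
  have S0 : (0 <= \sum_(l < N) fmax al (s l) x `^ P)%R by rewrite sumr_ge0// => l _; exact: powR_ge0.
  rewrite -lee_fin -poweR_EFin; apply: le_poweR_root; rewrite ?lee_fin ?fmax_ge0//.
  apply: fmax_le => [|n nk Qx]; first exact: powR_ge0.
  rewrite -lee_fin -poweR_EFin; apply: poweR_le_root => //.
    by rewrite alE; exact: avg_ge0.
  rewrite poweR_EFin lee_fin (bigD1 (lab n))//= -[leLHS]addr0; apply: lerD; last first.
    by rewrite sumr_ge0// => l _; exact: powR_ge0.
  apply: ge0_ler_powR; rewrite ?nnegrE ?fmax_ge0//; first exact: ltW.
    by rewrite fine_ge0//; exact: avg_ge0.
  by apply: le_fmax => //; rewrite mem_filter eqxx.
rewrite int_sum//.
apply: (@le_trans _ _ (\sum_(l < N) (((P / (P - 1)) `^ P)%:E * \int[nu]_x (f x `^ P)))).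
  apply: lee_sum => l _; apply: (@doob_strong f l) => // n.
  by rewrite mem_filter => /andP[/eqP].
by rewrite sumr_const card_ord EFinM -muleA mule_natl.
Qed.

End one_measure.
End cubes.

(** * Rubio de Francia iteration and Fefferman-Stein inequality *)

Section vector_valued_maximal.
Context {R : realType} {d : measure_display} {X : measurableType d}.
Variables (N : nat) (Q : nat -> set X) (lab : nat -> 'I_N).
Hypothesis lamQ : laminar Q lab.

Let mQ n : measurable (Q n). Proof. exact: laminar_measurable lamQ n. Qed.

(* The [P]-th power of the norm of [g] in L^P(l^T). *)
Definition mixed (nu : {measure set X -> \bar R}) (J : nat) (P T : R)
    (g : nat -> X -> \bar R) : \bar R :=
  \int[nu]_x ((\sum_(j < J) g j x `^ T) `^ (P / T)).

Definition mixed_bounded nu J (P T B : R) : Prop :=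
  forall g, (forall j, nnm (g j)) ->
    mixed nu J P T (fun j => maximal Q nu (g j)) <= B%:E * mixed nu J P T g.

Implicit Types (f : X -> \bar R) (nu : {measure set X -> \bar R}).

Lemma nnm_mixed J (P T : R) (g : nat -> X -> \bar R) : (forall j, nnm (g j)) ->
  nnm (fun x => (\sum_(j < J) g j x `^ T) `^ (P / T)).
Proof.
by move=> mg; apply: nnm_pow; apply: (nnm_sum _ (fun j : 'I_J => nnm_pow T (mg j).1)).1.
Qed.

Lemma nnm_iter_maximal nu k f : nnm f -> nnm (iter k (maximal Q nu) f).
Proof. by move=> mf; elim: k => //= k; exact: (nnm_maximal lamQ). Qed.

(* [A j] is the series of the [eps ^+ k] times the [k]-th iterate of the maximal
   operator on [g j]. *)
Lemma rubio_de_francia (P T B : R) : (0 < P)%R -> (0 < T)%R -> (0 < B)%R ->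
  exists2 C : R, (0 < C)%R & forall nu J, finite_pos Q nu -> mixed_bounded nu J P T B ->
  forall g : nat -> X -> \bar R, (forall j, nnm (g j)) ->
  exists A : nat -> X -> \bar R, [/\ forall j, nnm (A j),
    forall j x, g j x <= A j x,
    forall j x, maximal Q nu (A j) x <= C%:E * A j x &
    mixed nu J P T A <= C%:E * mixed nu J P T g].
Proof.
move=> P0 T0 B0.
have PT : (0 < P / T)%R by rewrite divr_gt0.
(* eps^P B 2^{(1+T) P/T} = 1/2 *)
pose c1 := (2 `^ ((1 + T) * (P / T)))%R : R.
have c10 : (0 < c1)%R by rewrite powR_gt0.
pose eps := ((2 * B * c1)^-1 `^ P^-1)%R : R.
have e0 : (0 < eps)%R by rewrite powR_gt0// invr_gt0 !mulr_gt0.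
have epsP : (eps `^ P = (2 * B * c1)^-1)%R.
  by rewrite /eps -powRrM mulVf ?gt_eqF// powRr1// invr_ge0 !mulr_ge0// ltW.
exists (eps^-1 + 2 * c1)%R.
  by rewrite addr_gt0 ?invr_gt0 ?mulr_gt0.
move=> nu J nuQ hB g mg.
pose y k j := iter k (maximal Q nu) (g j).
have my k j : nnm (y k j) by exact: nnm_iter_maximal.
have mey k j : nnm (fun x => (eps ^+ k)%:E * y k j x).
  by apply: nnm_mul => //; apply: nnm_cst; rewrite lee_fin exprn_ge0// ltW.
pose A j x := \sum_(0 <= k <oo) ((eps ^+ k)%:E * y k j x).
have mA j : nnm (A j) by exact: nnm_series.
have gA j x : g j x <= A j x.
  rewrite /A; apply: le_trans (nneseries_lim_ge 1 _) => [|k _ _]; last exact: (mey k j).2.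
  by rewrite big_nat1 expr0 mul1e.
have hyB k : mixed nu J P T (y k) <= (B ^+ k)%:E * mixed nu J P T g.
  elim: k => [|k IH]; first by rewrite expr0 mul1e.
  apply: (le_trans (hB (y k) (my k))).
  by rewrite exprS EFinM -muleA; apply: lee_wpmul2l => //; rewrite lee_fin ltW.
have mx0 h : (forall j, nnm (h j)) -> 0 <= mixed nu J P T h.
  by move=> mh; apply: int_ge0; exact: nnm_mixed.
exists A; split => //.
(* Averaging sends each term of the series below the next one, up to the factor eps^-1, so the
   maximal function of A is at most eps^-1 A. *)
- move=> j x; apply: maximal_le => [|n Qx].
    apply: mule_ge0; last exact: (mA j).2.
    by rewrite lee_fin addr_ge0 ?invr_ge0 ?mulr_ge0// ltW.
  have [Q0 Qy] := nuQ n.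
  rewrite /A avg_series//.
  apply: (@le_trans _ _ (eps^-1%:E * A j x)); last first.
    apply: lee_wpmul2r; first exact: (mA j).2.
    by rewrite lee_fin lerDl mulr_ge0// ltW.
  rewrite /A -nneseriesZl => [|k _]; last exact: (mey k j).2.
  rewrite [leRHS]nneseries_recl => [|k _|//]; last first.
    by apply: mule_ge0; [rewrite lee_fin invr_ge0 ltW|exact: (mey k j).2].
  apply: (@le_trans _ _ (\sum_(1 <= k <oo) (eps^-1%:E * ((eps ^+ k)%:E * y k j x)))); last first.
    by rewrite leeDr//; apply: mule_ge0; [rewrite lee_fin invr_ge0 ltW|exact: (mey 0%N j).2].
  rewrite -(@nneseries_addn _ _ 1%N) => [|k]; last first.
    by apply: mule_ge0; [rewrite lee_fin invr_ge0 ltW|exact: (mey k j).2].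
  apply: lee_nneseries => [k _ _|k _]; first exact: avg_ge0.
  rewrite avg_scale//; last by rewrite lee_fin exprn_ge0// ltW.
  rewrite addn1 [leRHS]muleA -EFinM exprS mulKf ?gt_eqF//; apply: lee_wpmul2l.
    by rewrite lee_fin exprn_ge0// ltW.
  exact: avg_le_maximal.
(* The series is summed by [nneseries_poweR_le] twice, for the exponents T and P / T, which may be
   less than 1. The weights 2^(k+1) that it introduces, together with the growth B^k of the
   iterates, are outweighed by eps^(k P). *)
- have b2 k : (2 ^+ k.+1 * eps ^+ k >= 0 :> R)%R by rewrite mulr_ge0// exprn_ge0// ltW.
  pose w k : R := (2 ^+ k.+1 * (2 ^+ k.+1 * eps ^+ k) `^ T)%R.
  have w0 k : (0 <= w k)%R by rewrite mulr_ge0 ?powR_ge0.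
  have m1 k : nnm (fun x => (w k `^ (P / T))%:E * (\sum_(j < J) y k j x `^ T) `^ (P / T)).
    by apply: nnm_mul; [apply: nnm_cst; rewrite lee_fin powR_ge0|exact: nnm_mixed].
  apply: (@le_trans _ _ (\int[nu]_x \sum_(0 <= k <oo) ((w k `^ (P / T))%:E * (\sum_(j < J) y k j x `^ T) `^ (P / T)))).
    apply: le_int; [exact: nnm_mixed|exact: nnm_series|move=> x].
    have s0 k : 0 <= \sum_(j < J) y k j x `^ T by apply: sume_ge0 => j _; exact: poweR_ge0.
    apply: (@le_trans _ _ ((\sum_(0 <= k <oo) (((2 ^+ k.+1 * eps ^+ k) `^ T)%:E * \sum_(j < J) y k j x `^ T)) `^ (P / T))).
      apply: lee_poweR; first exact: ltW.
        by apply: sume_ge0 => j _; exact: poweR_ge0.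
      have -> : \sum_(0 <= k <oo) (((2 ^+ k.+1 * eps ^+ k) `^ T)%:E * \sum_(j < J) y k j x `^ T) =
          \sum_(0 <= k <oo) \sum_(j < J) ((2 ^+ k.+1 * eps ^+ k) `^ T)%:E * y k j x `^ T.
        apply: eq_eseriesr => k _; rewrite ge0_sume_distrr// => j _; exact: poweR_ge0.
      rewrite nneseries_sum => [|j k _]; last by rewrite mule_ge0 ?lee_fin ?powR_ge0// poweR_ge0.
      apply: lee_sum => j _.
      apply: (le_trans (nneseries_poweR_le T0 (fun k => (mey k j).2 x))).
      apply: lee_nneseries => [k _ _|k _]; first exact: poweR_ge0.
      by rewrite muleA -EFinM poweRM ?lee_fin//; exact: (my k j).2.
    apply: (le_trans (nneseries_poweR_le PT _)).
      by move=> k; rewrite mule_ge0 ?lee_fin ?powR_ge0.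
    apply: lee_nneseries => [k _ _|k _]; first exact: poweR_ge0.
    by rewrite muleA -EFinM poweRM ?lee_fin ?w0.
  rewrite int_series//.
  apply: (@le_trans _ _ (\sum_(0 <= k <oo) ((2 * c1)%:E * mixed nu J P T g * ((2^-1) ^+ k.+1)%:E))).
    apply: lee_nneseries => [k _ _|k _]; first by apply: int_ge0.
    rewrite int_scale ?lee_fin ?powR_ge0//; last exact: nnm_mixed.
    apply: (@le_trans _ _ ((w k `^ (P / T))%:E * ((B ^+ k)%:E * mixed nu J P T g))).
      by apply: lee_wpmul2l (hyB k); rewrite lee_fin powR_ge0.
    rewrite muleA -EFinM -muleA (muleC (mixed _ _ _ _ _)) muleA -EFinM.
    apply: lee_wpmul2r; first exact: mx0.
    rewrite lee_fin le_eqVlt; apply/orP; left; apply/eqP.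
    rewrite /w powRM; [|exact: exprn_ge0|exact: powR_ge0].
    rewrite -powRrM.
    have -> : (T * (P / T) = P)%R by rewrite mulrCA mulfV ?mulr1// gt_eqF.
    rewrite (@powRM _ (2 ^+ k.+1)%R) ?exprn_ge0// ?(ltW e0)//.
    rewrite !exprn_powR ?(ltW e0)// epsP mulrA -exprMn -powRD; last by rewrite pnatr_eq0 implybT.
    have -> : (P / T + P = (1 + T) * (P / T))%R.
      by rewrite mulrDl mul1r mulrCA mulfV ?mulr1// gt_eqF.
    have aux (c : R) : (0 < c)%R ->
        (c ^+ k.+1 * (2 * B * c)^-1 ^+ k * B ^+ k = 2 * c * 2^-1 ^+ k.+1)%R.
      move=> c0; rewrite exprS -!mulrA -!exprMn exprS mulrCA mulrC.
      have -> : ((2 * (B * c))^-1 * (c * B) = 2^-1)%R by field; rewrite !gt_eqF.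
      by set z := (2^-1 ^+ k)%R; field.
    by apply: aux; rewrite powR_gt0.
  rewrite -{2}(mule1 (mixed nu J P T g)).
  have [My|My] := eqVneq (mixed nu J P T g) +oo.
    by rewrite {2}My mule1 gt0_muley ?leey// lte_fin; posR.
  have Mf : mixed nu J P T g \is a fin_num by rewrite ge0_fin_numE ?mx0// lt_neqAle My leey.
  rewrite mule1 -(fineK Mf) -EFinM.
  have := @epsilon_trick0 R (2 * c1 * fine (mixed nu J P T g))%R predT.
  rewrite !mulr_ge0 ?fine_ge0 ?mx0 ?(ltW c10)// => /(_ isT) h.
  apply: le_trans (le_trans h _).
    apply: lee_nneseries => [k _ _|k _].
      by rewrite mule_ge0// lee_fin ?mulr_ge0 ?fine_ge0 ?mx0 ?exprn_ge0 ?invr_ge0 ?(ltW c10).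
    by rewrite -EFinM lee_fin natrX exprVn.
  rewrite -EFinM lee_fin ler_wpM2r ?fine_ge0 ?mx0//.
  by rewrite lerDr invr_ge0 ltW.
Qed.

Let Nbig (l : 'I_N) : (0 < N%:R :> R)%R.
Proof. by rewrite ltr0n (leq_ltn_trans _ (ltn_ord l)). Qed.

Let doob_cst (P : R) : R := (N%:R * (P / (P - 1)) `^ P)%R.

Let doob_cst0 (P : R) : (1 < P)%R -> (0 < doob_cst P)%R.
Proof.
move=> P1; rewrite mulr_gt0 ?(Nbig (lab 0%N))// powR_gt0// divr_gt0 ?subr_gt0//.
exact: lt_trans P1.
Qed.

(** The case of a single function, in which Doob's inequality is the bound to iterate. *)
Lemma rdf1 (P : R) : (1 < P)%R ->
  exists2 C : R, (0 < C)%R & forall nu, finite_pos Q nu -> forall f, nnm f ->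
  exists A : X -> \bar R, [/\ nnm A, forall x, f x <= A x,
    forall x, maximal Q nu A x <= C%:E * A x &
    \int[nu]_x (A x `^ P) <= C%:E * \int[nu]_x (f x `^ P)].
Proof.
move=> P1; have P0 : (0 < P)%R by apply: lt_trans P1.
have [C C0 hC] := @rubio_de_francia P 1 (doob_cst P) P0 ltr01 (doob_cst0 P1).
have mE nu (h : nat -> X -> \bar R) : (forall j, nnm (h j)) ->
    mixed nu 1 P 1 h = \int[nu]_x (h 0%N x `^ P).
  move=> mh; apply: eq_integral => x _.
  by rewrite big_ord1 divr1 poweRe1//; exact: (mh 0%N).2.
exists C => // nu nuQ f mf.
have [|A [mA fA MA hA]] := hC nu 1%N nuQ _ (fun=> f) (fun=> mf).
  move=> g mg; rewrite !mE//; first exact: (maximal_strong lamQ nuQ).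
  by move=> j; exact: (nnm_maximal lamQ).
exists (A 0%N); split=> //.
by rewrite !mE in hA.
Qed.

Lemma le_avg_ae nu (A : set X) (f g : X -> \bar R) : measurable A -> nnm f -> nnm g ->
  (\forall x \ae nu, A x -> f x <= g x) -> avg nu f A <= avg nu g A.
Proof.
move=> mA mf mg fg; rewrite /avg lee_wpmul2l ?lee_fin ?invr_ge0 ?fine_ge0//.
apply: le_int_ae; try exact: nnm_setf.
apply: filterS fg => x h.
by rewrite indicE; case: (boolP (x \in A)) => [/set_mem/h|_]; rewrite ?mule1 ?mule0.
Qed.

Lemma mixed_diag nu J (P : R) (g : nat -> X -> \bar R) : (0 < P)%R -> (forall j, nnm (g j)) ->
  mixed nu J P P g = \sum_(j < J) \int[nu]_x (g j x `^ P).
Proof.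
move=> P0 mg; rewrite -int_sum => [|j]; last by apply: nnm_pow; exact: (mg j).1.
apply: eq_integral => x _; rewrite mulfV ?gt_eqF// poweRe1//.
by apply: sume_ge0 => j _; exact: poweR_ge0.
Qed.

(** Let G be the l^T norm of the sequence and A its Rubio de Francia majorant. Splitting g_j = (g_j
    A^(-al)) A^al inside the averages, with al = 1 - P/T, bounds M g_j by (M k_j)^(P/T) (C A)^al,
    where k_j = (g_j A^(-al))^(T/P). Only the scalar bound of M on L^P is then used. *)
Lemma fefferman_stein_up (P T : R) : (1 < P)%R -> (P <= T)%R ->
  exists2 B : R, (0 < B)%R & forall nu J, finite_pos Q nu -> mixed_bounded nu J P T B.
Proof.
move=> P1; have P0 : (0 < P)%R by apply: lt_trans P1.
rewrite le_eqVlt => /predU1P[<-|PT].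
  exists (doob_cst P); first exact: doob_cst0.
  move=> nu J nuQ g mg; rewrite !mixed_diag// => [|j]; last exact: (nnm_maximal lamQ).
  rewrite ge0_sume_distrr => [|j _]; last by apply: int_ge0; apply: nnm_pow; exact: (mg j).1.
  by apply: lee_sum => j _; exact: (maximal_strong lamQ nuQ).
have T0 : (0 < T)%R by apply: lt_trans PT.
have [C C0 hC] := rdf1 P1.
pose al : R := (1 - P / T)%R.
have al0 : (0 < al)%R by rewrite subr_gt0 ltr_pdivrMr// mul1r.
pose b : R := (P / T)%R.
have b0 : (0 < b)%R by rewrite divr_gt0.
have alb : (al + b = 1)%R by rewrite /al subrK.
pose B := ((C `^ P * C) `^ al * doob_cst P `^ b)%R.
have B0 : (0 < B)%R by have := doob_cst0 P1; rewrite /B => ?; posR.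
exists B => // nu J nuQ g mg.
set F := mixed nu J P T g.
have [Fy|Fy] := eqVneq F +oo; first by rewrite Fy gt0_muley ?leey// lte_fin.
pose S x := \sum_(j < J) g j x `^ T.
have mS : nnm S by apply: nnm_sum => j; apply: nnm_pow; exact: (mg j).1.
pose G x := S x `^ T^-1.
have mG : nnm G by apply: nnm_pow; exact: mS.1.
have GT x : G x `^ T = S x by rewrite /G poweRVK ?gt_eqF//; exact: mS.2.
have FE : F = \int[nu]_x (G x `^ P).
  by apply: eq_integral => x _; rewrite /G -poweRrM mulrC.
have gG j x : (j < J)%N -> g j x <= G x.
  move=> jJ; apply: poweR_le_root => //; first exact: (mg j).2.
  rewrite /S (bigD1 (Ordinal jJ))//= leeDl// sume_ge0// => i _; exact: poweR_ge0.
have F0 : 0 <= F by rewrite FE; apply: int_ge0; apply: nnm_pow; exact: mG.1.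
have [A [mA GA MA hA]] := hC nu nuQ G mG.
rewrite -FE in hA.
have mAP : nnm (fun x => A x `^ P) by apply: nnm_pow; exact: mA.1.
have Afin : \forall x \ae nu, A x < +oo.
  have : \int[nu]_x (A x `^ P) < +oo.
    by apply: le_lt_trans hA _; apply: lte_mul_pinfty; rewrite ?lee_fin ?(ltW C0)// lt_neqAle Fy leey.
  move=> /(ae_lty_int mAP); apply: filterS => x; apply: lty_poweRy; by rewrite gt_eqF.
pose D x := A x `^ (- al).
have mD : nnm D by apply: nnm_pow; exact: mA.1.
have gDA j x : (j < J)%N -> g j x <= (g j x * D x) * A x `^ al.
  move=> jJ; have := mA.2 x; rewrite le_eqVlt => /predU1P[A0|A0].
    apply: (@le_trans _ _ 0); first by rewrite A0; apply: le_trans (GA x); exact: gG.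
    by rewrite !mule_ge0 ?poweR_ge0//; exact: (mg j).2.
  have [Ay|Ay] := eqVneq (A x) +oo.
    rewrite /D Ay !poweRyr ?oppr_eq0 ?gt_eqF//.
    have := (mg j).2 x; rewrite le_eqVlt => /predU1P[<-|g0]; first by rewrite !mul0e.
    by rewrite -muleA mulyy gt0_muley// leey.
  have Af : A x \is a fin_num by rewrite ge0_fin_numE ?(ltW A0)// lt_neqAle Ay leey.
  rewrite -muleA /D -(fineK Af) !poweR_EFin -EFinM -powRD; last first.
    by rewrite (gt_eqF (_ : 0 < fine (A x))%R) ?implybT// fine_gt0// A0 lt_neqAle Ay leey.
  by rewrite addNr powRr0 mule1.
(* The P-th powers of the k_j sum to S D^T, which is at most G^P almost everywhere because G <= A
   and al T = T - P. *)
pose k j x := (g j x * D x) `^ b^-1.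
have mk j : nnm (k j) by apply: nnm_pow; apply: emeasurable_funM; [exact: (mg j).1|exact: mD.1].
have kb j x : k j x `^ b = g j x * D x.
  by rewrite /k poweRVK ?gt_eqF//; apply: mule_ge0; [exact: (mg j).2|exact: mD.2].
have Mg j x : (j < J)%N -> maximal Q nu (g j) x <= maximal Q nu (k j) x `^ b * (C%:E * A x) `^ al.
  move=> jJ; apply: maximal_le => [|n Qx]; first by rewrite mule_ge0 ?poweR_ge0.
  have [Q0 Qy] := nuQ n.
  apply: (@le_trans _ _ (avg nu (fun x => k j x `^ b * A x `^ al) (Q n))).
    apply: le_avg => // [|y _].
      by apply: nnm_mul; apply: nnm_pow; [exact: (mk j).1|exact: mA.1].
    by rewrite kb; exact: gDA.
  have bal : (b + al = 1)%R by rewrite addrC.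
  apply: (le_trans (avg_hoelder nu (mQ n) (ltW b0) (ltW al0) bal (mk j) mA)).
  apply: lee_pmul; rewrite ?poweR_ge0//; apply: lee_poweR; rewrite ?(ltW b0) ?(ltW al0)//.
  - exact: avg_ge0.
  - exact: avg_le_maximal.
  - exact: avg_ge0.
  - by apply: le_trans (MA x); exact: avg_le_maximal.
pose U x := C%:E `^ P * A x `^ P.
have mU : nnm U by apply: nnm_mul => //; apply: nnm_cst; exact: poweR_ge0.
pose V x := \sum_(j < J) maximal Q nu (k j) x `^ P.
have mV : nnm V.
  by apply: nnm_sum => j; apply: nnm_pow; exact: (nnm_maximal lamQ nu (mk j)).1.
apply: (@le_trans _ _ (\int[nu]_x (U x `^ al * V x `^ b))).
  apply: le_int.
  - by apply: (nnm_mixed J P T (g := fun j => maximal Q nu (g j))) => j; exact: (nnm_maximal lamQ).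
  - by apply: nnm_mul; apply: nnm_pow; [exact: mU.1|exact: mV.1].
  move=> x.
  have V0 : 0 <= V x by exact: mV.2.
  have CA0 : 0 <= C%:E * A x by rewrite mule_ge0 ?lee_fin ?(ltW C0)//; exact: mA.2.
  apply: (@le_trans _ _ (((C%:E * A x) `^ (al * T) * V x) `^ b)).
    apply: lee_poweR; [exact: ltW|by apply: sume_ge0 => j _; exact: poweR_ge0|].
    rewrite /V ge0_sume_distrr => [|j _]; last exact: poweR_ge0.
    apply: lee_sum => j _.
    apply: (le_trans (lee_poweR (ltW T0) _ (Mg j x (ltn_ord j)))).
      exact: (nnm_maximal lamQ nu (mg j)).2.
    rewrite poweRM ?poweR_ge0// -!poweRrM muleC /b divfK// ?lexx//.
    by rewrite gt_eqF.
  rewrite poweRM ?poweR_ge0// -poweRrM /U -poweRM ?lee_fin ?(ltW C0)//; last exact: mA.2.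
  by rewrite -poweRrM /b -mulrA (mulrCA T) mulfV ?gt_eqF// mulr1 mulrC.
apply: (le_trans (hoelder_int2 _ (ltW al0) (ltW b0) alb mU mV)).
apply: (@le_trans _ _ (((C `^ P * C)%:E * F) `^ al * ((doob_cst P)%:E * F) `^ b)).
  apply: lee_pmul; rewrite ?poweR_ge0//; apply: lee_poweR; rewrite ?(ltW b0) ?(ltW al0)//.
  - exact: int_ge0.
  - rewrite /U int_scale ?poweR_ge0// EFinM -muleA poweR_EFin.
    by apply: lee_wpmul2l => //; rewrite lee_fin powR_ge0.
  - exact: int_ge0.
  rewrite /V int_sum => [|j]; last by apply: nnm_pow; exact: (nnm_maximal lamQ nu (mk j)).1.
  apply: (@le_trans _ _ (\sum_(j < J) ((doob_cst P)%:E * \int[nu]_x (k j x `^ P)))).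
    by apply: lee_sum => j _; exact: (maximal_strong lamQ nuQ).
  rewrite -ge0_sume_distrr => [|j _]; last by apply: int_ge0; apply: nnm_pow; exact: (mk j).1.
  apply: lee_wpmul2l; first by rewrite lee_fin ltW// doob_cst0.
  rewrite -int_sum => [|j]; last by apply: nnm_pow; exact: (mk j).1.
  rewrite FE; apply: le_int_ae.
  - by apply: nnm_sum => j; apply: nnm_pow; exact: (mk j).1.
  - by apply: nnm_pow; exact: mG.1.
  apply: filterS Afin => x Ax.
  have -> : \sum_(j < J) k j x `^ P = S x * D x `^ T.
    rewrite /S ge0_sume_distrl => [|j _]; last exact: poweR_ge0.
    apply: eq_bigr => j _; rewrite /k -poweRrM /b invf_div divfK ?gt_eqF//.
    by rewrite poweRM//; [exact: (mg j).2|exact: mD.2].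
  rewrite -GT; have := mG.2 x; rewrite le_eqVlt => /predU1P[<-|G0].
    by rewrite poweR0r ?gt_eqF// mul0e poweR_ge0.
  have A0 : 0 < A x by apply: lt_le_trans (GA x).
  have Af : A x \is a fin_num by rewrite ge0_fin_numE// ltW.
  have Gf : G x \is a fin_num.
    by rewrite ge0_fin_numE ?(ltW G0)//; apply: le_lt_trans Ax; exact: GA.
  have := GA x; rewrite /D -(fineK Af) -(fineK Gf) !poweR_EFin -EFinM !lee_fin => h.
  have a0 : (0 < fine (A x))%R by rewrite fine_gt0// A0.
  have g0 : (0 < fine (G x))%R by rewrite fine_gt0// G0 ltey_eq Gf.
  rewrite -powRrM mulNr powRN.
  have -> : (fine (G x) `^ T = fine (G x) `^ P * fine (G x) `^ (al * T))%R.
    rewrite -powRD ?(gt_eqF g0) ?implybT//; congr (_ `^ _)%R.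
    by rewrite /al mulrBl mul1r divfK ?gt_eqF// addrC subrK.
  rewrite -mulrA ler_piMr ?powR_ge0//.
  rewrite ler_pdivrMr ?powR_gt0// mul1r ge0_ler_powR ?nnegrE ?(ltW a0) ?(ltW g0)//.
  by rewrite mulr_ge0 ?(ltW al0) ?(ltW T0).
rewrite !poweRM ?lee_fin ?mulr_ge0 ?powR_ge0 ?(ltW C0) ?(ltW (doob_cst0 P1))//.
rewrite muleACA -poweRD; last by rewrite /poweRD_def alb oner_eq0.
by rewrite alb poweRe1// !poweR_EFin -EFinM.
Qed.

(** Duality at the exponent P / T reduces the claim to an L^T bound of M with a weight phi.
    Replacing phi by its Rubio de Francia majorant gives a weight a with M a <= C a almost
    everywhere; averages for nu are then controlled by averages for a nu, and the maximal theorem,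
    uniform in the measure, applies to a nu. *)
Lemma fefferman_stein_down (P T : R) : (1 < T)%R -> (T < P)%R ->
  exists2 B : R, (0 < B)%R & forall nu J e, finite_pos Q nu -> integrable_pos nu e ->
    mixed_bounded nu J P T B.
Proof.
move=> T1 TP; have T0 : (0 < T)%R by apply: lt_trans T1.
have P0 : (0 < P)%R by apply: lt_trans TP.
pose rho := (P / T)%R.
have rho1 : (1 < rho)%R by rewrite ltr_pdivlMr// mul1r.
have rho0 : (0 < rho)%R by apply: lt_trans rho1.
pose k := (1 - rho^-1)%R.
have k0 : (0 < k)%R by rewrite subr_gt0 invf_lt1.
have k1 : (k < 1)%R by rewrite gtrBl invr_gt0.
have r'1 : (1 < k^-1)%R by rewrite invf_gt1.
have [C C0 hC] := rdf1 r'1.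
pose T' := ((1 + T) / 2)%R.
have T'1 : (1 < T')%R by rewrite /T'; lra.
have T'0 : (0 < T')%R by apply: lt_trans T'1.
have TT' : (1 < T / T')%R by rewrite ltr_pdivlMr// mul1r /T'; lra.
pose C' := ((2 * C) `^ (T / T') * doob_cst (T / T'))%R.
have C'0 : (0 < C')%R.
  by apply: mulr_gt0; [apply: powR_gt0; exact: mulr_gt0|exact: doob_cst0].
pose B := ((4 * (C' * (2 * C `^ k))) `^ rho)%R.
have B0 : (0 < B)%R by rewrite /B; posR.
exists B => // nu J e nuQ he g mg.
set F := mixed nu J P T g.
have [Fy|Fy] := eqVneq F +oo; first by rewrite Fy gt0_muley ?leey// lte_fin.
pose S x := \sum_(j < J) g j x `^ T.
have mS : nnm S by apply: nnm_sum => j; apply: nnm_pow; exact: (mg j).1.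
pose Y x := \sum_(j < J) maximal Q nu (g j) x `^ T.
have mY : nnm Y by apply: nnm_sum => j; apply: nnm_pow; exact: (nnm_maximal lamQ nu (mg j)).1.
have F0 : 0 <= F by apply: int_ge0; exact: nnm_mixed.
have Ff : F \is a fin_num by rewrite ge0_fin_numE// lt_neqAle Fy leey.
rewrite /mixed -/rho.
pose K := (C' * (2 * C `^ k) * fine (F `^ rho^-1))%R.
have K0 : (0 <= K)%R by rewrite !mulr_ge0 ?powR_ge0 ?(ltW C'0)// fine_ge0 ?poweR_ge0.
have -> : B%:E * F = ((4 * K) `^ rho)%:E.
  rewrite /K mulrA powRM ?mulr_ge0 ?powR_ge0 ?(ltW C'0) ?fine_ge0 ?poweR_ge0// EFinM.
  by congr (_ * _); rewrite -poweR_EFin fineK ?fin_num_poweR// poweRVK ?gt_eqF.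
apply: (dual_poweR he) => // phi mphi phi0; rewrite -/k => phiy.
have mphiE : nnm (EFin \o phi) by apply: nnm_EFin => // x; exact: ltW.
have [A [mA phiA MA hA]] := hC nu nuQ _ mphiE.
have Afin : \forall x \ae nu, A x < +oo.
  have : \int[nu]_x (A x `^ k^-1) < +oo.
    by apply: le_lt_trans hA _; apply: lte_mul_pinfty; rewrite ?lee_fin ?(ltW C0).
  have mAk : nnm (fun x => A x `^ k^-1) by apply: nnm_pow; exact: mA.1.
  move=> /(ae_lty_int mAk); apply: filterS => x; apply: lty_poweRy.
  by rewrite gt_eqF// invr_gt0.
(* Positive and real everywhere, at most 2 A, and at least A almost everywhere: a version of A that
   can serve as a density. *)
pose a x := (phi x + fine (A x))%R.
have a0 x : (0 < a x)%R by rewrite ltr_wpDr// fine_ge0//; exact: mA.2.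
have ma : nnm (EFin \o a).
  apply: nnm_EFin => [|x]; last exact: ltW.
  by apply: measurable_funD => //; apply: measurableT_comp => //; exact: mA.1.
have a2A x : (a x)%:E <= 2%:E * A x.
  rewrite mule_natl mule2n EFinD; apply: leeD; first exact: phiA.
  by case: (A x) (mA.2 x) => //= _; exact: leey.
have Aa x : A x < +oo -> A x <= (a x)%:E.
  move=> Ax; rewrite -[leLHS]fineK ?ge0_fin_numE//; last exact: mA.2.
  by rewrite lee_fin lerDr ltW.
have avga n x : Q n x -> A x < +oo -> avg nu (EFin \o a) (Q n) <= (2 * C * a x)%:E.
  move=> Qx Ax; have [Q0 Qy] := nuQ n.
  apply: (@le_trans _ _ (2%:E * avg nu A (Q n))).
    rewrite -avg_scale//; apply: le_avg => //.
      by apply: nnm_mul => //; apply: nnm_cst.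
    by move=> y _; exact: a2A.
  rewrite -mulrA EFinM; apply: lee_wpmul2l => //.
  apply: (le_trans (avg_le_maximal _ _ Qx)).
  apply: (le_trans (MA x)); rewrite EFinM; apply: lee_wpmul2l; first by rewrite lee_fin ltW.
  exact: Aa.
pose nu' := density nu ma.
have nu'Q : finite_pos Q nu'.
  move=> n; have [Q0 Qy] := nuQ n; split.
    rewrite lt_neqAle measure_ge0 andbT eq_sym; apply/eqP => h.
    have : \int[nu]_x ((a x)%:E * (\1_(Q n) x)%:E) = 0 by rewrite -density_setE.
    move=> /(ae_eq0_int (nnm_setf (mQ n) ma)) h2.
    have /negligibleP : nu.-negligible (Q n).
      apply: negligibleS h2 => x Qx /= ; rewrite indicE mem_set// mule1 => -[] /eqP.
      by rewrite gt_eqF.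
    by move=> /(_ (mQ n)) h3; rewrite h3 ltxx in Q0.
  have [x [Qx Ax]] : exists x, Q n x /\ A x < +oo.
    apply: contrapT => h; have : nu.-negligible (Q n).
      by apply: negligibleS Afin => x Qx /= Ax; apply: h; exists x.
    by move=> /negligibleP => /(_ (mQ n)) h3; rewrite h3 ltxx in Q0.
  have : avg nu (EFin \o a) (Q n) < +oo by exact: le_lt_trans (avga n x Qx Ax) (ltry _).
  by rewrite /nu' density_setE// -(avgK Q0 Qy) => ?; apply: lte_mul_pinfty => //; rewrite ge0_fin_numE.
(* The average of a over a cube is at most 2 C a almost everywhere on it. Inserting this ratio into
   the average of f^T' turns nu into nu'. *)
have Mg f x : nnm f -> maximal Q nu f x <=
    ((2 * C)%:E * maximal Q nu' (fun y => f y `^ T') x) `^ T'^-1.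
  move=> mf; have mfT : nnm (fun y => f y `^ T') by apply: nnm_pow; exact: mf.1.
  apply: maximal_le => [|n Qx]; first exact: poweR_ge0.
  have [Q0 Qy] := nuQ n; have [Q0' Qy'] := nu'Q n.
  apply: poweR_le_root => //; first exact: avg_ge0.
  have q0 : (0 < fine (nu (Q n)))%R by rewrite fine_gt0// Q0.
  have q0' : (0 < fine (nu' (Q n)))%R by rewrite fine_gt0// Q0'.
  pose av := (fine (nu' (Q n)) / fine (nu (Q n)))%R.
  have av0 : (0 < av)%R by rewrite divr_gt0.
  have avE : avg nu (EFin \o a) (Q n) = av%:E.
    by rewrite /avg -(density_setE nu ma)// -/nu' -(@fineK _ (nu' (Q n))) ?ge0_fin_numE// -EFinM mulrC.
  have avh h : nnm h -> avg nu (fun y => h y * (a y)%:E) (Q n) = av%:E * avg nu' h (Q n).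
    move=> mh; rewrite /avg int_density; last exact: nnm_setf.
    rewrite muleA -EFinM /av mulrAC divff ?gt_eqF// mul1r; congr (_ * _).
    by apply: eq_integral => y _; rewrite muleAC.
  apply: (le_trans (avg_poweR (mQ n) Q0 Qy (ltW T'1) mf)).
  apply: (@le_trans _ _ (avg nu (fun y => (2 * C / av)%:E * (f y `^ T' * (a y)%:E)) (Q n))).
    apply: le_avg_ae => //.
      by apply: nnm_mul; [apply: nnm_cst; rewrite lee_fin divr_ge0 ?mulr_ge0// ltW|exact: nnm_mul].
    apply: filterS Afin => y Ay Qy1; rewrite muleCA -{1}(mule1 (f y `^ T')).
    apply: lee_wpmul2l; first exact: poweR_ge0.
    have := avga n y Qy1 Ay; rewrite avE -EFinM !lee_fin => h.
    by rewrite mulrAC ler_pdivlMr// mul1r.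
  rewrite avg_scale//; [|exact: nnm_mul|by rewrite lee_fin divr_ge0 ?mulr_ge0// ltW].
  rewrite avh// muleA -EFinM divfK ?gt_eqF//.
  apply: lee_wpmul2l; first by rewrite lee_fin mulr_ge0// ltW.
  exact: avg_le_maximal.
have MgT f : nnm f -> \int[nu]_x (maximal Q nu f x `^ T * (a x)%:E) <=
    C'%:E * \int[nu]_x (f x `^ T * (a x)%:E).
  move=> mf; have mfT : nnm (fun y => f y `^ T') by apply: nnm_pow; exact: mf.1.
  have mM := nnm_maximal lamQ nu mf; have mM' := nnm_maximal lamQ nu' mfT.
  rewrite -int_density; last by apply: nnm_pow; exact: mM.1.
  rewrite -int_density; last by apply: nnm_pow; exact: mf.1.
  have c0 : (0 <= (2 * C) `^ (T / T'))%R by rewrite powR_ge0.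
  apply: (@le_trans _ _ (\int[nu']_x (((2 * C) `^ (T / T'))%:E *
      maximal Q nu' (fun y => f y `^ T') x `^ (T / T')))).
    apply: le_int; first by apply: nnm_pow; exact: mM.1.
      by apply: nnm_mul; [exact: nnm_cst|apply: nnm_pow; exact: mM'.1].
    move=> x; apply: (le_trans (lee_poweR (ltW T0) _ (Mg f x mf))); first exact: mM.2.
    rewrite -poweRrM (mulrC (T'^-1)%R) poweRM ?lee_fin ?mulr_ge0 ?(ltW C0)//.
    exact: mM'.2.
  rewrite int_scale//; last by apply: nnm_pow; exact: mM'.1.
  rewrite /C' EFinM -muleA; apply: lee_wpmul2l => //.
  apply: (le_trans (maximal_strong lamQ nu'Q mfT TT')).
  rewrite le_eqVlt; apply/orP; left; apply/eqP; congr (_ * _).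
  by apply: eq_integral => x _; rewrite -poweRrM mulrCA mulfV ?mulr1// gt_eqF.
apply: (@le_trans _ _ (\int[nu]_x (Y x * (a x)%:E))).
  apply: le_int; [exact: nnm_mul|exact: nnm_mul|move=> x].
  apply: lee_wpmul2l; first exact: mY.2.
  by rewrite lee_fin lerDl fine_ge0//; exact: mA.2.
have distr (h : nat -> X -> \bar R) : (forall j, nnm (h j)) ->
    \int[nu]_x ((\sum_(j < J) h j x `^ T) * (a x)%:E) =
    \sum_(j < J) \int[nu]_x (h j x `^ T * (a x)%:E).
  move=> mh; rewrite -int_sum => [|j]; last by apply: nnm_mul => //; apply: nnm_pow; exact: (mh j).1.
  by apply: eq_integral => x _; rewrite ge0_sume_distrl// => j _; exact: poweR_ge0.
rewrite /Y (distr (fun j => maximal Q nu (g j)))//; last by move=> j; exact: (nnm_maximal lamQ).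
apply: (@le_trans _ _ (\sum_(j < J) (C'%:E * \int[nu]_x (g j x `^ T * (a x)%:E)))).
  by apply: lee_sum => j _; exact: MgT.
rewrite -ge0_sume_distrr => [|j _]; last first.
  by apply: int_ge0; apply: nnm_mul => //; apply: nnm_pow; exact: (mg j).1.
have KE : K%:E = C'%:E * (F `^ rho^-1 * (2 * C `^ k)%:E).
  rewrite /K EFinM (EFinM C') fineK ?fin_num_poweR// -[LHS]muleA.
  by congr (_ * _); exact: muleC.
rewrite -(distr g mg) KE -[leRHS]muleA.
apply: lee_wpmul2l; first by rewrite lee_fin ltW.
have ma' : nnm (fun x => (a x `^ k^-1)%:E).
  apply: nnm_EFin => [|x]; last exact: powR_ge0.
  by apply: (measurableT_comp (measurable_powR _)); apply/measurable_EFinP; exact: ma.1.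
have mSr : nnm (fun x => S x `^ rho) by apply: nnm_pow; exact: mS.1.
have i0 : (0 <= rho^-1)%R by rewrite invr_ge0 ltW.
apply: (@le_trans _ _ (F `^ rho^-1 * (\int[nu]_x (a x `^ k^-1)%:E) `^ k)).
  have := @hoelder_int2 _ _ _ nu (fun x => S x `^ rho) (fun x => (a x `^ k^-1)%:E) rho^-1 k i0 (ltW k0).
  rewrite /k addrC subrK -/k => /(_ erefl mSr ma'); apply: le_trans.
  apply: le_int.
  - exact: nnm_mul.
  - by apply: nnm_mul; apply: nnm_pow; [exact: mSr.1|exact: ma'.1].
  - move=> x; rewrite poweRK ?gt_eqF//; last exact: mS.2.
    by rewrite poweR_EFin -powRrM mulVf ?gt_eqF// powRr1// ltW.
rewrite -muleA; apply: lee_wpmul2l; first exact: poweR_ge0.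
rewrite (_ : (2 * C `^ k)%R = ((2 `^ k^-1 * C) `^ k)%R); last first.
  by rewrite powRM ?powR_ge0 ?(ltW C0)// -powRrM mulVf ?gt_eqF// powRr1.
have I0 : 0 <= \int[nu]_x (phi x `^ k^-1)%:E.
  apply: int_ge0; apply: nnm_EFin => [|x]; last exact: powR_ge0.
  exact: (measurableT_comp (measurable_powR _)).
have c0 : (0 <= 2 `^ k^-1 * C)%R by posR.
rewrite -poweR_EFin -poweRM ?lee_fin//.
apply: lee_poweR; [exact: ltW|exact: int_ge0|].
have mAk : nnm (fun x => A x `^ k^-1) by apply: nnm_pow; exact: mA.1.
rewrite EFinM -muleA; apply: le_trans (lee_wpmul2l _ hA); last by rewrite lee_fin powR_ge0.
rewrite -int_scale ?lee_fin ?powR_ge0//; apply: le_int => //.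
  by apply: nnm_mul => //; apply: nnm_cst; rewrite lee_fin powR_ge0.
move=> x; rewrite -!poweR_EFin -poweRM ?lee_fin//; last exact: mA.2.
by apply: lee_poweR; rewrite ?lee_fin ?invr_ge0 ?(ltW k0) ?(ltW (a0 x)).
Qed.

Lemma fefferman_stein (P T : R) : (1 < P)%R -> (1 < T)%R ->
  exists2 B : R, (0 < B)%R & forall nu J e, finite_pos Q nu -> integrable_pos nu e ->
    mixed_bounded nu J P T B.
Proof.
move=> P1 T1; have [PT|TP] := leP P T; last exact: fefferman_stein_down.
have [B B0 hB] := fefferman_stein_up P1 PT.
by exists B => // nu J e nuQ _; exact: hB.
Qed.

End vector_valued_maximal.

(** * Sparse forms *)

Section sparse_sums.
Context {R : realType} {d : measure_display} {X : measurableType d}.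
Variable mu : {measure set X -> \bar R}.

Lemma esum_le (T : choiceType) (S : set T) (a : T -> \bar R) (C : \bar R) :
  (forall s : seq T, uniq s -> (forall t, t \in s -> S t) -> \sum_(t <- s) a t <= C) ->
  \esum_(t in S) a t <= C.
Proof.
move=> h; apply: ge_ereal_sup => _ [F [finF FS] <-].
rewrite fsbig_finite//; apply: h => // t.
by rewrite in_fset_set// => /set_mem/FS.
Qed.

Lemma sum_indic_le1 (T : eqType) (s : seq T) (H : T -> set X) x : uniq s ->
  (forall t u, t \in s -> u \in s -> H t x -> H u x -> t = u) ->
  \sum_(t <- s) (\1_(H t) x)%:E <= 1 :> \bar R.
Proof.
move=> us h.
have [[t [ts Ht]]|hn] := pselect (exists t, t \in s /\ H t x).
  rewrite (bigD1_seq t)//= big_seq_cond big1 => [|u /andP[us' ut]].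
    by rewrite adde0 lee_fin indicE lern1 leq_b1.
  rewrite indicE; case: (boolP (x \in H u)) => // /set_mem Hu.
  by move: ut; rewrite (h u t)// eqxx.
rewrite big_seq big1 ?lee01// => t ts; rewrite indicE.
by case: (boolP (x \in H t)) => // /set_mem Ht; case: hn; exists t.
Qed.

Lemma sum_int_disjoint (T : eqType) (s : seq T) (H : T -> set X) (h : X -> \bar R) :
  uniq s -> (forall t, t \in s -> measurable (H t)) ->
  (forall x t u, t \in s -> u \in s -> H t x -> H u x -> t = u) -> nnm h ->
  \sum_(t <- s) \int[mu]_x (h x * (\1_(H t) x)%:E) <= \int[mu]_x h x.
Proof.
move=> us mH dH mh.
pose H' t := if t \in s then H t else set0.
have mH' t : measurable (H' t) by rewrite /H'; case: ifP => // /mH.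
rewrite big_seq (eq_bigr (fun t => \int[mu]_x (h x * (\1_(H' t) x)%:E))); last first.
  by move=> t ts; rewrite /H' ts.
rewrite -big_seq -int_sum => [|t]; last exact: nnm_setf.
apply: le_int => // [|x]; first by apply: nnm_sum => t; exact: nnm_setf.
rewrite -ge0_sume_distrr => [|t _]; last by rewrite lee_fin.
rewrite -[leRHS]mule1; apply: lee_wpmul2l; first exact: mh.2.
apply: sum_indic_le1 => // t u ts us'; rewrite /H' ts us'; exact: dH.
Qed.

Variables (N : nat) (Q : nat -> set X) (lab : nat -> 'I_N).
Hypothesis lamQ : laminar Q lab.
Hypothesis muQ : finite_pos Q mu.

Let mQ n : measurable (Q n). Proof. exact: laminar_measurable lamQ n. Qed.

(** The disjoint set E_Q fills at least the proportion delta0 of Q. Discarding an exceptional part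
    of proportion delta0 / 2 leaves at least half of this, and there t(Q) is at most h. *)
Lemma sparse_sum_le (delta0 : R) (S : set (set X)) (t : set X -> \bar R) (h : X -> \bar R) :
  (0 < delta0)%R -> S `<=` range Q -> sparse mu delta0 S ->
  (forall B, 0 <= t B) -> nnm h ->
  (forall n, exists G, [/\ measurable G, G `<=` Q n,
      mu (Q n `\` G) <= (delta0 / 2)%:E * mu (Q n) & forall x, G x -> t (Q n) <= h x]) ->
  \esum_(B in S) (mu B * t B) <= (2 / delta0)%:E * \int[mu]_x h x.
Proof.
move=> d0 SQ [E [tE hE]] t0 mh hG; apply: esum_le => s us sS.
have [G {}hG] := choice hG.
(* The sets G are indexed by integers and the sparse family consists of sets, so an index is chosen
   for each set of the list. *)
pose idx B := xget 0%N [set n | Q n = B].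
have idxE B : B \in s -> Q (idx B) = B.
  by move=> /sS/SQ [n _ nB]; rewrite /idx; case: xgetP => // /(_ n) /=.
pose H B := E B `&` G (idx B).
have mH B : B \in s -> measurable (H B).
  move=> Bs; have [mE _ _] := hE B (sS B Bs); have [mG _ _ _] := hG (idx B).
  exact: measurableI.
apply: (@le_trans _ _ (\sum_(B <- s) ((2 / delta0)%:E * \int[mu]_x (h x * (\1_(H B) x)%:E)))).
  rewrite [leLHS]big_seq [leRHS]big_seq; apply: lee_sum => B Bs.
  have [mE EB dE] := hE B (sS B Bs); have [mG GB dG tG] := hG (idx B).
  rewrite (idxE B Bs) in GB dG tG.
  have mB : measurable B by rewrite -(idxE B Bs).
  have [B0 By] : 0 < mu B /\ mu B < +oo by rewrite -(idxE B Bs); exact: muQ.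
  have Bf : mu B \is a fin_num by rewrite ge0_fin_numE// ltW.
  have HB : (delta0 / 2)%:E * mu B <= mu (H B).
    have : mu (E B) <= mu (H B) + mu (B `\` G (idx B)).
      rewrite (measureDI mu mE mG) addeC leeD// le_measure ?inE//; try exact: measurableD.
      - by move=> x [Ex Gx]; split => //; exact: EB.
    move=> /(le_trans dE) /le_trans /(_ (leeD (lexx _) dG)).
    rewrite {1}(splitr delta0) EFinD ge0_muleDl ?lee_fin ?divr_ge0 ?(ltW d0)//.
    by rewrite leeD2rE// -(fineK Bf) -EFinM.
  apply: (@le_trans _ _ ((2 / delta0)%:E * (mu (H B) * t B))).
    rewrite muleA; apply: lee_wpmul2r => //.
    rewrite -[leLHS]mul1e -(_ : (2 / delta0)%:E * (delta0 / 2)%:E = 1).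
      by rewrite -muleA; apply: lee_wpmul2l => //; rewrite lee_fin divr_ge0// ltW.
    by rewrite -EFinM mulrA divfK ?gt_eqF// divff.
  apply: lee_wpmul2l; first by rewrite lee_fin divr_ge0// ltW.
  rewrite muleC -[X in _ * mu X]setIT -(integral_indic mu measurableT (mH B Bs)).
  rewrite -int_scale//; last by apply: nnm_indic; exact: mH.
  apply: le_int.
  - by apply: nnm_mul; [exact: nnm_cst|apply: nnm_indic; exact: mH].
  - by apply: nnm_setf => //; exact: mH.
  move=> x; rewrite indicE; case: (boolP (x \in H B)) => [/set_mem [_ Gx]|_].
    by rewrite !mule1; exact: tG.
  by rewrite !mule0.
rewrite -ge0_sume_distrr => [|B _]; last first.
  by apply: integral_ge0 => x _; rewrite mule_ge0// ?lee_fin//; exact: mh.2.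
apply: lee_wpmul2l; first by rewrite lee_fin divr_ge0// ltW.
apply: sum_int_disjoint => // x A B As Bs [EA _] [EB _].
have := tE A B (sS A As) (sS B Bs); apply.
by exists x.
Qed.

End sparse_sums.

(** * Muckenhoupt weights in symmetric form, and the pointwise domination of the form *)

Section muckenhoupt.
Context {R : realType} {d : measure_display} {X : measurableType d}.
Variable mu : {measure set X -> \bar R}.
Variables (N : nat) (Q : nat -> set X) (lab : nat -> 'I_N).
Hypothesis lamQ : laminar Q lab.
Hypothesis muQ : finite_pos Q mu.
Context {K : finType}.
Variable g : K -> R.
Hypothesis g0 : forall k, (0 < g k)%R.

Let mQ n : measurable (Q n). Proof. exact: laminar_measurable lamQ n. Qed.

(* For k = Some i, [v k] is the power [- (g k)^-1] of the i-th weight; for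
   k = None, it is the power [(g k)^-1] of the product of the weights. *)
Record muckenhoupt (W0 : R) (v : K -> X -> R) : Prop := Muckenhoupt {
  muck_meas : forall k, measurable_fun setT (v k) ;
  muck_gt0 : forall k x, (0 < v k x)%R ;
  muck_prod : forall x, (\prod_k (v k x `^ g k) = 1)%R ;
  muck_le : forall n, \prod_k (avg mu (EFin \o v k) (Q n) `^ g k) <= W0%:E }.

Section one_weight.
Variables (W0 : R) (v : K -> X -> R).
Hypothesis Wv : muckenhoupt W0 v.

Lemma muck_nnm k : nnm (EFin \o v k).
Proof.
by apply: nnm_EFin => [|x]; [exact: muck_meas Wv k|apply: ltW; exact: muck_gt0 Wv k x].
Qed.

Definition wmeas k : {measure set X -> \bar R} := density mu (muck_nnm k).

Lemma avg_muck_gt0 k n : 0 < avg mu (EFin \o v k) (Q n).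
Proof.
have [Q0 Qy] := muQ n.
rewrite lt_neqAle avg_ge0 ?andbT; last exact: muck_nnm.
apply/eqP => /esym; rewrite /avg => /eqP; rewrite mule_eq0 eqe invr_eq0 gt_eqF ?fine_gt0 ?Q0//=.
move=> /eqP /(ae_eq0_int (nnm_setf (mQ n) (muck_nnm k))) h.
have /negligibleP : mu.-negligible (Q n).
  apply: negligibleS h => x Qx /= ; rewrite indicE mem_set// mule1 => -[] /eqP.
  by rewrite gt_eqF//; exact: muck_gt0 Wv k x.
by move=> /(_ (mQ n)) h3; rewrite h3 ltxx in Q0.
Qed.

(** All factors of the bounded product are positive, so none of them can be infinite. *)
Lemma avg_muck_lty k n : avg mu (EFin \o v k) (Q n) < +oo.
Proof.
rewrite lt_neqAle leey andbT; apply/eqP => h.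
have := muck_le Wv n; rewrite (@prode_eqy _ _ _ k) => [|j|].
- by rewrite leNgt ltry.
- by apply: poweR_gt0; exact: avg_muck_gt0.
- by rewrite h poweRyr// gt_eqF.
Qed.

Lemma wmeasE k n : wmeas k (Q n) = mu (Q n) * avg mu (EFin \o v k) (Q n).
Proof. by have [Q0 Qy] := muQ n; rewrite avgK// /wmeas density_setE. Qed.

Lemma wmeas_finite_pos k : finite_pos Q (wmeas k).
Proof.
move=> n; have [Q0 Qy] := muQ n; rewrite wmeasE; split.
  by rewrite mule_gt0// avg_muck_gt0.
by apply: lte_mul_pinfty; rewrite ?(ltW Q0)// ?avg_muck_lty// ge0_fin_numE// ltW.
Qed.

Lemma muckenhoupt_const_gt0 : (0 < W0)%R.
Proof.
rewrite -lte_fin; apply: lt_le_trans (muck_le Wv 0%N).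
by apply: prode_gt0 => k; apply: poweR_gt0; exact: avg_muck_gt0.
Qed.

(** Hoelder's inequality for 1 = prod v_k^(g_k / G), integrated over B. *)
Lemma hoelder_subset (B : set X) : (0 < \sum_k g k)%R -> measurable B ->
  mu B <= \prod_k (wmeas k B `^ (g k / \sum_j g j)).
Proof.
move=> G0 mB; set G := (\sum_k g k)%R.
rewrite -[X in mu X]setIT -(integral_indic mu measurableT mB).
have b1 : (\sum_k g k / G = 1)%R by rewrite -mulr_suml divff// gt_eqF.
have b0 k : (0 <= g k / G)%R by rewrite divr_ge0// ltW.
have := @hoelder_int _ _ _ mu K _ b0 b1 (fun k x => (v k x)%:E * (\1_B x)%:E)
  (fun k => nnm_setf mB (muck_nnm k)).
under eq_bigr do rewrite -(density_setE mu (muck_nnm _) mB) -/(wmeas _).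
apply: le_trans; apply: le_int.
- exact: nnm_indic.
- by apply: nnm_prod => k; apply: nnm_pow; exact: (nnm_setf mB (muck_nnm k)).1.
move=> x; rewrite indicE; case: (boolP (x \in B)) => xB; last first.
  by rewrite prode_ge0// => k _; exact: poweR_ge0.
under eq_bigr do rewrite mule1 poweRrM poweR_EFin.
by rewrite -prode_poweR ?prodEFin ?(muck_prod Wv)// ?poweR1r// => k; rewrite lee_fin powR_ge0.
Qed.

(** Hoelder's inequality bounds mu(B) from above by the v_k mu(B), and the Muckenhoupt condition
    bounds the product of the v_k mu(Q n) by powers of mu(Q n). Smallness for one index is therefore
    inherited by mu. *)
Lemma small_proportion n k (B : set X) (eps : R) : (0 <= eps)%R ->
  measurable B -> B `<=` Q n -> wmeas k B <= eps%:E * wmeas k (Q n) ->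
  mu B <= ((W0 * eps `^ g k) `^ (\sum_j g j)^-1)%:E * mu (Q n).
Proof.
move=> e0 mB BQ hB; have [Q0 Qy] := muQ n; set G := (\sum_j g j)%R.
have G0 : (0 < G)%R.
  by rewrite /G (bigD1 k)//= ltr_pwDl// sumr_ge0// => j _; exact: ltW.
apply: (le_trans (hoelder_subset G0 mB)).
(* Only the factor of index k gains eps; the others are bounded by the whole cube. *)
pose c j : R := if j == k then eps else 1%R.
have c0 j : (0 <= c j)%R by rewrite /c; case: ifP.
have h j : wmeas j B <= (c j)%:E * (mu (Q n) * avg mu (EFin \o v j) (Q n)).
  rewrite -wmeasE /c; case: eqVneq => [->//|_]; rewrite mul1e.
  by apply: le_measure => //; rewrite inE.
apply: (@le_trans _ _ (\prod_j (((c j)%:E * (mu (Q n) * avg mu (EFin \o v j) (Q n))) `^ (g j / G)))).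
  apply: lee_prod => j; first exact: poweR_ge0.
  by apply: lee_poweR => //; rewrite divr_ge0// ltW.
have a0 j : 0 <= avg mu (EFin \o v j) (Q n) by rewrite ltW// avg_muck_gt0.
under eq_bigr => j _ do rewrite (poweRM _ _ (mule_ge0 (ltW Q0) (a0 j))) ?lee_fin// (poweRM _ (ltW Q0))//.
rewrite !big_split/= muleCA muleC.
have -> : \prod_j (mu (Q n) `^ (g j / G)) = mu (Q n).
  have Qf : mu (Q n) \is a fin_num by rewrite ge0_fin_numE.
  under eq_bigr do rewrite -(fineK Qf) poweR_EFin.
  rewrite prodEFin -{2}(fineK Qf) -[in RHS](@powRr1 _ (fine (mu (Q n)))) ?fine_ge0//.
  have {2}<- : (\sum_k g k / G = 1)%R by rewrite -mulr_suml divff// gt_eqF.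
  congr EFin; apply/esym.
  have q0 : (fine (mu (Q n)) != 0)%R by rewrite gt_eqF// fine_gt0// Q0.
  apply: (big_morph (fun c => (fine (mu (Q n)) `^ c)%R)) => [x y|]; first by rewrite powRD// q0 implybT.
  by rewrite powRr0.
apply: lee_wpmul2r => //.
rewrite powRM ?powR_ge0 ?(ltW muckenhoupt_const_gt0)// EFinM muleC; apply: lee_pmul.
- by apply: prode_ge0 => j _; rewrite ?lee_fin ?powR_ge0 ?poweR_ge0.
- by apply: prode_ge0 => j _; rewrite ?lee_fin ?powR_ge0 ?poweR_ge0.
- have -> : \prod_j (avg mu (EFin \o v j) (Q n) `^ (g j / G)) =
     (\prod_j (avg mu (EFin \o v j) (Q n) `^ g j)) `^ G^-1.
    rewrite prode_poweR => [|j]; last exact: poweR_ge0.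
    by apply: eq_bigr => j _; rewrite poweRrM.
  rewrite -poweR_EFin; apply: lee_poweR; [by rewrite invr_ge0 ltW| |exact: muck_le].
  by apply: prode_ge0 => j _; exact: poweR_ge0.
- rewrite (bigD1 k)//= big1 ?mule1 => [|j jk]; last by rewrite /c (negbTE jk) powR1.
  by rewrite /c eqxx powRrM.
Qed.

Variable r : K -> R.
Hypothesis r0 : forall k, (0 < r k)%R.

(** The density of |f|^(r_k) mu with respect to v_k mu. *)
Definition wfun k (f : X -> R) (x : X) : \bar R := (`|f x| `^ r k / v k x)%:E.

Lemma nnm_wfun k f : measurable_fun setT f -> nnm (wfun k f).
Proof.
move=> mf; apply: nnm_EFin => [|x]; last by rewrite divr_ge0 ?powR_ge0// ltW//; exact: muck_gt0 Wv k x.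
apply: measurable_funM.
  by apply: (measurableT_comp (measurable_powR _)); exact: measurableT_comp.
under eq_fun do rewrite -powR_inv1 ?(ltW (muck_gt0 Wv _ _))//.
by apply: (measurableT_comp (measurable_powR _)); exact: muck_meas Wv k.
Qed.

(** An average of f to the power r_k is the product of the averages of v_k and of [wfun]. Here the
    first is replaced by the value of v_k at x, the second by the maximal function at x. *)
Definition wmax k (f : X -> R) (x : X) : \bar R :=
  (maximal Q (wmeas k) (wfun k f) x * (v k x)%:E) `^ (r k)^-1.

Lemma nnm_wmax k f : measurable_fun setT f -> nnm (wmax k f).
Proof.
move=> mf; apply: nnm_pow; apply: (nnm_mul _ (muck_nnm k)).1.
by apply: (nnm_maximal lamQ); exact: nnm_wfun.
Qed.

Lemma averageE k n f : measurable_fun setT f ->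
  average mu (r k)%:E (Q n) f =
  (avg mu (EFin \o v k) (Q n) * avg (wmeas k) (wfun k f) (Q n)) `^ (r k)^-1.
Proof.
move=> mf; have [Q0 Qy] := muQ n; have [w0 wy] := wmeas_finite_pos k n.
rewrite /average; congr (_ `^ _).
have q0 : (0 < fine (mu (Q n)))%R by rewrite fine_gt0// Q0.
have Qf : mu (Q n) \is a fin_num by rewrite ge0_fin_numE.
have -> : (mu (Q n))^-1 = (fine (mu (Q n)))^-1%:E.
  by rewrite -{1}(fineK Qf) inver gt_eqF.
rewrite {1}/avg -[X in _ = _ * X * _](density_setE mu (muck_nnm k))// -muleA; congr (_ * _).
rewrite -/(wmeas k) avgK// int_density; last by apply: nnm_setf => //; exact: nnm_wfun.
rewrite int_set//; apply: eq_integral => x _.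
rewrite muleAC; congr (_ * _); rewrite -EFinM divfK// gt_eqF//.
exact: muck_gt0 Wv k x.
Qed.

(* The exceptional set consists of the points where [v k] is small, or [A] large,
   compared with its average with respect to [mu], or to [wmeas k]. *)
Lemma average_good k n (f A : X -> R) (al CA eps : R) :
  (0 <= al)%R -> (0 < CA)%R -> (0 < eps)%R ->
  measurable_fun setT f -> measurable_fun setT A -> (forall x, 0 < A x)%R ->
  (\forall x \ae wmeas k, maximal Q (wmeas k) (EFin \o A) x <= CA%:E * (A x)%:E) ->
  exists b, [/\ measurable b, b `<=` Q n,
    mu b <= (2 * (W0 * eps `^ g k) `^ (\sum_j g j)^-1)%:E * mu (Q n) &
    forall x, Q n x -> ~ b x ->
      average mu (r k)%:E (Q n) (fun y => (f y * A y `^ (- al))%R) <=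
      ((eps^-1) `^ (r k)^-1 * (CA / eps) `^ al)%:E * ((A x `^ (- al))%:E * wmax k f x)].
Proof.
move=> al0 CA0 e0 mf mA A0 hA; have [Q0 Qy] := muQ n; have [w0 wy] := wmeas_finite_pos k n.
have nA : nnm (EFin \o A) by apply: nnm_EFin => // x; exact: ltW.
have vpos := muck_gt0 Wv k.
have cy : avg (wmeas k) (EFin \o A) (Q n) < +oo.
  rewrite ltey; apply/eqP => cE.
  have : (wmeas k).-negligible (Q n).
    apply: negligibleS hA => x Qx /=; apply/negP; rewrite -ltNge.
    by apply: lt_le_trans (avg_le_maximal _ _ Qx); rewrite cE -EFinM ltry.
  by move=> /negligibleP => /(_ (mQ n)) h; rewrite h ltxx in w0.
have cf : avg (wmeas k) (EFin \o A) (Q n) \is a fin_num.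
  by rewrite ge0_fin_numE// avg_ge0.
set c := fine (avg (wmeas k) (EFin \o A) (Q n)).
have cE : avg (wmeas k) (EFin \o A) (Q n) = c%:E by rewrite fineK.
have cA : \forall x \ae wmeas k, Q n x -> (c <= CA * A x)%R.
  apply: filterS hA => x hx Qx; rewrite -lee_fin -cE EFinM; apply: le_trans hx.
  exact: avg_le_maximal.
have c0 : (0 < c)%R.
  rewrite lt_neqAle fine_ge0 ?avg_ge0// andbT; apply/eqP => cz.
  have := avgK w0 wy (EFin \o A); rewrite cE -cz mule0.
  move=> /esym /(ae_eq0_int (nnm_setf (mQ n) nA)) h.
  have /negligibleP : (wmeas k).-negligible (Q n).
    apply: negligibleS h => x Qx /= ; rewrite indicE mem_set// mule1 => -[] /eqP.
    by rewrite gt_eqF.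
  by move=> /(_ (mQ n)) h3; rewrite h3 ltxx in w0.
have Vf : avg mu (EFin \o v k) (Q n) \is a fin_num.
  by rewrite ge0_fin_numE ?avg_muck_lty// ltW// avg_muck_gt0.
set V := fine (avg mu (EFin \o v k) (Q n)).
have VE : avg mu (EFin \o v k) (Q n) = V%:E by rewrite fineK.
have V0 : (0 < V)%R by rewrite -lte_fin -VE avg_muck_gt0.
pose b1 := Q n `&` [set x | (v k x < eps * V)%R].
pose b2 := Q n `&` [set x | (c / eps < A x)%R].
have mb1 : measurable b1.
  apply: measurableI => //; rewrite -[X in measurable X]setTI.
  exact: (measurable_fun_ltr (muck_meas Wv k) (measurable_cst _)).
have mb2 : measurable b2.
  apply: measurableI => //; rewrite -[X in measurable X]setTI.
  exact: (measurable_fun_ltr (measurable_cst _) mA).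
have wb1 : wmeas k b1 <= eps%:E * wmeas k (Q n).
  rewrite wmeasE VE /wmeas density_setE//.
  apply: (@le_trans _ _ (\int[mu]_x ((eps * V)%:E * (\1_(Q n) x)%:E))).
    apply: le_int => [||x].
    - by apply: nnm_setf => //; exact: muck_nnm.
    - by apply: nnm_setf => //; apply: nnm_cst; rewrite lee_fin mulr_ge0 ?ltW.
    rewrite !indicE /b1 in_setI /=.
    case: (boolP (x \in Q n)) => xQ /=; last by rewrite !mule0.
    rewrite mule1; case: (boolP (x \in _)) => [/set_mem/= h|_]; rewrite ?mule1 ?mule0 lee_fin.
      exact: ltW.
    by rewrite mulr_ge0 ?ltW.
  rewrite int_scale ?lee_fin ?mulr_ge0 ?(ltW e0) ?(ltW V0)//; last exact: nnm_indic.
  rewrite integral_indic// setIT EFinM -muleA [(mu _ * _)]muleC; exact: lexx.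
have wb2 : wmeas k b2 <= eps%:E * wmeas k (Q n).
  have : (c / eps)%:E * wmeas k b2 <= wmeas k (Q n) * c%:E.
    rewrite -cE avgK// -[b2]setIT -(integral_indic (wmeas k) measurableT mb2).
    rewrite -int_scale ?lee_fin ?divr_ge0 ?(ltW c0) ?(ltW e0)//; last exact: nnm_indic.
    apply: le_int => [||x].
    - by apply: nnm_setf => //; apply: nnm_cst; rewrite lee_fin divr_ge0 ?ltW.
    - exact: nnm_setf.
    rewrite !indicE /b2 in_setI /=.
    case: (boolP (x \in Q n)) => xQ /=; last by rewrite !mule0.
    rewrite mule1; case: (boolP (x \in _)) => [/set_mem/= h|_]; rewrite ?mule1 ?mule0 lee_fin.
      exact: ltW.
    by rewrite ltW.
  have ce0 : (0 <= (c / eps)^-1)%R by rewrite invr_ge0 divr_ge0 ?ltW.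
  move=> /(lee_wpmul2l (x := ((c / eps)^-1)%:E) ce0).
  rewrite muleA -EFinM mulVf ?mul1e ?gt_eqF ?divr_gt0//.
  rewrite [X in _ -> _ <= X]muleC [wmeas k (Q n) * _]muleC muleA -EFinM invf_div divfK ?gt_eqF//.
  by rewrite muleC.
exists (b1 `|` b2); split.
- exact: measurableU.
- by move=> x [] [].
- apply: (le_trans (measureU2 _ mb1 mb2)).
  rewrite mulr_natl mulr2n EFinD ge0_muleDl ?lee_fin ?powR_ge0//.
  apply: leeD; apply: (@small_proportion _ _ _ _ (ltW e0)) => //; by move=> x [].
move=> x Qx nb; have [/negP h1 /negP h2] : ~ (v k x < eps * V)%R /\ ~ (c / eps < A x)%R.
  by split => h; apply: nb; [left|right].
rewrite -leNgt in h1; rewrite -leNgt ler_pdivlMr// mulrC in h2.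
(* Almost everywhere on the cube A is at least c / CA, while A x <= c / eps. Hence A^(-al) <= ka
   there, and this factor can be taken out of the average. *)
pose ka := ((CA / eps) `^ al * A x `^ (- al))%R.
have ka0 : (0 <= ka)%R by rewrite mulr_ge0 ?powR_ge0.
have r0k := r0 k.
have mfA : measurable_fun setT (fun y => (f y * A y `^ (- al))%R).
  apply: measurable_funM => //.
  exact: (measurableT_comp (measurable_powR _) mA).
rewrite averageE// VE.
have nwf := nnm_wfun k mf; have nwfA := nnm_wfun k mfA.
have key : avg (wmeas k) (wfun k (fun y => (f y * A y `^ (- al))%R)) (Q n) <=
    (ka `^ r k)%:E * maximal Q (wmeas k) (wfun k f) x.
  apply: (@le_trans _ _ ((ka `^ r k)%:E * avg (wmeas k) (wfun k f) (Q n))); last first.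
    by apply: lee_wpmul2l; rewrite ?lee_fin ?powR_ge0//; exact: avg_le_maximal.
  rewrite -avg_scale ?lee_fin ?powR_ge0//.
  apply: le_avg_ae => //.
    by apply: nnm_mul => //; apply: nnm_cst; rewrite lee_fin powR_ge0.
  apply: filterS cA => y hy Qy'; rewrite /wfun -EFinM lee_fin mulrA.
  apply: ler_wpM2r; first by rewrite invr_ge0 ltW.
  rewrite normrM powRM// mulrC ler_wpM2r ?powR_ge0// ge0_ler_powR ?nnegrE ?(ltW r0k)//.
  rewrite ger0_norm ?powR_ge0// /ka.
  rewrite (_ : ((CA / eps) `^ al = (eps / CA) `^ (- al))%R); last first.
    have t0 : ((eps / CA) `^ al != 0)%R by rewrite gt_eqF// powR_gt0// divr_gt0.
    rewrite powRN; apply: (mulIf t0); rewrite mulVf// -powRM ?divr_ge0 ?(ltW e0) ?(ltW CA0)//.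
    by rewrite mulrA divfK ?gt_eqF// divff ?gt_eqF// powR1.
  rewrite -powRM ?divr_ge0 ?(ltW e0) ?(ltW CA0) ?(ltW (A0 _))//.
  have eC : (0 < eps / CA)%R by rewrite divr_gt0.
  rewrite !powRN lef_pV2 ?posrE ?powR_gt0 ?(mulr_gt0 eC)//.
  apply: ge0_ler_powR => //; rewrite ?nnegrE; [exact: mulr_ge0 (ltW eC) (ltW (A0 x))|exact: ltW (A0 y)|].
  by rewrite mulrAC ler_pdivrMr// [leRHS]mulrC; apply: (le_trans h2); exact: hy.
have M0 : 0 <= maximal Q (wmeas k) (wfun k f) x by have [] := nnm_maximal lamQ (wmeas k) nwf.
apply: (@le_trans _ _ (((eps^-1)%:E * ((ka `^ r k)%:E * (maximal Q (wmeas k) (wfun k f) x * (v k x)%:E))) `^ (r k)^-1)).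
  apply: lee_poweR; first by rewrite invr_ge0 ltW.
    by apply: mule_ge0; rewrite ?lee_fin ?(ltW V0)//; exact: avg_ge0.
  rewrite [leRHS](_ : _ = (eps^-1 * v k x)%:E * ((ka `^ r k)%:E * maximal Q (wmeas k) (wfun k f) x)).
    apply: lee_pmul => //; rewrite ?lee_fin ?(ltW V0)//; first exact: avg_ge0.
    by rewrite mulrC ler_pdivlMr// mulrC.
  by rewrite EFinM -!muleA; congr (_ * _); rewrite [RHS]muleCA; congr (_ * _); rewrite muleC.
have vx0 : 0 <= (v k x)%:E by rewrite lee_fin ltW.
have kr0 : 0 <= (ka `^ r k)%:E by rewrite lee_fin powR_ge0.
rewrite /wmax !poweRM ?lee_fin ?invr_ge0 ?(ltW e0) ?mule_ge0 ?powR_ge0 ?(ltW (vpos x))//.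
rewrite !poweR_EFin -powRrM mulfV ?gt_eqF// powRr1// /ka !EFinM !muleA; exact: lexx.
Qed.

End one_weight.

(* Equal to (\int z)^eta z^(-eta): where [z] is at most its average over a cube B,
   up to a constant, this absorbs the factor mu(B)^eta of the form. *)
Definition zweight (z : X -> \bar R) (eta : R) (x : X) : \bar R :=
  if z x == 0 then +oo else (\int[mu]_y z y) `^ eta * (fine (z x) `^ (- eta))%:E.

Lemma nnm_zweight z eta : nnm z -> nnm (zweight z eta).
Proof.
move=> mz; split => [|x]; last first.
  by rewrite /zweight; case: ifP => // _; rewrite mule_ge0 ?poweR_ge0// lee_fin powR_ge0.
apply: measurable_fun_ifT.
- by apply: (measurable_fun_eqe mz.1); exact: measurable_cst.
- exact: measurable_cst.
- apply: emeasurable_funM; first exact: measurable_cst.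
  apply/measurable_EFinP; apply: (measurableT_comp (measurable_powR _)).
  by apply: (measurableT_comp _ mz.1); exact: fine_measurable.
Qed.

(** By Markov's inequality, z exceeds rho^-1 (int z) / mu(Q n) on a proportion at most rho of the
    cube. Elsewhere mu(Q n) <= rho^-1 (int z) / z, and this is raised to the power eta. *)
Lemma measure_power_good n (z : X -> \bar R) (eta rho : R) : (0 <= eta)%R -> (0 < rho)%R ->
  nnm z -> \int[mu]_x z x < +oo ->
  exists b, [/\ measurable b, b `<=` Q n, mu b <= rho%:E * mu (Q n) &
    forall x, Q n x -> ~ b x -> mu (Q n) `^ eta <= (rho^-1 `^ eta)%:E * zweight z eta x].
Proof.
move=> eta0 rho0 mz zy; have [Q0 Qy] := muQ n.
have Qf : mu (Q n) \is a fin_num by rewrite ge0_fin_numE// ltW.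
have If : \int[mu]_x z x \is a fin_num by rewrite ge0_fin_numE// int_ge0.
set q := fine (mu (Q n)); set I := fine (\int[mu]_x z x).
have qE : mu (Q n) = q%:E by rewrite fineK.
have IE : \int[mu]_x z x = I%:E by rewrite fineK.
have q0 : (0 < q)%R by rewrite -lte_fin -qE.
have I0 : (0 <= I)%R by rewrite fine_ge0// int_ge0.
pose c := (rho^-1 * I / q)%R.
have c0 : (0 <= c)%R by rewrite !(divr_ge0, mulr_ge0, invr_ge0)// ltW.
exists (Q n `&` [set x | c%:E < z x]).
have mb : measurable [set x | c%:E < z x].
  by rewrite -[X in measurable X]setTI; apply: emeasurable_fun_o_infty => //; exact: mz.1.
split.
- exact: measurableI.
- by move=> x [].
- have [Iz|Ip] : (I = 0 \/ 0 < I)%R by move: I0; rewrite le_eqVlt => /orP[/eqP <-|]; [left|right].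
    have /(ae_eq0_int mz) h : \int[mu]_x z x = 0 by rewrite IE Iz.
    suff -> : mu (Q n `&` [set x | c%:E < z x]) = 0.
      by rewrite mule_ge0 ?lee_fin// ltW.
    apply/negligibleP; first exact: measurableI.
    apply: (@negligibleS _ _ _ _ [set x | c%:E < z x]); first by move=> x [].
    apply: negligibleS h => x /= cz; apply/eqP; rewrite gt_eqF//.
    by apply: le_lt_trans cz; rewrite lee_fin.
  have cp : (0 < c)%R by rewrite divr_gt0 ?mulr_gt0 ?invr_gt0.
  have h : c%:E * mu (Q n `&` [set x | c%:E < z x]) <= I%:E.
    rewrite -IE; apply: le_trans (int_Markov mu mz (_ : 0 <= c%:E)); rewrite ?lee_fin//.
    apply: lee_wpmul2l; first by rewrite lee_fin.
    apply: le_measure; rewrite ?inE.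
    - exact: measurableI.
    - by rewrite -[X in measurable X]setTI; apply: emeasurable_fun_c_infty => //; exact: mz.1.
    - by move=> x [_ /ltW].
  have ci : 0 <= (c^-1)%:E by rewrite lee_fin invr_ge0.
  have := lee_wpmul2l ci h; rewrite muleA -EFinM mulVf ?gt_eqF// mul1e => /le_trans; apply.
  rewrite qE -!EFinM lee_fin (_ : c^-1 * I = rho * q)%R// /c.
  by field; rewrite !gt_eqF.
move=> x Qx nb; have zc : z x <= c%:E.
  by rewrite leNgt; apply/negP => h; apply: nb.
rewrite /zweight; case: eqVneq => [_|z0].
  by rewrite gt0_muley ?leey// lte_fin powR_gt0 ?invr_gt0.
have zf : z x \is a fin_num by rewrite ge0_fin_numE ?mz.2//; apply: le_lt_trans zc _; exact: ltry.
have zp : (0 < fine (z x))%R by rewrite fine_gt0// lt_neqAle eq_sym z0 mz.2 -ge0_fin_numE ?mz.2.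
move: zc; rewrite -{1}(fineK zf) lee_fin /c ler_pdivlMr// => zc.
rewrite qE IE !poweR_EFin -!EFinM lee_fin powRN mulrA ler_pdivlMr ?powR_gt0//.
rewrite -!powRM ?invr_ge0 ?(ltW rho0) ?(ltW q0) ?(ltW zp)//.
have qz : (0 <= fine (z x) * q)%R by rewrite mulr_ge0 ?(ltW q0) ?(ltW zp).
by rewrite mulrC; apply: ge0_ler_powR => //; exact: le_trans qz zc.
Qed.

Lemma bad_union n (b : K -> set X) (a : R) (s : seq K) : (0 <= a)%R ->
  (forall k, measurable (b k) /\ mu (b k) <= a%:E * mu (Q n)) ->
  exists U, [/\ measurable U, mu U <= ((size s)%:R * a)%:E * mu (Q n) &
    forall k x, k \in s -> b k x -> U x].
Proof.
move=> a0 hb; have [Q0 _] := muQ n; elim: s => [|k s [U [mU hU sU]]].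
  by exists set0; split => //; rewrite measure0 mul0r mul0e.
have [mb hk] := hb k; exists (b k `|` U); split; first exact: measurableU.
  apply: (le_trans (measureU2 _ mb mU)); rewrite -natr1 mulrDl mul1r addrC EFinD.
  by rewrite ge0_muleDl ?lee_fin ?mulr_ge0// leeD.
move=> j x; rewrite inE => /orP[/eqP ->|js bx]; first by left.
by right; exact: sU bx.
Qed.

(** One eps serves for all k: with t = rho^G / max(W0, 1) <= 1 and eps = t^S, where S is the sum of
    the 1 / g_k, each eps^(g_k) is at most t. *)
Lemma small_eps (W0 rho : R) : (0 < W0)%R -> (0 < rho)%R -> (rho <= 1)%R ->
  exists2 eps, (0 < eps)%R & forall k, ((W0 * eps `^ g k) `^ (\sum_j g j)^-1 <= rho)%R.
Proof.
move=> W0p rho0 rho1; set G := (\sum_j g j)%R.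
pose W1 := Num.max W0 1%R; have W1p : (1 <= W1)%R by rewrite le_max lexx orbT.
pose S := (\sum_k (g k)^-1)%R; pose t := (rho `^ G / W1)%R.
have G0 : (0 <= G)%R by apply: sumr_ge0 => j _; exact: ltW.
have W10 : (0 < W1)%R by apply: lt_le_trans W1p.
have t0 : (0 < t)%R by rewrite divr_gt0// powR_gt0.
have t1 : (t <= 1)%R.
  rewrite ler_pdivrMr// mul1r; apply: le_trans W1p.
  by have := ge0_ler_powR G0 (ltW rho0) ler01 rho1; rewrite powR1.
exists (t `^ S)%R => [|k]; first by rewrite powR_gt0.
have Gp : (0 < G)%R by rewrite /G (bigD1 k)//= ltr_pwDl// sumr_ge0// => j _; exact: ltW.
have h : ((t `^ S) `^ g k <= t)%R.
  rewrite -powRrM -[leRHS]powRr1 ?(ltW t0)//; apply: ger_powR; first by rewrite t0 t1.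
  rewrite /S (bigD1 k)//= mulrDl mulVf ?gt_eqF// lerDl mulr_ge0 ?(ltW (g0 _))//.
  by apply: sumr_ge0 => j _; rewrite invr_ge0 ltW.
apply: (@le_trans _ _ ((rho `^ G) `^ G^-1)%R); last first.
  by rewrite -powRrM mulfV ?gt_eqF// powRr1// ltW.
rewrite ge0_ler_powR ?nnegrE ?invr_ge0 ?mulr_ge0 ?powR_ge0 ?(ltW W0p)//.
apply: (@le_trans _ _ (W1 * t)%R); last by rewrite /t mulrC divfK ?gt_eqF.
by apply: ler_pM; rewrite ?powR_ge0 ?(ltW W0p)// le_max lexx.
Qed.

Section domination.
Variables (r : K -> R) (W0 delta0 al CA eta : R).
Hypothesis r0 : forall k, (0 < r k)%R.
Hypothesis d0 : (0 < delta0)%R.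
Hypothesis d1 : (delta0 <= 1)%R.
Hypothesis al0 : (0 <= al)%R.
Hypothesis CA0 : (0 < CA)%R.
Hypothesis eta0 : (0 <= eta)%R.

(** Off the exceptional sets of z and of all the v_k, each factor of a term of the form lies below
    its pointwise counterpart, up to a constant. This constant depends on the weights through W0
    alone. *)
Lemma form_domination : exists2 C : R, (0 < C)%R &
  forall v (Wv : muckenhoupt W0 v) (S : set (set X)), S `<=` range Q -> sparse mu delta0 S ->
  forall (f A : K -> X -> R) (z : X -> \bar R),
  (forall k, measurable_fun setT (f k)) -> (forall k, measurable_fun setT (A k)) ->
  (forall k x, 0 < A k x)%R ->
  (forall k, \forall x \ae wmeas Wv k,
     maximal Q (wmeas Wv k) (EFin \o A k) x <= CA%:E * (A k x)%:E) ->
  nnm z -> \int[mu]_x z x < +oo ->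
  \esum_(B in S) (mu B `^ (eta + 1) *
     \prod_k average mu (r k)%:E B (fun y => (f k y * A k y `^ (- al))%R)) <=
  C%:E * \int[mu]_x (zweight z eta x *
     \prod_k ((A k x `^ (- al))%:E * wmax Wv r k (f k) x)).
Proof.
have [W0n|W0p] := leP W0 0%R.
  by exists 1%R => // v Wv; have := muckenhoupt_const_gt0 Wv; rewrite ltNge W0n.
(* The exceptional sets consume one share rho for z and two shares for each k, in total delta0 /
   2. *)
pose rho := (delta0 / 2 / (2 * #|K|%:R + 1))%R.
have k1 : (1 <= 2 * #|K|%:R + 1 :> R)%R by rewrite lerDr mulr_ge0.
have k0 : (0 < 2 * #|K|%:R + 1 :> R)%R by apply: lt_le_trans k1.
have rho0 : (0 < rho)%R by rewrite !divr_gt0.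
have rho1 : (rho <= 1)%R.
  by rewrite ler_pdivrMr// mul1r; apply: le_trans k1; rewrite ler_pdivrMr// mul1r (le_trans d1)// ler1n.
have [eps e0 heps] := small_eps W0p rho0 rho1.
pose ck k := (eps^-1 `^ (r k)^-1 * (CA / eps) `^ al)%R.
have ck0 k : (0 < ck k)%R by rewrite mulr_gt0 ?powR_gt0 ?invr_gt0 ?divr_gt0.
pose C1 := (rho^-1 `^ eta * \prod_k ck k)%R.
have C10 : (0 < C1)%R by rewrite mulr_gt0 ?powR_gt0 ?invr_gt0 ?prodr_gt0.
exists (2 / delta0 * C1)%R; first by rewrite mulr_gt0 ?divr_gt0.
move=> v Wv S SQ sS f A z mf mA A0 hA mz zy.
pose h x := zweight z eta x * \prod_k ((A k x `^ (- al))%:E * wmax Wv r k (f k) x).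
have mh : nnm h.
  apply: nnm_mul; first exact: nnm_zweight.
  apply: nnm_prod => k; apply: nnm_mul; last exact: nnm_wmax.
  apply: nnm_EFin => [|x]; last exact: powR_ge0.
  by apply: (measurableT_comp (measurable_powR _)); exact: mA.
pose t B := mu B `^ eta *
  \prod_k average mu (r k)%:E B (fun y => (f k y * A k y `^ (- al))%R).
have t0 B : 0 <= t B.
  by rewrite mule_ge0 ?poweR_ge0// prode_ge0// => k _; exact: poweR_ge0.
apply: (@le_trans _ _ (\esum_(B in S) (mu B * t B))).
  apply: le_esum => B /SQ [n _ <-]; have [Q0 Qy] := muQ n.
  rewrite /t muleA poweRD; last by apply: nneg_neq0_poweRD_def => //; rewrite gt_eqF.
  by rewrite poweRe1 ?(ltW Q0)// [_ `^ _ * mu _]muleC.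
rewrite EFinM -muleA -int_scale ?lee_fin ?(ltW C10)//.
apply: (sparse_sum_le lamQ muQ) => //.
  by apply: nnm_mul => //; apply: nnm_cst; rewrite lee_fin ltW.
move=> n; have [Q0 Qy] := muQ n.
have [bz [mbz bzQ hbz gz]] := measure_power_good n eta0 rho0 mz zy.
have hb k : exists b, [/\ measurable b, b `<=` Q n, mu b <= (2 * rho)%:E * mu (Q n) &
    forall x, Q n x -> ~ b x ->
      average mu (r k)%:E (Q n) (fun y => (f k y * A k y `^ (- al))%R) <=
      (ck k)%:E * ((A k x `^ (- al))%:E * wmax Wv r k (f k) x)].
  have [b [mb bQ hb gb]] := average_good r0 n al0 CA0 e0 (mf k) (mA k) (A0 k) (hA k).
  exists b; split => //; apply: (le_trans hb); apply: lee_wpmul2r; first exact: ltW.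
  by rewrite lee_fin ler_wpM2l.
have [b {}hb] := choice hb.
have [|k|U [mU hU sU]] := @bad_union n b (2 * rho) (enum K); first by rewrite mulr_ge0// ltW.
  by have [? _ ? _] := hb k.
exists (Q n `\` (bz `|` U)); split.
- by apply: measurableD => //; exact: measurableU.
- by move=> x [].
- apply: (@le_trans _ _ (mu (bz `|` U))).
    apply: le_measure; rewrite ?inE.
    + by apply: measurableD => //; apply: measurableD => //; exact: measurableU.
    + exact: measurableU.
    + by move=> x [Qx nq]; apply: contrapT => nx; apply: nq.
  apply: (le_trans (measureU2 _ mbz mU)); apply: (le_trans (leeD hbz hU)).
  have rho2 : (0 <= (size (enum K))%:R * (2 * rho))%R by do 2 apply: mulr_ge0 => //; exact: ltW.
  rewrite -ge0_muleDl ?lee_fin ?(ltW rho0)//.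
  apply: lee_wpmul2r; first exact: ltW.
  rewrite -EFinD lee_fin -cardE le_eqVlt; apply/orP; left; apply/eqP.
  transitivity ((2 * #|K|%:R + 1) * rho)%R; first by ring.
  by rewrite /rho mulrC divfK ?gt_eqF.
move=> x [Qx nb]; have nz : ~ bz x by move=> ?; apply: nb; left.
have nk k : ~ b k x by move=> ?; apply: nb; right; apply: (sU k); rewrite ?mem_enum.
rewrite /t /h /C1 EFinM -prodEFin muleACA -big_split/=.
apply: lee_pmul; rewrite ?poweR_ge0//.
- by apply: prode_ge0 => k _; exact: poweR_ge0.
- exact: gz.
- by apply: lee_prod => k; [exact: poweR_ge0|have [_ _ _] := hb k; apply].
Qed.

End domination.

End muckenhoupt.

#[global] Arguments wmeas : simpl never.
#[global] Arguments wfun : simpl never.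
#[global] Arguments wmax : simpl never.
#[global] Arguments avg : simpl never.

Lemma powR_sum_exponents (R : realType) (I : finType) (q : R) (b : I -> R) : (0 < q)%R ->
  (q `^ (\sum_i b i) = \prod_i (q `^ b i))%R.
Proof.
move=> q0; apply: (big_morph (fun c => (q `^ c)%R)) => [s t|]; last by rewrite powRr0.
by rewrite powRD//; apply/implyP => _; rewrite gt_eqF.
Qed.

(** * Hoelder's inequality for sums, with exponents of sum at least 1 *)

Section discrete.
Context {R : realType} {I : finType}.
Variable b : I -> R.
Hypothesis b0 : forall i, (0 <= b i)%R.
Hypothesis b1 : (1 <= \sum_i b i)%R.

Lemma poweR_sum_le (J : Type) (s : seq J) (y : J -> \bar R) (B : R) : (1 <= B)%R ->
  (forall j, 0 <= y j) -> \sum_(j <- s) y j `^ B <= (\sum_(j <- s) y j) `^ B.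
Proof.
move=> B1 y0; have B0 : (0 < B)%R by apply: lt_le_trans B1.
elim: s => [|j s IH]; first by rewrite !big_nil poweR0r// gt_eqF.
rewrite !big_cons; set S := \sum_(j <- s) y j.
have S0 : 0 <= S by apply: sume_ge0.
apply: (le_trans (leeD (lexx _) IH)).
have yj := y0 j.
have [->|ny] := eqVneq (y j) +oo.
  by rewrite addye ?(@poweRyr _ _ (lt0r_neq0 B0)) ?leey// -ltNye (lt_le_trans _ S0)// ltNy0.
have [->|nS] := eqVneq S +oo.
  by rewrite addey ?(@poweRyr _ _ (lt0r_neq0 B0)) ?leey// -ltNye (lt_le_trans _ yj)// ltNy0.
have yf : y j \is a fin_num by rewrite ge0_fin_numE// ltey.
have Sf : S \is a fin_num by rewrite ge0_fin_numE// ltey.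
rewrite -/S -(fineK yf) -(fineK Sf); set u := fine (y j); set w := fine S.
rewrite -(EFinD u w) !poweR_EFin -EFinD lee_fin.
have u0 : (0 <= u)%R by exact: fine_ge0.
have w0 : (0 <= w)%R by exact: fine_ge0.
have spl x : (0 <= x)%R -> (x `^ B = x * x `^ (B - 1))%R.
  move=> x0; have [->|xn] := eqVneq x 0%R; first by rewrite mul0r powR0// gt_eqF.
  rewrite -{2}[x]powRr1// -powRD; last by rewrite xn implybT.
  by congr (_ `^ _)%R; ring.
rewrite !spl ?addr_ge0// mulrDl; apply: lerD; apply: ler_wpM2l => //;
by apply: ge0_ler_powR; rewrite ?nnegrE ?subr_ge0 ?addr_ge0// ?lerDl ?lerDr.
Qed.

(** Hoelder's inequality with the exponents b_i / B, then superadditivity of the power B >= 1. In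
    the application B = eta + 1, which is how the fractional power of the measure is
    accommodated. *)
Lemma hoelder_sum_ge1 (J : Type) (s : seq J) (x : I -> J -> \bar R) :
  (forall i j, 0 <= x i j) ->
  \sum_(j <- s) \prod_i (x i j `^ b i) <= \prod_i ((\sum_(j <- s) x i j) `^ b i).
Proof.
move=> x0; set B := (\sum_i b i)%R.
have B0 : (0 < B)%R by apply: lt_le_trans b1.
have bB i : (0 <= b i / B)%R by rewrite divr_ge0// ltW.
have bB1 : (\sum_i b i / B = 1)%R by rewrite -mulr_suml divff// gt_eqF.
have e i (t : \bar R) : t `^ b i = (t `^ (b i / B)) `^ B.
  by rewrite -poweRrM divfK// gt_eqF.
under eq_bigr do under eq_bigr do rewrite e.
under [leRHS]eq_bigr do rewrite e.
under eq_bigr do rewrite -(prode_poweR _ _ (fun i => poweR_ge0 _ _)).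
rewrite -prode_poweR => [|i]; last exact: poweR_ge0.
apply: (le_trans (poweR_sum_le _ _ _)) => // [j|].
  by apply: prode_ge0 => i _; exact: poweR_ge0.
apply: lee_poweR; first exact: ltW.
  by apply: sume_ge0 => j _; apply: prode_ge0 => i _; exact: poweR_ge0.
exact: hoelder_sum.
Qed.

End discrete.

(** * The sharp bound of the sparse form *)

Section sharp.
Context {R : realType} {d : measure_display} {X : measurableType d}.
Variable mu : {measure set X -> \bar R}.
Variables (N : nat) (Q : nat -> set X) (lab : nat -> 'I_N).
Hypothesis lamQ : laminar Q lab.
Hypothesis muQ : finite_pos Q mu.
Context {K : finType}.
Variable g : K -> R.
Hypothesis g0 : forall k, (0 < g k)%R.
Let G := (\sum_k g k)%R.
Hypothesis G0 : (0 < G)%R.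

Let mQ n : measurable (Q n). Proof. exact: laminar_measurable lamQ n. Qed.

Section one_weight.
Variables (W0 : R) (v : K -> X -> R).
Hypothesis Wv : muckenhoupt mu Q g W0 v.
Variables (b : K -> R) (M : R).
Hypothesis b0 : forall k, (0 <= b k)%R.
Hypothesis bM : forall k, (b k / g k <= M)%R.

(** The ratios (x_k / y_k)^(g_k) of a cube to its portion are all at least 1. Their product is at
    most W0 delta0^(-G), by the Muckenhoupt condition for the x_k and [hoelder_subset] for the y_k.
    As b_k <= M g_k, its M-th power suffices. *)
Lemma prod_wmeas_le (delta0 : R) n (E : set X) : (0 < delta0)%R ->
  measurable E -> E `<=` Q n -> delta0%:E * mu (Q n) <= mu E ->
  \prod_k (wmeas Wv k (Q n) `^ b k) <=
  ((W0 * delta0 `^ (- G)) `^ M)%:E * \prod_k (wmeas Wv k E `^ b k).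
Proof.
move=> d0 mE EQ hE; have [Q0 Qy] := muQ n.
have W0p := muckenhoupt_const_gt0 lamQ muQ Wv.
have Qf : mu (Q n) \is a fin_num by rewrite ge0_fin_numE// ltW.
pose q := fine (mu (Q n)); have qE : mu (Q n) = q%:E by rewrite fineK.
have q0 : (0 < q)%R by rewrite -lte_fin -qE.
have Ey : mu E < +oo by apply: le_lt_trans Qy; apply: le_measure; rewrite ?inE.
have Ef : mu E \is a fin_num by rewrite ge0_fin_numE.
pose e := fine (mu E); have eE : mu E = e%:E by rewrite fineK.
have dqe : (delta0 * q <= e)%R by rewrite -lee_fin -eE EFinM -qE.
have e0 : (0 < e)%R by apply: lt_le_trans dqe; rewrite mulr_gt0.
have [x0 xy] : (forall k, 0 < wmeas Wv k (Q n)) /\ (forall k, wmeas Wv k (Q n) < +oo).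
  by split=> k; have [] := wmeas_finite_pos lamQ muQ g0 Wv k n.
have xf k : wmeas Wv k (Q n) \is a fin_num by rewrite ge0_fin_numE// ltW.
have yx k : wmeas Wv k E <= wmeas Wv k (Q n) by apply: le_measure; rewrite ?inE.
have yf k : wmeas Wv k E \is a fin_num.
  by rewrite ge0_fin_numE//; apply: le_lt_trans (yx k) (xy k).
pose x k := fine (wmeas Wv k (Q n)); pose y k := fine (wmeas Wv k E).
have xE k : wmeas Wv k (Q n) = (x k)%:E by rewrite fineK.
have yE k : wmeas Wv k E = (y k)%:E by rewrite fineK.
have eG : (e <= \prod_k (y k `^ (g k / G)))%R.
  rewrite -lee_fin -eE -prodEFin; apply: (le_trans (hoelder_subset g0 Wv G0 mE)).
  by apply: lee_prod => k; [exact: poweR_ge0|rewrite yE].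
have yn k : (0 <= y k)%R by exact: fine_ge0.
have y0 k : (0 < y k)%R.
  rewrite lt_neqAle yn andbT; apply/eqP => yz.
  move: eG; rewrite (bigD1 k)//= -yz powR0 ?mul0r ?leNgt ?e0//.
  by rewrite gt_eqF// divr_gt0.
have xp k : (0 < x k)%R by rewrite -lte_fin -xE.
have eyg : (e `^ G <= \prod_k (y k `^ g k))%R.
  have -> : (\prod_k (y k `^ g k) = (\prod_k (y k `^ (g k / G))) `^ G)%R.
    apply: EFin_inj; rewrite -poweR_EFin -!prodEFin prode_poweR => [|k]; last by rewrite lee_fin powR_ge0.
    by apply: eq_bigr => k _; rewrite poweR_EFin -powRrM divfK// gt_eqF.
  apply: ge0_ler_powR => //; rewrite ?nnegrE ?(ltW G0) ?(ltW e0)//.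
  by apply: prodr_ge0 => k _; exact: powR_ge0.
have xg : (\prod_k (x k `^ g k) <= q `^ G * W0)%R.
  rewrite powR_sum_exponents//.
  rewrite -lee_fin EFinM -!prodEFin; apply: le_trans (lee_wpmul2l _ (muck_le Wv n)); last first.
    by apply: prode_ge0 => k _; rewrite lee_fin powR_ge0.
  rewrite -big_split/=; apply: lee_prod => k; first by rewrite lee_fin powR_ge0.
  rewrite -poweR_EFin -xE (wmeasE lamQ muQ Wv) poweRM ?(ltW Q0)//; first by rewrite qE poweR_EFin.
  exact: ltW (avg_muck_gt0 lamQ muQ Wv k n).
have yg0 : (0 < \prod_k (y k `^ g k))%R by apply: prodr_gt0 => k _; exact: powR_gt0.
have ratio : (\prod_k ((x k / y k) `^ g k) <= W0 * delta0 `^ (- G))%R.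
  have -> : (\prod_k ((x k / y k) `^ g k) = \prod_k (x k `^ g k) / \prod_k (y k `^ g k))%R.
    rewrite -prodf_div; apply: eq_bigr => k _; rewrite powRM ?invr_ge0 ?(ltW (xp k))//.
    congr (_ * _)%R; apply: (mulIf (x := (y k `^ g k)%R)); first by rewrite gt_eqF// powR_gt0.
    by rewrite mulVf ?gt_eqF ?powR_gt0// -powRM ?invr_ge0// mulVf ?gt_eqF// powR1.
  rewrite ler_pdivrMr//; apply: (le_trans xg); rewrite mulrC -mulrA; apply: ler_wpM2l; first exact: ltW.
  rewrite powRN mulrC ler_pdivlMr ?powR_gt0//; apply: le_trans eyg.
  rewrite -powRM ?(ltW q0) ?(ltW d0)//; apply: ge0_ler_powR; rewrite ?nnegrE ?(ltW G0) ?(ltW e0)//.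
    by rewrite mulr_ge0// ltW.
  by rewrite mulrC.
under eq_bigr do rewrite xE poweR_EFin.
under [X in _ <= _ * X]eq_bigr do rewrite yE poweR_EFin.
rewrite !prodEFin -EFinM lee_fin.
have xb : (\prod_k (x k `^ b k) = \prod_k ((x k / y k) `^ b k) * \prod_k (y k `^ b k))%R.
  rewrite -big_split/=; apply: eq_bigr => k _.
  by rewrite -powRM ?divr_ge0 ?(ltW (xp k))// divfK// gt_eqF.
have yxk k : (y k <= x k)%R by rewrite -lee_fin -xE -yE.
have ge1 k : (1 <= (x k / y k) `^ g k)%R.
  have h1 : (1 <= x k / y k)%R by rewrite ler_pdivlMr// mul1r.
  have := ge0_ler_powR (ltW (g0 k)) ler01 (le_trans ler01 h1) h1.
  by rewrite powR1.
rewrite xb; apply: ler_wpM2r; first by apply: prodr_ge0 => k _; exact: powR_ge0.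
apply: (@le_trans _ _ ((\prod_k ((x k / y k) `^ g k)) `^ M)%R); last first.
  apply: ge0_ler_powR => //; rewrite ?nnegrE ?mulr_ge0 ?powR_ge0 ?(ltW W0p)//.
  - have [k _] : exists k, (0 < g k)%R.
      apply: contrapT => h; move: G0; rewrite /G big1 ?ltxx// => k _.
      by case: h; exists k.
    by apply: le_trans (bM k); rewrite divr_ge0// ltW.
  - by apply: prodr_ge0 => k _; exact: powR_ge0.
rewrite -lee_fin -[leRHS]poweR_EFin -!prodEFin prode_poweR => [|k]; last by rewrite lee_fin powR_ge0.
apply: lee_prod => k; first by rewrite lee_fin powR_ge0.
rewrite poweR_EFin lee_fin -{1}[b k](divfK (lt0r_neq0 (g0 k))) [(_ * g k)%R]mulrC powRrM.
exact: (ler_powR (ge1 k) (bM k)).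
Qed.

End one_weight.

Variables (r b : K -> R) (delta0 M eta : R).
Hypothesis r0 : forall k, (0 < r k)%R.
Hypothesis b0 : forall k, (0 < b k)%R.
Hypothesis rgb : forall k, ((r k)^-1 = g k + b k)%R.
Hypothesis sb : (\sum_k b k = eta + 1)%R.
Hypothesis eta0 : (0 <= eta)%R.
Hypothesis bM : forall k, (b k / g k <= M)%R.
Hypothesis d0 : (0 < delta0)%R.

(** One factor W0 comes from the averages of the v_k to the powers g_k, and W0^M from the passage to
    the disjoint sets E_B. On E_B the remaining averages lie below the maximal functions, and
    Hoelder's inequality separates the indices k. *)
Lemma sparse_form_sharp : exists2 C : R, (0 < C)%R &
  forall W0 v (Wv : muckenhoupt mu Q g W0 v) (S : set (set X)), S `<=` range Q ->
  sparse mu delta0 S -> forall f : K -> X -> R, (forall k, measurable_fun setT (f k)) ->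
  \esum_(B in S) (mu B `^ (eta + 1) * \prod_k average mu (r k)%:E B (f k)) <=
  (C * W0 `^ (1 + M))%:E *
    \prod_k (\int[wmeas Wv k]_x (wfun v r k (f k) x `^ (b k * r k)^-1)) `^ b k.
Proof.
(* Greater than 1, since 1 / r_k = g_k + b_k with g_k > 0; so the maximal operator of v_k mu is
   bounded in this exponent. *)
pose P k := ((b k * r k)^-1)%R.
have br0 k : (0 < b k * r k)%R by rewrite mulr_gt0.
have P1 k : (1 < P k)%R.
  rewrite /P invf_gt1//; have := mulVf (lt0r_neq0 (r0 k)); rewrite rgb mulrDl => <-.
  by rewrite ltrDr mulr_gt0.
pose cM k := (N%:R * (P k / (P k - 1)) `^ P k)%R.
have N0 : (0 < N)%N by have [i] := lab 0; case: N i.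
have cM0 k : (0 < cM k)%R.
  by rewrite mulr_gt0 ?ltr0n// powR_gt0// divr_gt0// ?subr_gt0// (lt_trans ltr01).
exists ((delta0 `^ (- G)) `^ M * \prod_k (cM k `^ b k))%R.
  by rewrite mulr_gt0 ?powR_gt0 ?prodr_gt0// => k _; rewrite powR_gt0.
move=> W0 v Wv S SQ [E [tE hE]] f mf.
have W0p := muckenhoupt_const_gt0 lamQ muQ Wv.
apply: esum_le => s us sS.
have nwf k : nnm (wfun v r k (f k)) by exact: (nnm_wfun Wv).
pose F k := maximal Q (wmeas Wv k) (wfun v r k (f k)).
have mF k : nnm (F k) by exact: (nnm_maximal lamQ).
pose H k x := F k x `^ P k.
have mH k : nnm (H k) by apply: nnm_pow; exact: (mF k).1.
pose E' B := if B \in s then E B else set0.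
have mE' B : measurable (E' B).
  by rewrite /E'; case: ifP => // /sS/hE[].
pose xx k B := \int[wmeas Wv k]_x (H k x * (\1_(E' B) x)%:E).
have xx0 k B : 0 <= xx k B by apply: int_ge0; exact: nnm_setf.
pose C1 := (W0 `^ (1 + M) * (delta0 `^ (- G)) `^ M)%R.
have C10 : (0 <= C1)%R by rewrite mulr_ge0 ?powR_ge0.
apply: (@le_trans _ _ (\sum_(B <- s) C1%:E * \prod_k (xx k B `^ b k))).
  rewrite [leLHS]big_seq [leRHS]big_seq; apply: lee_sum => B Bs.
  have [mE EB dE] := hE B (sS B Bs).
  have E'B : E' B = E B by rewrite /E' Bs.
  have [n _ nB] := SQ B (sS B Bs); rewrite -nB in dE.
  have EB' : E B `<=` Q n by rewrite nB.
  suff : mu (Q n) `^ (eta + 1) * \prod_k average mu (r k)%:E (Q n) (f k) <=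
      C1%:E * \prod_k (xx k B `^ b k) by rewrite nB.
  have {}dE : delta0%:E * mu (Q n) <= mu (E B) by rewrite -nB.
  have [Q0 Qy] := muQ n.
  have a0 k : 0 <= avg mu (EFin \o v k) (Q n) by apply: avg_ge0; exact: muck_nnm Wv k.
  have A0 k : 0 <= avg (wmeas Wv k) (wfun v r k (f k)) (Q n) by exact: avg_ge0.
  under eq_bigr do rewrite (averageE lamQ muQ g0 Wv)//.
  (* As 1 / r_k = g_k + b_k, the powers g_k of the averages of v_k go to the Muckenhoupt constant.
     Their powers b_k combine with mu(Q n)^(eta + 1), which is the product of the mu(Q n)^(b_k),
     into powers of v_k mu(Q n). *)
  have step k : (avg mu (EFin \o v k) (Q n) * avg (wmeas Wv k) (wfun v r k (f k)) (Q n)) `^ (r k)^-1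
     = avg mu (EFin \o v k) (Q n) `^ g k *
       ((avg mu (EFin \o v k) (Q n) `^ b k) *
       (avg (wmeas Wv k) (wfun v r k (f k)) (Q n) `^ P k) `^ b k).
    rewrite poweRM// -poweRrM {1}rgb poweRD; last first.
      by apply: nneg_neq0_poweRD_def; rewrite ?ltW// gt_eqF// (avg_muck_gt0 lamQ muQ Wv).
    rewrite -muleA; congr (_ * (_ * (_ `^ _))).
    by rewrite /P invfM mulrC mulrA divff ?mul1r// gt_eqF.
  under eq_bigr do rewrite step.
  rewrite !big_split/=.
  have -> : mu (Q n) `^ (eta + 1) = \prod_k (mu (Q n) `^ b k).
    have Qf : mu (Q n) \is a fin_num by rewrite ge0_fin_numE// ltW.
    under eq_bigr do rewrite -(fineK Qf) poweR_EFin.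
    by rewrite prodEFin -{1}(fineK Qf) poweR_EFin -sb powR_sum_exponents// fine_gt0// Q0.
  have swap (x y z t : \bar R) : x * (y * (z * t)) = y * ((x * z) * t).
    by rewrite muleCA !muleA.
  rewrite swap -[X in _ * (X * _)]big_split/=.
  have -> : \prod_i (mu (Q n) `^ b i * avg mu (EFin \o v i) (Q n) `^ b i) =
      \prod_k (wmeas Wv k (Q n) `^ b k).
    by apply: eq_bigr => k _; rewrite (wmeasE lamQ muQ Wv) (poweRM _ (ltW Q0) (a0 k)).
  have pr0 (h : K -> \bar R) : 0 <= \prod_k (h k `^ b k).
    by apply: prode_ge0 => k _; exact: poweR_ge0.
  apply: (@le_trans _ _ (W0%:E * ((((W0 * delta0 `^ (- G)) `^ M)%:E * \prod_k (wmeas Wv k (E B) `^ b k)) * \prod_k (avg (wmeas Wv k) (wfun v r k (f k)) (Q n) `^ P k) `^ b k))).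
    apply: lee_pmul.
    - by apply: prode_ge0 => k _; exact: poweR_ge0.
    - by apply: mule_ge0.
    - exact: muck_le.
    apply: lee_wpmul2r => //.
    apply: prod_wmeas_le => //.
    by move=> k; exact: ltW.
  rewrite -!muleA -big_split/= muleA -EFinM.
  have -> : (W0 * (W0 * delta0 `^ (- G)) `^ M = C1)%R.
    rewrite /C1 powRD ?(gt_eqF W0p) ?implybT// powRr1 ?(ltW W0p)// powRM ?powR_ge0 ?(ltW W0p)//.
    by rewrite mulrA.
  apply: lee_wpmul2l; first by rewrite lee_fin.
  apply: lee_prod => k; first by rewrite mule_ge0 ?poweR_ge0.
  rewrite -poweRM ?poweR_ge0//; apply: lee_poweR; first exact: ltW.
    by rewrite mule_ge0 ?poweR_ge0.
  have -> : wmeas Wv k (E B) = \int[wmeas Wv k]_x (\1_(E B) x)%:E.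
    by rewrite integral_indic// setIT.
  rewrite /xx E'B muleC -int_scale ?poweR_ge0//; last exact: nnm_indic.
  apply: le_int.
  - by apply: nnm_mul; [apply: nnm_cst; exact: poweR_ge0|exact: nnm_indic].
  - exact: nnm_setf.
  move=> x; rewrite indicE; case: (boolP (x \in E B)) => [/set_mem Ex|_]; last by rewrite !mule0.
  rewrite !mule1; apply: lee_poweR => //; first by rewrite ltW// (lt_trans ltr01).
  by apply: avg_le_maximal; exact: EB'.
rewrite -ge0_sume_distrr => [|B _]; last first.
  by apply: prode_ge0 => k _; exact: poweR_ge0.
have -> : ((delta0 `^ (- G)) `^ M * \prod_k (cM k `^ b k) * W0 `^ (1 + M) =
    C1 * \prod_k (cM k `^ b k))%R by rewrite /C1; ring.
rewrite (EFinM C1) -muleA; apply: lee_wpmul2l; first by rewrite lee_fin.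
rewrite -prodEFin -big_split/=.
have sb1 : (1 <= \sum_k b k)%R by rewrite sb lerDr.
apply: (le_trans (hoelder_sum_ge1 (fun k => ltW (b0 k)) sb1 _ _)) => //.
apply: lee_prod => k; first exact: poweR_ge0.
have i0 : 0 <= \int[wmeas Wv k]_x (wfun v r k (f k) x `^ (b k * r k)^-1).
  by apply: int_ge0; apply: nnm_pow; exact: (nwf k).1.
rewrite -(poweR_EFin (cM k)) -poweRM ?lee_fin ?(ltW (cM0 k))//.
apply: lee_poweR; [exact: ltW|by apply: sume_ge0|].
apply: (@le_trans _ _ (\int[wmeas Wv k]_x H k x)).
  apply: sum_int_disjoint => // x A B As Bs; rewrite /E' As Bs => EA EB.
  by apply: (tE A B (sS A As) (sS B Bs)); exists x.
apply: (maximal_strong lamQ) => //; exact: (wmeas_finite_pos lamQ).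
Qed.

End sharp.

Lemma hoelder_sum2 (R : realType) (J : Type) (s : seq J) (x y : J -> \bar R) (a b : R) :
  (0 <= a)%R -> (0 <= b)%R -> (a + b = 1)%R -> (forall j, 0 <= x j) -> (forall j, 0 <= y j) ->
  \sum_(j <- s) (x j `^ a * y j `^ b) <= (\sum_(j <- s) x j) `^ a * (\sum_(j <- s) y j) `^ b.
Proof.
move=> a0 b0 ab x0 y0.
have := @hoelder_sum R bool (fun i : bool => if i then a else b) _ _ J s
  (fun i : bool => if i then x else y).
rewrite !big_bool /=; under eq_bigr do rewrite big_bool.
by apply => // -[].
Qed.

Lemma powR_expR (R : realType) (a b : R) : (expR a `^ b = expR (b * a))%R.
Proof. by rewrite /powR gt_eqF ?expR_gt0// expRK. Qed.

Lemma powRD_gt0 (R : realType) (x a b : R) : (0 < x)%R -> (x `^ (a + b) = x `^ a * x `^ b)%R.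
Proof. by move=> x0; rewrite powRD//; apply/implyP => _; rewrite gt_eqF. Qed.

(** * Extrapolation and vector-valued estimates *)

Section extrapolation.
Context {R : realType} {d : measure_display} {X : measurableType d}.
Variables (N : nat) (Q : nat -> set X) (lab : nat -> 'I_N).
Hypothesis lamQ : laminar Q lab.

Let mQ n : measurable (Q n). Proof. exact: laminar_measurable lamQ n. Qed.

Lemma maximal_ae_eq (nu : {measure set X -> \bar R}) (f h : X -> \bar R) x :
  nnm f -> nnm h -> (\forall y \ae nu, f y = h y) -> maximal Q nu f x = maximal Q nu h x.
Proof.
move=> mf mh fh.
have e n : avg nu f (Q n) = avg nu h (Q n).
  by apply/eqP; rewrite eq_le; apply/andP; split;
    apply: le_avg_ae => //; apply: filterS fh => y ->.
by rewrite /maximal; under eq_fun do rewrite e.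
Qed.

Variables q tau kappa : R.
Hypothesis q0 : (0 < q)%R.
Hypothesis tau0 : (0 < tau)%R.
Hypothesis qk : (q < kappa)%R.
Hypothesis tk : (tau < kappa)%R.

Let kappa0 : (0 < kappa)%R. Proof. exact: lt_trans qk. Qed.
(** [c] and [dd] are the complementary exponents in Hoelder's inequality, from L^kappa to L^q and
    from l^kappa to l^tau. *)
Let c := (q^-1 - kappa^-1)^-1%R.
Let dd := (tau^-1 - kappa^-1)^-1%R.
Let c0 : (0 < c)%R. Proof. by rewrite invr_gt0 subr_gt0 ltf_pV2. Qed.
Let dd0 : (0 < dd)%R. Proof. by rewrite invr_gt0 subr_gt0 ltf_pV2. Qed.
Let cE : (c * (1 - q / kappa) = q)%R.
Proof.
have h : (q^-1 - kappa^-1 != 0)%R by rewrite -invr_eq0 gt_eqF.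
have -> : (1 - q / kappa = q * (q^-1 - kappa^-1))%R by field; rewrite !gt_eqF.
by rewrite mulrC /c mulfK.
Qed.
Let ddE : ((1 - tau / kappa) * dd = tau)%R.
Proof.
have h : (tau^-1 - kappa^-1 != 0)%R by rewrite -invr_eq0 gt_eqF.
have -> : (1 - tau / kappa = tau * (tau^-1 - kappa^-1))%R by field; rewrite !gt_eqF.
by rewrite /dd mulfK.
Qed.
(** Makes c al and dd al larger than 2, so that the Fefferman-Stein inequality holds in L^(c al)
    with values in l^(dd al). *)
Let al := (2 / c + 2 / dd)%R.
Let al0 : (0 < al)%R. Proof. by rewrite addr_gt0// divr_gt0. Qed.

(** Used with u = u_j and w = sum of the u_j^tau. It solves two requirements: (u_j damp^(-al))^kappa
    summed over j is w^(q / tau), and the mixed norm of damp with exponents c al and dd al reduces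
    to the integral of the same function. *)
Let damp (u w : R) := ((u `^ (1 - tau / kappa) * w `^ ((tau - q) / (kappa * tau))) `^ al^-1)%R.

Let damp_gt0 u w : (0 < u)%R -> (0 < w)%R -> (0 < damp u w)%R.
Proof. by move=> u0 w0; rewrite /damp powR_gt0// mulr_gt0 ?powR_gt0. Qed.

Let damp_mixed u w : (0 < u)%R -> (0 < w)%R ->
  (damp u w `^ (dd * al) = u `^ tau * w `^ ((tau - q) / (kappa * tau) * dd))%R.
Proof.
move=> u0 w0; rewrite -(lnK (u0 : u \is Num.pos)) -(lnK (w0 : w \is Num.pos)) /damp.
rewrite !powR_expR -!expRD !powR_expR; congr expR.
transitivity ((1 - tau / kappa) * dd * ln u + (tau - q) / (kappa * tau) * dd * ln w)%R.
  have := al0; move: al => a a0.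
  by field; rewrite !gt_eqF.
by rewrite ddE; ring.
Qed.

Let damp_power u w : (0 < u)%R -> (0 < w)%R ->
  ((u * damp u w `^ (- al)) `^ kappa = u `^ tau * w `^ (- ((tau - q) / tau)))%R.
Proof.
move=> u0 w0; rewrite -(lnK (u0 : u \is Num.pos)) -(lnK (w0 : w \is Num.pos)) /damp.
rewrite !powR_expR -!expRD !powR_expR -!expRD !powR_expR; congr expR.
have := al0; move: al => a a0.
by field; rewrite !gt_eqF.
Qed.

(** Write th_j = (th_j A_j^(-al)) A_j^al. Hoelder's inequality in l^tau and then in L^q leaves the
    assumed estimates at kappa and a mixed norm of the A_j. With A_j the Rubio de Francia majorant
    of the damping of ch_j, both are bounded by the integral of the same function of the ch_j. *)
Lemma extrapolate : exists al CA : R, [/\ (0 < al)%R, (0 < CA)%R &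
  forall C1 : R, (0 < C1)%R -> exists2 C : R, (0 < C)%R &
  forall (nu : {measure set X -> \bar R}) J e, finite_pos Q nu -> integrable_pos nu e ->
  forall th ch : nat -> X -> \bar R, (forall j, nnm (th j)) -> (forall j, nnm (ch j)) ->
  (forall j (A : X -> R), (j < J)%N -> measurable_fun setT A -> (forall x, 0 < A x)%R ->
    (\forall x \ae nu, maximal Q nu (EFin \o A) x <= CA%:E * (A x)%:E) ->
    \int[nu]_x ((th j x * (A x `^ (- al))%:E) `^ kappa) <=
    C1%:E * \int[nu]_x ((ch j x * (A x `^ (- al))%:E) `^ kappa)) ->
  mixed nu J q tau th <= C%:E * mixed nu J q tau ch].
Proof.
have P1 : (1 < c * al)%R.
  rewrite /al mulrDr mulrCA divff ?gt_eqF// mulr1; apply: (@lt_trans _ _ 2%R); first by rewrite ltr1n.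
  by rewrite ltrDl mulr_gt0// divr_gt0.
have T1 : (1 < dd * al)%R.
  rewrite /al mulrDr [X in (_ + X)%R]mulrCA divff ?gt_eqF// mulr1.
  apply: (@lt_trans _ _ 2%R); first by rewrite ltr1n.
  by rewrite ltrDr mulr_gt0// divr_gt0.
have P0 : (0 < c * al)%R by apply: lt_trans P1.
have T0 : (0 < dd * al)%R by apply: lt_trans T1.
have [B B0 hB] := fefferman_stein lamQ P1 T1.
have [CA CA0 hCA] := rubio_de_francia lamQ P0 T0 B0.
exists al, CA; split => // C1 C10.
pose C3 := (2 `^ q * 2 `^ (q / tau))%R.
have C30 : (0 < C3)%R by rewrite mulr_gt0 ?powR_gt0.
exists (C1 `^ (q / kappa) * CA `^ (q / c) * C3)%R.
  by rewrite !mulr_gt0 ?powR_gt0.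
move=> nu J e nuQ he th ch mth mch hyp.
have [me e0 ie] := he.
(* For an empty family the left-hand side is 0; otherwise the sum [Xf] below has a term and is
   positive. *)
case: J hyp => [|J0] hyp.
  rewrite {1}/mixed; under eq_integral do rewrite big_ord0 poweR0r ?gt_eqF ?divr_gt0//.
  rewrite integral0 mule_ge0 ?lee_fin//; first by posR.
  by apply: int_ge0; exact: nnm_mixed.
set J := J0.+1 in hyp *.
set I0 := mixed nu J q tau ch.
have [I0y|I0y] := eqVneq I0 +oo.
  by rewrite I0y gt0_muley ?leey// lte_fin !mulr_gt0 ?powR_gt0.
have I00 : 0 <= I0 by apply: int_ge0; exact: nnm_mixed.
have I0lt : I0 < +oo by rewrite lt_neqAle I0y leey.
have I0f : I0 \is a fin_num by rewrite ge0_fin_numE.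
have qt0 : (0 < q / tau)%R by rewrite divr_gt0.
have mchT j : nnm (fun x => ch j x `^ tau) by apply: nnm_pow; exact: (mch j).1.
have chfin : \forall x \ae nu, forall j, (j < J)%N -> ch j x < +oo.
  have := ae_lty_int (nnm_mixed J q tau mch) I0lt.
  apply: filterS => x h j jJ.
  rewrite ltey; apply/eqP => chy; move: h; rewrite (bigD1 (Ordinal jJ))//= chy.
  rewrite poweRyr ?gt_eqF// addye; last first.
    by rewrite -ltNye (lt_le_trans ltNy0)// sume_ge0// => i _; exact: poweR_ge0.
  by rewrite poweRyr ?gt_eqF// ltxx.
suff main eps : (0 < eps)%R ->
    mixed nu J q tau th <= (C1 `^ (q / kappa) * CA `^ (q / c) * C3)%:E * (I0 + eps%:E).
  set CC := (C1 `^ (q / kappa) * CA `^ (q / c) * C3)%R in main *.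
  have CC0 : (0 < CC)%R by rewrite !mulr_gt0 ?powR_gt0.
  apply/lee_addgt0Pr => eps eps0.
  have := main (eps / CC)%R; rewrite divr_gt0// => /(_ isT) /le_trans; apply.
  rewrite ge0_muleDr ?lee_fin ?divr_ge0 ?(ltW eps0) ?(ltW CC0)//.
  by rewrite -(EFinM CC) [(CC * _)%R]mulrC divfK ?gt_eqF.
move=> eps0.
(* Each ch_j is perturbed by lam e^(1/q), which makes all functions positive. With this lam the J
   perturbations add at most eps to the integral, before the factor C3. *)
pose lam := ((eps / J%:R `^ (q / tau)) `^ q^-1)%R.
have Jp : (0 < J%:R `^ (q / tau) :> R)%R by rewrite powR_gt0// ltr0n.
have lam0 : (0 < lam)%R by rewrite powR_gt0// divr_gt0.
pose xt j x := (fine (ch j x) + lam * e x `^ q^-1)%R.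
have f0 j x : (0 <= fine (ch j x))%R by apply: fine_ge0; exact: (mch j).2.
have le0 x : (0 < lam * e x `^ q^-1)%R by exact: mulr_gt0 lam0 (powR_gt0 _ (e0 x)).
have xt0 j x : (0 < xt j x)%R by rewrite ltr_wpDl.
have mxt j : measurable_fun setT (xt j).
  apply: measurable_funD.
    by apply: (measurableT_comp _ (mch j).1); exact: fine_measurable.
  apply: measurable_funM => //.
  exact: (measurableT_comp (measurable_powR _) me).
pose Xf x := (\sum_(j < J) xt j x `^ tau)%R.
have Xf0 x : (0 < Xf x)%R.
  by rewrite /Xf big_ord_recl ltr_pwDl ?powR_gt0// sumr_ge0// => j _; exact: powR_ge0.
have mXf : measurable_fun setT Xf.
  apply: measurable_sum => j.
  exact: (measurableT_comp (measurable_powR _) (mxt j)).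
pose Xq x := (Xf x `^ (q / tau))%:E.
have mXq : nnm Xq.
  apply: nnm_EFin => [|x]; last exact: powR_ge0.
  exact: (measurableT_comp (measurable_powR _) mXf).
set IX := \int[nu]_x Xq x.
have IXle : IX <= C3%:E * (I0 + eps%:E).
  apply: (@le_trans _ _ (\int[nu]_x (C3%:E * ((\sum_(j < J) ch j x `^ tau) `^ (q / tau) + eps%:E * (e x)%:E)))).
    have mm : nnm (fun x => (\sum_(j < J) ch j x `^ tau) `^ (q / tau) + eps%:E * (e x)%:E).
      apply: nnm_add; first exact: nnm_mixed.
      apply: nnm_mul; first by apply: nnm_cst; rewrite lee_fin ltW.
      by apply: nnm_EFin => // x; exact: ltW.
    apply: le_int_ae => //.
      by apply: nnm_mul => //; apply: nnm_cst; rewrite lee_fin ltW.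
    apply: filterS chfin => x hx; rewrite /Xq /Xf.
    pose S := (\sum_(j < J) fine (ch j x) `^ tau)%R.
    have -> : \sum_(j < J) ch j x `^ tau = S%:E.
      rewrite /S -sumEFin; apply: eq_bigr => j _.
      by rewrite -poweR_EFin fineK// ge0_fin_numE ?hx//; exact: (mch j).2.
    have S0 : (0 <= S)%R by apply: sumr_ge0 => j _; exact: powR_ge0.
    set v := (lam * e x `^ q^-1)%R.
    have h1 : (\sum_(j < J) xt j x `^ tau <= 2 `^ tau * (S + J%:R * v `^ tau))%R.
      have -> : (J%:R * v `^ tau = \sum_(j < J) v `^ tau)%R.
        by rewrite sumr_const card_ord mulr_natl.
      rewrite /S -big_split/= mulr_sumr; apply: ler_sum => j _.
      rewrite -lee_fin EFinM EFinD -!poweR_EFin /xt EFinD poweR_EFin.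
      by apply: poweRD_le; rewrite ?lee_fin ?(ltW tau0)// ltW.
    have h2 : (Xf x `^ (q / tau) <= (2 `^ tau * (S + J%:R * v `^ tau)) `^ (q / tau))%R.
      by apply: ge0_ler_powR => //; rewrite ?nnegrE ?(ltW qt0) ?(ltW (Xf0 x))//; apply: le_trans h1; exact: ltW (Xf0 x).
    apply: (@le_trans _ _ ((2 `^ tau * (S + J%:R * v `^ tau)) `^ (q / tau))%:E); first by rewrite lee_fin.
    have Jv0 : (0 <= J%:R * v `^ tau)%R by rewrite mulr_ge0 ?powR_ge0.
    have tq : (tau * (q / tau) = q)%R by field; rewrite gt_eqF.
    rewrite powRM ?powR_ge0 ?addr_ge0// -powRrM tq.
    rewrite /C3 !EFinM -!muleA; apply: lee_wpmul2l; first by rewrite lee_fin powR_ge0.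
    rewrite -poweR_EFin EFinD; apply: (le_trans (poweRD_le (ltW qt0) _ _)); rewrite ?lee_fin//.
    apply: ler_wpM2l; first exact: powR_ge0.
    rewrite lerD2l powRM ?powR_ge0//.
    rewrite -powRrM tq.
    rewrite /v powRM ?powR_ge0 ?(ltW lam0)// /lam -!powRrM mulVf ?gt_eqF//.
    rewrite !powRr1 ?(ltW (e0 x)) ?divr_ge0 ?(ltW eps0) ?(ltW Jp)//.
    by rewrite mulrA mulrCA divff ?gt_eqF// mulr1.
  have mE : nnm (fun x => (e x)%:E) by apply: nnm_EFin => // x; exact: ltW.
  have mE' : nnm (fun x => eps%:E * (e x)%:E).
    by apply: nnm_mul => //; apply: nnm_cst; rewrite lee_fin ltW.
  rewrite int_scale ?lee_fin ?(ltW C30)//; last first.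
    by apply: nnm_add => //; exact: nnm_mixed.
  apply: lee_wpmul2l; first by rewrite lee_fin ltW.
  rewrite int_add//; last exact: nnm_mixed.
  rewrite leeD2l// int_scale ?lee_fin ?(ltW eps0)//.
  by rewrite -[leRHS]mule1; apply: lee_wpmul2l => //; rewrite lee_fin ltW.

have IX0 : 0 <= IX by exact: int_ge0.
have IXy : IX < +oo.
  apply: le_lt_trans IXle _; rewrite -(fineK I0f) -EFinD -EFinM; exact: ltry.
pose Dd j x := damp (xt j x) (Xf x).
have Dd0 j x : (0 < Dd j x)%R by exact: damp_gt0.
have mDd j : nnm (EFin \o Dd j).
  apply: nnm_EFin => [|x]; last exact: ltW.
  apply: (measurableT_comp (measurable_powR _)); apply: measurable_funM.
    exact: (measurableT_comp (measurable_powR _) (mxt j)).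
  exact: (measurableT_comp (measurable_powR _) mXf).
have [A [mA DA MA hA]] := hCA nu J nuQ (hB nu J e nuQ he) (fun j => EFin \o Dd j) mDd.
have mixD : mixed nu J (c * al) (dd * al) (fun j => EFin \o Dd j) = IX.
  apply: eq_integral => x _; rewrite /Xq.
  have -> : \sum_(j < J) (EFin \o Dd j) x `^ (dd * al) =
      (Xf x `^ (1 + (tau - q) / (kappa * tau) * dd))%:E.
    rewrite powRD_gt0//.
    rewrite powRr1 ?(ltW (Xf0 x))// {1}/Xf mulr_suml -sumEFin.
    by apply: eq_bigr => j _; rewrite -(damp_mixed (xt0 j x) (Xf0 x)).
  rewrite poweR_EFin -powRrM; congr (_ `^ _)%:E.
  have := ddE; have := cE; move: al0 c0 dd0; move: al c dd => a c' d' a0 c'0 d'0 hc hd.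
  have kt : (kappa - tau != 0)%R by rewrite subr_eq0 gt_eqF.
  have kq : (kappa - q != 0)%R by rewrite subr_eq0 gt_eqF.
  have -> : d' = (tau * kappa / (kappa - tau))%R.
    by apply: (mulIf kt); rewrite divfK// -{2}hd; field; rewrite gt_eqF.
  have -> : c' = (q * kappa / (kappa - q))%R.
    by apply: (mulIf kq); rewrite divfK// -{2}hc; field; rewrite gt_eqF.
  by field; rewrite kt kq !gt_eqF.
rewrite mixD in hA.
have mAT : nnm (fun x => (\sum_(j < J) A j x `^ (dd * al)) `^ (c * al / (dd * al))).
  exact: nnm_mixed.
have Afin : \forall x \ae nu, forall j, (j < J)%N -> A j x < +oo.
  have : mixed nu J (c * al) (dd * al) A < +oo.
    by apply: le_lt_trans hA _; apply: lte_mul_pinfty; rewrite ?lee_fin ?(ltW CA0).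
  move=> /(ae_lty_int mAT); apply: filterS => x h j jJ.
  rewrite ltey; apply/eqP => chy; move: h; rewrite (bigD1 (Ordinal jJ))//= chy.
  rewrite poweRyr ?gt_eqF// addye; last first.
    by rewrite -ltNye (lt_le_trans ltNy0)// sume_ge0// => i _; exact: poweR_ge0.
  by rewrite poweRyr ?gt_eqF ?divr_gt0// ltxx.
(* A is finite only almost everywhere; the value 1 on the exceptional set makes A' real and
   positive. *)
pose A' j x := if A j x == +oo then 1%R else fine (A j x).
have A'0 j x : (0 < A' j x)%R.
  rewrite /A'; case: eqVneq => // Ay; apply: fine_gt0; rewrite ltey Ay andbT.
  by apply: lt_le_trans (DA j x); rewrite lte_fin.
have mA' j : measurable_fun setT (A' j).
  apply: measurable_fun_ifT.
  - by apply: (measurable_fun_eqe (mA j).1); exact: measurable_cst.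
  - exact: measurable_cst.
  - by apply: (measurableT_comp _ (mA j).1); exact: fine_measurable.
have nA' j : nnm (EFin \o A' j) by apply: nnm_EFin => // x; exact: ltW.
have A'E j x : A j x < +oo -> (A' j x)%:E = A j x.
  move=> h; rewrite /A' lt_eqF// fineK// ge0_fin_numE//; exact: (mA j).2.
have A'ae j : (j < J)%N -> \forall x \ae nu, (EFin \o A' j) x = A j x.
  by move=> jJ; apply: filterS Afin => x h /=; apply: A'E; exact: h.
have bound j : (j < J)%N -> \int[nu]_x ((th j x * (A' j x `^ (- al))%:E) `^ kappa) <=
    C1%:E * \int[nu]_x (xt j x `^ tau * Xf x `^ (- ((tau - q) / tau)))%:E.
  move=> jJ; apply: (le_trans (hyp j (A' j) jJ (mA' j) (A'0 j) _)).
    apply: filterS (A'ae j jJ) => x h.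
    by rewrite (maximal_ae_eq x (nA' j) (mA j) (A'ae j jJ)) -[(A' j x)%:E]/((EFin \o A' j) x) h.
  apply: lee_wpmul2l; first by rewrite lee_fin ltW.
  apply: le_int_ae.
  - apply: nnm_pow; apply: emeasurable_funM; first exact: (mch j).1.
    apply/measurable_EFinP; exact: (measurableT_comp (measurable_powR _) (mA' j)).
  - apply: nnm_EFin => [|x]; last by rewrite mulr_ge0 ?powR_ge0.
    apply: measurable_funM.
      exact: (measurableT_comp (measurable_powR _) (mxt j)).
    exact: (measurableT_comp (measurable_powR _) mXf).
  apply: filterS2 chfin Afin => x hx hAx.
  have chE : ch j x = (fine (ch j x))%:E by rewrite fineK// ge0_fin_numE ?hx//; exact: (mch j).2.
  rewrite -(damp_power (xt0 j x) (Xf0 x)) chE -(EFinM (fine _)) poweR_EFin lee_fin.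
  apply: ge0_ler_powR; rewrite ?nnegrE ?(ltW kappa0) ?mulr_ge0 ?powR_ge0 ?(ltW (xt0 j x))//.
  apply: ler_pM; rewrite ?powR_ge0//.
    by rewrite /xt lerDl ltW.
  have dp := Dd0 j x; rewrite /Dd in dp.
  rewrite !powRN lef_pV2 ?posrE ?(powR_gt0 _ dp) ?(powR_gt0 _ (A'0 j x))//.
  apply: ge0_ler_powR; rewrite ?nnegrE ?(ltW al0) ?(ltW (A'0 j x)) ?(ltW (damp_gt0 _ _))//.
  by rewrite -lee_fin A'E ?hAx//; exact: DA.
pose aa j x := (th j x * (A' j x `^ (- al))%:E) `^ kappa.
have maa j : nnm (aa j).
  apply: nnm_pow; apply: emeasurable_funM; first exact: (mth j).1.
  apply/measurable_EFinP; exact: (measurableT_comp (measurable_powR _) (mA' j)).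
pose bb j x := (A' j x `^ (dd * al))%:E.
have mbb j : nnm (bb j).
  apply: nnm_EFin => [|x]; last exact: powR_ge0.
  exact: (measurableT_comp (measurable_powR _) (mA' j)).
have saa : nnm (fun x => \sum_(j < J) aa j x) by apply: nnm_sum => j; exact: maa.
have sbb : nnm (fun x => \sum_(j < J) bb j x) by apply: nnm_sum => j; exact: mbb.
have sa : \int[nu]_x (\sum_(j < J) aa j x) <= C1%:E * IX.
  rewrite int_sum => [|j]; last exact: maa.
  apply: (le_trans (lee_sum _ (fun (j : 'I_J) _ => bound j (ltn_ord j)))).
  have mt (j : 'I_J) : nnm (fun x => (xt j x `^ tau * Xf x `^ (- ((tau - q) / tau)))%:E).
    apply: nnm_EFin => [|x]; last by rewrite mulr_ge0 ?powR_ge0.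
    apply: measurable_funM.
      exact: (measurableT_comp (measurable_powR _) (mxt j)).
    exact: (measurableT_comp (measurable_powR _) mXf).
  rewrite -ge0_sume_distrr => [|j _]; last exact: int_ge0.
  apply: lee_wpmul2l; first by rewrite lee_fin ltW.
  rewrite -int_sum// le_eqVlt; apply/orP; left; apply/eqP; apply: eq_integral => x _.
  rewrite sumEFin -mulr_suml -/(Xf x) /Xq; congr EFin.
  rewrite -{1}[Xf x]powRr1 ?(ltW (Xf0 x))// -powRD_gt0//.
  by congr (_ `^ _)%R; field; rewrite gt_eqF.
have cal : (c * al / (dd * al) = c / dd)%R.
  move: al0 c0 dd0; move: al c dd => a c' d' a0 c'0 d'0.
  by field; rewrite !gt_eqF.
have sb : \int[nu]_x ((\sum_(j < J) bb j x) `^ (c / dd)) <= CA%:E * IX.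
  apply: le_trans hA; rewrite /mixed cal le_eqVlt; apply/orP; left; apply/eqP.
  apply: eq_int_ae.
  - by apply: nnm_pow; exact: sbb.1.
  - by rewrite -cal.
  apply: filterS Afin => x hx; congr (_ `^ _); apply: eq_bigr => j _.
  by rewrite /bb -poweR_EFin A'E// hx.
have e1 : (tau / kappa + tau / dd = 1)%R by rewrite /dd invrK; field; rewrite !gt_eqF.
have e2 : (q / kappa + q / c = 1)%R by rewrite /c invrK; field; rewrite !gt_eqF.
have x1 : (kappa * (tau / kappa) = tau)%R by field; rewrite gt_eqF.
have x2 : (tau / kappa * (q / tau) = q / kappa)%R by field; rewrite !gt_eqF.
have x3 : (tau / dd * (q / tau) = c / dd * (q / c))%R.
  move: c0 dd0; move: c dd => c' d' c'0 d'0; by field; rewrite !gt_eqF.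
have x4 : (- al * tau + dd * al * (tau / dd) = 0)%R.
  move: c0 dd0; move: al c dd => a c' d' c'0 d'0; by field; rewrite !gt_eqF.
apply: (@le_trans _ _ (\int[nu]_x ((\sum_(j < J) aa j x) `^ (q / kappa) *
    ((\sum_(j < J) bb j x) `^ (c / dd)) `^ (q / c)))).
  apply: le_int => [||x].
  - exact: nnm_mixed.
  - apply: nnm_mul; apply: nnm_pow; first exact: saa.1.
    by apply: (nnm_pow _ sbb.1).1.
  have thE j : th j x `^ tau = aa j x `^ (tau / kappa) * bb j x `^ (tau / dd).
    have t0 : 0 <= th j x by exact: (mth j).2.
    have A0 : 0 <= (A' j x `^ (- al))%:E by rewrite lee_fin powR_ge0.
    rewrite /aa /bb -poweRrM x1 poweRM// -muleA !poweR_EFin -EFinM -!powRrM.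
    by rewrite -powRD_gt0// x4 powRr0 mule1.
  under eq_bigr do rewrite thE.
  have h := @hoelder_sum2 R _ (index_enum 'I_J) (fun j : 'I_J => aa j x) (fun j : 'I_J => bb j x)
    (tau / kappa) (tau / dd).
  have tk0 : (0 <= tau / kappa)%R by rewrite divr_ge0 ?(ltW tau0) ?(ltW kappa0).
  have td0 : (0 <= tau / dd)%R by rewrite divr_ge0 ?(ltW tau0) ?(ltW dd0).
  have {}h := h tk0 td0 e1 (fun j => (maa j).2 x) (fun j => (mbb j).2 x).
  apply: (le_trans (lee_poweR (ltW qt0) _ h)).
    by apply: sume_ge0 => j _; rewrite mule_ge0 ?poweR_ge0.
  by rewrite poweRM ?poweR_ge0// -!poweRrM x2 x3 lexx.
have qk0 : (0 <= q / kappa)%R by rewrite divr_ge0 ?(ltW q0) ?(ltW kappa0).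
have qc0 : (0 <= q / c)%R by rewrite divr_ge0 ?(ltW q0) ?(ltW c0).
have sbc : nnm (fun x => (\sum_(j < J) bb j x) `^ (c / dd)) by apply: nnm_pow; exact: sbb.1.
apply: (le_trans (hoelder_int2 _ qk0 qc0 e2 saa sbc)).
apply: (@le_trans _ _ ((C1%:E * IX) `^ (q / kappa) * (CA%:E * IX) `^ (q / c))).
  by apply: lee_pmul; rewrite ?poweR_ge0//; apply: lee_poweR => //; exact: int_ge0.
rewrite !poweRM ?lee_fin ?(ltW C10) ?(ltW CA0)// muleACA -poweRD; last first.
  by rewrite /poweRD_def e2 oner_eq0.
rewrite e2 poweRe1// !poweR_EFin -EFinM (EFinM _ C3) -muleA.
by apply: lee_wpmul2l => //; rewrite lee_fin mulr_ge0 ?powR_ge0.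
Qed.

End extrapolation.

Lemma prode_option (R : realType) (I : finType) (F : option I -> \bar R) :
  \prod_k F k = F None * \prod_i F (Some i).
Proof.
rewrite (bigD1 None)//=; congr (_ * _).
rewrite (reindex_omap (Some : I -> option I) id) => [|[]//].
by apply: eq_bigl => i /=; rewrite eqxx.
Qed.

(** * Weighted and vector-valued estimates for functions dominated by sparse forms *)

Section transfer.
Context {R : realType} {d : measure_display} {X : measurableType d}.
Variable mu : {measure set X -> \bar R}.
Variables (N : nat) (Q : nat -> set X) (lab : nat -> 'I_N).
Hypothesis lamQ : laminar Q lab.
Hypothesis muQ : finite_pos Q mu.
Context {I : finType}.
Variables (g r : option I -> R) (delta0 eta K0 : R).
Hypothesis g0 : forall k, (0 < g k)%R.
Hypothesis r0 : forall k, (0 < r k)%R.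
Hypothesis d0 : (0 < delta0)%R.
Hypothesis d1 : (delta0 <= 1)%R.
Hypothesis eta0 : (0 <= eta)%R.
Hypothesis K00 : (0 < K0)%R.

Definition multilinear_form (S : set (set X)) (f : I -> X -> R) (psi : X -> R) : \bar R :=
  \esum_(B in S) (mu B `^ (eta + 1) * \prod_i average mu (r (Some i))%:E B (f i) *
    average mu (r None)%:E B psi).

Definition form_dominated (th : X -> \bar R) (f : I -> X -> R) : Prop :=
  forall psi : X -> R, measurable_fun setT psi -> (forall x, 0 <= psi x)%R ->
  \int[mu]_x (th x * (psi x)%:E) <= K0%:E * ereal_sup
    [set multilinear_form S f psi | S in [set S | S `<=` range Q /\ sparse mu delta0 S]].

(** With [r None] = s', this is 1 / s. *)
Let sg := (1 - (r None)^-1)%R.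

Definition form_majorant W0 v (Wv : muckenhoupt mu Q g W0 v) (z : X -> \bar R)
    (f : I -> X -> R) (x : X) : \bar R :=
  zweight mu z eta x * \prod_i wmax Wv r (Some i) (f i) x.

Lemma nnm_form_majorant W0 v (Wv : muckenhoupt mu Q g W0 v) z f : nnm z ->
  (forall i, measurable_fun setT (f i)) -> nnm (form_majorant Wv z f).
Proof.
move=> mz mf; apply: nnm_mul; first exact: nnm_zweight.
by apply: nnm_prod => i; exact: (nnm_wmax lamQ).
Qed.

(** Duality at kappa in the measure v_None mu turns a test function phi into psi = phi v_None^(1/s')
    A^(-al), where s' is [r None]. The form is then dominated by the majorant times a root of the
    maximal function of phi^s', and Hoelder's and Doob's inequalities remove phi. *)
Lemma scalar_weighted (W0 al CA kappa : R) : (0 <= al)%R -> (0 < CA)%R -> (1 < kappa)%R ->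
  (sg < kappa^-1)%R ->
  exists2 C : R, (0 < C)%R &
  forall v (Wv : muckenhoupt mu Q g W0 v) e, integrable_pos (wmeas Wv None) e ->
  forall th f z, nnm th -> (forall i, measurable_fun setT (f i)) -> nnm z ->
  \int[mu]_x z x < +oo -> form_dominated th f ->
  forall A : X -> R, measurable_fun setT A -> (forall x, 0 < A x)%R ->
  (\forall x \ae wmeas Wv None, maximal Q (wmeas Wv None) (EFin \o A) x <= CA%:E * (A x)%:E) ->
  \int[wmeas Wv None]_x ((th x * (v None x `^ (- sg))%:E * (A x `^ (- al))%:E) `^ kappa) <=
  C%:E * \int[wmeas Wv None]_x ((form_majorant Wv z f x * (v None x `^ (- sg))%:E
     * (A x `^ (- al))%:E) `^ kappa).
Proof.
move=> al0 CA0 k1 sk.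
have CA10 : (0 < CA + 1)%R by rewrite addr_gt0.
have [CF CF0 hF] := form_domination lamQ muQ g0 W0 r0 d0 d1 al0 CA10 eta0.
have k0 : (0 < kappa)%R by apply: lt_trans k1.
have rN := r0 None.
pose kb := (1 - kappa^-1)%R.
have kb0 : (0 < kb)%R by rewrite subr_gt0 invf_lt1.
(* This is kappa' / s', larger than 1 exactly because 1 / kappa > 1 / s. *)
pose P := (kb^-1 / r None)%R.
have P1 : (1 < P)%R.
  rewrite /P -invfM invf_gt1 ?mulr_gt0// -ltr_pdivlMr// mul1r.
  by move: sk; rewrite /sg /kb; lra.
have P0 : (0 < P)%R by apply: lt_trans P1.
have N0 : (0 < N)%N by have [i] := lab 0; case: N i.
pose CM := (N%:R * (P / (P - 1)) `^ P)%R.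
have CM0 : (0 < CM)%R.
  by rewrite mulr_gt0 ?ltr0n// powR_gt0// divr_gt0// subr_gt0.
exists ((4 * (K0 * CF * CM `^ kb)) `^ kappa)%R.
  by rewrite powR_gt0// mulr_gt0// !mulr_gt0// powR_gt0.
move=> v Wv e he th f z mth mf mz zy dom A mA A0 hA.
set nu := wmeas Wv None.
have v0 x : (0 < v None x)%R := muck_gt0 Wv None x.
have mv := muck_meas Wv None.
have mpow (a : R) (h : X -> R) : measurable_fun setT h -> measurable_fun setT (fun x => (h x `^ a)%R).
  by move=> mh; exact: (measurableT_comp (measurable_powR _) mh).
have nuQ : finite_pos Q nu := wmeas_finite_pos lamQ muQ g0 Wv None.
pose H := form_majorant Wv z f.
have mH : nnm H by exact: nnm_form_majorant.
have nvs : nnm (fun x => (v None x `^ (- sg))%:E).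
  by apply: nnm_EFin => [|x]; [exact: mpow|exact: powR_ge0].
have nAs : nnm (fun x => (A x `^ (- al))%:E).
  by apply: nnm_EFin => [|x]; [exact: mpow|exact: powR_ge0].
pose Y x := th x * (v None x `^ (- sg))%:E * (A x `^ (- al))%:E.
pose Z x := H x * (v None x `^ (- sg))%:E * (A x `^ (- al))%:E.
have mY : nnm Y by apply: nnm_mul => //; exact: nnm_mul.
have mZ : nnm Z by apply: nnm_mul => //; exact: nnm_mul.
set IZ := \int[nu]_x (Z x `^ kappa).
have mZk : nnm (fun x => Z x `^ kappa) by apply: nnm_pow; exact: mZ.1.
have IZ0 : 0 <= IZ by exact: int_ge0.
have [IZy|IZy] := eqVneq IZ +oo.
  rewrite -/IZ IZy gt0_muley ?leey// lte_fin powR_gt0// mulr_gt0// !mulr_gt0// powR_gt0//.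
have IZf : IZ \is a fin_num by rewrite ge0_fin_numE// lt_neqAle IZy leey.
have IZE : IZ = (fine IZ)%:E by rewrite fineK.
have fIZ0 : (0 <= fine IZ)%R by exact: fine_ge0.
pose KK := (K0 * CF * CM `^ kb * fine IZ `^ kappa^-1)%R.
have KK0 : (0 <= KK)%R by rewrite !mulr_ge0 ?powR_ge0 ?(ltW CF0) ?(ltW K00).
apply: (@le_trans _ _ ((4 * KK) `^ kappa)%:E); last first.
  rewrite -/IZ IZE -EFinM lee_fin /KK mulrA.
  have c0 : (0 <= 4 * (K0 * CF * CM `^ kb))%R.
    by rewrite mulr_ge0// !mulr_ge0 ?powR_ge0 ?(ltW CF0) ?(ltW K00).
  by rewrite powRM ?powR_ge0// -powRrM mulVf ?gt_eqF// powRr1.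
apply: (dual_poweR he k1 KK0 mY) => phi mphi phi0 phiy.
rewrite -/nu -/kb.
have nphi (a : R) : nnm (fun x => (phi x `^ a)%:E).
  by apply: nnm_EFin => [|x]; [exact: mpow|exact: powR_ge0].
pose psi' x := (phi x * v None x `^ (r None)^-1)%R.
have mpsi' : measurable_fun setT psi' by apply: measurable_funM => //; exact: mpow.
pose psi x := (psi' x * A x `^ (- al))%R.
have mpsi : measurable_fun setT psi by apply: measurable_funM => //; exact: mpow.
have psi0 x : (0 <= psi x)%R by rewrite !mulr_ge0 ?powR_ge0// ltW.
have nphi1 : nnm (EFin \o phi) by apply: nnm_EFin => // x; exact: ltW.
have -> : \int[nu]_x (Y x * (phi x)%:E) = \int[mu]_x (th x * (psi x)%:E).
  rewrite /nu int_density; last exact: nnm_mul.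
  apply: eq_integral => x _; rewrite /Y /psi /psi' -!muleA -!EFinM; congr (_ * _%:E).
  have -> : (v None x `^ (r None)^-1 = v None x `^ (- sg) * v None x)%R.
    by rewrite -[X in (_ * X)%R]powRr1 ?(ltW (v0 x))// -powRD_gt0// /sg; congr (_ `^ _)%R; ring.
  by ring.
apply: (le_trans (dom psi mpsi psi0)).
rewrite /KK -!mulrA EFinM -muleA; apply: lee_wpmul2l; first by rewrite lee_fin ltW.
apply: ge_ereal_sup => _ [S [SQ sS] <-].
pose F k := if k is Some i then f i else psi'.
(* The weight A accompanies only the dual function. The constant 1, put at the other indices,
   satisfies the maximal condition with the constant CA + 1 as well. *)
pose AA (k : option I) := if k is None then A else cst 1%R.
pose M := maximal Q nu (fun x => (phi x `^ r None)%:E).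
have mM : nnm M by exact: (nnm_maximal lamQ).
have := hF v Wv S SQ sS F AA z.
have mF k : measurable_fun setT (F k) by case: k.
have mAA k : measurable_fun setT (AA k) by case: k => //= i; exact: measurable_cst.
have AA0 k x : (0 < AA k x)%R by case: k.
have hAA k : \forall x \ae wmeas Wv k, maximal Q (wmeas Wv k) (EFin \o AA k) x <=
    (CA + 1)%:E * (AA k x)%:E.
  case: k => [i|] /=.
    apply: aeW => x; apply: maximal_le => [|n Qx].
      by rewrite mule1 lee_fin ltW.
    have [n0 ny] := wmeas_finite_pos lamQ muQ g0 Wv (Some i) n.
    rewrite (_ : EFin \o cst 1%R = cst 1)// (avg_cst (laminar_measurable lamQ n) n0 ny)// mule1 lee_fin lerDr; exact: ltW.
  apply: filterS hA => x /le_trans; apply; apply: lee_wpmul2r; first by rewrite lee_fin ltW.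
  by rewrite lee_fin lerDl.
move=> /(_ mF mAA AA0 hAA mz zy) hform.
apply: (@le_trans _ _ (CF%:E * \int[nu]_x (Z x * M x `^ (r None)^-1))).
  apply: le_trans (le_trans hform _).
    rewrite /multilinear_form le_eqVlt; apply/orP; left; apply/eqP; apply: eq_esum => B _.
    have pe : \prod_i average mu (r (Some i))%:E B (fun y => (F (Some i) y * AA (Some i) y `^ (- al))%R)
        = \prod_i average mu (r (Some i))%:E B (f i).
      by apply: eq_bigr => i _; congr average; apply: funext => y; rewrite /= powR1 mulr1.
    have sw (a b c : \bar R) : a * b * c = a * (c * b) by rewrite -muleA (muleC b).
    rewrite [X in _ = _ * X]prode_option.
    rewrite [X in _ = _ * (_ * X)]pe.
    exact: sw.
  apply: lee_wpmul2l; first by rewrite lee_fin ltW.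
  rewrite /nu int_density; last by apply: nnm_mul => //; apply: nnm_pow; exact: mM.1.
  rewrite le_eqVlt; apply/orP; left; apply/eqP; apply: eq_integral => x _.
  rewrite prode_option /AA /F.
  have -> : \prod_i ((cst 1 x `^ (- al))%:E * wmax Wv r (Some i) (f i) x) =
      \prod_i wmax Wv r (Some i) (f i) x.
    by apply: eq_bigr => i _; rewrite /= powR1 mul1e.
  rewrite /wmax (_ : wfun v r None psi' = (fun x => (phi x `^ r None)%:E)); last first.
    apply: funext => y; rewrite /wfun /psi' ger0_norm; last by rewrite mulr_ge0 ?powR_ge0// ltW.
    rewrite powRM ?powR_ge0 ?(ltW (phi0 y))// -powRrM mulVf ?gt_eqF// powRr1 ?(ltW (v0 y))//.
    by rewrite mulfK// gt_eqF.
  rewrite -/nu -/(M x) poweRM ?lee_fin ?(ltW (v0 x))//; last exact: mM.2.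
  rewrite poweR_EFin.
  have -> : (v None x `^ (r None)^-1 = v None x `^ (- sg) * v None x)%R.
    by rewrite -[X in (_ * X)%R]powRr1 ?(ltW (v0 x))// -powRD_gt0// /sg; congr (_ `^ _)%R; ring.
  rewrite /Z /H /form_majorant EFinM.
  set p1 := \prod_i _; set p2 := zweight _ _ _ _; set p3 := (A x `^ _)%:E; set p4 := M x `^ _.
  set p5 := (v None x `^ _)%:E; set p6 := (v None x)%:E.
  rewrite -!muleA; congr (_ * _).
  by rewrite [X in _ = p1 * X]muleCA [X in _ = p1 * (p3 * X)]muleCA [RHS]muleC -!muleA.
rewrite EFinM -muleA; apply: lee_wpmul2l; first by rewrite lee_fin ltW.
have kk : (kappa^-1 + kb = 1)%R by rewrite /kb; ring.
have ki0 : (0 <= kappa^-1)%R by rewrite invr_ge0 ltW.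
have mMP : nnm (fun x => M x `^ P) by apply: nnm_pow; exact: mM.1.
have := hoelder_int2 nu ki0 (ltW kb0) kk mZk mMP.
rewrite (eq_integral (fun x => Z x * M x `^ (r None)^-1)) => [/le_trans|x _]; last first.
  rewrite -!poweRrM mulfV ?gt_eqF// poweRe1; last exact: mZ.2.
  by rewrite /P mulrAC mulVf ?gt_eqF// mul1r.
apply; rewrite -/IZ [(CM `^ kb * _)%R]mulrC EFinM -[X in _ <= X * _ * _]poweR_EFin -IZE -muleA.
apply: lee_wpmul2l; first exact: poweR_ge0.
rewrite -[X in _ <= X * _]poweR_EFin -poweRM ?lee_fin ?(ltW CM0)//; last first.
  by apply: int_ge0; exact: nphi.
apply: lee_poweR; [exact: ltW|exact: int_ge0|].
apply: (le_trans (maximal_strong lamQ nuQ (nphi (r None)) P1)).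
apply: lee_wpmul2l; first by rewrite lee_fin ltW.
rewrite le_eqVlt; apply/orP; left; apply/eqP; apply: eq_integral => x _.
by rewrite poweR_EFin -powRrM /P mulrCA mulfV ?gt_eqF// mulr1.
Qed.

Lemma vector_transfer (W0 q tau kappa : R) : (0 < q)%R -> (0 < tau)%R -> (q < kappa)%R ->
  (tau < kappa)%R -> (1 < kappa)%R -> (sg < kappa^-1)%R ->
  exists2 C : R, (0 < C)%R &
  forall v (Wv : muckenhoupt mu Q g W0 v) e, integrable_pos mu e ->
  forall J th f z, (forall j, nnm (th j)) -> (forall j i, measurable_fun setT (f j i)) ->
  nnm z -> \int[mu]_x z x < +oo -> (forall j, (j < J)%N -> form_dominated (th j) (f j)) ->
  mixed (wmeas Wv None) J q tau (fun j x => th j x * (v None x `^ (- sg))%:E) <=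
  C%:E * mixed (wmeas Wv None) J q tau
    (fun j x => form_majorant Wv z (f j) x * (v None x `^ (- sg))%:E).
Proof.
move=> q0 tau0 qk tk k1 sk.
have [al [CA [al0 CA0 hex]]] := extrapolate lamQ q0 tau0 qk tk.
have [C1 C10 hC1] := scalar_weighted W0 (ltW al0) CA0 k1 sk.
have [C C0 hC] := hex C1 C10; exists C => // v Wv e he J th f z mth mf mz zy dom.
have [e' he'] := density_integrable_pos (muck_nnm Wv None) he.
have nvs : nnm (fun x => (v None x `^ (- sg))%:E).
  apply: nnm_EFin => [|x]; last exact: powR_ge0.
  by apply: (measurableT_comp (measurable_powR _)); exact: (muck_meas Wv None).
apply: (hC (wmeas Wv None) J e' (wmeas_finite_pos lamQ muQ g0 Wv None) he').
- by move=> j; exact: nnm_mul.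
- by move=> j; apply: nnm_mul => //; exact: nnm_form_majorant.
move=> j A jJ mA A0 hA.
exact: (hC1 v Wv e' he' (th j) (f j) z (mth j) (mf j) mz zy (dom j jJ) A mA A0 hA).
Qed.

End transfer.

(** * Norms of finite sequences *)

Section finite_ell.
Context {R : realType}.
Implicit Types (t : \bar R) (u w : nat -> \bar R).

(* The norm in l^t of the first [J] terms. *)
Definition ell t J u : \bar R :=
  match t with
  | t'%:E => (\sum_(j < J) u j `^ t') `^ t'^-1
  | _ => \big[maxe/0]_(j < J) u j
  end.

Arguments ell : simpl never.

Lemma ell_ge0 t J u : 0 <= ell t J u.
Proof. by case: t => [t| |]; rewrite /ell; [exact: poweR_ge0|exact: bigmax_ge_id|exact: bigmax_ge_id]. Qed.

Lemma le_ell t J u w : 0 <= t -> (forall j, (j < J)%N -> 0 <= u j) ->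
  (forall j, (j < J)%N -> u j <= w j) -> ell t J u <= ell t J w.
Proof.
case: t => [t| |] // t0 u0 uw; rewrite /ell.
  apply: lee_poweR; first by rewrite invr_ge0.
    by apply: sume_ge0 => j _; exact: poweR_ge0.
  by apply: lee_sum => j _; apply: lee_poweR; rewrite ?u0 ?uw.
by apply: le_bigmax2 => j _; exact: uw.
Qed.

(** An index with [t i] = +oo has exponent 0 in Hoelder's inequality and enters through its supremum
    [s i], which is taken out of the sum over j. *)
Lemma hoelder_ell (I : finType) (t : I -> \bar R) (tau : R) J (x : I -> nat -> \bar R) :
  (0 < tau)%R -> (forall i, 0 < t i) -> (tau^-1 = \sum_i fine ((t i)^-1))%R ->
  (forall i j, 0 <= x i j) ->
  ell tau%:E J (fun j => \prod_i x i j) <= \prod_i ell (t i) J (x i).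
Proof.
move=> tau0 t0 st x0.
pose a i := fine ((t i)^-1); pose b i := (tau * a i)%R.
have a0 i : (0 <= a i)%R by apply: fine_ge0; rewrite inve_ge0 ltW.
have b0 i : (0 <= b i)%R by rewrite mulr_ge0// ltW.
have b1 : (\sum_i b i = 1)%R by rewrite -mulr_sumr -st divff// gt_eqF.
pose y i j := if t i is t'%:E then x i j `^ t' else 0.
pose s i := if t i is t'%:E then 1 else ell (t i) J (x i).
have y0 i j : 0 <= y i j by rewrite /y; case: (t i) => // t'; exact: poweR_ge0.
have s0 i : 0 <= s i by rewrite /s; case: (t i) => // *; exact: ell_ge0.
have xy i j : (j < J)%N -> x i j `^ tau <= y i j `^ b i * s i `^ tau.
  move=> jJ; rewrite /y /s /b /a /ell; have := t0 i; case: (t i) => [t'| |]//= t'0.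
    rewrite lte_fin in t'0.
    rewrite powR1 mule1 -poweRrM inver gt_eqF//= mulrCA mulfV ?gt_eqF// mulr1; exact: lexx.
  rewrite mulr0 powRr0 mul1e; apply: lee_poweR => //; first exact: ltW.
  exact: (le_bigmax _ (fun j : 'I_J => x i j) (Ordinal jJ)).
rewrite {1}/ell.
apply: (@le_trans _ _ (((\prod_i ((\sum_(j < J) y i j) `^ b i)) * \prod_i (s i `^ tau)) `^ tau^-1)).
  apply: lee_poweR; first by rewrite invr_ge0 ltW.
    by apply: sume_ge0 => j _; exact: poweR_ge0.
  apply: (@le_trans _ _ (\sum_(j < J) ((\prod_i (y i j `^ b i)) * \prod_i (s i `^ tau)))).
    apply: lee_sum => j _; rewrite -big_split prode_poweR//.
    by apply: lee_prod => i; [exact: poweR_ge0|exact: xy].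
  rewrite -ge0_sume_distrl => [|j _]; last by apply: prode_ge0 => i _; exact: poweR_ge0.
  apply: lee_wpmul2r; first by apply: prode_ge0 => i _; exact: poweR_ge0.
  exact: (@hoelder_sum R I b b0 b1 _ _ (fun i (j : 'I_J) => y i j)).
rewrite poweRM; [|by apply: prode_ge0 => i _; exact: poweR_ge0|by apply: prode_ge0 => i _; exact: poweR_ge0].
rewrite !prode_poweR; [|by move=> i; exact: poweR_ge0|by move=> i; exact: poweR_ge0].
rewrite -big_split; apply: lee_prod => i; first by rewrite mule_ge0// poweR_ge0.
rewrite -!poweRrM mulfV ?gt_eqF// poweRe1//.
rewrite /y /s /b /a /ell; have := t0 i; case: (t i) => [t'| |]//= t'0.
  rewrite lte_fin in t'0.
  by rewrite mule1 inver gt_eqF//= mulrAC mulfV ?gt_eqF// mul1r lexx.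
by rewrite mulr0 mul0r poweRe0 mul1e lexx.
Qed.

Lemma nnm_ell (d : measure_display) (X : measurableType d) t J (u : nat -> X -> \bar R) :
  (forall j, nnm (u j)) -> nnm (fun x => ell t J (fun j => u j x)).
Proof.
move=> mu; have hm : nnm (fun x => \big[maxe/0]_(j < J) u j x).
  elim: J u mu => [|J IH] u mu.
    by under eq_fun do rewrite big_ord0; exact: nnm_cst.
  under eq_fun do rewrite big_ord_recl /=.
  have IHu := IH (fun j => u j.+1) (fun j => mu j.+1).
  split => [|x]; last by rewrite le_max (mu 0%N).2.
  by apply: measurable_maxe; [exact: (mu 0%N).1|exact: IHu.1].
case: t => [t| |] //; rewrite /ell; apply: nnm_pow; apply: (nnm_sum _ _).1 => j.
by apply: nnm_pow; exact: (mu j).1.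
Qed.

End finite_ell.

#[global] Arguments ell : simpl never.

(** * Weighted vector-valued bounds of the maximal functions *)

Section weighted_maximal.
Context {R : realType} {d : measure_display} {X : measurableType d}.
Variable mu : {measure set X -> \bar R}.
Variables (N : nat) (Q : nat -> set X) (lab : nat -> 'I_N).
Hypothesis lamQ : laminar Q lab.
Hypothesis muQ : finite_pos Q mu.
Context {K : finType}.
Variables (g r : K -> R).
Hypothesis g0 : forall k, (0 < g k)%R.
Hypothesis r0 : forall k, (0 < r k)%R.
Variables (k : K) (p : R).
Hypothesis rp : (r k < p)%R.
Hypothesis gE : (g k = (r k)^-1 - p^-1)%R.

Let rk := r0 k.
Let p0 : (0 < p)%R. Proof. exact: lt_trans rp. Qed.
Let P1 : (1 < p / r k)%R. Proof. by rewrite ltr_pdivlMr// mul1r. Qed.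
Let P0 : (0 < p / r k)%R. Proof. by rewrite divr_gt0. Qed.

(** As g_k = 1 / r_k - 1 / p, the powers of v_k combine to v_k^(p / r_k - p g_k) = v_k. Weighted L^p
    norms for mu thus become L^(p / r_k) norms for v_k mu. *)
Lemma int_root_weight W0 v (Wv : muckenhoupt mu Q g W0 v) (G : X -> \bar R) : nnm G ->
  \int[mu]_x (((G x * (v k x)%:E) `^ (r k)^-1 * (v k x `^ (- g k))%:E) `^ p) =
  \int[wmeas Wv k]_x (G x `^ (p / r k)).
Proof.
move=> mG; rewrite int_density; last by apply: nnm_pow; exact: mG.1.
apply: eq_integral => x _; have v0 : (0 < v k x)%R := muck_gt0 Wv k x.
have G0 := mG.2 x.
have v0e : 0 <= (v k x)%:E by rewrite lee_fin ltW.
rewrite poweRM ?poweR_ge0//; last by rewrite lee_fin powR_ge0.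
rewrite -poweRrM poweRM// -muleA !poweR_EFin -EFinM -powRrM -powRD_gt0//.
rewrite mulrC; congr (_ * _%:E).
by rewrite gE -[RHS](powRr1 (ltW v0)); congr (_ `^ _)%R; field; rewrite !gt_eqF.
Qed.

Lemma ell_root (t : R) J (G : nat -> \bar R) (c : R) : (0 < t)%R -> (0 < c)%R ->
  (forall j, 0 <= G j) ->
  ell t%:E J (fun j => (G j * c%:E) `^ (r k)^-1) =
  ((\sum_(j < J) G j `^ (t / r k)) `^ (r k / t) * c%:E) `^ (r k)^-1.
Proof.
move=> t0 c0 G0; have c0e : 0 <= c%:E by rewrite lee_fin ltW.
have T0 : (t / r k != 0)%R by rewrite gt_eqF// divr_gt0.
rewrite /ell (_ : \sum_(j < J) _ = (\sum_(j < J) G j `^ (t / r k)) * (c `^ (t / r k))%:E).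
  have S0 : 0 <= \sum_(j < J) G j `^ (t / r k) by apply: sume_ge0 => j _; exact: poweR_ge0.
  rewrite poweRM// ?lee_fin ?powR_ge0// poweRM ?poweR_ge0// -poweRrM !poweR_EFin -powRrM.
  by congr (_ `^ _ * (_ `^ _)%:E); field; rewrite !gt_eqF.
rewrite ge0_sume_distrl => [|j _]; last exact: poweR_ge0.
apply: eq_bigr => j _; by rewrite -poweRrM mulrC poweRM// poweR_EFin.
Qed.

Lemma wfunK v (v0 : forall x, (0 < v k x)%R) (f : X -> R) x :
  (wfun v r k f x * (v k x)%:E) `^ (r k)^-1 = `|f x|%:E.
Proof.
rewrite /wfun -EFinM divfK ?gt_eqF// poweR_EFin -powRrM mulfV ?gt_eqF// powRr1//.
Qed.

(** For real t this is the Fefferman-Stein inequality for v_k mu, with the exponents p / r_k and t /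
    r_k, both larger than 1. For t = +oo the supremum over j is moved inside the maximal
    function. *)
Lemma weighted_fefferman_stein (t : \bar R) : (r k)%:E < t ->
  exists2 B : R, (0 < B)%R &
  forall W0 v (Wv : muckenhoupt mu Q g W0 v) e, integrable_pos mu e ->
  forall J (f : nat -> X -> R), (forall j, measurable_fun setT (f j)) ->
  \int[mu]_x ((ell t J (fun j => wmax Wv r k (f j) x) * (v k x `^ (- g k))%:E) `^ p) <=
  B%:E * \int[mu]_x ((ell t J (fun j => `|f j x|%:E) * (v k x `^ (- g k))%:E) `^ p).
Proof.
case: t => [t| |]//=.
  rewrite lte_fin => rt; have t0 : (0 < t)%R by exact: lt_trans rt.
  have T1 : (1 < t / r k)%R by rewrite ltr_pdivlMr// mul1r.
  have [B B0 hB] := fefferman_stein lamQ P1 T1.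
  exists B => // W0 v Wv e he J f mf.
  have [e' he'] := density_integrable_pos (muck_nnm Wv k) he.
  have vk x := muck_gt0 Wv k x.
  have tr (G : nat -> X -> \bar R) : (forall j, nnm (G j)) ->
      \int[mu]_x ((ell t%:E J (fun j => (G j x * (v k x)%:E) `^ (r k)^-1) * (v k x `^ (- g k))%:E) `^ p)
      = mixed (wmeas Wv k) J (p / r k) (t / r k) G.
    move=> mG; under eq_integral do rewrite (ell_root _ t0 (vk _) (fun j => (mG j).2 _)).
    rewrite (int_root_weight Wv); last first.
      by apply: nnm_pow; apply: (nnm_sum _ _).1 => j; apply: nnm_pow; exact: (mG j).1.
    apply: eq_integral => x _; rewrite -poweRrM; congr (_ `^ _).
    by field; rewrite !gt_eqF.
  have mF j : nnm (wfun v r k (f j)) by exact: (nnm_wfun Wv).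
  have e1 : \int[mu]_x ((ell t%:E J (fun j => `|f j x|%:E) * (v k x `^ (- g k))%:E) `^ p) =
      mixed (wmeas Wv k) J (p / r k) (t / r k) (fun j => wfun v r k (f j)).
    have fE x : (fun j => `|f j x|%:E) = (fun j => (wfun v r k (f j) x * (v k x)%:E) `^ (r k)^-1).
      by apply: funext => j; rewrite wfunK.
    by rewrite -(tr _ mF); apply: eq_integral => x _; rewrite fE.
  have e2 := tr (fun j => maximal Q (wmeas Wv k) (wfun v r k (f j))) (fun j => nnm_maximal lamQ _ (mF j)).
  rewrite e1; apply: le_trans (hB (wmeas Wv k) J e' (wmeas_finite_pos lamQ muQ g0 Wv k) he' _ mF).
  by rewrite -e2.
move=> _; pose cM := (N%:R * (p / r k / (p / r k - 1)) `^ (p / r k))%R.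
have N0 : (0 < N)%N by have [i] := lab 0; case: N i.
exists cM.
  by rewrite mulr_gt0 ?ltr0n// powR_gt0// divr_gt0// subr_gt0.
move=> W0 v Wv e _ J f mf; have vk x := muck_gt0 Wv k x.
pose G x := \big[Num.max/0%R]_(j < J) `|f j x|%R.
have hG J' (h : nat -> X -> R) : (forall j, measurable_fun setT (h j)) ->
    measurable_fun setT (fun x => \big[Num.max/0%R]_(j < J') `|h j x|%R).
  elim: J' h => [|J' IH] h mh.
    by under eq_fun do rewrite big_ord0; exact: measurable_cst.
  under eq_fun do rewrite big_ord_recl /=.
  apply: measurable_maxr; first exact: measurableT_comp.
  exact: (IH (fun j => h j.+1) (fun j => mh j.+1)).
have mG : measurable_fun setT G by exact: hG.
have G0 x : (0 <= G x)%R by exact: bigmax_ge_id.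
have GE x : \big[maxe/0]_(j < J) `|f j x|%:E = (G x)%:E.
  by rewrite /G; elim/big_rec2: _ => // j y z _ ->; rewrite EFin_max.
have fG j x : (j < J)%N -> (`|f j x| <= `|G x|)%R.
  move=> jJ; rewrite (ger0_norm (G0 x)).
  exact: (le_bigmax _ (fun j : 'I_J => `|f j x|%R) (Ordinal jJ)).
have nG : nnm (wfun v r k G) by exact: (nnm_wfun Wv).
apply: (@le_trans _ _ (\int[mu]_x ((wmax Wv r k G x * (v k x `^ (- g k))%:E) `^ p))).
  have mw : nnm (fun x => (v k x `^ (- g k))%:E).
    apply: nnm_EFin => [|x]; last exact: powR_ge0.
    by apply: (measurableT_comp (measurable_powR _)); exact: (muck_meas Wv k).
  have mW j : nnm (wmax Wv r k (f j)) by exact: (nnm_wmax lamQ).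
  have mWG : nnm (wmax Wv r k G) by exact: (nnm_wmax lamQ).
  have mE := nnm_ell +oo J mW.
  apply: le_int => [||x].
  - by apply: nnm_pow; exact: (nnm_mul mE mw).1.
  - by apply: nnm_pow; exact: (nnm_mul mWG mw).1.
  apply: lee_poweR; [exact: ltW| |].
    by rewrite mule_ge0 ?lee_fin ?powR_ge0//; exact: bigmax_ge_id.
  apply: lee_wpmul2r; first by rewrite lee_fin powR_ge0.
  apply: bigmax_le; first exact: mWG.2.
  move=> j _; apply: lee_poweR; first by rewrite invr_ge0 ltW.
    rewrite mule_ge0 ?lee_fin ?(ltW (vk x))//.
    by apply: (nnm_maximal lamQ _ _).2; exact: (nnm_wfun Wv).
  apply: lee_wpmul2r; first by rewrite lee_fin ltW.
  apply: (le_maximal lamQ) => //; first exact: (nnm_wfun Wv).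
  move=> y; rewrite /wfun lee_fin; apply: ler_wpM2r; first by rewrite invr_ge0 ltW.
  by apply: ge0_ler_powR; rewrite ?nnegrE ?(ltW rk)//; exact: fG.
rewrite (int_root_weight Wv); last exact: (nnm_maximal lamQ).
apply: (le_trans (maximal_strong lamQ (wmeas_finite_pos lamQ muQ g0 Wv k) nG P1)).
rewrite -(int_root_weight Wv)// le_eqVlt; apply/orP; left; apply/eqP; congr (_ * _).
by apply: eq_integral => x _; rewrite wfunK// /ell GE ger0_norm.
Qed.

End weighted_maximal.

Lemma ell_scale (R : realType) (tau : R) J (u : nat -> \bar R) (c : \bar R) : (0 < tau)%R ->
  0 <= c -> (forall j, 0 <= u j) -> ell tau%:E J (fun j => c * u j) = c * ell tau%:E J u.
Proof.
move=> t0 c0 u0; rewrite /ell; under eq_bigr do rewrite poweRM//.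
rewrite -ge0_sume_distrr => [|j _]; last exact: poweR_ge0.
rewrite poweRM ?poweR_ge0//; last by apply: sume_ge0 => j _; exact: poweR_ge0.
by rewrite -poweRrM mulfV ?gt_eqF// poweRe1.
Qed.

(** * The vector-valued bound *)

Section vector_bound.
Context {R : realType} {d : measure_display} {X : measurableType d}.
Variable mu : {measure set X -> \bar R}.
Variables (N : nat) (Q : nat -> set X) (lab : nat -> 'I_N).
Hypothesis lamQ : laminar Q lab.
Hypothesis muQ : finite_pos Q mu.
Context {I : finType}.
Variables (g r : option I -> R) (delta0 eta K0 : R) (p : I -> R) (q tau : R) (t : I -> \bar R).
Hypothesis g0 : forall k, (0 < g k)%R.
Hypothesis r0 : forall k, (0 < r k)%R.
Hypothesis d0 : (0 < delta0)%R.
Hypothesis d1 : (delta0 <= 1)%R.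
Hypothesis eta0 : (0 <= eta)%R.
Hypothesis K00 : (0 < K0)%R.
Hypothesis rp : forall i, (r (Some i) < p i)%R.
Hypothesis gS : forall i, (g (Some i) = (r (Some i))^-1 - (p i)^-1)%R.
Hypothesis gN : (g None = q^-1 - (1 - (r None)^-1))%R.
Hypothesis q0 : (0 < q)%R.
Hypothesis qE : (q^-1 = \sum_i (p i)^-1 - eta)%R.
Hypothesis rt : forall i, (r (Some i))%:E < t i.
Hypothesis tau0 : (0 < tau)%R.
Hypothesis tauE : (tau^-1 = \sum_i fine ((t i)^-1))%R.
Hypothesis stau : (1 - (r None)^-1 < tau^-1)%R.

Let sg := (1 - (r None)^-1)%R.
Let p0 i : (0 < p i)%R. Proof. exact: lt_trans (r0 _) (rp i). Qed.
Let t0 i : 0 < t i. Proof. by apply: lt_trans (rt i); rewrite lte_fin. Qed.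

(** 1 / kappa is the midpoint between max(1/s, 0) and min(1, 1/q, 1/tau). There is room because
    [g None] > 0 says 1/s < 1/q, and 1/s < 1/tau is assumed. *)
Lemma exponent_between : exists kappa : R,
  [/\ (q < kappa)%R, (tau < kappa)%R, (1 < kappa)%R & (sg < kappa^-1)%R].
Proof.
have sq : (sg < q^-1)%R by have := g0 None; rewrite gN subr_gt0.
have s1 : (sg < 1)%R by rewrite /sg ltrBlDr ltrDl invr_gt0.
pose a := Num.max sg 0%R; pose b := Num.min 1%R (Num.min q^-1 tau^-1)%R.
have ab : (a < b)%R.
  by rewrite /a gt_max !lt_min sq s1 stau !invr_gt0 q0 tau0 ltr01.
have a0 : (0 <= a)%R by rewrite le_max lexx orbT.
have sa : (sg <= a)%R by rewrite le_max lexx.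
have [b1 bq bt] : [/\ (b <= 1)%R, (b <= q^-1)%R & (b <= tau^-1)%R].
  by rewrite /b !ge_min !lexx ?orbT.
pose c := ((a + b) / 2)%R.
have ac : (a < c)%R by rewrite /c; lra.
have cb : (c < b)%R by rewrite /c; lra.
have c0 : (0 < c)%R by apply: le_lt_trans ac.
exists c^-1%R; rewrite invrK; split.
- by rewrite -[ltLHS]invrK ltf_pV2 ?posrE ?invr_gt0//; exact: lt_le_trans cb bq.
- by rewrite -[ltLHS]invrK ltf_pV2 ?posrE ?invr_gt0//; exact: lt_le_trans cb bt.
- by rewrite invf_gt1//; exact: lt_le_trans cb b1.
- exact: le_lt_trans sa ac.
Qed.

Lemma mixed_dual_weight W0 v (Wv : muckenhoupt mu Q g W0 v) J (h : nat -> X -> \bar R) :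
  (forall j, nnm (h j)) ->
  mixed (wmeas Wv None) J q tau (fun j x => h j x * (v None x `^ (- sg))%:E) =
  \int[mu]_x ((ell tau%:E J (h^~ x) * (v None x `^ g None)%:E) `^ q).
Proof.
move=> mh; have v0 x : (0 < v None x)%R := muck_gt0 Wv None x.
have mv : nnm (fun x => (v None x `^ (- sg))%:E).
  apply: nnm_EFin => [|x]; last exact: powR_ge0.
  by apply: (measurableT_comp (measurable_powR _)); exact: (muck_meas Wv None).
rewrite /mixed int_density; last exact: (nnm_mixed J q tau (fun j => nnm_mul (mh j) mv)).
apply: eq_integral => x _.
have S0 : 0 <= \sum_(j < J) h j x `^ tau by apply: sume_ge0 => j _; exact: poweR_ge0.
have c0 (a : R) : 0 <= (v None x `^ a)%:E by rewrite lee_fin powR_ge0.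
rewrite (_ : \sum_(j < J) _ = (\sum_(j < J) h j x `^ tau) * ((v None x `^ (- sg)) `^ tau)%:E); last first.
  rewrite ge0_sume_distrl => [|j _]; last exact: poweR_ge0.
  by apply: eq_bigr => j _; rewrite poweRM ?poweR_EFin//; exact: (mh j).2.
rewrite /ell poweRM// ?lee_fin ?powR_ge0// poweRM ?poweR_ge0// -!poweRrM !poweR_EFin -!powRrM.
rewrite -muleA -EFinM; congr (_ `^ _ * _%:E); first by rewrite mulrC.
rewrite -{2}[v None x]powRr1 ?(ltW (v0 x))// -powRD_gt0//; congr (_ `^ _)%R.
by rewrite gN /sg; field; rewrite !gt_eqF.
Qed.

(** The target exponent that Hoelder's inequality would give for eta = 0. *)
Let q1 := (\sum_i (p i)^-1)^-1%R.
Let q1V : (q1^-1 = q^-1 + eta)%R. Proof. by rewrite /q1 invrK qE subrK. Qed.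
Let q10 : (0 < q1)%R. Proof. by rewrite -invr_gt0 q1V ltr_pwDl ?invr_gt0. Qed.
Let qq1 : (q / q1 = 1 + eta * q)%R.
Proof. by rewrite q1V; field; rewrite gt_eqF. Qed.

(** Since 1 / q1 - eta = 1 / q, the q-th power of z^(-eta) z^(1 / q1) is z itself: the reason for
    taking z to be the q1-th power of h c. *)
Lemma zweight_power (z h c : X -> \bar R) x : 
  (forall u, 0 <= h u) -> (forall u, 0 < c u) -> (forall u, c u < +oo) ->
  nnm z -> (forall u, z u = (h u * c u) `^ q1) -> z x < +oo ->
  (zweight mu z eta x * h x * c x) `^ q <= (\int[mu]_u z u) `^ (eta * q) * z x.
Proof.
move=> h0 c0 cy mz zE zy; have I0 : 0 <= \int[mu]_u z u by exact: int_ge0.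
have hc0 : 0 <= h x * c x by rewrite mule_ge0// ltW.
rewrite /zweight; case: eqVneq => [z0|z0].
  (* Where z vanishes [zweight] is +oo, but it multiplies h x = 0 and the product is 0. *)
  have hz : h x * c x = 0.
    by rewrite -(poweRK (lt0r_neq0 q10) hc0) -zE z0 poweR0r// invr_neq0// gt_eqF.
  have -> : h x = 0.
    by move: hz => /eqP; rewrite mule_eq0 (gt_eqF (c0 x)) orbF => /eqP.
  by rewrite mule0 mul0e poweR0r ?gt_eqF// mule_ge0 ?poweR_ge0// mz.2.
have zf : z x \is a fin_num by rewrite ge0_fin_numE// mz.2.
have zp : (0 < fine (z x))%R by rewrite fine_gt0// lt_neqAle eq_sym z0 mz.2.
have zr : z x = (fine (z x))%:E by rewrite fineK.
have yE : h x * c x = (fine (z x) `^ q1^-1)%:E.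
  by rewrite -poweR_EFin -zr zE -poweRrM mulfV ?gt_eqF// poweRe1.
rewrite -muleA yE -muleA -EFinM -powRD_gt0// poweRM ?poweR_ge0 ?lee_fin ?powR_ge0//.
rewrite -poweRrM poweR_EFin -powRrM [in leRHS]zr -[X in _ <= _ * X%:E](powRr1 (ltW zp)).
rewrite (_ : ((- eta + q1^-1) * q = 1)%R) ?lexx//.
by rewrite q1V; field; rewrite gt_eqF.
Qed.

(** The function z in the majorant is still free. For the choice below, Hoelder's inequality and the
    weighted Fefferman-Stein inequality bound int z, while the transferred estimate gives (int
    z)^(eta q) int z = (int z)^(q / q1). *)
Lemma vector_bound (W0 : R) : exists2 C : R, (0 < C)%R &
  forall v (Wv : muckenhoupt mu Q g W0 v) e, integrable_pos mu e ->
  forall J th f, (forall j, nnm (th j)) -> (forall j i, measurable_fun setT (f j i)) ->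
  (forall j, (j < J)%N -> form_dominated mu Q r delta0 eta K0 (th j) (f j)) ->
  (forall i, \int[mu]_x ((ell (t i) J (fun j => `|f j i x|%:E) *
      (v (Some i) x `^ (- g (Some i)))%:E) `^ p i) < +oo) ->
  \int[mu]_x ((ell tau%:E J (th^~ x) * (v None x `^ g None)%:E) `^ q) <=
  C%:E * \prod_i ((\int[mu]_x ((ell (t i) J (fun j => `|f j i x|%:E) *
      (v (Some i) x `^ (- g (Some i)))%:E) `^ p i)) `^ (q / p i)).
Proof.
have [kappa [qk tk k1 sk]] := exponent_between.
have [C1 C10 hC1] := vector_transfer lamQ muQ g0 r0 d0 d1 eta0 K00 W0 q0 tau0 qk tk k1 sk.
have hB0 i := cid2 (weighted_fefferman_stein lamQ muQ g0 r0 (rp i) (gS i) (rt i)).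
pose B i := s2val (hB0 i).
have B0 i : (0 < B i)%R := s2valP (hB0 i).
have hB i := s2valP' (hB0 i).
exists (C1 * \prod_i (B i `^ (q / p i)))%R.
  by rewrite mulr_gt0// prodr_gt0// => i _; exact: powR_gt0.
move=> v Wv e he J th f mth mf dom fin.
have v0 k x : (0 < v k x)%R := muck_gt0 Wv k x.
pose H j x := \prod_i wmax Wv r (Some i) (f j i) x.
have mW j i : nnm (wmax Wv r (Some i) (f j i)) by exact: (nnm_wmax lamQ).
have mH j : nnm (H j) by apply: nnm_prod => i; exact: mW.
pose HH x := ell tau%:E J (H^~ x).
have mHH : nnm HH by exact: nnm_ell.
pose c x := (v None x `^ g None)%:E.
have mc : nnm c.
  apply: nnm_EFin => [|x]; last exact: powR_ge0.
  by apply: (measurableT_comp (measurable_powR _)); exact: (muck_meas Wv None).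
pose w i x := (v (Some i) x `^ (- g (Some i)))%:E.
have mw i : nnm (w i).
  apply: nnm_EFin => [|x]; last exact: powR_ge0.
  by apply: (measurableT_comp (measurable_powR _)); exact: (muck_meas Wv (Some i)).
(* The weight of the target space is the product of the others, by the normalization of the v_k. *)
have cE x : c x = \prod_i w i x.
  rewrite /c /w prodEFin; congr EFin.
  have := muck_prod Wv x; rewrite (bigD1 None)//=.
  rewrite (reindex_omap (Some : I -> option I) id) => [/=|[]//].
  rewrite (eq_bigl xpredT) => [h|i /=]; last by rewrite eqxx.
  have P0 : (0 < \prod_i (v (Some i) x `^ g (Some i)))%R.
    by apply: prodr_gt0 => i _; exact: powR_gt0.
  under eq_bigr do rewrite powRN.
  by rewrite prodfV; apply: (mulIf (lt0r_neq0 P0)); rewrite h mulVf ?gt_eqF.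
(* One function for the whole sequence, built from its l^tau norm, so that [zweight] comes out of
   this norm as a factor. *)
pose z x := (HH x * c x) `^ q1.
have mz : nnm z by apply: nnm_pow; exact: (nnm_mul mHH mc).1.
pose A i := \int[mu]_x ((ell (t i) J (fun j => `|f j i x|%:E) * w i x) `^ p i).
have A0 i : 0 <= A i.
  apply: int_ge0; apply: nnm_pow; apply: (nnm_mul _ (mw i)).1.
  apply: nnm_ell => j; apply: nnm_EFin => //; exact: measurableT_comp.
have b0 i : (0 <= q1 / p i)%R by rewrite divr_ge0// ltW.
have b1 : (\sum_i q1 / p i = 1)%R.
  by rewrite -mulr_sumr /q1 mulVf// -invr_eq0 -/q1 gt_eqF.
have mL i : nnm (fun x => ell (t i) J (fun j => wmax Wv r (Some i) (f j i) x)).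
  by apply: nnm_ell => j; exact: mW.
have Iz : \int[mu]_x z x <= \prod_i (((B i)%:E * A i) `^ (q1 / p i)).
  apply: (@le_trans _ _ (\prod_i (\int[mu]_x ((ell (t i) J (fun j => wmax Wv r (Some i) (f j i) x) * w i x) `^ p i)) `^ (q1 / p i))); last first.
    apply: lee_prod => i; first exact: poweR_ge0.
    apply: lee_poweR => //; first by apply: int_ge0; apply: nnm_pow; exact: (nnm_mul (mL i) (mw i)).1.
    exact: (hB i W0 v Wv e he J (fun j => f j i)).
  have mLw i : nnm (fun x => (ell (t i) J (fun j => wmax Wv r (Some i) (f j i) x) * w i x) `^ p i).
    by apply: nnm_pow; exact: (nnm_mul (mL i) (mw i)).1.
  apply: le_trans (hoelder_int mu b0 b1 mLw).
  apply: le_int => //.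
    by apply: nnm_prod => i; apply: nnm_pow; exact: (mLw i).1.
  move=> x; under eq_bigr do rewrite -poweRrM mulrCA mulfV ?gt_eqF// mulr1.
  rewrite -prode_poweR => [|i]; last by rewrite mule_ge0 ?ell_ge0// (mw i).2.
  apply: lee_poweR; [exact: ltW|by rewrite mule_ge0 ?mHH.2// mc.2|].
  rewrite cE big_split; apply: lee_wpmul2r.
    by apply: prode_ge0 => i _; exact: (mw i).2.
  exact: (hoelder_ell J tau0 t0 tauE (fun i j => (mW j i).2 x)).
have Iy : \int[mu]_x z x < +oo.
  apply: le_lt_trans Iz _; rewrite ltey; apply/eqP => hy.
  have Af i : A i = (fine (A i))%:E by rewrite fineK// ge0_fin_numE// fin.
  move: hy; under eq_bigr do rewrite Af -EFinM poweR_EFin.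
  by rewrite prodEFin.
have I0 : 0 <= \int[mu]_x z x by exact: int_ge0.
have Zm := nnm_zweight mu eta mz.
apply: (@le_trans _ _ (C1%:E * (\int[mu]_x z x) `^ (q / q1))).
  rewrite -(mixed_dual_weight Wv J mth).
  apply: (le_trans (hC1 v Wv e he J th f z mth mf mz Iy dom)).
  apply: lee_wpmul2l; first by rewrite lee_fin ltW.
  rewrite (mixed_dual_weight Wv J (fun j => nnm_form_majorant lamQ r eta Wv mz (mf j))).
  apply: (@le_trans _ _ (\int[mu]_x ((\int[mu]_u z u) `^ (eta * q) * z x))).
    apply: le_int_ae.
    - apply: nnm_pow; apply: (nnm_mul _ mc).1.
      by apply: nnm_ell => j; exact: (nnm_form_majorant lamQ r eta Wv mz (mf j)).
    - by apply: nnm_mul => //; apply: nnm_cst; exact: poweR_ge0.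
    apply: filterS (ae_lty_int mz Iy) => x zx.
    rewrite (_ : ell _ _ _ = zweight mu z eta x * HH x); last first.
      by rewrite /form_majorant (ell_scale J tau0 (Zm.2 x) (fun j => (mH j).2 x)).
    apply: (@zweight_power z HH c x) => // u; [exact: mHH.2|by rewrite lte_fin powR_gt0|exact: ltry].
  rewrite int_scale ?poweR_ge0// qq1 addrC poweRD; last first.
    by rewrite /poweRD_def gt_eqF ?implybT// ltr_wpDl ?mulr_ge0// ltW.
  by rewrite poweRe1.
rewrite EFinM -muleA; apply: lee_wpmul2l; first by rewrite lee_fin ltW.
apply: (le_trans (lee_poweR _ I0 Iz)); first by rewrite divr_ge0 ?ltW.
rewrite prode_poweR => [|i]; last exact: poweR_ge0.
rewrite -prodEFin -big_split le_eqVlt; apply/orP; left; apply/eqP; apply: eq_bigr => i _.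
rewrite -poweRrM (_ : (q1 / p i * (q / q1) = q / p i)%R); last by field; rewrite !gt_eqF.
by rewrite poweRM ?lee_fin ?(ltW (B0 i))// poweR_EFin.
Qed.

End vector_bound.

(** * Dyadic cubes, weights and operators *)

Section homogeneous.
Context {R : realType} {d : measure_display} {X : measurableType d}.
Variables (rho : X -> X -> R) (mu : {measure set X -> \bar R}).
Hypothesis hom : homogeneous_type rho mu.

Let B x r : set X := qball rho x r.
Let mB x r : measurable (B x r). Proof. exact: homogeneous_measurable_ball hom x r. Qed.

Lemma qball_gt0 x r : (0 < r)%R -> 0 < mu (B x r).
Proof.
move=> r0; have [C /(_ x (r / 2)%R)] := homogeneous_doubling hom.
by rewrite divr_gt0// => /(_ isT) []; rewrite mulrC divfK.
Qed.

Lemma qball_lty x r : (0 < r)%R -> mu (B x r) < +oo.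
Proof. by move=> r0; have [C /(_ x r r0)[]] := homogeneous_doubling hom. Qed.

Lemma qball_cover x y : exists n : nat, B x n.+1%:R y.
Proof.
have [n hn] : exists n : nat, (rho x y < n%:R)%R.
  by exists (Num.truncn (rho x y)).+1; exact: truncnS_gt.
by exists n; apply: lt_trans hn _; rewrite ltr_nat.
Qed.

Lemma qball_incr x m n : (m <= n)%N -> B x m%:R `<=` B x n%:R.
Proof. by move=> mn y /= h; apply: (lt_le_trans h); rewrite ler_nat. Qed.

(** Indicators of concentric balls exhausting X, with weights 2^(-n-1) / (1 + mu(B_n)): the weights
    keep both the sum and its integral at most 1. *)
Lemma homogeneous_integrable_pos : exists e, integrable_pos mu e.
Proof.
pose x0 : X := point.
pose Bn n := B x0 n.+1%:R.
have Bf n : mu (Bn n) \is a fin_num by rewrite ge0_fin_numE// qball_lty.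
pose a n : R := (1 / (2 ^ n.+1)%:R / (1 + fine (mu (Bn n))))%R.
have mBn n : measurable (Bn n) := mB _ _.
have b0 n : (0 < 1 + fine (mu (Bn n)))%R by rewrite ltr_pwDl// fine_ge0.
have p0 n : (0 < 1 / (2 ^ n.+1)%:R :> R)%R by rewrite divr_gt0// ltr0n expn_gt0.
have a0 n : (0 < a n)%R by rewrite divr_gt0.
pose u n x := (a n)%:E * (\1_(Bn n) x)%:E.
have mu0 n : nnm (u n).
  apply: nnm_mul; first by apply: nnm_cst; rewrite lee_fin ltW.
  exact: nnm_indic.
pose E x := \sum_(0 <= n <oo) u n x.
have mE : nnm E by exact: nnm_series.
have E1 x : E x <= 1.
  apply: le_trans (epsilon_trick0 xpredT (ler01 : 0 <= 1 :> R)%R).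
  apply: lee_nneseries => n _; first by move=> _; exact: (mu0 n).2.
  rewrite /u -EFinM lee_fin /a.
  apply: (@le_trans _ _ (1 / (2 ^ n.+1)%:R / (1 + fine (mu (Bn n))))%R).
    rewrite ler_piMr ?(ltW (a0 n))// ?indicE ?lern1 ?leq_b1//; exact: ltW (a0 n).
  by rewrite ler_pdivrMr// ler_peMr ?(ltW (p0 n))// lerDl fine_ge0.
have Ef x : E x \is a fin_num by rewrite ge0_fin_numE ?mE.2//; apply: le_lt_trans (E1 x) _; exact: ltry.
exists (fun x => fine (E x)); split.
- by apply: (measurableT_comp _ mE.1); exact: fine_measurable.
- move=> x; apply: fine_gt0; rewrite -ge0_fin_numE ?mE.2// Ef andbT.
  have [n Bx] := qball_cover x0 x.
  apply: (@lt_le_trans _ _ (u n x)).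
    by rewrite /u indicE mem_set// mule1 lte_fin.
  rewrite -[leLHS]add0e; apply: le_trans (nneseries_lim_ge n.+1 _); last first.
    by move=> k _ _; exact: (mu0 k).2.
  rewrite big_nat_recr//=; apply: leeD => //.
  by apply: sume_ge0 => k _; exact: (mu0 k).2.
under eq_integral do rewrite fineK//.
rewrite /E int_series//.
apply: le_trans (epsilon_trick0 xpredT (ler01 : 0 <= 1 :> R)%R).
apply: lee_nneseries => n _; first by move=> _; exact: int_ge0.
rewrite int_scale ?lee_fin ?(ltW (a0 n))//; last exact: nnm_indic.
rewrite integral_indic// setIT -(fineK (Bf n)) -EFinM lee_fin /a mulrAC.
rewrite ler_pdivrMr//; apply: ler_wpM2l; first exact: ltW.
by rewrite lerDr.
Qed.

(** For each m, at most (m + 1) mu(A) of the disjoint sets meet A in measure at least 1 / (m +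
    1). *)
Lemma countable_disjoint_pos (F : set (set X)) (A : set X) :
  measurable A -> mu A < +oo -> (forall C, F C -> measurable C) ->
  (forall C C' x, F C -> F C' -> C x -> C' x -> C = C') ->
  countable [set C | F C /\ 0 < mu (C `&` A)].
Proof.
move=> mA Ay mF dF.
pose G m := [set C | F C /\ (m.+1%:R^-1)%:E <= mu (C `&` A)].
apply: (@sub_countable _ _ _ (\bigcup_m G m)).
  apply: subset_card_le => C [FC]; rewrite lt0e => /andP[C0 _].
  have Cf : mu (C `&` A) \is a fin_num.
    rewrite ge0_fin_numE//; apply: le_lt_trans Ay; apply: le_measure; rewrite ?inE//.
    by apply: measurableI => //; exact: mF.
  have c0 : (0 < fine (mu (C `&` A)))%R.
    by rewrite fine_gt0// lt0e C0 measure_ge0 -ge0_fin_numE.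
  exists (Num.truncn (fine (mu (C `&` A)))^-1) => //; split => //.
  rewrite -(fineK Cf) lee_fin invf_ple ?posrE//; exact/ltW/truncnS_gt.
apply: bigcup_countable => // m _; apply: finite_set_countable.
apply: contrapT => /infinite_set_fset inf.
have Af : mu A \is a fin_num by rewrite ge0_fin_numE.
have [S0 SG0 cS] := inf (Num.truncn (fine (mu A) * m.+1%:R)).+1.
pose S : seq (set X) := finmap.enum_fset S0.
have SG C : C \in S -> G m C by move=> CS; exact: SG0.
have uS : uniq S by exact: finmap.fset_uniq.
have h : \sum_(C <- S) \int[mu]_x ((\1_A x)%:E * (\1_C x)%:E) <= \int[mu]_x (\1_A x)%:E.
  apply: (@sum_int_disjoint _ _ _ _ _ S (fun C => C)) => //; last exact: nnm_indic.
    by move=> C CS; have [FC _] := SG _ CS; exact: mF.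
  move=> x C C' CS CS' Cx C'x.
  by have [FC _] := SG _ CS; have [FC' _] := SG _ CS'; exact: dF FC FC' Cx C'x.
rewrite [leRHS]integral_indic// setIT in h.
have : \sum_(C <- S) (m.+1%:R^-1)%:E <= mu A.
  apply: le_trans h; rewrite [leLHS]big_seq [leRHS]big_seq; apply: lee_sum => C CS.
  have [FC hC] := SG _ CS; apply: (le_trans hC).
  rewrite -[C `&` A]setIT -(integral_indic mu measurableT (measurableI _ _ (mF _ FC) mA)).
  rewrite le_eqVlt; apply/orP; left; apply/eqP; apply: eq_integral => x _.
  by rewrite -EFinM !indicE in_setI -natrM mulnb andbC.
rewrite sumEFin big_const_seq count_predT iter_addr_0 -(fineK Af) lee_fin -(mulr_natl m.+1%:R^-1) ler_pdivrMr ?ltr0n//.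
rewrite leNgt => /negP; apply; apply: lt_le_trans (truncnS_gt _) _.
by rewrite ler_nat.
Qed.

Section lattices.
Variables (N : nat) (D : 'I_N -> dyadic_lattice rho).
Hypothesis adj : adjacent_lattices D.

Let level n k : set (set X) := [set C | exists j : dy_index (D n) k, C = dy_cube j].

Lemma dy_cube_gt0 n k (j : dy_index (D n) k) : 0 < mu (dy_cube j).
Proof.
have [h _] := dy_ball_sub j; have /andP[dl0 _] := dy_delta_bound (D n).
apply: lt_le_trans (_ : mu (B (dy_center j) (dy_c0 (D n) * dy_delta (D n) ^ k)) <= _).
  by apply: qball_gt0; rewrite mulr_gt0 ?dy_c0_gt0// exprz_gt0.
by apply: le_measure; rewrite ?inE//; exact: dy_measurable.
Qed.

Lemma dy_cube_lty n k (j : dy_index (D n) k) : mu (dy_cube j) < +oo.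
Proof.
have [_ h] := dy_ball_sub j; have /andP[dl0 _] := dy_delta_bound (D n).
apply: le_lt_trans (_ : _ <= mu (B (dy_center j) (dy_C0 (D n) * dy_delta (D n) ^ k))) _.
  by apply: le_measure; rewrite ?inE//; exact: dy_measurable.
apply: qball_lty; rewrite mulr_gt0 ?exprz_gt0//.
exact: lt_le_trans (dy_c0_gt0 _) (dy_c0_le_C0 _).
Qed.

(** The index types are arbitrary, so countability is extracted from the measure: distinct cubes of
    a level are disjoint, and each meets some ball of a countable exhaustion in positive measure. *)
Lemma countable_level n k : countable (level n k).
Proof.
pose x0 : X := point.
apply: (@sub_countable _ _ _ (\bigcup_l [set C | level n k C /\ 0 < mu (C `&` B x0 l.+1%:R)])).
  apply: subset_card_le => C LC; have [j CE] := LC.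
  have mC : measurable C by rewrite CE; exact: dy_measurable.
  apply: contrapT => hn.
  have z l : mu (C `&` B x0 l.+1%:R) = 0.
    apply/eqP; rewrite eq_le measure_ge0 andbT leNgt; apply/negP => h.
    by apply: hn; exists l.
  have : mu.-negligible C.
    have -> : C = \bigcup_l (C `&` B x0 l.+1%:R).
      rewrite -setI_bigcupr; apply/esym/setIidPl => y _.
      by have [l hl] := qball_cover x0 y; exists l.
    by apply: negligible_bigcup => l; exists (C `&` B x0 l.+1%:R); split => //; exact: measurableI.
  move=> /negligibleP => /(_ mC); rewrite CE => h.
  by have := dy_cube_gt0 j; rewrite h ltxx.
apply: bigcup_countable => // l _; apply: countable_disjoint_pos => //.
- by apply: qball_lty; rewrite ltr0n.
- by move=> C [j ->]; exact: dy_measurable.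
(* Nestedness is used in both directions within one level: two cubes with a common point are
   equal. *)
move=> C C' x [j ->] [j' ->] jx jx'; apply/seteqP; split.
  have [h|//] := dy_nested j j' (lexx k).
  by have : (dy_cube j `&` dy_cube j') x by []; rewrite h.
have [h|//] := dy_nested j' j (lexx k).
by have : (dy_cube j' `&` dy_cube j) x by []; rewrite h.
Qed.

(** One set may be a cube of several lattices, so pairs of a lattice and a set are enumerated;
    nestedness holds among cubes with the same label. *)
Lemma dyadic_enumeration : exists (Q : nat -> set X) (lab : nat -> 'I_N),
  [/\ laminar Q lab, finite_pos Q mu & range Q = dyadic_cubes D].
Proof.
pose P : set ('I_N * set X) := [set c | exists k, level c.1 k c.2].
have cP : countable P.
  have -> : P = \bigcup_n (\bigcup_k (pair n @` level n k)).
    apply/seteqP; split => [[n C] [k /= LC]|[n C] [n' _ [k _ [C' LC' [<- <-]]]]]; last by exists k.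
    by exists n => //; exists k => //; exists C.
  apply: bigcup_countable => // n _; apply: bigcup_countable => // k _.
  by apply: sub_countable (card_image_le _ _) _; exact: countable_level.
(* A cube containing some ball is the default value of the enumeration, at integers that code no
   cube. *)
have [c0 Pc0] : P !=set0.
  have [ga _ /(_ point 1%R ltr01) [C [[n [k [j CE]]] _ _]]] := adj.
  by exists (n, C); exists k; exists j.
have /countable_injP [f finj] := cP.
pose F l := xget c0 [set c | P c /\ f c = l].
have PF l : P (F l) by rewrite /F; case: xgetP => [c -> []|].
have FP c : P c -> exists l, F l = c.
  move=> Pc; exists (f c); rewrite /F; case: xgetP => [c' -> [Pc' ff]|/(_ c)[]//].
  by apply: finj; rewrite ?inE.
exists (fun l => (F l).2), (fun l => (F l).1); split.
- split => [l|i j].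
    by have [k [e ->]] := PF l; exact: dy_measurable.
  have [k [e He]] := PF i; have [k' [e' He']] := PF j.
  move: (F i) (F j) k e He k' e' He' => [ni Ci] [nj Cj] /= k e He k' e' He' nij.
  subst nj Ci Cj.
  have [kk|kk] := leP k' k.
    by have [?|?] := dy_nested e e' kk; [left|right; left].
  have [h|?] := dy_nested e' e (ltW kk); [left|by right; right].
  by rewrite setIC.
- by move=> l; have [k [e ->]] := PF l; split; [exact: dy_cube_gt0|exact: dy_cube_lty].
apply/seteqP; split => [_ [l _ <-]|C [n [k [j ->]]]].
  by have [k [e h]] := PF l; exists (F l).1, k, e.
by have [|l hl] := FP (n, dy_cube j); [exists k; exists j|exists l => //; rewrite hl].
Qed.

End lattices.

End homogeneous.

Lemma powRVl (R : realType) (x a : R) : (0 < x)%R -> (x^-1 `^ a = x `^ (- a))%R.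
Proof. by move=> x0; rewrite -powR_inv1 ?(ltW x0)// -powRrM mulN1r. Qed.

(** Expresses the inverse, also at 0 and at negative numbers, through functions known to be
    measurable. *)
Lemma invr_powR (R : realType) (x : R) : (x^-1 = x * (x ^+ 2) `^ (-1))%R.
Proof.
rewrite powR_inv1 ?sqr_ge0//; have [->|x0] := eqVneq x 0%R; first by rewrite invr0 mul0r.
by rewrite expr2 invfM mulrA divff// mul1r.
Qed.

(** * From the Muckenhoupt class to its symmetric form *)

Section weights.
Context {R : realType} {d : measure_display} {X : measurableType d}.
Variable mu : {measure set X -> \bar R}.
Variables (N : nat) (Q : nat -> set X) (lab : nat -> 'I_N).
Hypothesis lamQ : laminar Q lab.
Hypothesis muQ : finite_pos Q mu.
Variables (m : nat) (r p : 'I_m -> R) (s' pt : R).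
Hypothesis r0 : forall i, (0 < r i)%R.
Hypothesis rp : forall i, (r i < p i)%R.
Hypothesis s0 : (0 < s')%R.
Hypothesis pt0 : (0 < pt)%R.

(** The inverses of the exponents of the averages in [A_const]; in the case [None], 1 - 1 / s' is 1
    / s. *)
Definition gap (k : option 'I_m) : R :=
  if k is Some i then (r i)^-1 - (p i)^-1 else pt^-1 - (1 - s'^-1).

Definition base (k : option 'I_m) : R := if k is Some i then r i else s'.

Hypothesis gapN : (0 < gap None)%R.

Let p0 i : (0 < p i)%R. Proof. exact: lt_trans (r0 i) (rp i). Qed.

Lemma gap_gt0 k : (0 < gap k)%R.
Proof. by case: k => [i|]//; rewrite /gap subr_gt0 ltf_pV2 ?posrE. Qed.

Lemma gap_exponent_EFin (a b : R) : (0 < a)%R -> (0 < b)%R -> (a < b)%R ->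
  gap_exponent a%:E b%:E = (a^-1 - b^-1)^-1%:E.
Proof.
move=> a0 b0 ab; rewrite /gap_exponent !inver !gt_eqF// -EFinB inver gt_eqF//.
by rewrite subr_gt0 ltf_pV2.
Qed.

(** The inverse of the conjugate exponent is 1 - 1 / s' also for s' = 1, when s = +oo. *)
Lemma gap_exponent_dual :
  gap_exponent pt%:E (hoelder_conjugate s'%:E) = (gap None)^-1%:E.
Proof.
have h : (hoelder_conjugate s'%:E)^-1 = (1 - s'^-1)%:E.
  have := @hoelder_conjugate_eq1 R s'%:E (ltNyr _); rewrite eqe gt_eqF// => /(_ isT).
  rewrite inver gt_eqF//; case: ((hoelder_conjugate s'%:E)^-1) => [z| |]//.
  rewrite -EFinD => -[h]; congr EFin; rewrite -h.
  by ring.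
by rewrite /gap_exponent h inver gt_eqF// -EFinB inver gt_eqF.
Qed.

Section regularized.
Variable w : 'I_m -> X -> R.
Hypothesis mw : forall i, measurable_fun setT (w i).
Hypothesis w0 : forall i, \forall x \ae mu, (0 < w i x)%R.

(* Modifying the weights on a null set makes them positive everywhere. *)
Definition pweight i x := if (0 < w i x)%R then w i x else 1%R.

Lemma pweight_gt0 i x : (0 < pweight i x)%R.
Proof. by rewrite /pweight; case: ifP. Qed.

Lemma measurable_pweight i : measurable_fun setT (pweight i).
Proof.
apply: measurable_fun_ifT => //.
by apply: measurable_fun_ltr => //; exact: measurable_cst.
Qed.

Lemma pweightE : \forall x \ae mu, forall i, w i x = pweight i x.
Proof.
have : \forall x \ae mu, forall i, (0 < w i x)%R.
  exact: filter_forall.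
by apply: filterS => x h i; rewrite /pweight h.
Qed.

Definition dual_weights (k : option 'I_m) (x : X) : R :=
  if k is Some i then pweight i x `^ (- (gap k)^-1)
  else (\prod_i pweight i x) `^ (gap k)^-1.

Lemma dual_weights_gt0 k x : (0 < dual_weights k x)%R.
Proof.
case: k => [i|] /=; rewrite powR_gt0 ?pweight_gt0//.
by apply: prodr_gt0 => i _; exact: pweight_gt0.
Qed.

Lemma measurable_dual_weights k : measurable_fun setT (dual_weights k).
Proof.
case: k => [i|] /=; apply: (measurableT_comp (measurable_powR _)).
  exact: measurable_pweight.
by apply: measurable_prod => i _; exact: measurable_pweight.
Qed.

Lemma dual_weights_Some i x : (dual_weights (Some i) x `^ (- gap (Some i)) = pweight i x)%R.
Proof.
rewrite /dual_weights -powRrM mulrNN mulVf ?gt_eqF ?gap_gt0// powRr1// ltW//.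
exact: pweight_gt0.
Qed.

Lemma dual_weights_None x : (dual_weights None x `^ gap None = \prod_i pweight i x)%R.
Proof.
rewrite /dual_weights -powRrM mulVf ?gt_eqF ?gap_gt0// powRr1// ltW//.
by apply: prodr_gt0 => i _; exact: pweight_gt0.
Qed.

Let average_gap k n (f : X -> R) : (\forall x \ae mu, `|f x| `^ (gap k)^-1 = dual_weights k x)%R ->
  measurable_fun setT f ->
  average mu (gap k)^-1%:E (Q n) f = avg mu (EFin \o dual_weights k) (Q n) `^ gap k.
Proof.
move=> hf mf; have [Q0 Qy] := muQ n; rewrite /average invrK; congr (_ `^ _).
have mQ := laminar_measurable lamQ n.
have Qf : mu (Q n) \is a fin_num by rewrite ge0_fin_numE// ltW.
rewrite /avg -{1}(fineK Qf) inver gt_eqF ?fine_gt0 ?Q0//; congr (_ * _).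
have mv : nnm (EFin \o dual_weights k).
  by apply: nnm_EFin => [|x]; [exact: measurable_dual_weights|exact/ltW/dual_weights_gt0].
have mff : nnm (fun x => (`|f x| `^ (gap k)^-1)%:E).
  apply: nnm_EFin => [|x]; last exact: powR_ge0.
  by apply: (measurableT_comp (measurable_powR _)); exact: measurableT_comp.
rewrite int_set//; apply: eq_int_ae; [exact: nnm_setf|exact: nnm_setf|].
by apply: filterS hf => x -> .
Qed.

(** The powers are such that an average of exponent 1 / g_k in the definition is the g_k-th power of
    a plain average of v_k. The product of the v_k^(g_k) is that of the weights times that of their
    inverses, hence 1. *)
Lemma muckenhoupt_dual_weights :
  let W := A_const mu (range Q) (EFin \o r) (hoelder_conjugate s'%:E) (EFin \o p) pt%:E w in
  W < +oo -> muckenhoupt mu Q gap (fine W) dual_weights.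
Proof.
move=> W Wy; split.
- exact: measurable_dual_weights.
- exact: dual_weights_gt0.
- move=> x; apply: EFin_inj; rewrite -prodEFin prode_option.
  rewrite dual_weights_None prodEFin -EFinM; congr EFin.
  rewrite -[RHS](@divff _ (\prod_i pweight i x)%R); last first.
    by rewrite gt_eqF// prodr_gt0// => i _; exact: pweight_gt0.
  rewrite -prodfV; congr (_ * _)%R; apply: eq_bigr => i _.
  by rewrite -[in RHS]dual_weights_Some powRN invrK.
move=> n.
have hA : \prod_k (avg mu (EFin \o dual_weights k) (Q n) `^ gap k) <= W.
  apply: ereal_sup_ubound; exists (Q n) => //.
  rewrite prode_option muleC; congr (_ * _).
    rewrite gap_exponent_dual; apply: average_gap.
      apply: filterS pweightE => x h; rewrite /weight_prod /dual_weights.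
      rewrite ger0_norm; first by congr (_ `^ _)%R; apply: eq_bigr => i _; rewrite h.
      by apply: prodr_ge0 => i _; rewrite h ltW// pweight_gt0.
    by apply: measurable_prod => i _.
  apply: eq_bigr => i _; rewrite gap_exponent_EFin// -[((r i)^-1 - _)%R]/(gap (Some i)).
  apply: average_gap.
    apply: filterS pweightE => x h; rewrite h /dual_weights.
    by rewrite ger0_norm ?invr_ge0 ?powRVl ?ltW ?pweight_gt0.
  under eq_fun do rewrite invr_powR.
  apply: measurable_funM => //; apply: (measurableT_comp (measurable_powR _)).
  exact: measurable_funX.
rewrite fineK// ge0_fin_numE//; apply: le_trans hA; apply: prode_ge0 => k _; exact: poweR_ge0.
Qed.

End regularized.
End weights.

(** * Bounded functions with bounded support *)

Section bounded_support.
Context {R : realType} {d : measure_display} {X : measurableType d}.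
Variable rho : X -> X -> R.

Lemma Linfb_le (f h : X -> R) : Linfb rho f -> measurable_fun setT h ->
  (forall x, `|h x| <= `|f x|)%R -> Linfb rho h.
Proof.
move=> [mf [M fM] [x0 [r0 sf]]] mh hf; split => //.
  by exists M => x; exact: le_trans (hf x) (fM x).
exists x0, r0 => x hx; apply: sf; move: hx; apply: contraNneq => fx.
by rewrite -normr_le0; apply: le_trans (hf x) _; rewrite fx normr0.
Qed.

Definition pospart (f : X -> R) x := Num.max (f x) 0%R.
Definition negpart (f : X -> R) x := Num.max (- f x)%R 0%R.

Lemma pospart_ge0 f x : (0 <= pospart f x)%R. Proof. by rewrite le_max lexx orbT. Qed.
Lemma negpart_ge0 f x : (0 <= negpart f x)%R. Proof. by rewrite le_max lexx orbT. Qed.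

Lemma pospart_le f x : (`|pospart f x| <= `|f x|)%R.
Proof.
by rewrite ger0_norm ?pospart_ge0// /pospart ge_max ler_norm normr_ge0.
Qed.

Lemma negpart_le f x : (`|negpart f x| <= `|f x|)%R.
Proof.
by rewrite ger0_norm ?negpart_ge0// /negpart ge_max -normrN ler_norm normr_ge0.
Qed.

Lemma posneg f x : (pospart f x + -1 * negpart f x = f x)%R.
Proof.
rewrite /pospart /negpart; have [h|h] := leP 0%R (f x).
  by rewrite max_r ?oppr_le0// mulr0 addr0.
by rewrite max_l ?oppr_ge0 ?(ltW h)// add0r mulN1r opprK.
Qed.

Lemma Linfb_pospart f : Linfb rho f -> Linfb rho (pospart f).
Proof.
move=> Lf; apply: (Linfb_le Lf); last exact: pospart_le.
by apply: measurable_maxr; [have [] := Lf|exact: measurable_cst].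
Qed.

Lemma Linfb_negpart f : Linfb rho f -> Linfb rho (negpart f).
Proof.
move=> Lf; apply: (Linfb_le Lf); last exact: negpart_le.
by apply: measurable_maxr; [apply: measurable_funN; have [] := Lf|exact: measurable_cst].
Qed.

Lemma Linfb_add f h : quasi_metric rho -> Linfb rho f -> Linfb rho h ->
  Linfb rho (fun x => f x + h x)%R.
Proof.
move=> qm [mf [M fM] [x0 [r0 sf]]] [mh [M' hM'] [x1 [r1 sh]]]; split.
- exact: measurable_funD.
- by exists (M + M')%R => x; apply: le_trans (ler_normD _ _) _; exact: lerD.
have [A0 tri] := quasi_metric_triangle qm.
(* By the quasi-triangle inequality this ball around x0 contains both supports. The absolute values
   allow for radii and a constant A0 of any sign; adding 1 makes the inequality strict. *)
exists x0, (`|r0| + (`|A0| * (`|rho x0 x1| + `|r1|) + 1))%R => x hx.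
rewrite /qball /=.
have [fx|fx] := eqVneq (f x) 0%R; last first.
  apply: (lt_le_trans (sf x fx)); apply: (le_trans (ler_norm _)).
  by rewrite lerDl addr_ge0// mulr_ge0// addr_ge0.
have hx' : h x != 0%R by move: hx; rewrite fx add0r.
have := sh x hx'; rewrite /qball /= => h1.
apply: (le_lt_trans (tri x0 x1 x)).
apply: (@le_lt_trans _ _ (`|A0| * (`|rho x0 x1| + `|r1|))%R).
  apply: (@le_trans _ _ (`|A0| * (rho x0 x1 + rho x1 x))%R).
    apply: ler_wpM2r; last exact: ler_norm.
    by rewrite addr_ge0// (quasi_metric_ge0 qm).
  apply: ler_wpM2l => //; apply: lerD; first exact: ler_norm.
  by apply: le_trans (ltW h1) _; exact: ler_norm.
have := normr_ge0 r0; lra.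
Qed.

Lemma Linfb_scale f (c : R) : Linfb rho f -> Linfb rho (fun x => c * f x)%R.
Proof.
move=> [mf [M fM] [x0 [r0 sf]]]; split.
- by apply: measurable_funM => //; exact: measurable_cst.
- by exists (`|c| * M)%R => x; rewrite normrM; apply: ler_wpM2l.
- by exists x0, r0 => x h; apply: sf; apply: contraNneq h => ->; rewrite mulr0.
Qed.

End bounded_support.

(** * From the hypothesis on T to the domination of |T f| *)

Section domination.
Context {R : realType} {d : measure_display} {X : measurableType d}.
Variables (rho : X -> X -> R) (mu : {measure set X -> \bar R}).
Hypothesis hom : homogeneous_type rho mu.
Variables (N : nat) (Q : nat -> set X) (lab : nat -> 'I_N).
Hypothesis lamQ : laminar Q lab.
Variables (m : nat) (r : 'I_m -> R) (s' delta0 eta K : R).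
Hypothesis r0 : forall i, (0 < r i)%R.
Hypothesis s0 : (0 < s')%R.
Hypothesis K0 : (0 < K)%R.
Variable T : ('I_m -> X -> R) -> X -> R.
Hypothesis subT : msublinear mu (fun=> Linfb rho) T.
Hypothesis domT : sparse_dominated mu rho (range Q) delta0 eta (EFin \o r) s'%:E K T.

Let rr := base r s'.

Let supform (f : 'I_m -> X -> R) psi := ereal_sup
  [set multilinear_form mu rr eta S f psi | S in [set S | S `<=` range Q /\ sparse mu delta0 S]].

Lemma le_average (a : R) n (f h : X -> R) : (0 < a)%R -> measurable_fun setT f ->
  measurable_fun setT h -> (forall x, `|f x| <= `|h x|)%R ->
  average mu a%:E (Q n) f <= average mu a%:E (Q n) h.
Proof.
move=> a0 mf mh fh; have mQ := laminar_measurable lamQ n.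
have nn (u : X -> R) : measurable_fun setT u -> nnm (fun x => (`|u x| `^ a)%:E).
  move=> mu'; apply: nnm_EFin => [|x]; last exact: powR_ge0.
  by apply: (measurableT_comp (measurable_powR _)); exact: measurableT_comp.
rewrite /average (int_set mu (fun x => (`|f x| `^ a)%:E) mQ) (int_set mu (fun x => (`|h x| `^ a)%:E) mQ).
apply: lee_poweR; first by rewrite invr_ge0 ltW.
  by rewrite mule_ge0 ?inve_ge0//; apply: int_ge0; apply: nnm_setf => //; exact: nn.
apply: lee_wpmul2l; first by rewrite inve_ge0.
apply: le_int => [||x]; [by apply: nnm_setf => //; exact: nn|by apply: nnm_setf => //; exact: nn|].
apply: lee_wpmul2r; first by rewrite lee_fin.
by rewrite lee_fin; apply: ge0_ler_powR; rewrite ?nnegrE ?(ltW a0).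
Qed.

Lemma le_supform (f f' : 'I_m -> X -> R) (psi psi' : X -> R) :
  (forall i, measurable_fun setT (f i)) -> (forall i, measurable_fun setT (f' i)) ->
  measurable_fun setT psi -> measurable_fun setT psi' ->
  (forall i x, `|f i x| <= `|f' i x|)%R -> (forall x, `|psi x| <= `|psi' x|)%R ->
  supform f psi <= supform f' psi'.
Proof.
move=> mf mf' mp mp' ff pp; apply: ge_ereal_sup => _ [S [SQ sS] <-].
apply: le_trans (_ : multilinear_form mu rr eta S f' psi' <= _); last first.
  by apply: ereal_sup_ubound; exists S.
apply: le_esum => B /SQ [n _ <-]; apply: lee_pmul.
- by rewrite mule_ge0 ?poweR_ge0// prode_ge0// => i _; exact: poweR_ge0.
- exact: poweR_ge0.
- apply: lee_wpmul2l; first exact: poweR_ge0.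
  by apply: lee_prod => i; [exact: poweR_ge0|apply: le_average => //; exact: r0].
- exact: le_average.
Qed.

Let mT f : (forall i, Linfb rho (f i)) -> measurable_fun setT (T f).
Proof. by have [h _ _] := subT; exact: h. Qed.

Let nTpsi f (psi : X -> R) : (forall i, Linfb rho (f i)) -> measurable_fun setT psi ->
  (forall x, 0 <= psi x)%R -> nnm (fun x => `|T f x|%:E * (psi x)%:E).
Proof.
move=> Lf mp p0; apply: nnm_mul; apply: nnm_EFin => //.
by apply: measurableT_comp => //; exact: mT.
Qed.

(** The hypothesis controls the absolute value of an integral, not the integral of |T f|.
    Restricting psi to where T f >= 0 and to where T f < 0 gives two integrands of constant sign, at
    the cost of a factor 2. *)
Lemma nonneg_dominated f (psi : X -> R) : (forall i, Linfb rho (f i)) -> (forall i x, 0 <= f i x)%R ->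
  Linfb rho psi -> (forall x, 0 <= psi x)%R ->
  \int[mu]_x (`|T f x|%:E * (psi x)%:E) <= (2 * K)%:E * supform f psi.
Proof.
move=> Lf f0 Lp p0; have mTf := mT Lf; have [mp _ _] := Lp.
pose p1 x := if (0 <= T f x)%R then psi x else 0%R.
pose p2 x := if (0 <= T f x)%R then 0%R else psi x.
have mge : measurable_fun setT (fun x => (0 <= T f x)%R).
  by apply: measurable_fun_ler => //; exact: measurable_cst.
have mp1 : measurable_fun setT p1 by apply: measurable_fun_ifT => //; exact: measurable_cst.
have mp2 : measurable_fun setT p2 by apply: measurable_fun_ifT => //; exact: measurable_cst.
have p10 x : (0 <= p1 x)%R by rewrite /p1; case: ifP.
have p20 x : (0 <= p2 x)%R by rewrite /p2; case: ifP.
have p1p x : (`|p1 x| <= `|psi x|)%R by rewrite /p1; case: ifP; rewrite ?normr0.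
have p2p x : (`|p2 x| <= `|psi x|)%R by rewrite /p2; case: ifP; rewrite ?normr0.
have Lp1 := Linfb_le Lp mp1 p1p; have Lp2 := Linfb_le Lp mp2 p2p.
have mf i : measurable_fun setT (f i) by have [] := Lf i.
have bound p : Linfb rho p -> (forall x, 0 <= p x)%R -> (forall x, `|p x| <= `|psi x|)%R ->
    `|\int[mu]_x (T f x * p x)%:E| <= K%:E * supform f psi.
  move=> Lp' p'0 pp; apply: (le_trans (domT Lf f0 Lp' p'0)).
  apply: lee_wpmul2l; first by rewrite lee_fin ltW.
  have [mp' _ _] := Lp'.
  exact: (le_supform mf mf mp' mp (fun i x => lexx _) pp).
rewrite (eq_integral (fun x => `|T f x|%:E * (p1 x)%:E + `|T f x|%:E * (p2 x)%:E)) => [|x _]; last first.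
  rewrite -ge0_muleDr ?lee_fin// -EFinD; congr (_ * _%:E).
  by rewrite /p1 /p2; case: ifP; rewrite ?addr0 ?add0r.
rewrite int_add; [|exact: nTpsi|exact: nTpsi].
rewrite mulr_natl mulr2n EFinD ge0_muleDl ?lee_fin ?(ltW K0)//; apply: leeD.
- apply: le_trans (bound p1 Lp1 p10 p1p); apply: le_trans (lee_abs _).
  rewrite le_eqVlt; apply/orP; left; apply/eqP; apply: eq_integral => x _.
  by rewrite -EFinM /p1; case: ifP => [h|_]; rewrite ?mulr0// ger0_norm.
- apply: le_trans (bound p2 Lp2 p20 p2p).
  have -> : \int[mu]_x (T f x * p2 x)%:E = - \int[mu]_x (`|T f x|%:E * (p2 x)%:E).
    rewrite -integral_ge0N => [|x _]; last by rewrite mule_ge0 ?lee_fin.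
    apply: eq_integral => x _.
    rewrite -EFinM -EFinN /p2; case: ifP => [_|/negbT]; first by rewrite !mulr0 oppr0.
    by rewrite -ltNge => h; rewrite ltr0_norm// mulNr opprK.
  by rewrite abseN lee_abs.
Qed.

(** Only the first n coordinates may change sign. By sublinearity, and homogeneity for -1, splitting
    the last of these into positive and negative parts bounds |T f| by two terms with one signed
    coordinate less; hence 2^n. *)
Lemma signed_dominated n (f : 'I_m -> X -> R) (psi : X -> R) : (forall i, Linfb rho (f i)) ->
  (forall (i : 'I_m) x, (n <= i)%N -> (0 <= f i x)%R) -> Linfb rho psi -> (forall x, 0 <= psi x)%R ->
  \int[mu]_x (`|T f x|%:E * (psi x)%:E) <= (2 * K * 2 ^+ n)%:E * supform f psi.
Proof.
move=> + + Lp p0; have [mp _ _] := Lp; elim: n f => [|n IH] f Lf fn.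
  by rewrite expr0 mulr1; apply: nonneg_dominated => // i x; exact: fn.
have mf i : measurable_fun setT (f i) by have [] := Lf i.
have s0' : 0 <= supform f psi.
  apply: le_trans (_ : multilinear_form mu rr eta set0 f psi <= _).
    by rewrite /multilinear_form esum_set0.
  apply: ereal_sup_ubound; exists set0 => //; split => //.
  by exists (fun=> set0); split => //; exact: trivIset_set0.
(* For n >= m there is no coordinate of index n to split. *)
have [nm|mn] := ltnP n m; last first.
  have h (i : 'I_m) x : (n <= i)%N -> (0 <= f i x)%R.
    by move=> ni; have := leq_trans mn ni; rewrite leqNgt ltn_ord.
  apply: (le_trans (IH f Lf h)); apply: lee_wpmul2r => //.
  by rewrite lee_fin exprS ler_wpM2l ?mulr_ge0 ?(ltW K0)// ler_peMl ?exprn_ge0// ler1n.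
pose i0 := Ordinal nm.
pose f1 := dfwith f i0 (pospart (f i0)); pose f2 := dfwith f i0 (negpart (f i0)).
have dfle h (hle : forall x, (`|h x| <= `|f i0 x|)%R) i x : (`|dfwith f i0 h i x| <= `|f i x|)%R.
  by case: dfwithP.
have dfL h : Linfb rho h -> forall i, Linfb rho (dfwith f i0 h i) by move=> Lh i; case: dfwithP.
have Lf1 := dfL _ (Linfb_pospart (Lf i0)); have Lf2 := dfL _ (Linfb_negpart (Lf i0)).
have df0 h (h0 : forall x, (0 <= h x)%R) (i : 'I_m) x : (n <= i)%N -> (0 <= dfwith f i0 h i x)%R.
  move=> + ; case: dfwithP => // j ij nj; apply: fn; rewrite ltn_neqAle nj andbT.
  by apply: contraNneq ij => e; apply/eqP/val_inj.
have nf1 := df0 _ (pospart_ge0 (f i0)); have nf2 := df0 _ (negpart_ge0 (f i0)).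
have [_ subadd homog] := subT.
have E1 : f = dfwith f i0 (fun y => pospart (f i0) y + -1 * negpart (f i0) y)%R.
  apply: functional_extensionality_dep => i; case: dfwithP => [|//].
  by apply: funext => y; rewrite posneg.
have E2 : dfwith f2 i0 (fun y => -1 * f2 i0 y)%R = dfwith f i0 (fun y => -1 * negpart (f i0) y)%R.
  apply: functional_extensionality_dep => i; case: dfwithP => [|j ij].
    by rewrite dfwithin /f2 dfwithin.
  by rewrite dfwithout// /f2 dfwithout.
have Tle : \forall x \ae mu, (`|T f x| <= `|T f1 x| + `|T f2 x|)%R.
  have h1 := subadd f i0 (pospart (f i0)) (fun y => -1 * negpart (f i0) y)%R Lf
    (Linfb_pospart (Lf i0)) (Linfb_scale _ (Linfb_negpart (Lf i0))).
  have h2 := homog f2 i0 (-1)%R Lf2.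
  rewrite -E1 in h1; rewrite E2 in h2; apply: filterS2 h1 h2 => x h1 h2.
  by apply: (le_trans h1); rewrite h2 normrN1 mul1r.
apply: (@le_trans _ _ (\int[mu]_x (`|T f1 x|%:E * (psi x)%:E + `|T f2 x|%:E * (psi x)%:E))).
  apply: le_int_ae; [exact: nTpsi|by apply: nnm_add; exact: nTpsi|].
  apply: filterS Tle => x h; rewrite -!EFinM -EFinD lee_fin -mulrDl.
  exact: ler_wpM2r.
rewrite int_add; [|exact: nTpsi|exact: nTpsi].
have b g : (forall i, Linfb rho (g i)) -> (forall (i : 'I_m) x, (n <= i)%N -> (0 <= g i x)%R) ->
    (forall i x, `|g i x| <= `|f i x|)%R ->
    \int[mu]_x (`|T g x|%:E * (psi x)%:E) <= (2 * K * 2 ^+ n)%:E * supform f psi.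
  move=> Lg ng gf; apply: (le_trans (IH g Lg ng)).
  apply: lee_wpmul2l; first by rewrite lee_fin mulr_ge0 ?mulr_ge0 ?(ltW K0)// exprn_ge0.
  by apply: le_supform => // i; have [] := Lg i.
apply: (le_trans (leeD (b f1 Lf1 nf1 (dfle _ (pospart_le (f i0)))) (b f2 Lf2 nf2 (dfle _ (negpart_le (f i0)))))).
rewrite -ge0_muleDl ?lee_fin ?mulr_ge0 ?exprn_ge0 ?(ltW K0)//.
by apply: lee_wpmul2r => //; rewrite -EFinD lee_fin exprS; lra.
Qed.

(** All m coordinates may change sign. An arbitrary psi is cut off to balls and heights, then
    recovered by monotone convergence. *)
Lemma operator_form_dominated f : (forall i, Linfb rho (f i)) ->
  form_dominated mu Q rr delta0 eta (2 * K * 2 ^+ m) (fun x => `|T f x|%:E) f.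
Proof.
move=> Lf psi mp p0; pose x0 : X := point.
pose B n := qball rho x0 n.+1%:R.
have mB n : measurable (B n) by exact: (homogeneous_measurable_ball hom).
pose ps n x := if x \in B n then Num.min (psi x) n%:R else 0%R.
have ps0 n x : (0 <= ps n x)%R by rewrite /ps; case: ifP => // _; rewrite le_min p0 ler0n.
have psp n x : (ps n x <= psi x)%R by rewrite /ps; case: ifP => // _; rewrite ge_min lexx.
have mps n : measurable_fun setT (ps n).
  apply: measurable_fun_ifT.
  - apply: (measurable_fun_bool true) => //; rewrite setTI.
    rewrite (_ : _ @^-1` _ = B n)//; apply/seteqP; split => x /=; first by move/set_mem.
    exact: mem_set.
  - by apply: measurable_minr => //; exact: measurable_cst.
  - exact: measurable_cst.
have Lps n : Linfb rho (ps n).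
  split => //.
    exists n%:R => x; rewrite ger0_norm// /ps; by case: ifP => // _; rewrite ge_min lexx orbT.
  by exists x0, n.+1%:R => x; rewrite /ps; case: ifPn => [/set_mem//|_]; rewrite eqxx.
have mf i : measurable_fun setT (f i) by have [] := Lf i.
apply: (@le_trans _ _ (\int[mu]_x ereal_sup (range (fun n => `|T f x|%:E * (ps n x)%:E)))).
  apply: le_int => [||x].
  - exact: nTpsi.
  - by apply: nnm_sup => n; exact: nTpsi.
  have [n1 hn1] := qball_cover rho x0 x.
  pose n := maxn n1 (Num.truncn (psi x)).+1.
  apply: ereal_sup_ubound; exists n => //; congr (_ * _%:E).
  rewrite /ps mem_set; last by apply: (qball_incr _ hn1); rewrite ltnS leq_maxl.
  rewrite min_l//; apply: (le_trans (ltW (truncnS_gt _))).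
  by rewrite ler_nat leq_maxr.
apply: int_sup_le => [n|x|n].
- exact: nTpsi.
- apply/nondecreasing_seqP => n; apply: lee_wpmul2l => //.
  rewrite lee_fin /ps; case: ifPn => [/set_mem xB|_]; last exact: ps0.
  rewrite mem_set; last by apply: (qball_incr _ xB).
  by rewrite le_min ge_min lexx/= ge_min ler_nat leqnSn orbT.
apply: (le_trans (@signed_dominated m f (ps n) Lf _ (Lps n) (ps0 n))).
  by move=> i x; rewrite leqNgt ltn_ord.
apply: lee_wpmul2l; first by rewrite lee_fin mulr_ge0 ?mulr_ge0 ?(ltW K0)// exprn_ge0.
by apply: le_supform => // x; rewrite !ger0_norm.
Qed.

End domination.

Section weighted_powers.
Context {R : realType} {d : measure_display} {X : measurableType d}.
Variable mu : {measure set X -> \bar R}.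

Definition wpow (p : R) (w : X -> R) (f : X -> \bar R) : \bar R :=
  \int[mu]_x (`|f x * (w x)%:E| `^ p).

Lemma wnormE p w f : wnorm mu p%:E w f = wpow p w f `^ p^-1.
Proof. by rewrite /wnorm unlock. Qed.

Lemma wpow_ge0 p w f : 0 <= wpow p w f.
Proof. by apply: integral_ge0 => x _; exact: poweR_ge0. Qed.

Lemma nnm_wpow p (w : X -> R) f : measurable_fun setT w -> measurable_fun setT f ->
  nnm (fun x => `|f x * (w x)%:E| `^ p).
Proof.
move=> mw mf; apply: nnm_pow; apply: measurableT_comp => //.
by apply: emeasurable_funM => //; apply/measurable_EFinP.
Qed.

Lemma le_wpow p w f h : (0 <= p)%R -> measurable_fun setT w -> measurable_fun setT f ->
  measurable_fun setT h -> (\forall x \ae mu, `|f x| <= `|h x|) -> wpow p w f <= wpow p w h.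
Proof.
move=> p0 mw mf mh fh; apply: le_int_ae; [exact: nnm_wpow|exact: nnm_wpow|].
apply: filterS fh => x h'; apply: lee_poweR => //; rewrite !abseM.
exact: lee_wpmul2r.
Qed.

End weighted_powers.

(* The exponent of [v k] is [1 - (b k * r k)^-1 = - g k / b k]. *)
Lemma int_wfun_power (R : realType) (d : measure_display) (X : measurableType d)
  (mu : {measure set X -> \bar R}) (Q : nat -> set X) (K : finType) (g r : K -> R)
  (b W0 : R) (v : K -> X -> R) (Wv : muckenhoupt mu Q g W0 v) (k : K) (f : X -> R) :
  (0 < r k)%R -> (0 < b)%R -> ((r k)^-1 = g k + b)%R -> measurable_fun setT f ->
  \int[wmeas Wv k]_x (wfun v r k f x `^ (b * r k)^-1) =
  \int[mu]_x ((`|f x| * v k x `^ (- g k))%:E `^ b^-1).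
Proof.
move=> r0 b0 rE mf; rewrite int_density; last by apply: nnm_pow; have [] := nnm_wfun Wv r k mf.
apply: eq_integral => x _; have v0 : (0 < v k x)%R := muck_gt0 Wv k x.
rewrite /wfun !poweR_EFin -EFinM; congr (_%:E).
rewrite !powRM ?powR_ge0 ?invr_ge0 ?(ltW v0)// -!powRrM powRVl// -mulrA.
rewrite -[X in (_ * (_ * X))%R = _](powRr1 (ltW v0)) -powRD_gt0//.
rewrite (_ : - (b * r k)^-1 + 1 = - g k / b)%R; last first.
  have -> : g k = ((r k)^-1 - b)%R by rewrite rE addrK.
  by field; rewrite !gt_eqF.
by congr (_ `^ _ * _)%R; field; rewrite !gt_eqF.
Qed.

(** * Bounds on tuples of bounded functions with bounded support *)

Section operator_bounds.
Context {R : realType} {d : measure_display} {X : measurableType d}.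
Variables (rho : X -> X -> R) (mu : {measure set X -> \bar R}).
Hypothesis hom : homogeneous_type rho mu.
Variables (N : nat) (Q : nat -> set X) (lab : nat -> 'I_N).
Hypothesis lamQ : laminar Q lab.
Hypothesis muQ : finite_pos Q mu.
Variables (m : nat) (r p : 'I_m -> R) (s' pt delta0 eta K : R).
Hypothesis r0 : forall i, (0 < r i)%R.
Hypothesis rp : forall i, (r i < p i)%R.
Hypothesis s1 : (1 <= s')%R.
Hypothesis pt0 : (0 < pt)%R.
Hypothesis ptE : (pt^-1 = \sum_i (p i)^-1 - eta)%R.
Hypothesis gapN : (0 < gap r p s' pt None)%R.
Hypothesis d0 : (0 < delta0)%R.
Hypothesis d1 : (delta0 <= 1)%R.
Hypothesis eta0 : (0 <= eta)%R.
Hypothesis K0 : (0 < K)%R.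

Let s0 : (0 < s')%R. Proof. exact: lt_le_trans s1. Qed.
Let p0 i : (0 < p i)%R. Proof. exact: lt_trans (r0 i) (rp i). Qed.
Let base0 k : (0 < base r s' k)%R. Proof. by case: k => [i|] /=. Qed.
Let gap0 k : (0 < gap r p s' pt k)%R. Proof. exact: gap_gt0. Qed.
Let K1 := (2 * K * 2 ^+ m)%R.
Let K10 : (0 < K1)%R. Proof. by rewrite !mulr_gt0// exprn_gt0. Qed.

Let Wc := A_const mu (range Q) (EFin \o r) (hoelder_conjugate s'%:E) (EFin \o p) pt%:E.

Definition admissible T := msublinear mu (fun=> Linfb rho) T /\
  sparse_dominated mu rho (range Q) delta0 eta (EFin \o r) s'%:E K T.

Definition ae_weights (w : 'I_m -> X -> R) :=
  (forall i, measurable_fun setT (w i)) /\ (forall i, \forall x \ae mu, (0 < w i x)%R).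

Lemma measurable_weight_prod w : ae_weights w -> measurable_fun setT (weight_prod w).
Proof. by move=> [mw _]; apply: measurable_prod => i _. Qed.

(** Off a null set the weights agree with everywhere positive ones, so both sides are integrals in
    symmetric form for [dual_weights]. *)
Lemma operator_vector_bound (t : 'I_m -> \bar R) (tau W0 : R) : (forall i, (r i)%:E < t i) ->
  (0 < tau)%R -> (tau^-1 = \sum_i fine ((t i)^-1))%R -> (1 - s'^-1 < tau^-1)%R ->
  exists2 C : R, (0 < C)%R &
  forall T, admissible T -> forall w, ae_weights w -> Wc w < +oo -> fine (Wc w) = W0 ->
  forall J (f : nat -> 'I_m -> X -> R), (forall j i, Linfb rho (f j i)) ->
  (forall i, wpow mu (p i) (w i) (fun x => ell (t i) J (fun j => `|f j i x|%:E)) < +oo) ->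
  wpow mu pt (weight_prod w) (fun x => ell tau%:E J (fun j => `|T (f j) x|%:E)) <=
  C%:E * \prod_i (wpow mu (p i) (w i) (fun x => ell (t i) J (fun j => `|f j i x|%:E)) `^ (pt / p i)).
Proof.
move=> rt tau0 tauE stau.
have [C C0 hC] := vector_bound lamQ muQ gap0 base0 d0 d1 eta0 K10 rp (fun i => erefl)
  (erefl : gap r p s' pt None = (pt^-1 - (1 - (base r s' None)^-1))%R) pt0 ptE rt tau0 tauE stau W0.
exists C => // T [subT domT] w ww Wy WE J f Lf fin.
have [mw w0] := ww; have [e he] := homogeneous_integrable_pos hom.
have Wv := muckenhoupt_dual_weights lamQ muQ r0 rp s0 pt0 gapN mw w0 Wy; rewrite WE in Wv.
have mT j : measurable_fun setT (T (f j)) by have [h _ _] := subT; exact: h.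
have mf j i : measurable_fun setT (f j i) by have [] := Lf j i.
have nf j i : nnm (fun x => `|f j i x|%:E) by apply: nnm_EFin => //; exact: measurableT_comp.
have nT j : nnm (fun x => `|T (f j) x|%:E) by apply: nnm_EFin => //; exact: measurableT_comp.
have pwE := pweightE w0.
have rhsE i : wpow mu (p i) (w i) (fun x => ell (t i) J (fun j => `|f j i x|%:E)) =
    \int[mu]_x ((ell (t i) J (fun j => `|f j i x|%:E) *
      (dual_weights r p s' pt w (Some i) x `^ (- gap r p s' pt (Some i)))%:E) `^ p i).
  have mE := nnm_ell (t i) J (fun j => nf j i).
  apply: eq_int_ae.
  - by apply: nnm_wpow => //; exact: mE.1.
  - apply: nnm_pow; apply: emeasurable_funM; first exact: mE.1.
    apply/measurable_EFinP; apply: (measurableT_comp (measurable_powR _)).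
    exact: measurable_dual_weights.
  apply: filterS pwE => x h; rewrite h dual_weights_Some// abseM !gee0_abs//.
  - by rewrite lee_fin ltW// pweight_gt0.
  - exact: mE.2.
have lhsE : wpow mu pt (weight_prod w) (fun x => ell tau%:E J (fun j => `|T (f j) x|%:E)) =
    \int[mu]_x ((ell tau%:E J (fun j => `|T (f j) x|%:E) *
      (dual_weights r p s' pt w None x `^ gap r p s' pt None)%:E) `^ pt).
  have mE := nnm_ell tau%:E J nT.
  apply: eq_int_ae.
  - by apply: nnm_wpow; [exact: measurable_weight_prod|exact: mE.1].
  - apply: nnm_pow; apply: emeasurable_funM; first exact: mE.1.
    apply/measurable_EFinP; apply: (measurableT_comp (measurable_powR _)).
    exact: measurable_dual_weights.
  apply: filterS pwE => x h; rewrite dual_weights_None// /weight_prod.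
  have -> : (\prod_(i < m) w i x = \prod_(i < m) pweight w i x)%R by apply: eq_bigr.
  rewrite abseM !gee0_abs//.
  - by rewrite lee_fin prodr_ge0// => i _; rewrite ltW// pweight_gt0.
  - exact: mE.2.
rewrite lhsE; under eq_bigr do rewrite rhsE.
apply: (hC _ Wv e he J (fun j x => `|T (f j) x|%:E) f nT mf) => [j jJ|i].
  exact: (operator_form_dominated hom lamQ r0 s0 K0 subT domT (Lf j)).
by rewrite -rhsE; exact: fin.
Qed.

Lemma ell1 (t : \bar R) (a : R) : 0 < t -> (0 <= a)%R -> ell t 1 (fun=> a%:E) = a%:E.
Proof.
move=> t0 a0; rewrite /ell; case: t t0 => [t t0| _|//].
  by rewrite big_ord1 poweRK ?lee_fin// gt_eqF.
by rewrite big_ord_recl big_ord0; apply/max_l; rewrite lee_fin.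
Qed.

(** A one-term sequence with t_i = p_i and 1 / tau = sum of the 1 / p_i. This covers pt <= 1, and
    the extension of the operator rests on it for every pt. *)
Lemma operator_scalar_bound (W0 : R) : exists2 C : R, (0 < C)%R &
  forall T, admissible T -> forall w, ae_weights w -> Wc w < +oo -> fine (Wc w) = W0 ->
  forall f : 'I_m -> X -> R, (forall i, Linfb rho (f i)) ->
  (forall i, wpow mu (p i) (w i) (EFin \o f i) < +oo) ->
  wpow mu pt (weight_prod w) (EFin \o T f) <=
  C%:E * \prod_i (wpow mu (p i) (w i) (EFin \o f i) `^ (pt / p i)).
Proof.
pose tau := (\sum_i (p i)^-1)^-1%R.
have tauV : (tau^-1 = pt^-1 + eta)%R by rewrite /tau invrK ptE subrK.
have tau0 : (0 < tau)%R by rewrite -invr_gt0 tauV ltr_pwDl ?invr_gt0.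
have pE : (tau^-1 = \sum_i fine (((p i)%:E)^-1))%R.
  by rewrite /tau invrK; apply: eq_bigr => i _; rewrite inver gt_eqF.
have stau : (1 - s'^-1 < tau^-1)%R.
  by move: gapN; rewrite /gap subr_gt0 tauV => /lt_le_trans; apply; rewrite lerDl.
have [C C0 hC] := @operator_vector_bound (fun i => (p i)%:E) tau W0 (fun i => rp i) tau0 pE stau.
exists C => // T adT w ww Wy WE f Lf fin.
have [mw _] := ww; have [subT _] := adT.
have mf i : measurable_fun setT (f i) by have [] := Lf i.
have mT : measurable_fun setT (T f) by have [h _ _] := subT; exact: h.
have ew i : wpow mu (p i) (w i) (fun x => ell (p i)%:E 1 (fun=> `|f i x|%:E)) =
    wpow mu (p i) (w i) (EFin \o f i).
  by apply: eq_integral => x _; rewrite ell1 ?lte_fin// !abseM abse_EFin normr_id.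
have eT : wpow mu pt (weight_prod w) (fun x => ell tau%:E 1 (fun=> `|T f x|%:E)) =
    wpow mu pt (weight_prod w) (EFin \o T f).
  by apply: eq_integral => x _; rewrite ell1 ?lte_fin// !abseM abse_EFin normr_id.
rewrite -eT; under eq_bigr do rewrite -ew.
by apply: (hC T adT w ww Wy WE 1%N (fun=> f)) => // i; rewrite ew.
Qed.

(** Duality in L^pt makes the test function the coordinate [None] of the form, with exponent 1 - 1 /
    pt, positive because pt > 1. *)
Lemma operator_sharp_bound : (1 < pt)%R -> exists2 C : R, (0 < C)%R &
  forall T, admissible T -> forall w, ae_weights w -> Wc w < +oo ->
  forall f : 'I_m -> X -> R, (forall i, Linfb rho (f i)) ->
  (forall i, wpow mu (p i) (w i) (EFin \o f i) < +oo) ->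
  wpow mu pt (weight_prod w) (EFin \o T f) <=
  ((C * fine (Wc w) `^ Theta r s' p pt) `^ pt)%:E *
    \prod_i (wpow mu (p i) (w i) (EFin \o f i) `^ (pt / p i)).
Proof.
move=> pt1.
pose b (k : option 'I_m) : R := (if k is Some i then (p i)^-1 else 1 - pt^-1)%R.
have ptV1 : (pt^-1 < 1)%R by rewrite invf_lt1.
have b0 k : (0 < b k)%R by case: k => [i|] /=; rewrite ?invr_gt0// subr_gt0.
have rgb k : ((base r s' k)^-1 = gap r p s' pt k + b k)%R by case: k => [i|] /=; ring.
have sb : (\sum_k b k = eta + 1)%R.
  rewrite (bigD1 None)//= (reindex_omap (Some : 'I_m -> option 'I_m) id) => [|[]//].
  rewrite (eq_bigl xpredT) => [|i]; last by rewrite /= eqxx.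
  by rewrite ptE; ring.
(* For [Some i] the ratio is r_i / (p_i - r_i) = p_i / (p_i - r_i) - 1; for [None] it is s' / (pt' -
   s') = pt' / (pt' - s') - 1. *)
have bM k : (b k / gap r p s' pt k <= Theta r s' p pt - 1)%R.
  rewrite lerBrDr; case: k => [i|].
    apply: le_trans (le_bigmax_cond _ (fun i => p i / (p i - r i))%R (erefl true : xpredT i)).
    rewrite /b /gap le_eqVlt; apply/orP; left; apply/eqP; have := rp i; have := p0 i; have := r0 i.
    by move=> a1 a2 a3; field; rewrite !gt_eqF ?subr_gt0.
  apply: le_trans (bigmax_ge_id _ _ _ _).
  move: gapN; rewrite /b /gap; set y := (1 - pt^-1)%R => gy.
  have y0 : (0 < y)%R by rewrite subr_gt0.
  have e1 : (pt^-1 - (1 - s'^-1) = s'^-1 - y)%R by rewrite /y; ring.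
  rewrite e1 in gy *; rewrite le_eqVlt; apply/orP; left; apply/eqP.
  have h : (0 < 1 - s' * y)%R.
    by rewrite subr_gt0 -(@ltr_pM2l _ s'^-1) ?invr_gt0// mulrA mulVf ?gt_eqF// mul1r mulr1 -subr_gt0.
  clearbody y; field; rewrite (gt_eqF y0) (gt_eqF s0) /= andbT.
  by rewrite mulNr (gt_eqF h).
have G0 : (0 < \sum_k gap r p s' pt k)%R.
  by rewrite (bigD1 None)//=; apply: ltr_pwDl => //; apply: sumr_ge0 => k _; exact: ltW (gap0 k).
have [C C0 hC] := sparse_form_sharp lamQ muQ gap0 G0 base0 b0 rgb sb eta0 bM d0.
exists (4 * (K1 * C))%R => [|T [subT domT] w ww Wy f Lf fin]; first by rewrite !mulr_gt0.
have [mw w0] := ww; have [e he] := homogeneous_integrable_pos hom.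
have Wv := muckenhoupt_dual_weights lamQ muQ r0 rp s0 pt0 gapN mw w0 Wy.
rewrite -/(Wc w) in Wv; set W0 := fine (Wc w) in Wv *.
have mT : measurable_fun setT (T f) by have [h _ _] := subT; exact: h.
have mf i : measurable_fun setT (f i) by have [] := Lf i.
have pwE := pweightE w0.
have mpw : measurable_fun setT (fun x => \prod_i pweight w i x)%R.
  by apply: measurable_prod => i _; exact: measurable_pweight.
have pp0 x : (0 < \prod_i pweight w i x)%R by apply: prodr_gt0 => i _; exact: pweight_gt0.
have rhsE i : \int[wmeas Wv (Some i)]_x (wfun (dual_weights r p s' pt w) (base r s') (Some i) (f i) x
    `^ (b (Some i) * base r s' (Some i))^-1) = wpow mu (p i) (w i) (EFin \o f i).
  apply: (etrans (int_wfun_power Wv (base0 (Some i)) (b0 (Some i)) (rgb (Some i)) (mf i))).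
  rewrite [in LHS]invrK; apply: eq_int_ae.
  - apply: nnm_pow; apply/measurable_EFinP; apply: measurable_funM; first exact: measurableT_comp.
    apply: (measurableT_comp (measurable_powR _)); exact: measurable_dual_weights.
  - by apply: nnm_wpow => //; apply/measurable_EFinP.
  apply: filterS pwE => x h; rewrite h dual_weights_Some// abseM EFinM !abse_EFin; congr ((_ * _%:E) `^ _).
  by rewrite ger0_norm// ltW// pweight_gt0.
pose Y x := (`|T f x| * \prod_i pweight w i x)%:E.
have mY : nnm Y.
  apply: nnm_EFin => [|x]; first by apply: measurable_funM => //; exact: measurableT_comp.
  by rewrite mulr_ge0// ltW.
have lhsE : wpow mu pt (weight_prod w) (EFin \o T f) = \int[mu]_x (Y x `^ pt).
  apply: eq_int_ae.
  - by apply: nnm_wpow; [exact: measurable_weight_prod|exact/measurable_EFinP].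
  - by apply: nnm_pow; exact: mY.1.
  apply: filterS pwE => x h; rewrite /Y /weight_prod.
  have -> : (\prod_(i < m) w i x = \prod_(i < m) pweight w i x)%R by apply: eq_bigr.
  by rewrite abseM EFinM !abse_EFin [`|\prod_(i < m) pweight w i x|%R]ger0_norm// ltW.
pose A := \prod_i (wpow mu (p i) (w i) (EFin \o f i) `^ (p i)^-1).
have A0 : 0 <= A by apply: prode_ge0 => i _; exact: poweR_ge0.
have Afin : A \is a fin_num.
  apply: prode_fin_num => i _; rewrite ge0_fin_numE; last exact: poweR_ge0.
  by apply: poweR_lty; exact: fin.
have -> : \prod_i (wpow mu (p i) (w i) (EFin \o f i) `^ (pt / p i)) = A `^ pt.
  rewrite prode_poweR => [|i]; last exact: poweR_ge0.
  by apply: eq_bigr => i _; rewrite -poweRrM mulrC.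
have W0p := muckenhoupt_const_gt0 lamQ muQ Wv.
pose L := (K1 * C * W0 `^ Theta r s' p pt * fine A)%R.
have KC0 : (0 <= K1 * C * W0 `^ Theta r s' p pt)%R.
  exact: mulr_ge0 (ltW (mulr_gt0 K10 C0)) (powR_ge0 _ _).
have L0 : (0 <= L)%R by exact: mulr_ge0 KC0 (fine_ge0 A0).
rewrite lhsE (_ : _ * _ = ((4 * L) `^ pt)%:E); last first.
  rewrite -{1}(fineK Afin) !poweR_EFin -EFinM -powRM ?fine_ge0//; last first.
    by rewrite -mulrA; exact: mulr_ge0.
  by congr ((_ `^ _)%:E); rewrite /L !mulrA.
apply: (dual_poweR he) => // phi mphi phi0 phiy.
pose psi x := (phi x * \prod_i pweight w i x)%R.
have mpsi : measurable_fun setT psi by exact: measurable_funM.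
have psi0 x : (0 <= psi x)%R by rewrite mulr_ge0 ?(ltW (pp0 x)) ?(ltW (phi0 x)).
have nE : \int[wmeas Wv None]_x (wfun (dual_weights r p s' pt w) (base r s') None psi x
    `^ (b None * base r s' None)^-1) = \int[mu]_x (phi x `^ (1 - pt^-1)^-1)%:E.
  apply: (etrans (int_wfun_power Wv (base0 None) (b0 None) (rgb None) mpsi)).
  apply: eq_integral => x _; rewrite -poweR_EFin.
  have -> : (`|psi x| * dual_weights r p s' pt w None x `^ (- gap r p s' pt None) = phi x)%R.
    rewrite powRN dual_weights_None// ger0_norm; last exact: psi0.
    by apply: mulfK; rewrite gt_eqF.
  by [].
have -> : \int[mu]_x (Y x * (phi x)%:E) = \int[mu]_x (`|T f x|%:E * (psi x)%:E).
  by apply: eq_integral => x _; rewrite /Y /psi -!EFinM; congr (_%:E); ring.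
apply: (le_trans (operator_form_dominated hom lamQ r0 s0 K0 subT domT Lf mpsi psi0)).
have -> : L%:E = K1%:E * ((C * W0 `^ Theta r s' p pt)%:E * A).
  by rewrite -[A in RHS](fineK Afin) -!EFinM /L !mulrA.
rewrite -(muleA K1%:E); apply: lee_wpmul2l; first by rewrite lee_fin ltW.
apply: ge_ereal_sup => _ [S [SQ sS] <-].
pose F (k : option 'I_m) := if k is Some i then f i else psi.
have mF k : measurable_fun setT (F k) by case: k => [i|] /=.
have := hC _ _ Wv S SQ sS F mF.
rewrite (eq_esum (b := fun B => mu B `^ (eta + 1) * \prod_i average mu (base r s' (Some i))%:E B (f i) *
    average mu (base r s' None)%:E B psi)) => [|B _]; last first.
  by rewrite prode_option /F -muleA [X in _ = _ * X]muleC.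
rewrite prode_option /F nE; under eq_bigr do rewrite rhsE.
rewrite addrCA subrr addr0 => /le_trans; apply.
by rewrite -muleA [X in _ <= _ * X]muleC.
Qed.

End operator_bounds.

(** * Extension of the operator *)

Section real_sequences.
Context {R : realType}.
Implicit Types u z : nat -> R.

Definition abs_summable z := \sum_(0 <= k <oo) `|z k|%:E < +oo.

Lemma abs_summable_cvg z : abs_summable z -> cvgn (series z).
Proof.
move=> zs; apply: normed_cvg; apply: nondecreasing_is_cvgn.
  by apply/nondecreasing_seqP => n; rewrite -[X in (_ <= X)%R]/(\sum_(0 <= k < n.+1) `|z k|)%R big_nat_recr//= lerDl.
exists (fine (\sum_(0 <= k <oo) `|z k|%:E)) => _ [n _ <-].
have S0 : 0 <= \sum_(0 <= k <oo) `|z k|%:E by apply: nneseries_ge0 => *; rewrite lee_fin.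
rewrite /series /= -lee_fin fineK ?ge0_fin_numE// -sumEFin.
by apply: nneseries_lim_ge => *; rewrite lee_fin.
Qed.

Lemma abs_summable_cvg0 z : abs_summable z -> z @ \oo --> 0%R.
Proof. by move=> /abs_summable_cvg/cvg_series_cvg_0. Qed.

Lemma abs_summable_is_cvg u : abs_summable (fun n => u n.+1 - u n)%R -> cvgn u.
Proof.
move=> /abs_summable_cvg h.
rewrite (_ : u = (fun n => u 0%N + series (fun n => u n.+1 - u n) n)%R).
  by apply: is_cvgD => //; exact: is_cvg_cst.
by apply: funext => n; rewrite /series /= telescope_sumr// addrC subrK.
Qed.

Lemma abs_summable0 : abs_summable (fun=> 0%R).
Proof. by rewrite /abs_summable eseries0// => n _ _; rewrite normr0. Qed.

Lemma le_abs_summable u z : (forall n, `|u n| <= `|z n|)%R -> abs_summable z -> abs_summable u.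
Proof.
by move=> uz; apply: le_lt_trans; apply: lee_nneseries => *; rewrite lee_fin.
Qed.

Lemma abs_summableD u z : abs_summable u -> abs_summable z ->
  abs_summable (fun n => u n + z n)%R.
Proof.
move=> us zs; apply: (@le_lt_trans _ _ (\sum_(0 <= k <oo) (`|u k|%:E + `|z k|%:E))).
  by apply: lee_nneseries => *; rewrite lee_fin// ler_normD.
rewrite nneseriesD => [| |]; try by move=> *; rewrite lee_fin.
exact: lte_add_pinfty.
Qed.

Lemma cvg_powR u (l a : R) : (0 < a)%R -> (0 <= l)%R -> (forall n, 0 <= u n)%R ->
  u @ \oo --> l -> (u n `^ a)%R @[n --> \oo] --> (l `^ a)%R.
Proof.
move=> a0; rewrite le_eqVlt => /predU1P[<-|l0] u0 ul.
  rewrite powR0 ?gt_eqF//; apply/cvgr0Pnorm_lt => e e0.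
  have ea : (0 < e `^ a^-1)%R by rewrite powR_gt0.
  move/cvgr0Pnorm_lt : ul => /(_ _ ea); apply: filterS => n.
  rewrite !ger0_norm ?powR_ge0// => h.
  rewrite -[ltRHS](powRr1 (ltW e0)) -(mulVf (lt0r_neq0 a0)) powRrM.
  by apply: gt0_ltr_powR; rewrite ?nnegrE ?powR_ge0.
have lE : (l `^ a = expR (a * ln l))%R by rewrite /powR gt_eqF.
rewrite lE; apply: (@cvg_trans _ (expR (a * ln (u n)) @[n --> \oo])).
  apply: near_eq_cvg; apply: filterS (cvgr_gt _ ul 0%R l0) => n un.
  by rewrite /powR gt_eqF.
apply: continuous_cvg; first exact: continuous_expR.
apply: cvgM; first exact: cvg_cst.
by apply: continuous_cvg => //; exact: continuous_ln.
Qed.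

Lemma cvg_ell_poweR (tau a c : R) J (u : nat -> nat -> R) (l : nat -> R) : (0 < tau)%R ->
  (0 < a)%R -> (forall j, 0 <= l j)%R -> (forall n j, 0 <= u n j)%R ->
  (forall j, u n j @[n --> \oo] --> l j) ->
  `|ell tau%:E J (fun j => (u n j)%:E) * c%:E| `^ a @[n --> \oo] -->
  `|ell tau%:E J (fun j => (l j)%:E) * c%:E| `^ a.
Proof.
move=> t0 a0 l0 u0 ul.
have eE (v : nat -> R) : `|ell tau%:E J (fun j => (v j)%:E) * c%:E| `^ a =
    (((\sum_(j < J) (v j) `^ tau) `^ tau^-1 * `|c|) `^ a)%:E.
  have -> : ell tau%:E J (fun j => (v j)%:E) = ((\sum_(j < J) (v j) `^ tau) `^ tau^-1)%:E.
    by rewrite /ell; under eq_bigr do rewrite poweR_EFin; rewrite sumEFin poweR_EFin.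
  by rewrite -(EFinM ((\sum_(j < J) (v j) `^ tau) `^ tau^-1)%R c) abse_EFin normrM (ger0_norm (powR_ge0 _ _)) poweR_EFin.
rewrite eE; under eq_fun do rewrite eE.
have S0 (v : nat -> R) : (0 <= \sum_(j < J) (v j) `^ tau)%R.
  by apply: sumr_ge0 => j _; exact: powR_ge0.
apply: cvg_EFin; first by apply: nearW.
apply: (@cvg_powR (fun n => (\sum_(j < J) (u n j) `^ tau) `^ tau^-1 * `|c|)%R) => //.
- by rewrite mulr_ge0// powR_ge0.
- by move=> n; rewrite mulr_ge0// powR_ge0.
apply: cvgM; last exact: cvg_cst.
apply: (@cvg_powR (fun n => \sum_(j < J) (u n j) `^ tau)%R) => //; first by rewrite invr_gt0.
rewrite (_ : (fun n => _) = \sum_(j < J) (fun n => u n j `^ tau))%R; last first.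
  by apply: funext => n; rewrite fct_sumE.
apply: (big_ind2 (fun (F : nat -> R) (y : R) => F @ \oo --> y)) => [|F y G z|j _].
- exact: cvg_cst.
- exact: cvgD.
- exact: cvg_powR.
Qed.

End real_sequences.

(** * Approximation in weighted Lebesgue spaces *)

Section approximation.
Context {R : realType} {d : measure_display} {X : measurableType d}.
Variable mu : {measure set X -> \bar R}.

Lemma fatou_le (f : nat -> X -> \bar R) (g : X -> \bar R) (C : \bar R) :
  (forall n, nnm (f n)) -> nnm g -> (\forall x \ae mu, f ^~ x @ \oo --> g x) ->
  (forall n, \int[mu]_x f n x <= C) -> \int[mu]_x g x <= C.
Proof.
move=> mf mg fg fC.
apply: (@le_trans _ _ (\int[mu]_x limn_einf (f ^~ x))).
  apply: le_int_ae => //.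
    split; last first.
      move=> x; rewrite limn_einf_lim; apply: lime_ge; first exact: is_cvg_einfs.
      by apply: nearW => n; apply: le_ereal_inf_tmp => _ [k _ <-]; exact: (mf k).2.
    rewrite (_ : (fun x => _) = (fun x => - limn_esup (fun n => - f n x))); last first.
      by apply: funext => x; rewrite /limn_einf; congr (- limn_esup _); apply: funext.
    apply: measurableT_comp => //; apply: measurable_fun_limn_esup => n.
    by apply: measurableT_comp => //; exact: (mf n).1.
  by apply: filterS fg => x h; have [-> _] := cvg_limn_einf_sup h.
apply: (le_trans (fatou _ _ _ _)) => //.
- by move=> n; exact: (mf n).1.
- by move=> n x _; exact: (mf n).2.
rewrite limn_einf_lim; apply: lime_le; first exact: is_cvg_einfs.
apply: nearW => n; apply: le_trans (fC n); apply: ereal_inf_lbound.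
by exists n => /=.
Qed.

Variables (p : R) (w : X -> R).
Implicit Types f g : X -> R.
Hypothesis p1 : (1 < p)%R.
Hypothesis mw : measurable_fun setT w.

Let p0 : (0 < p)%R. Proof. exact: lt_trans p1. Qed.

Lemma wLpE f : wLp mu p%:E w f <-> measurable_fun setT f /\ wpow mu p w (EFin \o f) < +oo.
Proof.
rewrite /wLp /= wnormE; split => -[mf h]; split => //; last exact: poweR_lty.
rewrite -[ltLHS](@poweRVK _ p) ?gt_eqF//; last exact: wpow_ge0.
exact: poweR_lty.
Qed.

Lemma wpow_scale f (c : R) : measurable_fun setT f ->
  wpow mu p w (EFin \o (fun x => c * f x)%R) = (`|c| `^ p)%:E * wpow mu p w (EFin \o f).
Proof.
move=> mf; rewrite /wpow -int_scale ?lee_fin ?powR_ge0//; last first.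
  by apply: nnm_wpow => //; exact/measurable_EFinP.
apply: eq_integral => x _.
rewrite (_ : _ * (w x)%:E = c%:E * ((EFin \o f) x * (w x)%:E)); last by rewrite muleA -EFinM.
by rewrite abseM poweRM ?abse_ge0// abse_EFin poweR_EFin.
Qed.

Lemma wpowD_le f g : measurable_fun setT f -> measurable_fun setT g ->
  wpow mu p w (EFin \o (fun x => f x + g x)%R) <=
  (2 `^ p)%:E * (wpow mu p w (EFin \o f) + wpow mu p w (EFin \o g)).
Proof.
move=> mf mg; have mf' := nnm_wpow p mw ((measurable_EFinP _ _).2 mf).
have mg' := nnm_wpow p mw ((measurable_EFinP _ _).2 mg).
rewrite -int_add// -int_scale ?lee_fin ?powR_ge0//; last exact: nnm_add.
apply: le_int.
- by apply: nnm_wpow => //; apply/measurable_EFinP; exact: measurable_funD.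
- by apply: nnm_mul; [apply: nnm_cst; rewrite lee_fin powR_ge0|exact: nnm_add].
move=> x; apply: le_trans (poweRD_le (ltW p0) (abse_ge0 _) (abse_ge0 _)).
apply: lee_poweR; rewrite ?(ltW p0) ?abse_ge0//.
by rewrite -!EFinM !abse_EFin -EFinD lee_fin mulrDl ler_normD.
Qed.

(** The constant 4 absorbs the factor 2^p and the two equal summands, since 2 <= 2^p. *)
Lemma wpowD_le_powR f g (a : R) : (0 <= a)%R -> measurable_fun setT f -> measurable_fun setT g ->
  wpow mu p w (EFin \o f) <= (a `^ p)%:E -> wpow mu p w (EFin \o g) <= (a `^ p)%:E ->
  wpow mu p w (EFin \o (fun x => f x + g x)%R) <= ((4 * a) `^ p)%:E.
Proof.
move=> a0 mf mg fa ga; apply: (le_trans (wpowD_le mf mg)).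
apply: (@le_trans _ _ ((2 `^ p)%:E * ((a `^ p)%:E + (a `^ p)%:E))).
  apply: lee_wpmul2l; [by rewrite lee_fin powR_ge0|exact: (leeD fa ga)].
rewrite -EFinD -EFinM lee_fin powRM// (_ : 4 = 2 * 2)%R; last by rewrite -natrM.
rewrite powRM// -mulrA; apply: ler_wpM2l; first exact: powR_ge0.
rewrite -mulr2n -[leLHS]mulr_natl; apply: ler_wpM2r; first exact: powR_ge0.
rewrite -[leLHS]powRr1//; apply: ler_powR; first by rewrite ler1n.
exact: ltW.
Qed.

(** f is cut off where it is large or far from a base point, and dominated convergence applies. The
    bound |a| <= |f| keeps the norms of the approximants below that of f. *)
Lemma wpow_dense (rho : X -> X -> R) (f : X -> R) (e : R) : homogeneous_type rho mu ->
  wLp mu p%:E w f -> (0 < e)%R -> exists a : X -> R,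
  [/\ Linfb rho a, forall x, (`|a x| <= `|f x|)%R &
      wpow mu p w (EFin \o (fun x => a x - f x)%R) <= e%:E].
Proof.
move=> hom /wLpE[mf fy] e0; pose x0 : X := point.
pose A n := qball rho x0 n.+1%:R `&` [set x | (`|f x| <= n.+1%:R)%R].
have mA n : measurable (A n).
  apply: measurableI; first exact: (homogeneous_measurable_ball hom).
  rewrite -[X in measurable X]setTI; apply: (measurable_fun_ler (f := fun x => `|f x|%R) (g := cst n.+1%:R)) => //.
  exact: measurableT_comp.
pose a n x := if x \in A n then f x else 0%R.
have ma n : measurable_fun setT (a n).
  apply: measurable_fun_ifT => //.
  apply: (measurable_fun_bool true).
  rewrite setTI (_ : _ @^-1` _ = A n)//; apply/seteqP; split => x /=; first by move/set_mem.
  by move/mem_set.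
have Fn n : nnm (fun x => `|(a n x - f x)%:E * (w x)%:E| `^ p).
  by apply: nnm_wpow => //; apply/measurable_EFinP; exact: measurable_funB.
have h : \int[mu]_x (`|(a n x - f x)%:E * (w x)%:E| `^ p) @[n --> \oo] --> 0.
  rewrite -[X in _ --> X](integral0 mu setT).
  have mF := nnm_wpow p mw ((measurable_EFinP _ _).2 mf).
  apply: (@dominated_cvg _ _ _ mu _ measurableT _ _ (fun x => `|(f x)%:E * (w x)%:E| `^ p)).
  - by move=> n; exact: (Fn n).1.
  - move=> x _; apply: cvg_near_cst.
    near=> n; have xA : x \in A n.
      rewrite inE; split => /=.
        rewrite /qball /=; near: n; apply: filterS (nbhs_infty_ger (rho x0 x)) => n.
        by move/le_lt_trans; apply; rewrite ltr_nat.
      near: n; apply: filterS (nbhs_infty_ger `|f x|%R) => n /le_trans; apply.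
      by rewrite ler_nat.
    by rewrite /a xA subrr mul0e abse0 poweR0r// gt_eqF.
  - by move=> x _; rewrite -EFinM abse_EFin poweR_EFin.
  - apply/integrableP; split; first exact: mF.1.
    by under eq_integral do rewrite gee0_abs ?poweR_ge0//.
  - move=> n x _; rewrite gee0_abs ?poweR_ge0//; apply: lee_poweR; rewrite ?abse_ge0 ?(ltW p0)//.
    rewrite !abseM; apply: lee_wpmul2r => //; rewrite !abse_EFin lee_fin /a.
    by case: ifP; rewrite ?subrr ?normr0// sub0r normrN.
have [n hn] : exists n, \int[mu]_x (`|(a n x - f x)%:E * (w x)%:E| `^ p) <= e%:E.
  have /h[n _ hn] : nbhs 0 [set y | y < e%:E].
    by apply: open_nbhs_nbhs; split; [exact: open_ereal_lt_ereal|rewrite /= lte_fin].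
  by exists n; apply: ltW; exact: (hn n (leqnn n)).
exists (a n); split => //.
  split => //.
    by exists n.+1%:R => x; rewrite /a; case: ifP => [/set_mem[]//|_]; rewrite normr0.
  exists x0, n.+1%:R => x; rewrite /a; case: ifP => [/set_mem[]//|_].
  by rewrite eqxx.
by move=> x; rewrite /a; case: ifP => // _; rewrite normr0.
Unshelve. all: by end_near. Qed.

End approximation.

(** * Norms of infinite sequences *)

Section sequence_norms.
Context {R : realType}.
Implicit Types (u : nat -> R) (t : \bar R).

(** Points have counting measure 1, so null sets are empty. *)
Lemma ae_countingP (P : nat -> Prop) : (\forall n \ae (@counting nat R), P n) -> forall n, P n.
Proof.
move=> [A [mA A0 PA]] n; apply: contrapT => nP; have An : A n by apply: PA.
move: A0; rewrite counting_dirac => A0.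
have : \d_n A <= \sum_(k <oo) (\d_k A : \bar R).
  apply: le_trans (nneseries_lim_ge n.+1 _) => //.
  by rewrite big_nat_recr//= leeDr// sume_ge0.
by rewrite A0 diracE mem_set// lee_fin ler10.
Qed.

(** Partial sums increase to the series; for t = +oo an essential supremum for the counting measure
    is a supremum. Estimates uniform in the number of functions thus pass to sequences. *)
Lemma ell_norm_sup t u : 0 < t ->
  ell_norm t u = ereal_sup (range (fun J => ell t J (fun j => `|u j|%:E))).
Proof.
case: t => [t|_|//].
  rewrite lte_fin => t0; rewrite /ell_norm Lnorm_counting//; apply/eqP; rewrite eq_le; apply/andP; split.
    set S := ereal_sup _.
    have SJ J : ell t%:E J (fun j => `|u j|%:E) <= S by apply: ereal_sup_ubound; exists J.
    have S0 : 0 <= S := le_trans (ell_ge0 _ 0 _) (SJ 0%N).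
    rewrite -(poweRK (lt0r_neq0 t0) S0); apply: lee_poweR; first by rewrite invr_ge0 ltW.
      by apply: nneseries_ge0 => *; exact: poweR_ge0.
    apply: lime_le; first by apply: is_cvg_nneseries => *; exact: poweR_ge0.
    apply: nearW => J; rewrite big_mkord.
    apply: le_trans (lee_poweR (ltW t0) (ell_ge0 _ _ _) (SJ J)).
    rewrite /ell poweRVK ?gt_eqF//; last by apply: sume_ge0 => *; exact: poweR_ge0.
  apply: ge_ereal_sup => _ [J _ <-]; apply: lee_poweR; first by rewrite invr_ge0 ltW.
    by apply: sume_ge0 => *; exact: poweR_ge0.
  apply: le_trans (nneseries_lim_ge J _) => [|n _ _]; last exact: poweR_ge0.
  by rewrite big_mkord; exact: lexx.
have c0 : 0 < @counting nat R setT.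
  rewrite lt_neqAle measure_ge0 andbT eq_sym; apply/eqP => /= h.
  have := @ae_countingP (fun=> False); apply => //; last exact: 0%N.
  by exists setT; split.
rewrite /ell_norm unlock c0; apply/eqP; rewrite eq_le; apply/andP; split.
  apply/ess_supP; apply: aeW => n; apply: le_trans (ereal_sup_ubound _); last by exists n.+1.
  exact: (le_bigmax_cond _ (fun j : 'I_n.+1 => `|u j|%:E) (erefl true : xpredT ord_max)).
apply: ge_ereal_sup => _ [J _ <-].
have h := ae_countingP (ess_sup_ge (@counting nat R) (abse \o (EFin \o u))).
rewrite /ell; apply: bigmax_le => [|j _]; last exact: h.
exact: le_trans (abse_ge0 _) (h 0%N).
Qed.

Lemma ell_le_ell_norm t J u : 0 < t -> ell t J (fun j => `|u j|%:E) <= ell_norm t u.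
Proof. by move=> t0; rewrite ell_norm_sup//; apply: ereal_sup_ubound; exists J. Qed.

Lemma abs_le_ell_norm t u j : 0 < t -> `|u j|%:E <= ell_norm t u.
Proof.
move=> t0; apply: le_trans (ell_le_ell_norm j.+1 u t0); rewrite /ell.
case: t t0 => [t|_|//]; last first.
  exact: (le_bigmax_cond _ (fun k : 'I_j.+1 => `|u k|%:E) (erefl true : xpredT ord_max)).
rewrite lte_fin => t0; apply: poweR_le_root => //.
by rewrite big_ord_recr/= leeDr// sume_ge0// => k _; exact: poweR_ge0.
Qed.

Lemma ell_norm0 t : 0 < t -> ell_norm t (fun=> 0%R : R) = 0.
Proof.
move=> t0; rewrite ell_norm_sup//; apply/eqP; rewrite eq_le; apply/andP; split.
  apply: ge_ereal_sup => _ [J _ <-]; rewrite /ell; case: t t0 => [t|_|//].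
    rewrite lte_fin => t0; rewrite big1 => [|k _]; last by rewrite normr0 poweR0r// gt_eqF.
    by rewrite poweR0r// gt_eqF// invr_gt0.
  by apply: bigmax_le => // k _; rewrite normr0.
by apply: le_trans (ell_ge0 _ 0 _) (ereal_sup_ubound _); exists 0%N.
Qed.

(** Superadditivity of the power t' / t. It serves to pass from the natural exponent tau to the
    larger one in the statement. *)
Lemma ell_norm_nonincreasing (t t' : R) u : (0 < t)%R -> (t <= t')%R ->
  ell_norm t'%:E u <= ell_norm t%:E u.
Proof.
move=> t0 tt; have t'0 := lt_le_trans t0 tt.
rewrite !ell_norm_sup ?lte_fin//; apply: ge_ereal_sup => _ [J _ <-].
apply: le_trans (ereal_sup_ubound _); last by exists J.
apply: (@le_trans _ _ (((\sum_(j < J) `|u j|%:E `^ t) `^ (t' / t)) `^ t'^-1)).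
  apply: lee_poweR; first by rewrite invr_ge0 ltW.
    by apply: sume_ge0 => *; exact: poweR_ge0.
  apply: le_trans (poweR_sum_le _ _ _) => [||j].
  - apply: lee_sum => j _; rewrite -poweRrM mulrC divfK ?gt_eqF//.
  - by rewrite ler_pdivlMr// mul1r.
  - exact: poweR_ge0.
by rewrite -poweRrM mulrAC mulfV ?gt_eqF// mul1r.
Qed.

Lemma nnm_ell_norm (d : measure_display) (X : measurableType d) t (f : nat -> X -> R) : 0 < t ->
  (forall j, measurable_fun setT (f j)) -> nnm (fun x => ell_norm t (fun j => f j x)).
Proof.
move=> t0 mf; under eq_fun do rewrite ell_norm_sup//.
have h : nnm (fun x => ereal_sup (range (fun J => ell t J (fun j => `|f j x|%:E)))).
  apply: (@nnm_sup _ _ _ (fun J x => ell t J (fun j => `|f j x|%:E))) => J.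
  by apply: nnm_ell => j; apply: nnm_EFin => //; exact: measurableT_comp.
exact: h.
Qed.

End sequence_norms.

Lemma prode_gt0_pinfty (R : realType) (I : finType) (F : I -> \bar R) (i : I) :
  (forall k, 0 < F k) -> F i = +oo -> \prod_k F k = +oo.
Proof.
move=> F0 Fi; rewrite (bigD1 i)//= Fi gt0_mulye//.
by elim/big_ind : _ => // x y; exact: mule_gt0.
Qed.

Lemma poweR_prod_le (R : realType) (I : finType) (q c : R) (p : I -> R) (V : \bar R)
    (E : I -> \bar R) : (0 < q)%R -> (0 <= c)%R -> 0 <= V -> (forall i, 0 <= E i) ->
  V <= c%:E * \prod_i (E i `^ (q / p i)) ->
  V `^ q^-1 <= (c `^ q^-1)%:E * \prod_i (E i `^ (p i)^-1).
Proof.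
move=> q0 c0 V0 E0 VE.
have P0 : 0 <= \prod_i (E i `^ (q / p i)) by apply: prode_ge0 => i _; exact: poweR_ge0.
apply: (le_trans (lee_poweR _ V0 VE)); first by rewrite invr_ge0 ltW.
rewrite poweRM ?lee_fin// poweR_EFin prode_poweR => [|i]; last exact: poweR_ge0.
rewrite (eq_bigr (fun i => E i `^ (p i)^-1))// => i _.
by rewrite -poweRrM mulrAC mulfV ?gt_eqF// mul1r.
Qed.

Lemma sup_nondecreasing_ell (R : realType) t J J' (u : nat -> \bar R) : 0 < t ->
  (forall j, 0 <= u j) -> (J <= J')%N -> ell t J u <= ell t J' u.
Proof.
move=> t0 u0 /subnKC <-; elim: (J' - J)%N => [|k IH]; first by rewrite addn0.
apply: (le_trans IH); rewrite addnS /ell; case: t t0 {IH} => [t|_|//].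
  rewrite lte_fin => t0; apply: lee_poweR; first by rewrite invr_ge0 ltW.
    by apply: sume_ge0 => *; exact: poweR_ge0.
  by rewrite big_ord_recr/= leeDl// poweR_ge0.
apply: bigmax_le => [|j _]; first exact: bigmax_ge_id.
exact: (le_bigmax_cond _ (fun j : 'I_(J + k).+1 => u j)
  (erefl true : xpredT (widen_ord (leqnSn _) j))).
Qed.

Lemma conjugate_exponent_lt (R : realType) (s x : R) : (0 < s)%R -> (0 < x)%R ->
  x%:E < hoelder_conjugate s%:E -> (1 - s^-1 < x^-1)%R.
Proof.
move=> s0 x0; have := @hoelder_conjugate_eq1 R s%:E (ltNyr _).
rewrite eqe gt_eqF// => /(_ isT); rewrite inver gt_eqF//.
case: (hoelder_conjugate s%:E) => [z| |]; last by rewrite ltNge leNye.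
  rewrite inver; case: eqP => [->|/eqP z0].
    by rewrite lte_fin ltNge (ltW x0).
  rewrite -EFinD => -[<-]; rewrite lte_fin => xz.
  by rewrite addrAC subrr add0r ltf_pV2 ?posrE// (lt_trans x0).
by rewrite invey adde0 => -[->] _; rewrite subrr invr_gt0.
Qed.

Lemma dfwith_dfwith (I : eqType) (T : I -> Type) (f : forall i, T i) i (u u' : T i) :
  dfwith (dfwith f i u) i u' = dfwith f i u'.
Proof.
apply: functional_extensionality_dep => k; have [->|ik] := eqVneq k i.
  by rewrite !dfwithin.
by rewrite !dfwithout// eq_sym.
Qed.

(** * Limits along rapidly converging approximations *)

Section extension.
Context {R : realType} {d : measure_display} {X : measurableType d}.
Variables (rho : X -> X -> R) (mu : {measure set X -> \bar R}).
Hypothesis hom : homogeneous_type rho mu.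
Variables (m : nat) (p : 'I_m -> R) (w : 'I_m -> X -> R) (v : X -> R) (q : R).
Hypothesis p1 : forall i, (1 < p i)%R.
Hypothesis mw : forall i, measurable_fun setT (w i).
Hypothesis mv : measurable_fun setT v.
Hypothesis v0 : \forall x \ae mu, (0 < v x)%R.
Hypothesis q0 : (0 < q)%R.

Let p0 i : (0 < p i)%R. Proof. exact: lt_trans (p1 i). Qed.

Notation E i u := (wpow mu (p i) (w i) (EFin \o u)).

(* Chosen so that the q-th powers of [2 ^+ n.+1 * rate n] are summable. *)
Definition rate (n : nat) : R := ((2 ^+ n.+1)^-1 * (2 ^+ n.+1) `^ (- q^-1))%R.

Lemma rate_gt0 n : (0 < rate n)%R.
Proof. by rewrite mulr_gt0 ?invr_gt0 ?exprn_gt0 ?powR_gt0// exprn_gt0. Qed.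

Lemma rateS n : (rate n.+1 <= rate n)%R.
Proof.
have h : (2 ^+ n.+1 <= 2 ^+ n.+2 :> R)%R by rewrite ler_eXn2l ?ltr1n.
apply: ler_pM; rewrite ?invr_ge0 ?exprn_ge0 ?powR_ge0//.
  by rewrite lef_pV2 ?posrE ?exprn_gt0.
rewrite !powRN lef_pV2 ?posrE ?powR_gt0 ?exprn_gt0//.
by apply: ge0_ler_powR; rewrite ?nnegrE ?invr_ge0 ?exprn_ge0// ltW.
Qed.

Lemma rate_le1 n : (rate n <= 1)%R.
Proof.
have h : (1 <= 2 ^+ n.+1 :> R)%R by rewrite exprn_ege1// ler1n.
apply: mulr_ile1; rewrite ?invr_ge0 ?exprn_ge0 ?powR_ge0//.
  by rewrite invf_le1 ?exprn_gt0.
rewrite powRN invf_le1 ?powR_gt0 ?exprn_gt0//.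
have := ge0_ler_powR (ltW (_ : 0 < q^-1)%R) ler01 (exprn_ge0 _ _) h.
by rewrite powR1; apply; rewrite ?invr_gt0.
Qed.

Lemma rate_poweR n : ((2 ^+ n.+1 * rate n) `^ q = (2 ^+ n.+1)^-1)%R.
Proof.
rewrite /rate mulrA mulfV ?expf_neq0 ?pnatr_eq0// mul1r -powRrM mulNr mulVf ?gt_eqF//.
by rewrite powR_inv1// exprn_ge0.
Qed.

Variable T : ('I_m -> X -> R) -> X -> R.
Hypothesis subT : msublinear mu (fun=> Linfb rho) T.

Let measT f : (forall i, Linfb rho (f i)) -> measurable_fun setT (T f).
Proof. by have [h _ _] := subT; exact: h. Qed.

Definition power_bounded (F : 'I_m -> set (X -> R)) (C : R)
    (S : ('I_m -> X -> R) -> X -> R) :=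
  forall f : 'I_m -> X -> R, (forall i, F i (f i)) -> (forall i, E i (f i) < +oo) ->
  wpow mu q v (EFin \o S f) <= C%:E * \prod_i (E i (f i) `^ (q / p i)).

Variable C : R.
Hypothesis C0 : (0 <= C)%R.
Hypothesis TB : power_bounded (fun=> Linfb rho) C T.

Let qm := homogeneous_quasi_metric hom.

Let LinfbB (f g : X -> R) : Linfb rho f -> Linfb rho g -> Linfb rho (fun x => f x - g x)%R.
Proof.
move=> Lf Lg; have := Linfb_add qm Lf (Linfb_scale (-1) Lg).
by rewrite (_ : (fun x => _) = (fun x => f x - g x)%R)//; apply: funext => x; rewrite mulN1r.
Qed.

(** The n-th difference is at most |T D_n|, where D_n has [u n - u' n] in coordinate i, and the q-th
    power of its norm is of order rate(n)^q. The rate beats the weights 2^(n+1) of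
    [nneseries_poweR_le], so the sum of the |T D_n| has a finite q-th moment, even for q < 1. *)
Lemma coordinate_summable (h : nat -> 'I_m -> X -> R) i (u u' : nat -> X -> R)
    (M : 'I_m -> R) (c : R) : (0 <= c)%R ->
  (forall n k, Linfb rho (h n k)) -> (forall n k, E k (h n k) <= (M k)%:E) ->
  (forall n, Linfb rho (u n)) -> (forall n, Linfb rho (u' n)) ->
  (forall n, E i (fun x => u n x - u' n x)%R <= ((c * rate n) `^ p i)%:E) ->
  \forall x \ae mu, abs_summable
    (fun n => `|T (dfwith (h n) i (u n)) x| - `|T (dfwith (h n) i (u' n)) x|)%R.
Proof.
move=> c0 Lh hM Lu Lu' uu.
pose D n := dfwith (h n) i (fun x => u n x - u' n x)%R.
have Ldf n (z : X -> R) : Linfb rho z -> forall k, Linfb rho (dfwith (h n) i z k).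
  move=> Lz k; have [->|ki] := eqVneq k i; first by rewrite dfwithin.
  by rewrite dfwithout// eq_sym.
have LD n k : Linfb rho (D n k) by apply: Ldf; exact: LinfbB.
(* Sublinearity is applied to u = u' + (u - u') and to u' = u + (u' - u); homogeneity for -1 equates
   |T| at the two differences. *)
have diff_le : \forall x \ae mu, forall n,
    (`| `|T (dfwith (h n) i (u n)) x| - `|T (dfwith (h n) i (u' n)) x| | <= `|T (D n) x|)%R.
  apply/ae_foralln => n; have [_ sub homT] := subT.
  have s1 := sub (h n) i (u' n) (fun x => u n x - u' n x)%R (Lh n) (Lu' n) (LinfbB (Lu n) (Lu' n)).
  have s2 := sub (h n) i (u n) (fun x => u' n x - u n x)%R (Lh n) (Lu n) (LinfbB (Lu' n) (Lu n)).
  have s3 := homT (D n) i (-1)%R (LD n).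
  apply: filterS3 s1 s2 s3 => x; rewrite /D dfwith_dfwith dfwithin -/(D n).
  rewrite (_ : (fun y => u' n y + (u n y - u' n y))%R = u n); last by apply: funext => y; rewrite addrC subrK.
  rewrite (_ : (fun y => u n y + (u' n y - u n y))%R = u' n); last by apply: funext => y; rewrite addrC subrK.
  rewrite (_ : (fun y => -1 * (u n y - u' n y))%R = (fun y => u' n y - u n y)%R); last first.
    by apply: funext => y; rewrite mulN1r opprB.
  rewrite normrN1 mul1r => a1 a2 a3; rewrite a3 in a2.
  by rewrite ler_norml; apply/andP; split; rewrite ?lerBlDl// lerNl opprB lerBlDl.
pose MM := (\prod_(k | k != i) (M k `^ (q / p k)))%R.
have MM0 : (0 <= MM)%R by apply: prodr_ge0 => k _; exact: powR_ge0.
have VD n : wpow mu q v (EFin \o T (D n)) <= (C * ((c * rate n) `^ q * MM))%:E.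
  pose M' k := if k == i then ((c * rate n) `^ p i)%R else M k.
  have EM k : E k (D n k) <= (M' k)%:E.
    rewrite /M' /D; have [->|ki] := eqVneq k i; first by rewrite dfwithin; exact: uu.
    by rewrite dfwithout ?hM// eq_sym.
  apply: (le_trans (TB (LD n) (fun k => le_lt_trans (EM k) (ltry _)))).
  rewrite EFinM; apply: lee_wpmul2l; first by rewrite lee_fin.
  apply: (@le_trans _ _ (\prod_k ((M' k)%:E `^ (q / p k)))).
    apply: lee_prod => k; first exact: poweR_ge0.
    by apply: lee_poweR; [rewrite divr_ge0// ltW|exact: wpow_ge0|exact: EM].
  under eq_bigr do rewrite poweR_EFin.
  rewrite prodEFin lee_fin (bigD1 i)//= /M' eqxx -powRrM [(p i * _)%R]mulrC divfK ?gt_eqF//.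
  by rewrite ler_wpM2l ?powR_ge0// le_eqVlt; apply/orP; left; apply/eqP; apply: eq_bigr => k /negbTE ->.
pose F n x := `|(T (D n) x)%:E * (v x)%:E|.
have mF n : nnm (F n).
  split => [|x]; last exact: abse_ge0.
  apply: measurableT_comp => //; apply: emeasurable_funM; first by apply/measurable_EFinP; exact: measT.
  exact/measurable_EFinP.
have mF' n : nnm (fun x => ((2 ^+ n.+1)%:E * F n x) `^ q).
  by apply: nnm_pow; apply: emeasurable_funM; [exact: measurable_cst|exact: (mF n).1].
have SF : \int[mu]_x ((\sum_(0 <= n <oo) F n x) `^ q) < +oo.
  apply: (@le_lt_trans _ _ (\int[mu]_x \sum_(0 <= n <oo) ((2 ^+ n.+1)%:E * F n x) `^ q)).
    apply: le_int; [by apply: nnm_pow; exact: (nnm_series mF).1|exact: nnm_series|move=> x].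
    by apply: nneseries_poweR_le => // n; exact: (mF n).2.
  rewrite int_series//.
  apply: (@le_lt_trans _ _ (\sum_(0 <= n <oo) ((C * c `^ q * MM) / (2 ^ n.+1)%:R)%:E)).
    apply: lee_nneseries => [n _ _|n _]; first exact: int_ge0.
    rewrite (_ : (fun x => _) = (fun x => ((2 ^+ n.+1) `^ q)%:E * F n x `^ q)); last first.
      by apply: funext => x; rewrite poweRM ?lee_fin ?exprn_ge0 ?(mF n).2// poweR_EFin.
    rewrite int_scale ?lee_fin ?powR_ge0//; last by apply: nnm_pow; exact: (mF n).1.
    apply: (le_trans (lee_wpmul2l _ (VD n))); first by rewrite lee_fin powR_ge0.
    rewrite -EFinM lee_fin natrX -rate_poweR !powRM ?exprn_ge0// ?(ltW (rate_gt0 n))//.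
    by rewrite le_eqVlt; apply/orP; left; apply/eqP; ring.
  apply: le_lt_trans (ltry _); apply: epsilon_trick0.
  by rewrite !mulr_ge0 ?powR_ge0.
have := ae_lty_int (nnm_pow q (nnm_series mF).1) SF.
move: diff_le v0; apply: filterS3 => x hx vx Sx.
have Sy : \sum_(0 <= n <oo) F n x < +oo.
  have S0 : 0 <= \sum_(0 <= n <oo) F n x by apply: nneseries_ge0 => n _ _; exact: (mF n).2.
  by rewrite -(poweRK (lt0r_neq0 q0) S0); exact: poweR_lty.
apply: (le_abs_summable hx); rewrite /abs_summable.
have e n : F n x = (v x)%:E * `|T (D n) x|%:E by rewrite /F abseM !abse_EFin (gtr0_norm vx) muleC.
move: Sy; under eq_eseriesr do rewrite e.
rewrite nneseriesZl; last by move=> n _; rewrite lee_fin.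
set S := \sum_(0 <= n <oo) _ => Sy.
have S0 : 0 <= S by apply: nneseries_ge0 => *; rewrite lee_fin.
by rewrite ltNge leye_eq; apply/negP => /eqP Se; move: Sy; rewrite Se mulry gtr0_sg// mul1e ltxx.
Qed.

Definition approaches (a : nat -> 'I_m -> X -> R) (f : 'I_m -> X -> R) (c : R) :=
  forall n i, Linfb rho (a n i) /\ E i (fun x => a n i x - f i x)%R <= ((c * rate n) `^ p i)%:E.

Definition in_wLp (f : 'I_m -> X -> R) := forall i, wLp mu (p i)%:E (w i) (f i).

Lemma le_approaches a f c c' : (0 <= c)%R -> (c <= c')%R ->
  approaches a f c -> approaches a f c'.
Proof.
move=> c0 cc h n i; have [La Ea] := h n i; split => //; apply: (le_trans Ea); rewrite lee_fin.
apply: ge0_ler_powR; rewrite ?nnegrE ?mulr_ge0 ?(le_trans c0 cc) ?(ltW (p0 i)) ?(ltW (rate_gt0 n))//.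
exact: (ler_wpM2r (ltW (rate_gt0 n)) cc).
Qed.

(** Coordinates are exchanged one at a time: [H k] takes its first k coordinates from b and the
    others from a, and each exchange is an instance of [coordinate_summable]. *)
Lemma approaches_summable a b f c : (0 <= c)%R -> in_wLp f -> approaches a f c ->
  approaches b f c -> \forall x \ae mu, abs_summable (fun n => `|T (a n) x| - `|T (b n) x|)%R.
Proof.
move=> c0 Lf ha hb.
have mf i : measurable_fun setT (f i) by have [] := (wLpE mu _ (p1 i) _).1 (Lf i).
have fy i : E i (f i) < +oo by have [] := (wLpE mu _ (p1 i) _).1 (Lf i).
have mLin u : Linfb rho u -> measurable_fun setT u by case.
(* A bound for the powers of all approximants at once, available because rate n <= 1. *)
pose M i := fine ((2 `^ p i)%:E * ((c `^ p i)%:E + E i (f i))).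
have bound a' n i : approaches a' f c -> E i (a' n i) <= (M i)%:E.
  move=> h; have [La Ea] := h n i.
  have S0 : 0 <= (c `^ p i)%:E + E i (f i).
    by apply: adde_ge0; [rewrite lee_fin powR_ge0|exact: wpow_ge0].
  rewrite fineK; last first.
    rewrite ge0_fin_numE; last by apply: mule_ge0; rewrite // lee_fin powR_ge0.
    by apply: lte_mul_pinfty; rewrite ?lee_fin ?powR_ge0// lte_add_pinfty// ltry.
  have := wpowD_le mu (p1 i) (mw i) (measurable_funB (mLin _ La) (mf i)) (mf i).
  rewrite (_ : (fun x => a' n i x - f i x + f i x)%R = a' n i); last by apply: funext => x; rewrite subrK.
  move=> /le_trans; apply; apply: lee_wpmul2l; first by rewrite lee_fin powR_ge0.
  apply: leeD => //; apply: (le_trans Ea); rewrite lee_fin.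
  apply: ge0_ler_powR; rewrite ?nnegrE ?mulr_ge0 ?(ltW (p0 i)) ?(ltW (rate_gt0 n))//.
  by rewrite ler_piMr// rate_le1.
pose H k n (i : 'I_m) := if (i < k)%N then b n i else a n i.
have LH k n i : Linfb rho (H k n i).
  by rewrite /H; case: ifP => _; [have [] := hb n i|have [] := ha n i].
have EH k n i : E i (H k n i) <= (M i)%:E by rewrite /H; case: ifP => _; exact: bound.
have EAB n i : E i (fun x => a n i x - b n i x)%R <= ((4 * c * rate n) `^ p i)%:E.
  have [La Ea] := ha n i; have [Lb Eb] := hb n i.
  have mfb : measurable_fun setT (fun x => f i x - b n i x)%R.
    by apply: measurable_funB => //; exact: mLin.
  rewrite (_ : (fun x => a n i x - b n i x) = (fun x => (a n i x - f i x) + (f i x - b n i x)))%R; last first.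
    by apply: funext => x; rewrite addrA subrK.
  have cr0 : (0 <= c * rate n)%R by rewrite mulr_ge0// ltW// rate_gt0.
  rewrite -(mulrA 4%R); apply: (wpowD_le_powR (p1 i) (mw i) cr0 _ mfb Ea).
    by apply: measurable_funB => //; exact: mLin.
  rewrite (_ : (fun x => f i x - b n i x)%R = (fun x => -1 * (b n i x - f i x))%R); last first.
    by apply: funext => x; rewrite mulN1r opprB.
  rewrite wpow_scale//; last by apply: measurable_funB => //; exact: mLin.
  by rewrite normrN1 powR1 mul1e.
suff h k : (k <= m)%N -> \forall x \ae mu, abs_summable (fun n => `|T (a n) x| - `|T (H k n) x|)%R.
  have := h m (leqnn m); apply: filterS => x.
  rewrite (_ : (fun n => `|T (a n) x| - `|T (H m n) x|)%R = (fun n => `|T (a n) x| - `|T (b n) x|)%R)//.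
  by apply: funext => n; congr (_ - `|T _ x|)%R; apply: funext => i; rewrite /H ltn_ord.
elim: k => [_|k IH km].
  apply: aeW => x; rewrite (_ : (fun n => _) = (fun=> 0%R)); first exact: abs_summable0.
  by apply: funext => n; rewrite (_ : H 0%N n = a n) ?subrr//; apply: funext => i.
have H1 := IH (ltnW km).
have H2 := @coordinate_summable (H k) (Ordinal km) (fun n => a n (Ordinal km))
  (fun n => b n (Ordinal km)) M (4 * c)%R (mulr_ge0 (ler0n _ _) c0) (LH k) (EH k)
  (fun n => (ha n _).1) (fun n => (hb n _).1) (fun n => EAB n _).
apply: filterS2 H1 H2 => x s1 s2; have := abs_summableD s1 s2; congr abs_summable.
apply: funext => n.
have -> : dfwith (H k n) (Ordinal km) (a n (Ordinal km)) = H k n.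
  apply: funext => i; have [->|ik] := eqVneq i (Ordinal km).
    by rewrite dfwithin /H /= ltnn.
  by rewrite dfwithout// eq_sym.
have -> : dfwith (H k n) (Ordinal km) (b n (Ordinal km)) = H k.+1 n.
  apply: funext => i; have [->|ik] := eqVneq i (Ordinal km).
    by rewrite dfwithin /H /= ltnSn.
  rewrite dfwithout 1?eq_sym// /H ltnS [in RHS]leq_eqVlt.
  by rewrite (negbTE (_ : (i : nat) != k))//; apply: contra ik => /eqP ik; apply/eqP/val_inj.
by rewrite addrA subrK.
Qed.

Variable A : forall i : 'I_m, (X -> R) -> nat -> X -> R.
Hypothesis hA : forall i u, wLp mu (p i)%:E (w i) u -> forall n,
  [/\ Linfb rho (A i u n), forall x, (`|A i u n x| <= `|u x|)%R &
      E i (fun x => A i u n x - u x)%R <= (rate n `^ p i)%:E].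

(* Only |T f| is determined by approximation; this suffices for an operator which
   is merely sublinear. *)
Definition extension (f : 'I_m -> X -> R) : X -> R :=
  if `[< forall i, Linfb rho (f i) >] then T f
  else fun x => fine (limn_esup (fun n => `|T (fun i => A i (f i) n) x|%:E)).

Lemma approximation_approaches f : in_wLp f -> approaches (fun n i => A i (f i) n) f 1.
Proof. by move=> Lf n i; have [LA _ EA] := hA (Lf i) n; rewrite mul1r. Qed.

(** Along two rapidly converging sequences the values of |T| have summable differences, which tend
    to 0. If all the f i are bounded with bounded support, the second sequence is constantly f.
    Otherwise it is the one defining the extension, whose values converge by comparison with its own
    shift. *)
Lemma extension_cvg f a c : (0 <= c)%R -> in_wLp f -> approaches a f c ->
  \forall x \ae mu, `|T (a n) x|%R @[n --> \oo] --> `|extension f x|%R.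
Proof.
move=> c0 Lf ha; rewrite /extension; case: asboolP => [Lif|_].
  have hf : approaches (fun=> f) f c.
    move=> n i; split => //; rewrite (_ : wpow _ _ _ _ = 0) ?lee_fin ?powR_ge0//.
    rewrite -[RHS](integral0 mu setT); apply: eq_integral => x _.
    have -> : (EFin \o (fun x => f i x - f i x)%R) x = 0 by rewrite /comp subrr.
    by rewrite mul0e abse0 poweR0r// gt_eqF.
  apply: filterS (approaches_summable c0 Lf ha hf) => x /abs_summable_cvg0 h.
  rewrite -[X in _ --> X]add0r.
  rewrite (_ : (fun n => _) = (fun n => (`|T (a n) x| - `|T f x|) + `|T f x|))%R; last first.
    by apply: funext => n; rewrite subrK.
  by apply: cvgD => //; exact: cvg_cst.
pose b n i := A i (f i) n.
have hb : approaches b f 1 by exact: approximation_approaches.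
have hb' : approaches (fun n => b n.+1) f 1.
  move=> n i; apply: (conj (hb n.+1 i).1); apply: (le_trans (hb n.+1 i).2); rewrite lee_fin.
  apply: ge0_ler_powR; rewrite ?nnegrE ?mulr_ge0 ?(ltW (p0 i)) ?(ltW (rate_gt0 _))//.
  by rewrite !mul1r rateS.
have c1 : (0 <= Num.max c 1)%R by rewrite le_max c0.
have ha1 : approaches a f (Num.max c 1%R) by apply: le_approaches ha; rewrite ?le_max ?lexx.
have hb1 : approaches b f (Num.max c 1%R).
  by apply: (le_approaches _ _ hb); rewrite ?le_max ?lexx ?orbT.
have H1 := approaches_summable c1 Lf ha1 hb1.
have H2 := approaches_summable ler01 Lf hb' hb.
apply: filterS2 H1 H2 => x /abs_summable_cvg0 h1 /(@abs_summable_is_cvg _ (fun n => `|T (b n) x|%R)).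
move=> /cvg_ex[l bl].
have l0 : (0 <= l)%R by apply: (ler_cvg_to (cvg_cst _) bl); exact: nearW.
have ble : `|T (b n) x|%:E @[n --> \oo] --> l%:E by apply: cvg_EFin => //; exact: nearW.
rewrite (cvg_limn_einf_sup ble).2.
rewrite /= ger0_norm// -[l]add0r.
rewrite (_ : (fun n => _) = (fun n => (`|T (a n) x| - `|T (b n) x|) + `|T (b n) x|))%R; last first.
  by apply: funext => n; rewrite subrK.
by apply: cvgD.
Qed.

Lemma measurable_extension f : in_wLp f -> measurable_fun setT (extension f).
Proof.
move=> Lf; rewrite /extension; case: asboolP => [|_]; first exact: measT.
apply: (measurableT_comp (fine_measurable _)) => //.
apply: measurable_fun_limn_esup => n; apply/measurable_EFinP; apply: measurableT_comp => //.
by apply: measT => i; have [] := hA (Lf i) n.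
Qed.

Lemma extension_extends :
  operator_extends mu (fun=> Linfb rho) (fun i => wLp mu (p i)%:E (w i)) T extension.
Proof. by move=> f Lf _; apply: aeW => x; rewrite /extension; case: asboolP. Qed.

Let mLin (u : X -> R) : Linfb rho u -> measurable_fun setT u. Proof. by case. Qed.

Let mwLp i u : wLp mu (p i)%:E (w i) u -> measurable_fun setT u. Proof. by case. Qed.

Lemma in_wLp_dfwith f i u : in_wLp f -> wLp mu (p i)%:E (w i) u -> in_wLp (dfwith f i u).
Proof.
move=> Lf Lu k; have [->|ki] := eqVneq k i; first by rewrite dfwithin.
by rewrite dfwithout// eq_sym.
Qed.

Lemma approaches_dfwith a f c i (u : nat -> X -> R) (u' : X -> R) : approaches a f c ->
  (forall n, Linfb rho (u n) /\ E i (fun x => u n x - u' x)%R <= ((c * rate n) `^ p i)%:E) ->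
  approaches (fun n => dfwith (a n) i (u n)) (dfwith f i u') c.
Proof.
move=> ha hu n k; have [->|ki] := eqVneq k i; first by rewrite !dfwithin.
by rewrite !dfwithout// eq_sym.
Qed.

(** Both laws hold for approximants and pass to the limit. Sums and multiples of the chosen
    approximants need not be chosen ones, but every rapidly converging sequence computes |extension
    f|. *)
Lemma extension_msublinear : msublinear mu (fun i => wLp mu (p i)%:E (w i)) extension.
Proof.
have [_ sub homT] := subT.
have ya u i : wLp mu (p i)%:E (w i) u -> E i u < +oo.
  by move=> h; have [] := (wLpE mu _ (p1 i) _).1 h.
split => [f Lf|f i g h Lf Lg Lh|f i c Lf]; first exact: measurable_extension.
- have mg := mwLp Lg; have mh := mwLp Lh.
  pose a n k := A k (f k) n.
  have LA k u n : wLp mu (p k)%:E (w k) u -> Linfb rho (A k u n) by move=> Lu; have [] := hA Lu n.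
  (* A sum of two approximants is only within 4 rate n of the sum of the functions, so this constant
     is taken in every coordinate. *)
  have ha : approaches a f 4.
    by apply: (le_approaches ler01 _ (approximation_approaches Lf)); rewrite ler1n.
  have near u : wLp mu (p i)%:E (w i) u -> forall n,
      E i (fun x => A i u n x - u x)%R <= ((1 * rate n) `^ p i)%:E.
    by move=> Lu n; have [_ _] := hA Lu n; rewrite mul1r.
  have near4 u : wLp mu (p i)%:E (w i) u -> forall n,
      Linfb rho (A i u n) /\ E i (fun x => A i u n x - u x)%R <= ((4 * rate n) `^ p i)%:E.
    move=> Lu n; split; first exact: LA.
    apply: (le_trans (near u Lu n)); rewrite lee_fin.
    apply: ge0_ler_powR; rewrite ?nnegrE ?mulr_ge0 ?(ltW (p0 i)) ?(ltW (rate_gt0 _))//.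
    by apply: ler_wpM2r; [exact: ltW (rate_gt0 n)|rewrite ler1n].
  have Lgh : wLp mu (p i)%:E (w i) (fun y => g y + h y)%R.
    apply/(wLpE mu _ (p1 i)); split; first exact: measurable_funD.
    apply: le_lt_trans (wpowD_le mu (p1 i) (mw i) mg mh) _.
    by apply: lte_mul_pinfty; rewrite ?lee_fin ?powR_ge0// lte_add_pinfty// ya.
  have hs n : Linfb rho (fun x => A i g n x + A i h n x)%R /\
      E i (fun x => (A i g n x + A i h n x) - (g x + h x))%R <= ((4 * rate n) `^ p i)%:E.
    split; first exact: Linfb_add qm (LA _ _ n Lg) (LA _ _ n Lh).
    rewrite (_ : (fun x => _) = (fun x => (A i g n x - g x) + (A i h n x - h x)))%R; last first.
      by apply: funext => x; ring.
    have := near g Lg n; have := near h Lh n; rewrite mul1r => e1 e2.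
    apply: (wpowD_le_powR (p1 i) (mw i) (ltW (rate_gt0 n)) _ _ e2 e1).
    + by apply: measurable_funB => //; apply: mLin; exact: LA Lg.
    + by apply: measurable_funB => //; apply: mLin; exact: LA Lh.
  have c4 : (0 <= 4 :> R)%R by [].
  have cg := extension_cvg c4 (in_wLp_dfwith Lf Lg) (approaches_dfwith ha (near4 g Lg)).
  have ch := extension_cvg c4 (in_wLp_dfwith Lf Lh) (approaches_dfwith ha (near4 h Lh)).
  have cs := extension_cvg c4 (in_wLp_dfwith Lf Lgh) (approaches_dfwith ha hs).
  have sn : \forall x \ae mu, forall n,
      (`|T (dfwith (a n) i (fun y => A i g n y + A i h n y)) x| <=
       `|T (dfwith (a n) i (A i g n)) x| + `|T (dfwith (a n) i (A i h n)) x|)%R.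
    apply/ae_foralln => n; apply: (sub (a n) i (A i g n) (A i h n)) => [k||].
    - exact: LA (Lf k).
    - exact: LA Lg.
    - exact: LA Lh.
  apply: filterS2 cg (filterI ch (filterI cs sn)) => x ug [uh [us un]].
  by apply: (ler_cvg_to us (cvgD ug uh)); apply: nearW => n; exact: un.
- pose a n k := A k (f k) n.
  have LA k n : Linfb rho (a n k) by have [] := hA (Lf k) n.
  have mf := mwLp (Lf i).
  (* Multiplication by c multiplies distances by |c| in coordinate i, while the other coordinates
     keep the constant 1. *)
  pose c' := Num.max 1%R `|c|%R.
  have c'0 : (0 <= c')%R by rewrite le_max ler01.
  have ha : approaches a f c'.
    by apply: (le_approaches ler01 _ (approximation_approaches Lf)); rewrite le_max lexx.
  have Lcf : wLp mu (p i)%:E (w i) (fun y => c * f i y)%R.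
    apply/(wLpE mu _ (p1 i)); split; first by apply: measurable_funM => //; exact: measurable_cst.
    by rewrite wpow_scale//; apply: lte_mul_pinfty; rewrite ?lee_fin ?powR_ge0// ya.
  have hs n : Linfb rho (fun x => c * a n i x)%R /\
      E i (fun x => c * a n i x - c * f i x)%R <= ((c' * rate n) `^ p i)%:E.
    split; first exact: Linfb_scale.
    rewrite (_ : (fun x => _) = (fun x => c * (a n i x - f i x)))%R; last first.
      by apply: funext => x; ring.
    rewrite wpow_scale//; last by apply: measurable_funB => //; apply: mLin.
    have [_ _ e1] := hA (Lf i) n; rewrite powRM// ?(ltW (rate_gt0 n))// EFinM.
    apply: lee_pmul => //; rewrite ?lee_fin ?powR_ge0 ?wpow_ge0//.
    by apply: ge0_ler_powR; rewrite ?nnegrE ?normr_ge0 ?(ltW (p0 i))// le_max lexx orbT.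
  have cf := extension_cvg c'0 Lf ha.
  have cs := extension_cvg c'0 (in_wLp_dfwith Lf Lcf) (approaches_dfwith ha hs).
  have sn : \forall x \ae mu, forall n,
      (`|T (dfwith (a n) i (fun y => c * a n i y)) x| = `|c| * `|T (a n) x|)%R.
    by apply/ae_foralln => n; exact: homT.
  apply: filterS3 cf cs sn => x uf us un.
  rewrite (_ : (fun n => _) = (fun n => `|c| * `|T (a n) x|)%R) in us; last exact: funext.
  apply: (cvg_unique _ us); first exact: norm_hausdorff.
  by apply: cvgM => //; exact: cvg_cst.
Qed.

(** Fatou's lemma along the approximants, whose norms are at most those of f because they are
    dominated by f pointwise. *)
Lemma extension_bound C' : (0 <= C')%R -> power_bounded (fun=> Linfb rho) C' T ->
  power_bounded (fun i => wLp mu (p i)%:E (w i)) C' extension.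
Proof.
move=> C'0 bT f Lf fy; pose a n i := A i (f i) n.
have ha := approximation_approaches Lf.
have La n i : Linfb rho (a n i) by have [] := hA (Lf i) n.
have mT n : measurable_fun setT (T (a n)) by apply: measT.
have Ea n i : E i (a n i) <= E i (f i).
  apply: le_wpow => //; first exact: ltW.
  - by apply/measurable_EFinP; exact: mLin.
  - by apply/measurable_EFinP; exact: mwLp (Lf i).
  - by apply: aeW => x; have [_ h _] := hA (Lf i) n; rewrite /comp !abse_EFin lee_fin; exact: h.
apply: (@fatou_le _ _ _ mu (fun n x => `|(T (a n) x)%:E * (v x)%:E| `^ q)).
- by move=> n; apply: nnm_wpow => //; exact/measurable_EFinP.
- by apply: nnm_wpow => //; apply/measurable_EFinP; exact: measurable_extension.
- apply: filterS (extension_cvg ler01 Lf ha) => x cx.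
  rewrite -EFinM abse_EFin poweR_EFin normrM.
  under eq_fun do rewrite -EFinM abse_EFin poweR_EFin normrM.
  apply: cvg_EFin; first exact: nearW.
  apply: (@cvg_powR _ (fun n => `|T (a n) x| * `|v x|)%R) => //.
  by apply: cvgM => //; exact: cvg_cst.
move=> n; apply: (le_trans (bT (a n) (La n) (fun i => le_lt_trans (Ea n i) (fy i)))).
apply: lee_wpmul2l; first by rewrite lee_fin.
apply: lee_prod => i; first exact: poweR_ge0.
by apply: lee_poweR (Ea n i); [rewrite divr_ge0// ltW|exact: wpow_ge0].
Qed.

Lemma extension_vector_bound (t : 'I_m -> \bar R) (tau C' : R) J : (forall i, 0 < t i) ->
  (0 < tau)%R -> (0 <= C')%R ->
  (forall g : nat -> 'I_m -> X -> R, (forall j i, Linfb rho (g j i)) ->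
    (forall i, wpow mu (p i) (w i) (fun x => ell (t i) J (fun j => `|g j i x|%:E)) < +oo) ->
    wpow mu q v (fun x => ell tau%:E J (fun j => `|T (g j) x|%:E)) <=
    C'%:E * \prod_i (wpow mu (p i) (w i) (fun x => ell (t i) J (fun j => `|g j i x|%:E)) `^ (q / p i))) ->
  forall f : nat -> 'I_m -> X -> R, (forall j, in_wLp (f j)) ->
    (forall i, wpow mu (p i) (w i) (fun x => ell (t i) J (fun j => `|f j i x|%:E)) < +oo) ->
    wpow mu q v (fun x => ell tau%:E J (fun j => `|extension (f j) x|%:E)) <=
    C'%:E * \prod_i (wpow mu (p i) (w i) (fun x => ell (t i) J (fun j => `|f j i x|%:E)) `^ (q / p i)).
Proof.
move=> t0 tau0 C'0 bT f Lf fy; pose a n j i := A i (f j i) n.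
have ha j := approximation_approaches (Lf j).
have La n j i : Linfb rho (a n j i) by have [] := hA (Lf j i) n.
have nT n j : nnm (fun x => `|T (a n j) x|%:E).
  by apply: nnm_EFin => //; apply: measurableT_comp => //; exact: measT.
have nX j : nnm (fun x => `|extension (f j) x|%:E).
  by apply: nnm_EFin => //; apply: measurableT_comp => //; exact: measurable_extension.
have na n j i : nnm (fun x => `|a n j i x|%:E).
  by apply: nnm_EFin => //; apply: measurableT_comp => //; exact: mLin.
have nf j i : nnm (fun x => `|f j i x|%:E).
  by apply: nnm_EFin => //; apply: measurableT_comp => //; exact: mwLp (Lf j i).
have Ea n i : wpow mu (p i) (w i) (fun x => ell (t i) J (fun j => `|a n j i x|%:E)) <=
    wpow mu (p i) (w i) (fun x => ell (t i) J (fun j => `|f j i x|%:E)).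
  apply: le_wpow => //; first exact: ltW.
  - exact: (nnm_ell (t i) J (fun j => na n j i)).1.
  - exact: (nnm_ell (t i) J (fun j => nf j i)).1.
  - apply: aeW => x; rewrite !gee0_abs ?ell_ge0//; apply: le_ell => [|j _|j _]; first exact: ltW.
      by rewrite lee_fin.
    by rewrite lee_fin; have [_ h _] := hA (Lf j i) n; exact: h.
apply: (@fatou_le _ _ _ mu (fun n x =>
    `|ell tau%:E J (fun j => `|T (a n j) x|%:E) * (v x)%:E| `^ q)).
- by move=> n; apply: nnm_wpow => //; exact: (nnm_ell tau%:E J (nT n)).1.
- by apply: nnm_wpow => //; exact: (nnm_ell tau%:E J nX).1.
- have cj : \forall x \ae mu, forall j, `|T (a n j) x|%R @[n --> \oo] --> `|extension (f j) x|%R.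
    by apply/ae_foralln => j; exact: extension_cvg ler01 (Lf j) (ha j).
  apply: filterS cj => x cx.
  exact: (@cvg_ell_poweR _ _ _ _ J (fun n j => `|T (a n j) x|%R) (fun j => `|extension (f j) x|%R)).
move=> n; apply: (le_trans (bT (a n) (La n) (fun i => le_lt_trans (Ea n i) (fy i)))).
apply: lee_wpmul2l; first by rewrite lee_fin.
apply: lee_prod => i; first exact: poweR_ge0.
by apply: lee_poweR (Ea n i); [rewrite divr_ge0// ltW|exact: wpow_ge0].
Qed.

(** The number J of functions tends to infinity by monotone convergence, and l^tau norms dominate
    l^tt norms. Norms equal to 0 or +oo are treated first, since the bound for J functions assumes
    finite norms. *)
Lemma extension_vector_norm (t : 'I_m -> \bar R) (tt tau C' : R) : (forall i, 0 < t i) ->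
  (0 < tau)%R -> (tau <= tt)%R -> (0 < C')%R ->
  (forall J (g : nat -> 'I_m -> X -> R), (forall j i, Linfb rho (g j i)) ->
    (forall i, wpow mu (p i) (w i) (fun x => ell (t i) J (fun j => `|g j i x|%:E)) < +oo) ->
    wpow mu q v (fun x => ell tau%:E J (fun j => `|T (g j) x|%:E)) <=
    C'%:E * \prod_i (wpow mu (p i) (w i) (fun x => ell (t i) J (fun j => `|g j i x|%:E)) `^ (q / p i))) ->
  forall f : nat -> 'I_m -> X -> R, (forall j, in_wLp (f j)) ->
    wnorm mu q%:E v (fun x => ell_norm tt%:E (fun j => extension (f j) x)) <=
    (C' `^ q^-1)%:E * \prod_i wnorm mu (p i)%:E (w i) (fun x => ell_norm (t i) (fun j => f j i x)).
Proof.
move=> t0 tau0 taut C'0 bT f Lf; have tt0 := lt_le_trans tau0 taut.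
pose F i x := ell_norm (t i) (fun j => f j i x).
have mf j i : measurable_fun setT (f j i) by exact: mwLp (Lf j i).
have mX j : measurable_fun setT (extension (f j)) by exact: measurable_extension.
have nF i : nnm (F i) by apply: nnm_ell_norm.
have nG : nnm (fun x => ell_norm tt%:E (fun j => extension (f j) x)) by exact: nnm_ell_norm.
rewrite wnormE; under eq_bigr do rewrite wnormE -/(F _).
have N0 i : 0 <= wpow mu (p i) (w i) (F i) by exact: wpow_ge0.
(* A vanishing factor makes the right-hand side 0 even if another factor is +oo. The scalar bound
   then shows that each extension (f j) vanishes almost everywhere. *)
have [[i Fi0]|F0] := pselect (exists i, wpow mu (p i) (w i) (F i) = 0).
  have X0 : \forall x \ae mu, forall j, extension (f j) x = 0%R.
    apply/ae_foralln => j.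
    have Ei k : E k (f j k) <= wpow mu (p k) (w k) (F k).
      apply: le_wpow => //; [exact: ltW|exact/measurable_EFinP|exact: (nF k).1|].
      apply: aeW => x; rewrite [leRHS]gee0_abs; last exact: (nF k).2.
      exact: (abs_le_ell_norm (fun j => f j k x) j (t0 k)).
    have Ei0 : E i (f j i) = 0 by apply/eqP; rewrite eq_le wpow_ge0 andbT -Fi0 Ei.
    have fy k : E k (f j k) < +oo by have [] := (wLpE mu _ (p1 k) _).1 (Lf j k).
    have := extension_bound C0 TB (Lf j) fy.
    rewrite (@prode_eq0 _ _ _ i) ?mule0//; last by rewrite Ei0 poweR0r// gt_eqF// divr_gt0.
    move=> V0; have {}V0 : wpow mu q v (EFin \o extension (f j)) = 0.
      by apply/eqP; rewrite eq_le V0 wpow_ge0.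
    have := ae_eq0_int (nnm_wpow q mv ((measurable_EFinP _ _).2 (mX j))) V0.
    apply: filterS2 v0 => x vx /(poweR_eq0_eq0 (abse_ge0 _)) /eqP.
    rewrite abse_eq0 mule_eq0 !eqe (gt_eqF vx) orbF.
    by move/eqP.
  rewrite (_ : wpow _ _ _ _ = 0); last first.
    rewrite -[RHS](integral0 mu setT); apply: eq_int_ae; first exact: nnm_wpow nG.1.
      exact: nnm_cst.
    apply: filterS X0 => x X0; rewrite (_ : (fun j => _) = (fun=> 0%R)); last exact: funext.
    by rewrite ell_norm0 ?lte_fin// mul0e abse0 poweR0r// gt_eqF.
  rewrite poweR0r ?gt_eqF ?invr_gt0//; apply: mule_ge0; first by rewrite lee_fin powR_ge0.
  by apply: prode_ge0 => k _; exact: poweR_ge0.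
have Fp i : 0 < wpow mu (p i) (w i) (F i).
  by rewrite lt_neqAle N0 andbT eq_sym; apply/eqP => Fi0; apply: F0; exists i.
have [[i Fiy]|Fy] := pselect (exists i, wpow mu (p i) (w i) (F i) = +oo).
  rewrite (@prode_gt0_pinfty _ _ _ i) => [|k|].
  - by rewrite gt0_muley ?leey// lte_fin powR_gt0.
  - by apply: poweR_gt0; exact: Fp.
  - by rewrite Fiy poweRyr// gt_eqF// invr_gt0.
have {}Fy i : wpow mu (p i) (w i) (F i) < +oo.
  by rewrite ltey; apply/eqP => Fiy; apply: Fy; exists i.
apply: poweR_prod_le => //; [exact: ltW|exact: wpow_ge0|].
pose G J x := `|ell tau%:E J (fun j => `|extension (f j) x|%:E) * (v x)%:E| `^ q.
have nX j : nnm (fun x => `|extension (f j) x|%:E).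
  by apply: nnm_EFin => //; exact: measurableT_comp.
have nf j i : nnm (fun x => `|f j i x|%:E) by apply: nnm_EFin => //; exact: measurableT_comp.
have mG J : nnm (G J) by apply: nnm_wpow => //; exact: (nnm_ell tau%:E J nX).1.
apply: (@le_trans _ _ (\int[mu]_x ereal_sup (range (G^~ x)))).
  apply: le_int; [exact: nnm_wpow nG.1|exact: nnm_sup|move=> x].
  set S := ereal_sup _; have GS J : G J x <= S by apply: ereal_sup_ubound; exists J.
  have S0 : 0 <= S := le_trans ((mG 0%N).2 x) (GS 0%N).
  have [vx|vx] := eqVneq (v x) 0%R; first by rewrite vx mule0 abse0 poweR0r// gt_eqF.
  have vp : (0 < `|v x|)%R by rewrite normr_gt0.
  rewrite -(poweRVK (lt0r_neq0 q0) S0); apply: lee_poweR; [exact: ltW|exact: abse_ge0|].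
  rewrite abseM abse_EFin gee0_abs; last exact: nG.2.
  rewrite -lee_pdivlMr//.
  apply: (@le_trans _ _ (ell_norm tau%:E (fun j => extension (f j) x))).
    exact: ell_norm_nonincreasing.
  rewrite ell_norm_sup ?lte_fin//; apply: ge_ereal_sup => _ [J _ <-].
  rewrite lee_pdivlMr//; apply: poweR_le_root => //.
    by rewrite mule_ge0// ?ell_ge0// lee_fin.
  apply: le_trans (GS J); rewrite /G abseM abse_EFin gee0_abs//; exact: ell_ge0.
apply: int_sup_le => // [x J J' JJ'|J].
  apply: lee_poweR; rewrite ?abse_ge0 ?(ltW q0)// !abseM; apply: lee_wpmul2r => //.
  rewrite !gee0_abs ?ell_ge0//; exact: sup_nondecreasing_ell.
have EF i : wpow mu (p i) (w i) (fun x => ell (t i) J (fun j => `|f j i x|%:E)) <=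
    wpow mu (p i) (w i) (F i).
  apply: le_wpow => //; [exact: ltW|exact: (nnm_ell (t i) J (fun j => nf j i)).1|exact: (nF i).1|].
  apply: aeW => x; rewrite !gee0_abs ?ell_ge0//; first exact: ell_le_ell_norm.
  exact: (nF i).2.
apply: (le_trans (extension_vector_bound t0 tau0 (ltW C'0) (bT J) Lf (fun i => le_lt_trans (EF i) (Fy i)))).
apply: lee_wpmul2l; first by rewrite lee_fin ltW.
apply: lee_prod => i; first exact: poweR_ge0.
by apply: lee_poweR (EF i); [rewrite divr_ge0// ltW|exact: wpow_ge0].
Qed.

End extension.

Lemma ae_weight_prod (R : realType) (d : measure_display) (X : measurableType d)
  (mu : {measure set X -> \bar R}) (m : nat) (w : 'I_m -> X -> R) :
  ae_weights mu w -> \forall x \ae mu, (0 < weight_prod w x)%R.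
Proof.
move=> [_ w0]; have : \forall x \ae mu, forall i, (0 < w i x)%R by exact: filter_forall.
by apply: filterS => x wx; apply: prodr_gt0.
Qed.

Lemma exists_approximation (R : realType) (d : measure_display) (X : measurableType d)
  (rho : X -> X -> R) (mu : {measure set X -> \bar R}) (m : nat) (p : 'I_m -> R)
  (w : 'I_m -> X -> R) (q : R) : homogeneous_type rho mu -> (forall i, (1 < p i)%R) ->
  (forall i, measurable_fun setT (w i)) ->
  exists A : 'I_m -> (X -> R) -> nat -> X -> R,
  forall i u, wLp mu (p i)%:E (w i) u -> forall n,
  [/\ Linfb rho (A i u n), forall x, (`|A i u n x| <= `|u x|)%R &
    wpow mu (p i) (w i) (EFin \o (fun x => A i u n x - u x)%R) <= (rate q n `^ p i)%:E].
Proof.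
move=> hom p1 mw.
have h (k : 'I_m * (X -> R) * nat) : exists a : X -> R, wLp mu (p k.1.1)%:E (w k.1.1) k.1.2 ->
    [/\ Linfb rho a, forall x, (`|a x| <= `|k.1.2 x|)%R &
      wpow mu (p k.1.1) (w k.1.1) (EFin \o (fun x => a x - k.1.2 x)%R) <=
      (rate q k.2 `^ p k.1.1)%:E].
  case: k => -[i u] n /=; have [Lu|nLu] := pselect (wLp mu (p i)%:E (w i) u).
    have [a ha] := wpow_dense (p1 i) (mw i) hom Lu (powR_gt0 (p i) (rate_gt0 q n)).
    by exists a.
  by exists u.
have [A hA] := choice h.
by exists (fun i u n => A (i, u, n)) => i u Lu n; exact: (hA (i, u, n)).
Qed.

Lemma operator_norm_le (R : realType) (d : measure_display) (X : measurableType d)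
  (mu : {measure set X -> \bar R}) (m : nat) (p : 'I_m -> R) (w : 'I_m -> X -> R) (v : X -> R)
  (q c : R) (T : ('I_m -> X -> R) -> X -> R) : (forall i, (1 < p i)%R) -> (0 < q)%R -> (0 <= c)%R ->
  power_bounded mu p w v q (fun i => wLp mu (p i)%:E (w i)) (c `^ q) T ->
  operator_norm mu (EFin \o p) w q%:E v T <= c%:E.
Proof.
move=> p1 q0 c0 hT; apply: ereal_inf_lbound; exists c => //; split => // f Lf.
rewrite wnormE (eq_bigr (fun i => wpow mu (p i) (w i) (EFin \o f i) `^ (p i)^-1)) => [|i _]; last exact: wnormE.
have fy i : wpow mu (p i) (w i) (EFin \o f i) < +oo by have [] := (wLpE mu _ (p1 i) _).1 (Lf i).
have := poweR_prod_le q0 (powR_ge0 _ _) (wpow_ge0 _ _ _ _) (fun i => wpow_ge0 _ _ _ _) (hT f Lf fy).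
by rewrite -powRrM mulfV ?gt_eqF// powRr1.
Qed.

Local Close Scope ereal_scope.

Theorem corollary2p14 (R : realType) (d : measure_display)
  (X : measurableType d) (rho : X -> X -> R) (mu : {measure set X -> \bar R})
  (N : nat) (D : 'I_N -> dyadic_lattice rho) (delta0 : R)
  (m : nat) (eta : R) (r : 'I_m -> R) (s' : R) (p : 'I_m -> R) (K : R) :
  let s := hoelder_conjugate s'%:E in
  let rE := EFin \o r in
  let pE := EFin \o p in
  let pt := ptilde eta pE in
  homogeneous_type rho mu ->
  adjacent_lattices D ->
  0 < delta0 < 1 ->
  0 <= eta < m%:R ->
  (forall i, 1 <= r i) ->
  1 <= s' ->
  (forall i, 1 < p i) ->
  0 < inv_ptilde eta pE ->
  exponents_lt rE s pE pt%:E ->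
  0 < K ->
  (* the implicit constants, chosen before the operator and the weights *)
  exists (C : R) (C1 : R -> R) (C2 : ('I_m -> \bar R) -> R -> R),
  forall T : ('I_m -> X -> R) -> X -> R,
  msublinear mu (fun=> Linfb rho) T ->
  sparse_dominated mu rho (dyadic_cubes D) delta0 eta rE s'%:E K T ->
  forall w : 'I_m -> X -> R,
  (forall i, weight rho mu (w i)) ->
  let W := A_const mu (dyadic_cubes D) rE s pE pt%:E w in
  (W < +oo)%E ->
  (* T is a priori given on tuples of Linfb functions; T' is its extension to
     the product of the weighted Lebesgue spaces *)
  exists T' : ('I_m -> X -> R) -> X -> R,
  [/\ msublinear mu (fun i => wLp mu (p i)%:E (w i)) T',
      operator_extends mu (fun=> Linfb rho)
        (fun i => wLp mu (p i)%:E (w i)) T T',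
      (operator_norm mu pE w pt%:E (weight_prod w) T'
         <= if (1 < pt)%R then C%:E * W `^ Theta r s' p pt
            else (C1 (fine W))%:E)%E &
      forall t : 'I_m -> \bar R,
        0 < inv_ptilde eta t ->
        exponents_lt rE s t (ptilde eta t)%:E ->
        forall f : nat -> 'I_m -> X -> R,
        (forall j i, wLp mu (p i)%:E (w i) (f j i)) ->
        (wnorm mu pt%:E (weight_prod w)
           (fun x => ell_norm (ptilde eta t)%:E (fun j => T' (f j) x))
         <= (C2 t (fine W))%:E *
            \prod_(i < m) wnorm mu (p i)%:E (w i)
              (fun x => ell_norm (t i) (fun j => f j i x)))%E].
Proof.
move=> s rE pE pt hom adj /andP[d0 d1] /andP[eta0 _] r1 s1 p1 ipt [rp ps] K0.
have r0 i : 0 < r i by exact: lt_le_trans (r1 i).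
have p0 i : 0 < p i by exact: lt_trans (p1 i).
have rp' i : r i < p i by have := rp i; rewrite lte_fin.
have s0 : 0 < s' by exact: lt_le_trans s1.
have pt0 : 0 < pt by rewrite invr_gt0.
have ptE : pt^-1 = \sum_i (p i)^-1 - eta.
  rewrite /pt /ptilde invrK /inv_ptilde; congr (_ - _); apply: eq_bigr => i _.
  by rewrite inver gt_eqF.
have gapN : 0 < gap r p s' pt None by rewrite subr_gt0; exact: conjugate_exponent_lt ps.
have [Q [lab [lamQ muQ QD]]] := dyadic_enumeration hom adj.
have sharp := operator_sharp_bound hom lamQ muQ r0 rp' s1 pt0 ptE gapN d0 eta0 K0.
have scalar := operator_scalar_bound hom lamQ muQ r0 rp' s1 pt0 ptE gapN d0 (ltW d1) eta0 K0.
have vector := operator_vector_bound hom lamQ muQ r0 rp' s1 pt0 ptE gapN d0 (ltW d1) eta0 K0.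
rewrite QD in sharp scalar vector.
(* The natural exponent: 1 / tau = 1 / ptilde + eta, so tau is at most ptilde, and 1 / s < 1 / tau
   is inherited. *)
pose tau (t : 'I_m -> \bar R) := (\sum_i fine ((t i)^-1)%E)^-1.
have tauP t : 0 < inv_ptilde eta t -> exponents_lt rE s t (ptilde eta t)%:E ->
    [/\ 0 < tau t, (tau t)^-1 = \sum_i fine ((t i)^-1)%E, tau t <= ptilde eta t &
        1 - s'^-1 < (tau t)^-1].
  move=> it [_ ts]; have te : (tau t)^-1 = inv_ptilde eta t + eta by rewrite invrK /inv_ptilde subrK.
  have it' : inv_ptilde eta t <= (tau t)^-1 by rewrite te lerDl.
  have tauV : 0 < (tau t)^-1 by exact: lt_le_trans it'.
  have tau0 : 0 < tau t by rewrite -invr_gt0.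
  have tt0 : 0 < ptilde eta t by rewrite invr_gt0.
  split => //; first by rewrite invrK.
    by rewrite -lef_pV2 ?posrE// invrK.
  by apply: lt_le_trans it'; rewrite -[ltRHS]invrK; exact: conjugate_exponent_lt ts.
(* The constant has to exist whatever pt is; for pt <= 1 the claim about it is vacuous and 0 stands
   in. *)
have [Cs hCs] : exists Cs : R, 1 < pt -> 0 < Cs /\ forall T, admissible rho mu Q r s' delta0 eta K T ->
    forall w, ae_weights mu w -> (A_const mu (dyadic_cubes D) rE s pE pt%:E w < +oo)%E ->
    forall f : 'I_m -> X -> R, (forall i, Linfb rho (f i)) ->
    (forall i, (wpow mu (p i) (w i) (EFin \o f i) < +oo)%E) ->
    (wpow mu pt (weight_prod w) (EFin \o T f) <=
     ((Cs * fine (A_const mu (dyadic_cubes D) rE s pE pt%:E w) `^ Theta r s' p pt) `^ pt)%:E *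
     \prod_i wpow mu (p i) (w i) (EFin \o f i) `^ (pt / p i))%E.
  have [pt1|pt1] := boolP (1 < pt); last by exists 0.
  by have [c c0 hc] := sharp pt1; exists c.
have [C1 hC1] := choice (fun W0 => let: ex_intro2 c c0 hc := scalar W0 in ex_intro _ c (conj c0 hc)).
(* Constants are selected for all pairs of exponents t and values of the weight constant, ahead of
   the operator and of the weights. The conditions on t are part of the predicate, which makes the
   choice total. *)
pose vector_constant (tW : ('I_m -> \bar R) * R) (c : R) :=
  0 < inv_ptilde eta tW.1 -> exponents_lt rE s tW.1 (ptilde eta tW.1)%:E ->
  0 < c /\ forall T, admissible rho mu Q r s' delta0 eta K T ->
  forall w, ae_weights mu w -> (A_const mu (dyadic_cubes D) rE s pE pt%:E w < +oo)%E ->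
  fine (A_const mu (dyadic_cubes D) rE s pE pt%:E w) = tW.2 ->
  forall J (f : nat -> 'I_m -> X -> R), (forall j i, Linfb rho (f j i)) ->
  (forall i, (wpow mu (p i) (w i) (fun x => ell (tW.1 i) J (fun j => `|f j i x|%:E)) < +oo)%E) ->
  (wpow mu pt (weight_prod w) (fun x => ell (tau tW.1)%:E J (fun j => `|T (f j) x|%:E)) <=
   c%:E *
   \prod_i wpow mu (p i) (w i) (fun x => ell (tW.1 i) J (fun j => `|f j i x|%:E)) `^ (pt / p i))%E.
have /choice[C2 hC2] : forall tW, exists c, vector_constant tW c.
  move=> [t W0]; rewrite /vector_constant /=.
  have [it|it] := boolP (0 < inv_ptilde eta t); last by exists 0.
  have [te|te] := pselect (exponents_lt rE s t (ptilde eta t)%:E); last by exists 0.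
  have [tau0 tauE _ stau] := tauP t it te.
  by have [c c0 hc] := vector t (tau t) W0 te.1 tau0 tauE stau; exists c.
(* The scalar and vector bounds concern pt-th powers of norms, hence the roots of order pt; Cs
   already refers to the norm. *)
exists Cs, (fun W0 => C1 W0 `^ pt^-1), (fun t W0 => C2 (t, W0) `^ pt^-1).
move=> T subT domT w ww W Wy.
have aw : ae_weights mu w by split => i; have [] := ww i.
have adT : admissible rho mu Q r s' delta0 eta K T by split => //; rewrite QD.
have [mw w0] := aw.
have mv := measurable_weight_prod aw; have v0 := ae_weight_prod aw.
have WyQ : (A_const mu (range Q) (EFin \o r) (hoelder_conjugate s'%:E) (EFin \o p) pt%:E w < +oo)%E.
  by rewrite QD.
have Wv := muckenhoupt_dual_weights lamQ muQ r0 rp' s0 pt0 gapN mw w0 WyQ.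
have W0p := muckenhoupt_const_gt0 lamQ muQ Wv; rewrite QD -/W in W0p.
have Wf : W = (fine W)%:E by move: W0p Wy; case: W => [z| |] //=; rewrite ltxx.
have [c0 scT] := hC1 (fine W).
(* This scalar bound makes the extension converge for every pt; the sharp bound is then passed to
   the limit separately. *)
have TB : power_bounded mu p w (weight_prod w) pt (fun=> Linfb rho) (C1 (fine W)) T.
  by move=> f; apply: scT.
have [A hA] := exists_approximation pt hom p1 mw.
exists (extension rho T A); split.
- exact: (extension_msublinear hom p1 mw mv v0 pt0 subT (ltW c0) TB hA).
- exact: extension_extends.
- have [pt1|pt1] := boolP (1 < pt).
    have [Cs0 hT] := hCs pt1.
    have cc : 0 <= Cs * fine W `^ Theta r s' p pt by rewrite mulr_ge0 ?powR_ge0// ltW.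
    rewrite [in leRHS]Wf poweR_EFin -EFinM; apply: operator_norm_le => //.
    apply: (extension_bound hom p1 mw mv v0 pt0 subT (ltW c0) TB hA); first exact: powR_ge0.
    by move=> f; apply: hT.
  apply: operator_norm_le => //; first exact: powR_ge0.
  rewrite -powRrM mulVf ?gt_eqF// powRr1 ?(ltW c0)//.
  exact: (extension_bound hom p1 mw mv v0 pt0 subT (ltW c0) TB hA (ltW c0) TB).
move=> t it te f Lf; have [tau0 tauE taut stau] := tauP t it te.
have [c2 hT] := hC2 (t, fine W) it te.
apply: (extension_vector_norm hom p1 mw mv v0 pt0 subT (ltW c0) TB hA _ tau0 taut c2) => // [i|J g Lg gy].
  by apply: lt_trans (te.1 i); rewrite lte_fin.
exact: (hT T adT w aw Wy erefl J g Lg gy).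
Qed.
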